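(* Let $E_1,E_2$ be de Branges functions without real zeros, with associated de Branges spaces $B_1,B_2$. Suppose $B_1$ and $B_2$ are homeomorphically embedded in $L^2(\mathbb R;\mu)$ for some Borel measure $\mu$ on $\mathbb R$. If $E_1$ and $E_2$ are of exponential type zero, then $B_1\supseteq B_2$ or $B_2\supseteq B_1$.
   Context: A function analytic in the upper half-plane $\mathbb C^+$ is of bounded type if it is a quotient of two bounded analytic functions there; its mean type is $\limsup_{y\to\infty}y^{-1}\ln|N(\mathrm iy)|$. A de Branges function is an entire $E$ with $|E(z)|>|E(z^\ast)|$ for $z\in\mathbb C^+$. Its de Branges space $B$ consists of all entire $F$ with $\int_{\mathbb R}|F(\lambda)|^2|E(\lambda)|^{-2}d\lambda<\infty$ such that $F/E$ and $F^\#/E$ (where $F^\#(z)=F(z^\ast)^\ast$) are of bounded type in $\mathbb C^+$ with non-positive mean type. It carries the inner product $\frac1\pi\int F G^\ast|E|^{-2}d\lambda$. ''Homeomorphically embedded in $L^2(\mathbb R;\mu)$'' means restriction to $\mathbb R$ maps $B$ into $L^2(\mathbb R;\mu)$ homeomorphically onto its image (equivalent norms). An entire function $E$ is of exponential type zero if $\ln^+|E(z)|=o(|z|)$ as $|z|\to\infty$, where $\ln^+=\max(\ln,0)$. *)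

(* Defs.v *)
From Stdlib Require Import Reals.
From Coquelicot Require Import Coquelicot.
From mathcomp Require Import all_boot all_algebra.
From mathcomp Require Import all_classical all_reals all_analysis.
From mathcomp Require Import Rstruct Rstruct_topology.

Set Implicit Arguments.
Unset Strict Implicit.
Unset Printing Implicit Defensive.

Local Open Scope ring_scope.
Local Open Scope R_scope.

Definition upper (z : C) : Prop := 0 < Im z.

Definition cdiff (f : C -> C) (z : C) : Prop := @Coquelicot.Derive.ex_derive C_AbsRing C_NormedModule f z.

Definition entire (f : C -> C) : Prop := forall z, cdiff f z.

Definition analytic_upper (f : C -> C) : Prop := forall z, upper z -> cdiff f z.

Definition bounded_analytic_upper (g : C -> C) : Prop :=
  analytic_upper g /\ exists M : R, forall z, upper z -> Cmod (g z) <= M.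

Definition bounded_type (N : C -> C) : Prop :=
  analytic_upper N /\
  exists g h : C -> C, bounded_analytic_upper g /\ bounded_analytic_upper h /\
    (exists z0, upper z0 /\ h z0 <> 0%C) /\
    forall z, upper z -> h z <> 0%C -> N z = Cdiv (g z) (h z).

(* mean type  limsup_{y -> oo} y^-1 ln|N(iy)|  is <= 0, i.e. for every eps > 0,
   eventually y^-1 ln|N(iy)| <= eps, i.e. |N(iy)| <= exp(eps y) (with ln 0 = -oo). *)
Definition nonpos_mean_type (N : C -> C) : Prop :=
  forall eps : R, 0 < eps -> exists Y : R, forall y : R, Y <= y ->
    Cmod (N (pair 0 y)) <= exp (eps * y).

Definition sharp (F : C -> C) : C -> C := fun z => Cconj (F (Cconj z)).

Definition deBranges_function (E : C -> C) : Prop :=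
  entire E /\ forall z, upper z -> Cmod (E (Cconj z)) < Cmod (E z).

Definition no_real_zeros (E : C -> C) : Prop :=
  forall x : R, E (RtoC x) <> 0%C.

Definition lnp (x : R) : R := Rmax (ln x) 0.

Definition exp_type_zero (E : C -> C) : Prop :=
  forall eps : R, 0 < eps -> exists r : R, forall z : C, r <= Cmod z ->
    lnp (Cmod (E z)) <= eps * Cmod z.

Definition dB_norm2 (E F : C -> C) : \bar R :=
  ((1 / PI)%R%:E * \int[@lebesgue_measure R]_(x in setT)
      ((Cmod (F (RtoC x)) / Cmod (E (RtoC x))) ^ 2)%R%:E)%E.

Definition in_dB (E F : C -> C) : Prop :=
  entire F /\
  (\int[@lebesgue_measure R]_(x in setT)
      ((Cmod (F (RtoC x)) / Cmod (E (RtoC x))) ^ 2)%R%:E < +oo)%E /\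
  bounded_type (fun z => Cdiv (F z) (E z)) /\
  nonpos_mean_type (fun z => Cdiv (F z) (E z)) /\
  bounded_type (fun z => Cdiv (sharp F z) (E z)) /\
  nonpos_mean_type (fun z => Cdiv (sharp F z) (E z)).

Definition L2_norm2 (mu : {measure set (measurableTypeR R) -> \bar R}) (F : C -> C) : \bar R :=
  (\int[mu]_(x in setT) ((Cmod (F (RtoC x))) ^ 2)%R%:E)%E.

Definition homeo_embedded (E : C -> C) (mu : {measure set (measurableTypeR R) -> \bar R}) : Prop :=
  (forall F, in_dB E F -> (L2_norm2 mu F < +oo)%E) /\
  exists c1 c2 : R, 0 < c1 /\ 0 < c2 /\
    forall F, in_dB E F ->
      (c1%:E * dB_norm2 E F <= L2_norm2 mu F)%E /\
      (L2_norm2 mu F <= c2%:E * dB_norm2 E F)%E.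

(* Main.v *)
Require Import Defs.
From Stdlib Require Import Reals Lra Psatz Lia ZArith Classical ClassicalEpsilon FunctionalExtensionality.
From Coquelicot Require Import Coquelicot.
From mathcomp Require Import ssreflect.
From mathcomp Require Rstruct_topology.

(** Following de Branges, suppose G1 lies in B1 but not in B2 and G2 in B2 but not in B1. Let nu be the sum of mu and of Lebesgue measure on
    [0, 1]; the second summand makes the elements of both spaces determined by their classes in L2(nu). An element F of B(E) satisfies
    |F(z)/E(z)|^2 <= 64 pi y int |F(t)/E(t)|^2 / |t - z|^2 dt, so norm convergence implies locally uniform convergence, and conversely this
    estimate exhibits a limit as a function of bounded type; hence B1 and B2 are closed in L2(nu). Take functionals l1, l2 on L2(nu) that
    annihilate B1 and B2 with l1(G2) and l2(G1) nonzero.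

    For H in B1 the quotient L1(z) = l1((H(z) G2 - G2(z) H)/(t - z)) / H(z) does not depend on H, since l1 annihilates
    (H'(z) H - H(z) H')/(t - z). Thus L1 is entire, of exponential type zero as a quotient of functions of type zero; L2 is defined
    symmetrically. Comparing |G1| with |G2| gives min(|L1|, |L2|) = O(1/|Im z|), so by Carleman's differential inequality one of the two
    is constant, and then both vanish because of their decay on the imaginary axis. But L1 = 0 means G1/G2 -> 0 along that axis, and
    L2 = 0 means G2/G1 -> 0. *)

(** What is used of L2(nu) is collected in [L2space], what is used of a de Branges space in
    [dBlike]. The two spaces are compared on this level, and measure theory enters only to verify
    these properties. A positive distance from the space is enough for a separating functional,
    which is a limit of inner products along a minimizing sequence. Write T1(H)(z) = l1(H/(t - z)),
    a function of size O(1/|Im z|). Off the line L1 = T1(G2) - (G2/H) T1(H) for every H in B1.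
    Taking H = G1 where |G2| <= |G1| gives L1 = O(1/|Im z|), and the opposite inequality gives the
    same for L2; this is the origin of the minimum. Since iy T1(H)(iy) tends to -l1(H), the relation
    L1 = 0 turns into (G1/G2) l1(G2) -> 0 along the axis, where l1(G2) is nonzero. A quotient of
    functions of type zero is treated on discs: dividing the zeros out of a bounded denominator and
    applying Harnack's inequality bounds the quotient by the value of the denominator at the
    centre. *)

Local Open Scope R_scope.

(* The logarithm in [lnp] is the one of MathComp-Analysis. *)
Lemma ln_le_lnp x : ln x <= lnp x.
Proof. rewrite Rstruct_topology.RlnE. exact: Rmax_l. Qed.


(** * Complex derivatives *)

(** The remainder is compared with |h| without division, so h = 0 is allowed and the rules of
    differentiation reduce to algebra on remainders. *)
Definition is_cder (f : C -> C) (z l : C) : Prop :=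
  forall eps, 0 < eps -> exists d, 0 < d /\ forall h, Cmod h < d ->
    Cmod (f (z + h) - f z - l * h)%C <= eps * Cmod h.

Definition ccont (f : C -> C) (z : C) : Prop :=
  forall eps, 0 < eps -> exists d, 0 < d /\ forall w, Cmod (w - z)%C < d ->
    Cmod (f w - f z)%C < eps.

Definition holo (f : C -> C) (z : C) : Prop := exists l, is_cder f z l.

Definition rcont (g : R -> C) (t : R) : Prop :=
  forall eps, 0 < eps -> exists d, 0 < d /\ forall s, Rabs (s - t) < d ->
    Cmod (g s - g t)%C < eps.

Definition is_rder (g : R -> C) (t : R) (l : C) : Prop :=
  forall eps, 0 < eps -> exists d, 0 < d /\ forall h, Rabs h < d ->
    Cmod (g (t + h)%R - g t - h * l)%C <= eps * Rabs h.

Lemma Cmod_sub (a b : C) : Cmod (a - b)%C <= Cmod a + Cmod b.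
Proof. rewrite -(Cmod_opp b). exact: Cmod_triangle. Qed.

Lemma Cmod_rev (a b : C) : Cmod a - Cmod b <= Cmod (a - b)%C.
Proof. have := Cmod_triangle (a - b)%C b. replace (a - b + b)%C with a by ring. lra. Qed.

Lemma Cmod_sub_sym (a b : C) : Cmod (a - b)%C = Cmod (b - a)%C.
Proof. rewrite -(Cmod_opp (a - b)%C). congr Cmod. ring. Qed.

(** The bridge to [cdiff] of the statement; the complex analysis below is carried out with the
    elementary form. *)
Lemma holo_ex_derive f z : holo f z <-> @ex_derive C_AbsRing C_NormedModule f z.
Proof.
split.
- case=> l Hl. exists l. split.
  + exact: is_linear_scal_l.
  + move=> x Hx. have -> : x = z by symmetry; apply: is_filter_lim_locally_unique; exact: Hx.
    move=> eps. case: (Hl eps (cond_pos eps)) => d [d0 H].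
    exists (mkposreal d d0) => y Hy.
    have := H (minus y z) Hy.
    change (minus y z) with ((y : C) - z)%C.
    have -> : (z + ((y : C) - z))%C = y by move: (y : C) => u; ring.
    move=> H1. refine (Rle_trans _ _ _ _ H1). right.
    change (Cmod (f y - f z - ((y : C) - z) * l)%C = Cmod (f y - f z - l * ((y : C) - z))%C).
    congr Cmod. move: (y : C) => u. ring.
- case=> l [_ H]. exists l => eps e0.
  case: (H z (fun P HP => HP) (mkposreal eps e0)) => d Hd.
  exists d; split; first exact: cond_pos. move=> h Hh.
  have := Hd (z + h)%C.
  have E : minus (z + h)%C z = h by change (z + h - z = h)%C; ring.
  have Hb : @ball (AbsRing_UniformSpace C_AbsRing) z d (z + h)%C.
    rewrite /ball /= /AbsRing_ball E. exact: Hh.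
  move/(_ Hb) => H1.
  refine (Rle_trans _ _ _ _ (Rle_trans _ _ _ H1 _)); right; last by rewrite /= E.
  change (Cmod (f (z + h) - f z - l * h)%C = Cmod (f (z + h) - f z - (z + h - z) * l)%C).
  congr Cmod. ring.
Qed.

Lemma is_cder_unique f z l m : is_cder f z l -> is_cder f z m -> l = m.
Proof.
move=> H1 H2.
have : Cmod (l - m)%C <= 0.
  apply: le_epsilon => e e0. rewrite Rplus_0_l.
  case: (H1 (e/2)) => [|d1 [d10 K1]]; first lra.
  case: (H2 (e/2)) => [|d2 [d20 K2]]; first lra.
  set h := RtoC (Rmin d1 d2 / 2).
  have hm : 0 < Rmin d1 d2 by apply: Rmin_glb_lt.
  have Eh : Cmod h = Rmin d1 d2 / 2 by rewrite Cmod_R Rabs_pos_eq; lra.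
  have := Rmin_l d1 d2. have := Rmin_r d1 d2. move=> a1 a2.
  have k1 := K1 h ltac:(lra). have k2 := K2 h ltac:(lra).
  have : Cmod ((l - m) * h)%C <= e * Cmod h.
    replace ((l - m) * h)%C with ((f (z + h) - f z - m * h) - (f (z+h) - f z - l * h))%C by ring.
    have := Cmod_sub (f (z + h) - f z - m * h)%C (f (z+h) - f z - l * h)%C. lra.
  rewrite Cmod_mult => H. apply: (Rmult_le_reg_r (Cmod h)); lra.
move=> H. have H0 : Cmod (l - m)%C = 0 by have := Cmod_ge_0 (l-m)%C; lra.
have := Cmod_eq_0 _ H0 => E. replace l with ((l - m) + m)%C by ring. rewrite E; ring.
Qed.

Lemma is_cder_ext_loc f g z l d : 0 < d -> (forall w, Cmod (w - z)%C < d -> f w = g w) ->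
  is_cder f z l -> is_cder g z l.
Proof.
move=> d0 E H e e0. case: (H e e0) => d1 [d10 K].
exists (Rmin d d1); split; first by apply: Rmin_glb_lt.
move=> h Hh. have := Rmin_l d d1; have := Rmin_r d d1 => a b.
rewrite -!E; first by apply: K; lra.
- replace (z - z)%C with (RtoC 0) by ring. rewrite Cmod_0. lra.
- replace (z + h - z)%C with h by ring. lra.
Qed.

Lemma is_cder_ext f g z l : (forall w, f w = g w) -> is_cder f z l -> is_cder g z l.
Proof. move=> E. apply: (is_cder_ext_loc f g z l 1); [lra | by move=> w _]. Qed.

Lemma holo_ext_loc f g z d : 0 < d -> (forall w, Cmod (w - z)%C < d -> f w = g w) ->
  holo f z -> holo g z.
Proof. move=> d0 E [l H]. exists l. exact: (is_cder_ext_loc f g z l d). Qed.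

Lemma holo_ext f g z : (forall w, f w = g w) -> holo f z -> holo g z.
Proof. move=> E [l H]. exists l. exact: (is_cder_ext f g). Qed.

Lemma holo_cont f z : holo f z -> ccont f z.
Proof.
case=> l H e e0. case: (H 1 Rlt_0_1) => d [d0 K].
have l0 := Cmod_ge_0 l.
have q0 : 0 < e / (Cmod l + 2) by apply: Rdiv_lt_0_compat; lra.
exists (Rmin d (e / (Cmod l + 2))); split; first exact: Rmin_glb_lt.
move=> w Hw. have a := Rmin_l d (e / (Cmod l + 2)). have b := Rmin_r d (e / (Cmod l + 2)).
have := K (w - z)%C ltac:(lra).
replace (z + (w - z))%C with w by ring => H1.
have := Cmod_triangle (f w - f z - l * (w - z))%C (l * (w - z))%C.
replace (f w - f z - l * (w - z) + l * (w - z))%C with (f w - f z)%C by ring.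
rewrite Cmod_mult => H2.
have H3 : Cmod (w - z)%C * (Cmod l + 2) < e.
  have : Cmod (w - z)%C < e / (Cmod l + 2) by lra.
  move/(Rmult_lt_compat_r (Cmod l + 2) _ _ ltac:(lra)).
  replace (e / (Cmod l + 2) * (Cmod l + 2)) with e by (field; lra). lra.
have := Cmod_ge_0 (w - z)%C. nra.
Qed.

Lemma is_cder_const c z : is_cder (fun _ => c) z 0%C.
Proof. move=> e e0; exists 1; split; first lra. move=> h _.
replace (c - c - 0 * h)%C with (RtoC 0) by ring. rewrite Cmod_0. have := Cmod_ge_0 h. nra. Qed.

Lemma is_cder_id z : is_cder (fun w => w) z 1%C.
Proof. move=> e e0; exists 1; split; first lra. move=> h _.
replace (z + h - z - 1 * h)%C with (RtoC 0) by ring. rewrite Cmod_0. have := Cmod_ge_0 h. nra. Qed.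

Lemma is_cder_plus f g z a b : is_cder f z a -> is_cder g z b -> is_cder (fun w => f w + g w)%C z (a + b)%C.
Proof.
move=> Hf Hg e e0. case: (Hf (e/2)) => [|d1 [p1 K1]]; first lra. case: (Hg (e/2)) => [|d2 [p2 K2]]; first lra.
exists (Rmin d1 d2); split; first exact: Rmin_glb_lt. move=> h Hh.
have := Rmin_l d1 d2; have := Rmin_r d1 d2 => u v.
have k1 := K1 h ltac:(lra). have k2 := K2 h ltac:(lra).
replace (f (z + h) + g (z + h) - (f z + g z) - (a + b) * h)%C with
  ((f (z + h) - f z - a * h) + (g (z+h) - g z - b * h))%C by ring.
have := Cmod_triangle (f (z + h) - f z - a * h)%C (g (z+h) - g z - b * h)%C. lra.
Qed.

Lemma is_cder_mult f g z a b : is_cder f z a -> is_cder g z b ->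
  is_cder (fun w => f w * g w)%C z (a * g z + f z * b)%C.
Proof.
move=> Hf Hg e e0.
have Cg : ccont g z by apply: holo_cont; exists b.
set F := Cmod (f z). set A := Cmod a. set G := Cmod (g z).
have F0 : 0 <= F by apply: Cmod_ge_0. have A0 : 0 <= A by apply: Cmod_ge_0. have G0 : 0 <= G by apply: Cmod_ge_0.
have [e1 [e10 [E1 [E2 E3]]]] : exists e1, 0 < e1 /\ e1 * (G + 1) <= e/3 /\ F * e1 <= e/3 /\ A * e1 <= e / 3.
  set S := F + A + G + 1. exists (e / 3 / S).
  have S0 : 0 < S by rewrite /S; lra.
  have q0 : 0 < e / 3 / S by apply: Rdiv_lt_0_compat; lra.
  have qq : e / 3 / S * S = e / 3 by field; lra.
  move: (e / 3 / S) q0 qq => q q0 qq.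
  split => //. rewrite /S in qq. repeat split; nra.
case: (Hf e1 e10) => d1 [p1 K1]. case: (Hg e1 e10) => d2 [p2 K2].
case: (Cg (Rmin 1 e1)) => [|d3 [p3 K3]]; first by apply: Rmin_glb_lt; lra.
exists (Rmin d1 (Rmin d2 d3)); split; first by do 2 (apply: Rmin_glb_lt => //).
move=> h Hh.
have := Rmin_l d1 (Rmin d2 d3); have := Rmin_r d1 (Rmin d2 d3); have := Rmin_l d2 d3; have := Rmin_r d2 d3 => u1 u2 u3 u4.
have k1 := K1 h ltac:(lra). have k2 := K2 h ltac:(lra).
have k3 := K3 (z + h)%C. replace (z + h - z)%C with h in k3 by ring. have {}k3 := k3 ltac:(lra).
have := Rmin_l 1 e1; have := Rmin_r 1 e1 => v1 v2.
replace (f (z + h) * g (z + h) - f z * g z - (a * g z + f z * b) * h)%C with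
 ((f (z + h) - f z - a * h) * g (z + h) + f z * (g (z+h) - g z - b * h) + a * h * (g (z + h) - g z))%C by ring.
have t1 := Cmod_triangle ((f (z + h) - f z - a * h) * g (z + h) + f z * (g (z+h) - g z - b * h))%C (a * h * (g (z + h) - g z))%C.
have t2 := Cmod_triangle ((f (z + h) - f z - a * h) * g (z + h))%C (f z * (g (z+h) - g z - b * h))%C.
rewrite !Cmod_mult in t1 t2. rewrite -/F -/A in t1 t2.
have g1 : Cmod (g (z + h)%C) <= G + 1.
  have := Cmod_rev (g (z + h)%C) (g z). rewrite -/G. lra.
have h0 := Cmod_ge_0 h.
have m1 : Cmod (f (z + h) - f z - a * h)%C * Cmod (g (z + h)%C) <= e / 3 * Cmod h.
  apply: (Rle_trans _ (e1 * Cmod h * (G + 1))); last by nra.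
  apply: Rmult_le_compat => //; exact: Cmod_ge_0.
have m2 : F * Cmod (g (z+h) - g z - b * h)%C <= e / 3 * Cmod h.
  apply: (Rle_trans _ (F * (e1 * Cmod h))); last by nra.
  exact: Rmult_le_compat_l.
have m3 : A * Cmod h * Cmod (g (z+h) - g z)%C <= e / 3 * Cmod h.
  apply: (Rle_trans _ (A * Cmod h * e1)); last by nra.
  apply: Rmult_le_compat_l; [nra|lra].
lra.
Qed.

Lemma is_cder_comp f g z a b : is_cder g z a -> is_cder f (g z) b -> is_cder (fun w => f (g w)) z (b * a)%C.
Proof.
move=> Hg Hf e e0.
have Cg : ccont g z by apply: holo_cont; exists a.
set A := Cmod a. set B := Cmod b.
have A0 : 0 <= A by apply: Cmod_ge_0. have B0 : 0 <= B by apply: Cmod_ge_0.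
have [e1 [e10 [E1 E2]]] : exists e1, 0 < e1 /\ e1 * (A + 1) <= e/2 /\ B * Rmin 1 e1 <= e/2.
  set S := B + A + 1. exists (e / 2 / S).
  have S0 : 0 < S by rewrite /S; lra.
  have q0 : 0 < e / 2 / S by apply: Rdiv_lt_0_compat; lra.
  have qq : e / 2 / S * S = e / 2 by field; lra.
  move: (e / 2 / S) q0 qq => q q0 qq.
  split => //. have := Rmin_r 1 q => hq. split; rewrite /S in qq; nra.
case: (Hf e1 e10) => d1 [p1 K1].
case: (Hg (Rmin 1 e1)) => [|d2 [p2 K2]]; first by apply: Rmin_glb_lt; lra.
case: (Cg d1 p1) => d3 [p3 K3].
exists (Rmin d2 d3); split; first exact: Rmin_glb_lt. move=> h Hh.
have := Rmin_l d2 d3; have := Rmin_r d2 d3 => u1 u2.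
have k2 := K2 h ltac:(lra).
have k3 := K3 (z + h)%C. replace (z + h - z)%C with h in k3 by ring. have {}k3 := k3 ltac:(lra).
set k := (g (z + h) - g z)%C in k3.
have k1 := K1 k k3. replace (g z + k)%C with (g (z + h)%C) in k1 by (rewrite /k; ring).
have h0 := Cmod_ge_0 h.
have kb : Cmod k <= (A + 1) * Cmod h.
  have := Cmod_triangle (g (z + h) - g z - a * h)%C (a * h)%C.
  replace (g (z + h) - g z - a * h + a * h)%C with k by (rewrite /k; ring).
  rewrite Cmod_mult -/A. have := Rmin_l 1 e1. nra.
replace (f (g (z + h)) - f (g z) - b * a * h)%C with
  ((f (g (z + h)) - f (g z) - b * k) + b * (g (z + h) - g z - a * h))%C by (rewrite /k; ring).
have t := Cmod_triangle (f (g (z + h)) - f (g z) - b * k)%C (b * (g (z + h) - g z - a * h))%C.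
rewrite Cmod_mult -/B in t.
have m1 : B * Cmod (g (z + h) - g z - a * h)%C <= e / 2 * Cmod h.
  apply: (Rle_trans _ (B * (Rmin 1 e1 * Cmod h))); last by nra. exact: Rmult_le_compat_l.
have m2 : e1 * Cmod k <= e / 2 * Cmod h by nra.
lra.
Qed.

Lemma Cmod_pos (z : C) : z <> 0%C -> 0 < Cmod z.
Proof. by move/Cmod_gt_0. Qed.

Lemma Cneq_mod (z : C) : 0 < Cmod z -> z <> 0%C.
Proof. move=> H E. rewrite E Cmod_0 in H. lra. Qed.

Lemma is_cder_inv (z : C) : z <> 0%C -> is_cder (fun w => / w)%C z (- / (z * z))%C.
Proof.
move=> z0 e e0. set Z := Cmod z. have Z0 : 0 < Z := Cmod_pos z z0.
(* For |h| < Z/2 the point z + h stays at distance at least Z/2 from 0, and the remainder is h^2 /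
   (z^2 (z + h)); the second radius makes it at most e |h|. *)
exists (Rmin (Z / 2) (e * (Z * Z * Z) / 2)); split.
  apply: Rmin_glb_lt; first lra. have q : 0 < Z * Z * Z by apply: Rmult_lt_0_compat => //; nra. have := Rmult_lt_0_compat _ _ e0 q; lra.
move=> h Hh. have := Rmin_l (Z / 2) (e * (Z * Z * Z) / 2); have := Rmin_r (Z / 2) (e * (Z * Z * Z) / 2) => u1 u2.
have w0 : Z / 2 <= Cmod (z + h)%C.
  have := Cmod_rev z (- h)%C. replace (z - - h)%C with (z + h)%C by ring. rewrite Cmod_opp -/Z. lra.
have wn : (z + h)%C <> 0%C by apply: Cneq_mod; lra.
replace (/ (z + h) - / z - - / (z * z) * h)%C with (h * h / (z * z * (z + h)))%C by (field; split => //).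
rewrite Cmod_div; last by apply: Cmult_neq_0 => //; apply: Cmult_neq_0.
rewrite !Cmod_mult -/Z. have h0 := Cmod_ge_0 h.
apply: (Rmult_le_reg_r (Z * Z * Cmod (z + h)%C)); first by apply: Rmult_lt_0_compat; nra.
rewrite /Rdiv Rmult_assoc Rinv_l; last by apply: Rgt_not_eq; apply: Rmult_lt_0_compat; nra.
rewrite Rmult_1_r.
have : Cmod h <= e * (Z * Z * Cmod (z + h)%C).
  have : e * (Z * Z) * (Z / 2) <= e * (Z * Z) * Cmod (z + h)%C.
    apply: Rmult_le_compat_l => //. have : 0 < Z * Z by nra. nra.
  nra.
nra.
Qed.

Lemma holo_const c z : holo (fun _ => c) z. Proof. eexists; exact: is_cder_const. Qed.
Lemma holo_id z : holo (fun w => w) z. Proof. eexists; exact: is_cder_id. Qed.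
Lemma holo_plus f g z : holo f z -> holo g z -> holo (fun w => f w + g w)%C z.
Proof. move=> [a Ha] [b Hb]; eexists; apply: is_cder_plus; eassumption. Qed.
Lemma holo_mult f g z : holo f z -> holo g z -> holo (fun w => f w * g w)%C z.
Proof. move=> [a Ha] [b Hb]; eexists; apply: is_cder_mult; eassumption. Qed.
Lemma holo_comp f g z : holo g z -> holo f (g z) -> holo (fun w => f (g w))%C z.
Proof. move=> [a Ha] [b Hb]; eexists; apply: is_cder_comp; eassumption. Qed.
Lemma holo_opp f z : holo f z -> holo (fun w => - f w)%C z.
Proof. move=> H. apply: (@holo_ext (fun w => (-1) * f w)%C); first by (move=> w; ring).
  apply: holo_mult => //. exact: holo_const. Qed.
Lemma holo_minus f g z : holo f z -> holo g z -> holo (fun w => f w - g w)%C z.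
Proof. move=> Hf Hg. apply: holo_plus => //. exact: holo_opp. Qed.
Lemma holo_inv (f : C -> C) z : f z <> 0%C -> holo f z -> holo (fun w => / f w)%C z.
Proof. move=> H0 Hf. refine (holo_comp (fun w => / w)%C f z Hf _). exists (- / (f z * f z))%C. exact: (is_cder_inv (f z) H0). Qed.
Lemma holo_div (f g : C -> C) z : g z <> 0%C -> holo f z -> holo g z -> holo (fun w => f w / g w)%C z.
Proof. move=> H0 Hf Hg. apply: holo_mult => //. exact: holo_inv. Qed.


(** * Line integrals and Goursat's theorem *)

Definition CI (g : R -> C) (a b : R) : C := @RInt C_R_CompleteNormedModule g a b.

Definition rcont_on (g : R -> C) a b := forall t, Rmin a b <= t <= Rmax a b -> rcont g t.

Lemma rcont_continuous (g : R -> C) t : rcont g t -> @continuous R_UniformSpace C_R_CompleteNormedModule g t.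
Proof.
move=> H P [e He]. case: (H e (cond_pos e)) => d [d0 K].
exists (mkposreal d d0) => s Hs. apply: He.
have := K s Hs => K1.
have := Rmax_Cmod (g s - g t)%C => K2.
split; rewrite /ball /= /AbsRing_ball /abs /minus /plus /opp /=.
- apply: Rle_lt_trans K1. refine (Rle_trans _ _ _ _ K2). exact: Rmax_l.
- apply: Rle_lt_trans K1. refine (Rle_trans _ _ _ _ K2). exact: Rmax_r.
Qed.

Lemma is_rder_derive (g : R -> C) t l : is_rder g t l -> @is_derive R_AbsRing C_R_NormedModule g t l.
Proof.
move=> H; split; first exact: is_linear_scal_l.
move=> x Hx. have -> : x = t by symmetry; apply: is_filter_lim_locally_unique; exact: Hx.
move=> eps. case: (H eps (cond_pos eps)) => d [d0 K].
exists (mkposreal d d0) => y Hy.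
have := K ((y : R) - t) Hy. have -> : t + ((y : R) - t) = y by move: (y : R) => u; ring.
move=> K1.
rewrite -Cmod_norm. change (norm (minus y t)) with (Rabs (y - t)).
refine (Rle_trans _ _ _ _ K1). right. rewrite scal_R_Cmult.
change (minus y t) with (y - t).
by [].
Qed.

Lemma CI_ex (g : R -> C) a b : rcont_on g a b -> @ex_RInt C_R_CompleteNormedModule g a b.
Proof. move=> H. apply: ex_RInt_continuous => z Hz. apply: rcont_continuous. exact: H. Qed.

Lemma CI_bound (g : R -> C) a b M : a <= b -> rcont_on g a b -> (forall t, a <= t <= b -> Cmod (g t) <= M) ->
  Cmod (CI g a b) <= M * (b - a).
Proof.
move=> ab Hc Hb. rewrite Cmod_norm.
refine (@norm_RInt_le C_R_NormedModule g (fun _ => M) a b (CI g a b) (M * (b - a)) ab _ _ _).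
- move=> x Hx. rewrite -Cmod_norm. exact: Hb.
- exact: (@RInt_correct C_R_CompleteNormedModule g a b (CI_ex g a b Hc)).
- have := @is_RInt_const R_NormedModule a b M. by rewrite /scal /= /mult /= Rmult_comm.
Qed.

Lemma CI_ext (f g : R -> C) a b : (forall t, Rmin a b < t < Rmax a b -> f t = g t) -> CI f a b = CI g a b.
Proof. move=> H. exact: (@RInt_ext C_R_CompleteNormedModule f g a b H). Qed.

Lemma CI_plus f g a b : rcont_on f a b -> rcont_on g a b -> CI (fun t => f t + g t)%C a b = (CI f a b + CI g a b)%C.
Proof. move=> Hf Hg. apply: (@RInt_plus C_R_CompleteNormedModule); exact: CI_ex. Qed.

Lemma CI_chasles f a b c : rcont_on f a b -> rcont_on f b c -> (CI f a b + CI f b c)%C = CI f a c.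
Proof. move=> H1 H2. apply: (@RInt_Chasles C_R_CompleteNormedModule); exact: CI_ex. Qed.

Lemma CI_FTC (P f : R -> C) a b : (forall t, Rmin a b <= t <= Rmax a b -> is_rder P t (f t)) -> rcont_on f a b ->
  CI f a b = (P b - P a)%C.
Proof.
move=> H Hc. apply: (@is_RInt_unique C_R_CompleteNormedModule).
apply: (@is_RInt_derive C_R_CompleteNormedModule P f) => t Ht.
- apply: is_rder_derive. exact: H.
- apply: rcont_continuous. exact: Hc.
Qed.

(** A complex factor mixes real and imaginary parts, hence the two real integrals are recombined
    componentwise. *)
Lemma CI_scal (c : C) f a b : rcont_on f a b -> CI (fun t => c * f t)%C a b = (c * CI f a b)%C.
Proof.
move=> H. apply: (@is_RInt_unique C_R_CompleteNormedModule).
have := RInt_correct _ _ _ (CI_ex f a b H). rewrite -/(CI f a b). move: (CI f a b) => I HI.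
have H1 := @is_RInt_fct_extend_fst R_NormedModule R_NormedModule f a b I HI.
have H2 := @is_RInt_fct_extend_snd R_NormedModule R_NormedModule f a b I HI.
apply: (@is_RInt_fct_extend_pair R_NormedModule R_NormedModule).
- apply: (is_RInt_ext (fun t => fst c * fst (f t) - snd c * snd (f t))) => //.
  apply: (@is_RInt_minus R_NormedModule); apply: (@is_RInt_scal R_NormedModule) => //.
- apply: (is_RInt_ext (fun t => fst c * snd (f t) + snd c * fst (f t))) => //.
  apply: (@is_RInt_plus R_NormedModule); apply: (@is_RInt_scal R_NormedModule) => //.
Qed.

Lemma CI_Re f a b : rcont_on f a b -> Re (CI f a b) = RInt (fun t => Re (f t)) a b.
Proof.
move=> H. symmetry. apply: is_RInt_unique.
have := RInt_correct _ _ _ (CI_ex f a b H). rewrite -/(CI f a b). move: (CI f a b) => I HI.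
exact: (@is_RInt_fct_extend_fst R_NormedModule R_NormedModule f a b I HI).
Qed.


Ltac holo_tac := repeat match goal with
  | |- holo (fun _ => ?c) _ => exact: (holo_const c)
  | |- holo (fun w => w) _ => exact: holo_id
  | |- holo (fun w => Cplus (@?f w) (@?g w)) _ => refine (holo_plus f g _ _ _)
  | |- holo (fun w => Cminus (@?f w) (@?g w)) _ => refine (holo_minus f g _ _ _)
  | |- holo (fun w => Copp (@?f w)) _ => refine (holo_opp f _ _)
  | |- holo (fun w => Cmult (@?f w) (@?g w)) _ => refine (holo_mult f g _ _ _)
  end.

Lemma is_rder_rcont g t l : is_rder g t l -> rcont g t.
Proof.
move=> H e e0. case: (H 1 Rlt_0_1) => d [d0 K].
have l0 := Cmod_ge_0 l.
have q0 : 0 < e / (Cmod l + 2) by apply: Rdiv_lt_0_compat; lra.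
exists (Rmin d (e / (Cmod l + 2))); split; first exact: Rmin_glb_lt.
move=> w Hw. have a := Rmin_l d (e / (Cmod l + 2)). have b := Rmin_r d (e / (Cmod l + 2)).
have := K (w - t) ltac:(lra).
replace (t + (w - t)) with w by ring => H1.
have := Cmod_triangle (g w - g t - (w - t)%R * l)%C ((w - t)%R * l)%C.
replace (g w - g t - (w - t)%R * l + (w - t)%R * l)%C with (g w - g t)%C by ring.
rewrite Cmod_mult Cmod_R => H2.
have H3 : Rabs (w - t) * (Cmod l + 2) < e.
  have : Rabs (w - t) < e / (Cmod l + 2) by lra.
  move/(Rmult_lt_compat_r (Cmod l + 2) _ _ ltac:(lra)).
  replace (e / (Cmod l + 2) * (Cmod l + 2)) with e by (field; lra). lra.
have := Rabs_pos (w - t). nra.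
Qed.

Lemma is_rder_comp P g t m l : is_rder g t m -> is_cder P (g t) l -> is_rder (fun s => P (g s)) t (l * m)%C.
Proof.
move=> Hg Hf e e0.
have Cg := is_rder_rcont g t m Hg.
set A := Cmod m. set B := Cmod l.
have A0 : 0 <= A by apply: Cmod_ge_0. have B0 : 0 <= B by apply: Cmod_ge_0.
have [e1 [e10 [E1 E2]]] : exists e1, 0 < e1 /\ e1 * (A + 1) <= e/2 /\ B * Rmin 1 e1 <= e/2.
  set S := B + A + 1.
  have S0 : 0 < S by rewrite /S; lra.
  have q0 : 0 < e / 2 / S by apply: Rdiv_lt_0_compat; lra.
  have qq : e / 2 / S * S = e / 2 by field; lra.
  exists (e / 2 / S).
  move: (e / 2 / S) q0 qq => q q0 qq.
  split => //. have := Rmin_r 1 q => hq. split; rewrite /S in qq; nra.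
case: (Hf e1 e10) => d1 [p1 K1].
case: (Hg (Rmin 1 e1)) => [|d2 [p2 K2]]; first by apply: Rmin_glb_lt; lra.
case: (Cg d1 p1) => d3 [p3 K3].
exists (Rmin d2 d3); split; first exact: Rmin_glb_lt. move=> h Hh.
have := Rmin_l d2 d3; have := Rmin_r d2 d3 => u1 u2.
have k2 := K2 h ltac:(lra).
have k3 := K3 (t + h). replace (t + h - t) with h in k3 by ring. have {}k3 := k3 ltac:(lra).
set k := (g (t + h)%R - g t)%C in k3.
have k1 := K1 k k3. replace (g t + k)%C with (g (t + h)) in k1 by (rewrite /k; ring).
have h0 := Rabs_pos h.
have kb : Cmod k <= (A + 1) * Rabs h.
  have := Cmod_triangle (g (t + h)%R - g t - h * m)%C (h * m)%C.
  replace (g (t + h)%R - g t - h * m + h * m)%C with k by (rewrite /k; ring).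
  rewrite Cmod_mult Cmod_R -/A. have := Rmin_l 1 e1. nra.
replace (P (g (t + h)%R) - P (g t) - h * (l * m))%C with
  ((P (g (t + h)%R) - P (g t) - l * k) + l * (g (t + h)%R - g t - h * m))%C by (rewrite /k; ring).
have q := Cmod_triangle (P (g (t + h)%R) - P (g t) - l * k)%C (l * (g (t + h)%R - g t - h * m))%C.
rewrite Cmod_mult -/B in q.
have m1 : B * Cmod (g (t + h)%R - g t - h * m)%C <= e / 2 * Rabs h.
  apply: (Rle_trans _ (B * (Rmin 1 e1 * Rabs h))); last by nra. exact: Rmult_le_compat_l.
have m2 : e1 * Cmod k <= e / 2 * Rabs h by nra.
lra.
Qed.

Lemma rcont_comp f g t : rcont g t -> ccont f (g t) -> rcont (fun s => f (g s)) t.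
Proof.
move=> Hg Hf e e0. case: (Hf e e0) => d [d0 K]. case: (Hg d d0) => d1 [d10 K1].
exists d1; split => // s Hs. apply: K. exact: K1.
Qed.

Lemma is_rder_affine (z w : C) t : is_rder (fun s => z + s * w)%C t w.
Proof.
move=> e e0; exists 1; split; first lra. move=> h _.
replace (z + (t + h)%R * w - (z + t * w) - h * w)%C with (RtoC 0); last by rewrite RtoC_plus; ring.
rewrite Cmod_0. have := Rabs_pos h; nra.
Qed.

Lemma is_rder_ext g1 g2 t l : (forall s, g1 s = g2 s) -> is_rder g1 t l -> is_rder g2 t l.
Proof. move=> E H e e0. case: (H e e0) => d [d0 K]. exists d; split => // h Hh. rewrite -!E. exact: K. Qed.

Lemma is_rder_hor y t : is_rder (fun s => (s, y)) t 1%C.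
Proof. apply: (is_rder_ext (fun s => (0, y) + s * 1)%C); last exact: is_rder_affine.
move=> s. apply: injective_projections; simpl; ring. Qed.

Lemma is_rder_ver x t : is_rder (fun s => (x, s)) t Ci.
Proof. apply: (is_rder_ext (fun s => (x, 0) + s * Ci)%C); last exact: is_rder_affine.
move=> s. apply: injective_projections; simpl; ring. Qed.

Lemma rcont_hor f x y : ccont f (x, y) -> rcont (fun s => f (s, y)) x.
Proof. move=> H. apply: (rcont_comp f (fun s => (s, y))) => //. apply: is_rder_rcont; exact: is_rder_hor. Qed.

Lemma rcont_ver f x y : ccont f (x, y) -> rcont (fun s => f (x, s)) y.
Proof. move=> H. apply: (rcont_comp f (fun s => (x, s))) => //. apply: is_rder_rcont; exact: is_rder_ver. Qed.

Section RectInd.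
Variable good : R -> R -> R -> R -> Prop.
Hypothesis Hq : forall a b c d, a <= b -> c <= d ->
  good a ((a + b) / 2) c ((c + d) / 2) -> good ((a + b) / 2) b c ((c + d) / 2) ->
  good a ((a + b) / 2) ((c + d) / 2) d -> good ((a + b) / 2) b ((c + d) / 2) d -> good a b c d.

Definition bad_rect (q : R * R * (R * R)) :=
  fst (fst q) <= snd (fst q) /\ fst (snd q) <= snd (snd q) /\
  ~ good (fst (fst q)) (snd (fst q)) (fst (snd q)) (snd (snd q)).

Lemma bad_quarter (q : {q | bad_rect q}) : exists r : {q | bad_rect q},
  let a := fst (fst (proj1_sig q)) in let b := snd (fst (proj1_sig q)) in
  let c := fst (snd (proj1_sig q)) in let d := snd (snd (proj1_sig q)) in
  let a' := fst (fst (proj1_sig r)) in let b' := snd (fst (proj1_sig r)) in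
  let c' := fst (snd (proj1_sig r)) in let d' := snd (snd (proj1_sig r)) in
  a <= a' /\ b' <= b /\ c <= c' /\ d' <= d /\ b' - a' = (b - a) / 2 /\ d' - c' = (d - c) / 2.
Proof.
case: q => [[[a b] [c d]]] [/= ab [/= cd /= nb]].
have : exists q, bad_rect q /\ let a' := fst (fst q) in let b' := snd (fst q) in
  let c' := fst (snd q) in let d' := snd (snd q) in
  a <= a' /\ b' <= b /\ c <= c' /\ d' <= d /\ b' - a' = (b - a) / 2 /\ d' - c' = (d - c) / 2.
  apply: NNPP => N. apply: nb.
  apply: Hq => //; apply: NNPP => H; apply: N.
  - exists (a, (a + b) / 2, (c, (c + d) / 2)). split; first by (split; [|split]) => //=; lra. simpl; lra.
  - exists ((a + b) / 2, b, (c, (c + d) / 2)). split; first by (split; [|split]) => //=; lra. simpl; lra.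
  - exists (a, (a + b) / 2, ((c + d) / 2, d)). split; first by (split; [|split]) => //=; lra. simpl; lra.
  - exists ((a + b) / 2, b, ((c + d) / 2, d)). split; first by (split; [|split]) => //=; lra. simpl; lra.
case=> q [Hb H]. by exists (exist _ q Hb).
Qed.

Definition next q := proj1_sig (constructive_indefinite_description _ (bad_quarter q)).

Lemma rect_ind A B Cc D : A <= B -> Cc <= D ->
  (forall x y, A <= x <= B -> Cc <= y <= D -> exists dl, 0 < dl /\
    forall a b c d, A <= a -> b <= B -> Cc <= c -> d <= D -> a <= x <= b -> c <= y <= d -> b - a < dl -> d - c < dl ->
      good a b c d) -> good A B Cc D.
Proof.
move=> AB CD Hloc. apply: NNPP => Nb.
have b0 : bad_rect (A, B, (Cc, D)) by split; [|split].
pose q := fix q n := match n with O => exist _ (A, B, (Cc, D)) b0 | S m => next (q m) end.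
pose a n := fst (fst (proj1_sig (q n))). pose b n := snd (fst (proj1_sig (q n))).
pose c n := fst (snd (proj1_sig (q n))). pose d n := snd (snd (proj1_sig (q n))).
have Hs n : a n <= a (S n) /\ b (S n) <= b n /\ c n <= c (S n) /\ d (S n) <= d n /\
   b (S n) - a (S n) = (b n - a n) / 2 /\ d (S n) - c (S n) = (d n - c n) / 2.
  exact: (proj2_sig (constructive_indefinite_description _ (bad_quarter (q n)))).
have Hb n : a n <= b n /\ c n <= d n /\ ~ good (a n) (b n) (c n) (d n) by exact: (proj2_sig (q n)).
have Hm k n : a n <= a (n + k)%nat /\ b (n + k)%nat <= b n /\ c n <= c (n + k)%nat /\ d (n + k)%nat <= d n.
  elim: k => [|k IH]; first by rewrite -plus_n_O; lra.
  rewrite -plus_n_Sm. have := Hs (n + k)%nat. lra.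
have Hw n : b n - a n = (B - A) * (/2)^n /\ d n - c n = (D - Cc) * (/2)^n.
  elim: n => [|n [I1 I2]]; first by rewrite /a /b /c /d /=; lra.
  have := Hs n => -[_ [_ [_ [_ [-> ->]]]]]. rewrite I1 I2 /=. split; field.
have ab_all n m : a n <= b m /\ c n <= d m.
  have h1 := Hm m n. have h2 := Hm n m. have h3 := Hb (n + m)%nat.
  rewrite Nat.add_comm in h2. lra.
have sup (u v : nat -> R) : (forall n m, u n <= v m) -> exists x, forall n, u n <= x <= v n.
  move=> H. have [||x [Hx1 Hx2]] := completeness (fun y => exists n, y = u n).
  - exists (v O) => y [n ->]. exact: H.
  - by exists (u O); exists O.
  - exists x => n; split; first by apply: Hx1; exists n.
    apply: Hx2 => y [m ->]. exact: H.
have [x Hx] := sup a b (fun n m => proj1 (ab_all n m)).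
have [y Hy] := sup c d (fun n m => proj2 (ab_all n m)).
have Hxy := Hx O. have Hyy := Hy O.
have [dl [dl0 K]] := Hloc x y Hxy Hyy.
have [n Hn] : exists n, (B - A + (D - Cc)) * (/2)^n < dl.
  have [N HN] := pow_lt_1_zero (/2) ltac:(rewrite Rabs_pos_eq; lra) (dl / (B - A + (D - Cc) + 1)) ltac:(apply: Rdiv_lt_0_compat; lra).
  exists N. have := HN N (le_n _). rewrite Rabs_pos_eq; last by apply: pow_le; lra.
  set S := B - A + (D - Cc). move=> H.
  have : (/2)^N * (S + 1) < dl.
    replace dl with (dl / (S + 1) * (S + 1)); last by field; rewrite /S; lra.
    apply: Rmult_lt_compat_r => //. rewrite /S; lra.
  have : 0 < (/2)^N by apply: pow_lt; lra. rewrite /S. nra.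
have [W1 W2] := Hw n. have := Hm n O => /= -[h1 [h2 [h3 h4]]].
have p2 : 0 < (/2)^n by apply: pow_lt; lra.
case: (Hb n) => _ [_]. apply. apply: K => //.
- nra.
- nra.
Qed.
End RectInd.

(** The contour integral over the boundary, counterclockwise; on the vertical sides dz = i ds. *)
Definition rectI (f : C -> C) a b c d : C :=
  (CI (fun s => f (s, c)) a b + Ci * CI (fun s => f (b, s)) c d
   - CI (fun s => f (s, d)) a b - Ci * CI (fun s => f (a, s)) c d)%C.

Definition in_rect a b c d (z : C) := a <= fst z <= b /\ c <= snd z <= d.

Definition ccont_rect f a b c d := forall z, in_rect a b c d z -> ccont f z.

Lemma rcont_on_hor f a b c d y x1 x2 : ccont_rect f a b c d -> a <= x1 <= b -> a <= x2 <= b -> c <= y <= d ->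
  rcont_on (fun s => f (s, y)) x1 x2.
Proof.
move=> H h1 h2 h3 t Ht. apply: rcont_hor. apply: H. split => //=.
move: Ht. rewrite /Rmin /Rmax. case: Rle_dec; lra.
Qed.

Lemma rcont_on_ver f a b c d x y1 y2 : ccont_rect f a b c d -> c <= y1 <= d -> c <= y2 <= d -> a <= x <= b ->
  rcont_on (fun s => f (x, s)) y1 y2.
Proof.
move=> H h1 h2 h3 t Ht. apply: rcont_ver. apply: H. split => //=.
move: Ht. rewrite /Rmin /Rmax. case: Rle_dec; lra.
Qed.

Lemma rectI_split_h f a m b c d : a <= m <= b -> c <= d -> ccont_rect f a b c d ->
  rectI f a b c d = (rectI f a m c d + rectI f m b c d)%C.
Proof.
move=> am cd H. rewrite /rectI.
rewrite -(CI_chasles (fun s => f (s, c)) a m b); try (apply: (rcont_on_hor f a b c d) => //; lra).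
rewrite -(CI_chasles (fun s => f (s, d)) a m b); try (apply: (rcont_on_hor f a b c d) => //; lra).
ring.
Qed.

Lemma rectI_split_v f a b c n d : a <= b -> c <= n <= d -> ccont_rect f a b c d ->
  rectI f a b c d = (rectI f a b c n + rectI f a b n d)%C.
Proof.
move=> am cd H. rewrite /rectI.
rewrite -(CI_chasles (fun s => f (a, s)) c n d); try (apply: (rcont_on_ver f a b c d) => //; lra).
rewrite -(CI_chasles (fun s => f (b, s)) c n d); try (apply: (rcont_on_ver f a b c d) => //; lra).
ring.
Qed.

Lemma rectI_prim P f a b c d : a <= b -> c <= d -> ccont_rect f a b c d ->
  (forall z, in_rect a b c d z -> is_cder P z (f z)) -> rectI f a b c d = 0%C.
Proof.
move=> ab cd Hc HP.
have Hh y : c <= y <= d -> CI (fun s => f (s, y)) a b = (P (b, y) - P (a, y))%C.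
  move=> Hy. apply: (CI_FTC (fun s => P (s, y)) (fun s => f (s, y))); last by apply: (rcont_on_hor f a b c d) => //; lra.
  rewrite Rmin_left // Rmax_right // => t Ht.
  replace (f (t, y)) with (f (t, y) * 1)%C by ring.
  apply: (is_rder_comp P (fun s => (s, y))); [exact: is_rder_hor | by apply: HP].
have Hv x : a <= x <= b -> (Ci * CI (fun s => f (x, s)) c d)%C = (P (x, d) - P (x, c))%C.
  move=> Hx. rewrite -CI_scal; last by apply: (rcont_on_ver f a b c d) => //; lra.
  have Hcc : rcont_on (fun s => Ci * f (x, s))%C c d.
    move=> t Ht. apply: (rcont_comp (fun w => Ci * w)%C (fun s => f (x, s))).
    - apply: (rcont_on_ver f a b c d x c d) => //; lra.
    - apply: holo_cont. apply: holo_mult; [exact: holo_const | exact: holo_id].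
  apply: (CI_FTC (fun s => P (x, s)) (fun s => Ci * f (x, s))%C) => //.
  rewrite Rmin_left // Rmax_right // => t Ht.
  rewrite Cmult_comm.
  apply: (is_rder_comp P (fun s => (x, s))); [exact: is_rder_ver | by apply: HP].
rewrite /rectI Hv; last lra. rewrite Hv; last lra. rewrite Hh; last lra. rewrite Hh; last lra. ring.
Qed.

Lemma rectI_minus f g a b c d : a <= b -> c <= d -> ccont_rect f a b c d -> ccont_rect g a b c d ->
  rectI (fun z => f z - g z)%C a b c d = (rectI f a b c d - rectI g a b c d)%C.
Proof.
move=> ab cd Hf Hg.
have E (u v : R -> C) x y : rcont_on u x y -> rcont_on v x y -> CI (fun s => u s - v s)%C x y = (CI u x y - CI v x y)%C.
  move=> Hu Hv. transitivity (CI (fun s => u s + (-1) * v s)%C x y).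
    apply: CI_ext => t _. ring.
  rewrite CI_plus //. rewrite CI_scal //; first ring.
  move=> t Ht. apply: (rcont_comp (fun w => (-1) * w)%C v); first by apply: Hv.
  apply: holo_cont. apply: holo_mult; [exact: holo_const | exact: holo_id].
rewrite /rectI (E (fun s => f (s, c))) ?(E (fun s => f (s, d))) ?(E (fun s => f (a, s))) ?(E (fun s => f (b, s))).
ring.
all: try (apply: (rcont_on_hor _ a b c d) => //; lra). all: apply: (rcont_on_ver _ a b c d) => //; lra.
Qed.

Lemma rectI_bound f a b c d M : a <= b -> c <= d -> ccont_rect f a b c d ->
  (forall z, in_rect a b c d z -> Cmod (f z) <= M) -> Cmod (rectI f a b c d) <= 2 * M * ((b - a) + (d - c)).
Proof.
move=> ab cd Hc HM.
have h1 : Cmod (CI (fun s => f (s, c)) a b) <= M * (b - a).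
  apply: CI_bound => //. apply: (rcont_on_hor _ a b c d) => //; lra. move=> t Ht. apply: HM. split => //=; lra.
have h2 : Cmod (CI (fun s => f (s, d)) a b) <= M * (b - a).
  apply: CI_bound => //. apply: (rcont_on_hor _ a b c d) => //; lra. move=> t Ht. apply: HM. split => //=; lra.
have h3 : Cmod (CI (fun s => f (a, s)) c d) <= M * (d - c).
  apply: CI_bound => //. apply: (rcont_on_ver _ a b c d) => //; lra. move=> t Ht. apply: HM. split => //=; lra.
have h4 : Cmod (CI (fun s => f (b, s)) c d) <= M * (d - c).
  apply: CI_bound => //. apply: (rcont_on_ver _ a b c d) => //; lra. move=> t Ht. apply: HM. split => //=; lra.
rewrite /rectI.
set u := CI _ _ _ in h1 *. set v := CI _ _ _ in h4 *. set w := CI _ _ _ in h2 *. set x := CI _ _ _ in h3 *.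
have t1 := Cmod_sub (u + Ci * v - w)%C (Ci * x)%C. have t2 := Cmod_sub (u + Ci * v)%C w.
have t3 := Cmod_triangle u (Ci * v)%C. rewrite !Cmod_mult Cmod_Ci in t1 t2 t3. lra.
Qed.

Lemma Cmod_le_sum (z : C) : Cmod z <= Rabs (fst z) + Rabs (snd z).
Proof.
replace z with (RtoC (fst z) + Ci * RtoC (snd z))%C at 1.
  have := Cmod_triangle (RtoC (fst z)) (Ci * RtoC (snd z))%C. rewrite Cmod_mult Cmod_Ci !Cmod_R. lra.
apply: injective_projections; simpl; ring.
Qed.

Lemma goursat f a b c d : a <= b -> c <= d -> (forall z, in_rect a b c d z -> holo f z) -> rectI f a b c d = 0%C.
Proof.
move=> ab cd Hf.
have Hc : ccont_rect f a b c d by move=> z Hz; apply: holo_cont; exact: Hf.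
have Hsub a' b' c' d' : a <= a' -> b' <= b -> c <= c' -> d' <= d -> ccont_rect f a' b' c' d'.
  move=> h1 h2 h3 h4 z [z1 z2]. apply: Hc. split; lra.
suff H e : 0 < e -> Cmod (rectI f a b c d) <= e * ((b - a) ^ 2 + (d - c) ^ 2).
  apply: Cmod_eq_0. apply: Rle_antisym; last exact: Cmod_ge_0.
  apply: le_epsilon => e e0. rewrite Rplus_0_l.
  set S := (b - a)^2 + (d - c)^2. have S0 : 0 <= S by rewrite /S; nra.
  apply: (Rle_trans _ (e / (S + 1) * S)); first by apply: H; apply: Rdiv_lt_0_compat; lra.
  have q0 : 0 < e / (S + 1) by apply: Rdiv_lt_0_compat; lra.
  have : e / (S + 1) * (S + 1) = e by field; lra. nra.
move=> e0.
(* The bound is additive under quartering, since each quarter carries a fourth of the sum of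
   squares; bisection thus needs no count of its steps. *)
pose good a' b' c' d' := a <= a' -> b' <= b -> c <= c' -> d' <= d ->
  Cmod (rectI f a' b' c' d') <= e * ((b' - a') ^ 2 + (d' - c') ^ 2).
apply: (rect_ind good _ a b c d) => //; try lra; last first.
- move=> x y Hx Hy.
  have [l Hl] := Hf (x, y) (conj Hx Hy).
  (* The affine part of f has a primitive and drops out. The rest is at most (e/8) S on the
     boundary, S being the sum of the two side lengths, and 2 (e/8) S^2 is at most e/2 times the sum
     of the squared sides. *)
  have e4 : 0 < e / 8 by lra.
  have [dl [dl0 K]] := Hl _ e4.
  exists (dl / 2); split; first lra. move=> a' b' c' d' h1 h2 h3 h4 h5 h6 h7 h8 _ _ _ _. have h5' : a' <= b' by lra. have h6' : c' <= d' by lra.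
  pose g (z : C) := (f (x, y) + l * (z - (x, y)))%C.
  pose P (z : C) := (f (x, y) * z + l * (z - (x, y)) * (z - (x, y)) / 2)%C.
  have g0 : rectI g a' b' c' d' = 0%C.
    apply: (rectI_prim P); try lra.
    + move=> z _. apply: holo_cont. rewrite /g; holo_tac.
    + move=> z _. move=> e' e'0. exists (e' / (Cmod l + 1)). have l0 := Cmod_ge_0 l.
      split; first by apply: Rdiv_lt_0_compat; lra.
      move=> h Hh. replace (P (z + h) - P z - g z * h)%C with (l * (h * h) / 2)%C.
        2: { rewrite /P /g. field. }
      have -> : (l * (h * h) / 2)%C = (l * (h * h) * RtoC (/2))%C by rewrite RtoC_inv.
      rewrite !Cmod_mult Cmod_R Rabs_pos_eq; last lra.
      have h0 := Cmod_ge_0 h.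
      have : Cmod h * (Cmod l + 1) <= e'.
        replace e' with (e' / (Cmod l + 1) * (Cmod l + 1)) by (field; lra).
        apply: Rmult_le_compat_r; lra.
      move: (Cmod l) (Cmod h) l0 h0 => L H l0 h0 q. have : 0 <= L * H by nra. nra.
  have gc z : ccont g z.
    apply: holo_cont. rewrite /g; holo_tac.
  have E : rectI f a' b' c' d' = rectI (fun z => f z - g z)%C a' b' c' d'.
    have -> := rectI_minus f g a' b' c' d' h5' h6' (Hsub a' b' c' d' h1 h2 h3 h4) (fun z _ => gc z). rewrite g0; ring.
  rewrite E.
  set S := (b' - a') + (d' - c').
  have S0 : 0 <= S by rewrite /S; lra.
  apply: (Rle_trans _ (2 * (e / 8 * S) * S)); last first.
    have K1 : S * S <= 2 * ((b' - a') ^ 2 + (d' - c') ^ 2).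
      rewrite /S. have := pow2_ge_0 ((b' - a') - (d' - c')). nra.
    have K0 : 0 <= (b' - a') ^ 2 + (d' - c') ^ 2 by nra.
    have := Rmult_le_compat_l e _ _ (Rlt_le _ _ e0) K1.
    have := Rmult_le_pos e _ (Rlt_le _ _ e0) K0. move: ((b' - a') ^ 2 + (d' - c') ^ 2) => T. lra.
  apply: rectI_bound; try lra.
  + move=> z Hz. have : ccont (fun w => f w - g w)%C z; last by [].
    move=> e' e'0. have [d1 [d10 K1]] := Hsub a' b' c' d' h1 h2 h3 h4 z Hz (e'/2) ltac:(lra).
    have [d2 [d20 K2]] := gc z (e'/2) ltac:(lra).
    exists (Rmin d1 d2); split; first exact: Rmin_glb_lt. move=> w Hw.
    have := Rmin_l d1 d2; have := Rmin_r d1 d2 => u1 u2.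
    have := K1 w ltac:(lra). have := K2 w ltac:(lra).
    replace (f w - g w - (f z - g z))%C with ((f w - f z) - (g w - g z))%C by ring.
    have := Cmod_sub (f w - f z)%C (g w - g z)%C. lra.
  + move=> [s t] [/= Hs Ht].
    set h := ((s, t) - (x, y))%C.
    have Hh : Cmod h <= S.
      apply: Rle_trans (Cmod_le_sum _) _. rewrite /h /S /=.
      apply: Rplus_le_compat; apply: Rabs_le; lra.
    have Sd : S < dl by rewrite /S; lra.
    have := K h ltac:(lra). have -> : ((x, y) + h)%C = (s, t) by rewrite /h; apply: injective_projections; simpl; ring.
    rewrite /g -/h. replace (f (s, t) - f (x, y) - l * h)%C with (f (s, t) - (f (x, y) + l * h))%C by ring.
    have := Cmod_ge_0 h. nra.
- move=> a' b' c' d' ab' cd' q1 q2 q3 q4 h1 h2 h3 h4.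
  set m := (a' + b') / 2 in q1 q2 q3 q4 *. set n := (c' + d') / 2 in q1 q2 q3 q4 *.
  have m1 : a' <= m <= b' by rewrite /m; lra. have n1 : c' <= n <= d' by rewrite /n; lra.
  rewrite (rectI_split_h f a' m b') //; last exact: Hsub.
  rewrite (rectI_split_v f a' m c' n d'); try lra; last by apply: Hsub; lra.
  rewrite (rectI_split_v f m b' c' n d'); try lra; last by apply: Hsub; lra.
  have {}q1 := q1 ltac:(lra) ltac:(lra) ltac:(lra) ltac:(lra).
  have {}q2 := q2 ltac:(lra) ltac:(lra) ltac:(lra) ltac:(lra).
  have {}q3 := q3 ltac:(lra) ltac:(lra) ltac:(lra) ltac:(lra).
  have {}q4 := q4 ltac:(lra) ltac:(lra) ltac:(lra) ltac:(lra).
  move: q1 q2 q3 q4. set u1 := rectI f a' m c' n. set u2 := rectI f m b' c' n. set u3 := rectI f a' m n d'. set u4 := rectI f m b' n d'.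
  have -> : m - a' = (b' - a') / 2 by rewrite /m; field. have -> : b' - m = (b' - a') / 2 by rewrite /m; field.
  have -> : n - c' = (d' - c') / 2 by rewrite /n; field. have -> : d' - n = (d' - c') / 2 by rewrite /n; field.
  move=> q1 q2 q3 q4.
  have := Cmod_triangle (u1 + u3)%C (u2 + u4)%C. have := Cmod_triangle u1 u3. have := Cmod_triangle u2 u4.
  have : Cmod u1 + Cmod u2 + Cmod u3 + Cmod u4 <= e * ((b' - a') ^ 2 + (d' - c') ^ 2) by nra.
  lra.
Qed.


(** * Exponential, mean values and primitives *)

Definition cis (t : R) : C := (cos t, sin t).
Definition cexp (z : C) : C := (exp (fst z) * cis (snd z))%C.

Lemma Cmod_cis t : Cmod (cis t) = 1.
Proof. rewrite /Cmod /cis /=. have := sin2_cos2 t. rewrite /Rsqr => H.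
replace (cos t * (cos t * 1) + sin t * (sin t * 1)) with 1 by lra. exact: sqrt_1. Qed.

Lemma cis_plus s t : cis (s + t) = (cis s * cis t)%C.
Proof. rewrite /cis cos_plus sin_plus. apply: injective_projections; simpl; ring. Qed.

Lemma cis_2PI t : cis (t + 2 * PI) = cis t.
Proof. by rewrite /cis cos_plus sin_plus cos_2PI sin_2PI !Rmult_0_r !Rmult_1_r Rminus_0_r Rplus_0_r. Qed.

Lemma cexp_plus z w : cexp (z + w) = (cexp z * cexp w)%C.
Proof. rewrite /cexp /= exp_plus cis_plus RtoC_mult. ring. Qed.

Lemma Cmod_cexp z : Cmod (cexp z) = exp (fst z).
Proof. rewrite /cexp Cmod_mult Cmod_R Cmod_cis Rmult_1_r. apply: Rabs_pos_eq. left; exact: exp_pos. Qed.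

Lemma cexp_0 : cexp 0 = 1%C.
Proof. rewrite /cexp /cis /= exp_0 cos_0 sin_0. apply: injective_projections; simpl; ring. Qed.

Lemma derivable_pt_lim_eps (g : R -> R) l : derivable_pt_lim g 0 l -> forall eps, 0 < eps -> exists d, 0 < d /\
  forall h, Rabs h < d -> Rabs (g h - g 0 - l * h) <= eps * Rabs h.
Proof.
move=> H eps e0. case: (H eps e0) => d K. exists d; split; first exact: cond_pos.
move=> h Hh. case: (Req_dec h 0) => [->|hn].
  rewrite Rabs_R0. replace (g 0 - g 0 - l * 0) with 0 by ring. rewrite Rabs_R0. lra.
have := K h hn Hh. rewrite Rplus_0_l => H1.
replace (g h - g 0 - l * h) with (((g h - g 0) / h - l) * h) by (field; auto).
rewrite Rabs_mult. apply: Rmult_le_compat_r; first exact: Rabs_pos. lra.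
Qed.

Lemma is_cder_cexp z : is_cder cexp z (cexp z).
Proof.
have H0 : is_cder cexp 0 1.
  move=> e e0.
  set e1 := Rmin 1 (e / 10). have e10 : 0 < e1 by apply: Rmin_glb_lt; lra.
  have e1a : e1 <= 1 by exact: Rmin_l. have e1b : e1 <= e / 10 by exact: Rmin_r. clearbody e1.
  have [d1 [p1 K1]] := derivable_pt_lim_eps exp 1 ltac:(rewrite -exp_0; exact: derivable_pt_lim_exp) e1 e10.
  have [d2 [p2 K2]] := derivable_pt_lim_eps sin 1 ltac:(rewrite -cos_0; exact: derivable_pt_lim_sin) e1 e10.
  have Lc := derivable_pt_lim_cos 0. rewrite sin_0 Ropp_0 in Lc.
  have [d3 [p3 K3]] := derivable_pt_lim_eps cos 0 Lc e1 e10.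
  exists (Rmin e1 (Rmin d1 (Rmin d2 d3))); split; first by repeat apply: Rmin_glb_lt.
  move=> [a b] Hh.
  have := Rmin_l e1 (Rmin d1 (Rmin d2 d3)). have := Rmin_r e1 (Rmin d1 (Rmin d2 d3)).
  have := Rmin_l d1 (Rmin d2 d3). have := Rmin_r d1 (Rmin d2 d3). have := Rmin_l d2 d3. have := Rmin_r d2 d3 => u1 u2 u3 u4 u5 u6.
  have := Rmax_Cmod (a, b) => /=. have := Rmax_l (Rabs a) (Rabs b). have := Rmax_r (Rabs a) (Rabs b) => m1 m2 m3.
  set H := Cmod (a, b) in Hh m3 *.
  have {}K1 := K1 a ltac:(lra). have {}K2 := K2 b ltac:(lra). have {}K3 := K3 b ltac:(lra).
  rewrite exp_0 in K1. rewrite sin_0 in K2. rewrite cos_0 in K3.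
  apply: Rle_trans (Cmod_le_sum _) _. rewrite cexp_0 /cexp /cis /= .
  replace (0 + a) with a by ring. replace (0 + b) with b by ring.
  have a1 : Rabs a <= e1 by lra. have b1 : Rabs b <= e1 by lra.
  have ha : Rabs (exp a - 1) <= 2 * Rabs a.
    have := Rabs_triang (exp a - 1 - 1 * a) a. replace (exp a - 1 - 1 * a + a) with (exp a - 1) by ring.
    have := Rabs_pos a. nra.
  have hs : Rabs (sin b) <= 2 * Rabs b.
    have := Rabs_triang (sin b - 0 - 1 * b) b. replace (sin b - 0 - 1 * b + b) with (sin b) by ring.
    have := Rabs_pos b. nra.
  have he : Rabs (exp a) <= 3.
    have := Rabs_triang (exp a - 1) 1. replace (exp a - 1 + 1) with (exp a) by ring. rewrite Rabs_R1. lra.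
  have pa := Rabs_pos a. have pb := Rabs_pos b.
  have r1 : Rabs (exp a * cos b - 0 * sin b + - (1) + - (1 * a - 0 * b)) <= 4 * e1 * H.
    replace (exp a * cos b - 0 * sin b + - (1) + - (1 * a - 0 * b)) with ((exp a - 1 - 1 * a) + exp a * (cos b - 1 - 0 * b)) by ring.
    have := Rabs_triang (exp a - 1 - 1 * a) (exp a * (cos b - 1 - 0 * b)). rewrite Rabs_mult.
    have : Rabs (exp a) * Rabs (cos b - 1 - 0 * b) <= 3 * (e1 * Rabs b) by apply: Rmult_le_compat => //; exact: Rabs_pos.
    nra.
  have r2 : Rabs (exp a * sin b + 0 * cos b + - 0 + - (1 * b + 0 * a)) <= 5 * e1 * H.
    replace (exp a * sin b + 0 * cos b + - 0 + - (1 * b + 0 * a)) with ((exp a - 1) * sin b + (sin b - 0 - 1 * b)) by ring.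
    have := Rabs_triang ((exp a - 1) * sin b) (sin b - 0 - 1 * b). rewrite Rabs_mult.
    have : Rabs (exp a - 1) * Rabs (sin b) <= (2 * Rabs a) * (2 * Rabs b) by apply: Rmult_le_compat => //; exact: Rabs_pos.
    nra.
  have H0 : 0 <= H by exact: Cmod_ge_0.
  have : e1 * H <= e / 10 * H by apply: Rmult_le_compat_r.
  move=> Q.   apply: (Rle_trans _ (4 * e1 * H + 5 * e1 * H)); first exact: (Rplus_le_compat _ _ _ _ r1 r2). have := Rmult_le_pos _ _ (Rlt_le _ _ e10) H0. lra.
apply: (is_cder_ext (fun w => cexp z * cexp (w - z))%C).
  move=> w. rewrite -cexp_plus. congr cexp. ring.
replace (cexp z) with (0 * cexp (z - z) + cexp z * (1 * (1 + - 0)))%C at 1 by ring.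
apply: (is_cder_mult (fun _ => cexp z) (fun w => cexp (w - z))%C); first exact: is_cder_const.
apply: (is_cder_comp cexp (fun w => w - z)%C).
- apply: (is_cder_ext (fun w => w + - z)%C) => //. replace (1 + - 0)%C with (1 + 0)%C by ring.
  apply: (is_cder_plus (fun w => w) (fun _ => (- z)%C)); [exact: is_cder_id | exact: is_cder_const].
- by replace (z - z)%C with (RtoC 0) by ring.
Qed.

Lemma holo_cexp z : holo cexp z. Proof. eexists; exact: is_cder_cexp. Qed.

Lemma is_rder_cis t : is_rder cis t (Ci * cis t)%C.
Proof.
apply: (is_rder_ext (fun s => cexp (0, s))).
  move=> s. rewrite /cexp /= exp_0. ring.
replace (Ci * cis t)%C with (cexp (0, t) * Ci)%C by (rewrite /cexp /= exp_0; ring).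
apply: (is_rder_comp cexp (fun s => (0, s))); [exact: is_rder_ver | exact: is_cder_cexp].
Qed.

Lemma is_rder_circle (c : C) (r t : R) : is_rder (fun s => c + r * cis s)%C t (r * (Ci * cis t))%C.
Proof.
replace (r * (Ci * cis t))%C with ((0 + (0 * cis t + r * 1)) * (Ci * cis t))%C by ring.
apply: (is_rder_comp (fun w => c + r * w)%C cis); first exact: is_rder_cis.
apply: (is_cder_plus (fun _ => c)); first exact: is_cder_const.
apply: (is_cder_mult (fun _ => RtoC r)); [exact: is_cder_const | exact: is_cder_id].
Qed.

Lemma rcont_circle f (c : C) (r t : R) : ccont f (c + r * cis t)%C -> rcont (fun s => f (c + r * cis s)%C) t.
Proof. move=> H. apply: (rcont_comp f (fun s => c + r * cis s)%C) => //. apply: is_rder_rcont; exact: is_rder_circle. Qed.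

Lemma Cmod_circle (c : C) r t : 0 <= r -> Cmod (c + r * cis t - c)%C = r.
Proof. move=> r0. replace (c + r * cis t - c)%C with (r * cis t)%C by ring. rewrite Cmod_mult Cmod_R Cmod_cis Rabs_pos_eq //. ring. Qed.

Lemma CI_const (k : C) a b : CI (fun _ => k) a b = ((b - a)%R * k)%C.
Proof. rewrite /CI (@RInt_const C_R_CompleteNormedModule). exact: scal_R_Cmult. Qed.

Lemma rcont_const (k : C) t : rcont (fun _ => k) t.
Proof. move=> e e0; exists 1; split; first lra. move=> s _. replace (k - k)%C with (RtoC 0) by ring. by rewrite Cmod_0. Qed.

Lemma CI_minus f g a b : rcont_on f a b -> rcont_on g a b -> CI (fun t => f t - g t)%C a b = (CI f a b - CI g a b)%C.
Proof.
move=> Hu Hv. transitivity (CI (fun s => f s + (-1) * g s)%C a b).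
  apply: CI_ext => t _. ring.
rewrite CI_plus //. rewrite CI_scal //; first ring.
move=> t Ht. apply: (rcont_comp (fun w => (-1) * w)%C g); first by apply: Hv.
apply: holo_cont. holo_tac.
Qed.

(** Goursat's theorem is applied to f(c + e^z) on rectangles of height 2 PI: by periodicity the
    horizontal sides cancel, so the mean over the circle of radius e^s does not depend on s. As s
    tends to minus infinity it tends to f(c). *)
Lemma mean_value f (c : C) R0 r : (forall z, Cmod (z - c)%C < R0 -> holo f z) -> 0 < r < R0 ->
  CI (fun t => f (c + r * cis t)%C) 0 (2 * PI) = ((2 * PI)%R * f c)%C.
Proof.
move=> Hf Hr. have pi0 := PI_RGT_0.
pose F z := f (c + cexp z)%C.
have HF z : fst z <= ln r -> holo F z.
  move=> Hz. apply: (holo_comp f (fun z => c + cexp z)%C).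
    apply: holo_plus; [exact: holo_const | exact: holo_cexp].
  apply: Hf. replace (c + cexp z - c)%C with (cexp z) by ring. rewrite Cmod_cexp.
  apply: Rle_lt_trans (proj2 Hr). rewrite -(exp_ln r); last lra.
  case: Hz => [H|->]; [left; exact: exp_increasing | lra].
have Hv s : s <= ln r -> CI (fun t => F (s, t)) 0 (2 * PI) = CI (fun t => F (ln r, t)) 0 (2 * PI).
  move=> Hs.
  have := goursat F s (ln r) 0 (2 * PI) Hs ltac:(lra) (fun z Hz => HF z (proj2 (proj1 Hz))).
  rewrite /rectI.
  have -> : CI (fun t => F (t, 2 * PI)) s (ln r) = CI (fun t => F (t, 0)) s (ln r).
    apply: CI_ext => t _. rewrite /F /cexp /=. by rewrite -(Rplus_0_l (2 * PI)) cis_2PI.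
  move: (CI (fun t => F (s, t)) _ _) (CI (fun t => F (ln r, t)) _ _) => u v H.
  have E : (Ci * v = Ci * u)%C.
    replace (Ci * v)%C with ((CI (fun s0 : R => F (s0, 0)) s (ln r) + Ci * v -  CI (fun s0 : R => F (s0, 0)) s (ln r) - Ci * u) + Ci * u)%C by ring.
    rewrite H; ring.
  have Q (w : C) : w = (- (Ci * (Ci * w)))%C by case: w => p q; apply: injective_projections; simpl; ring.
  by rewrite (Q u) -E -Q.
have -> : CI (fun t => f (c + r * cis t)%C) 0 (2 * PI) = CI (fun t => F (ln r, t)) 0 (2 * PI).
  apply: CI_ext => t _. rewrite /F /cexp /= exp_ln //. lra.
have FH s : s <= ln r -> rcont_on (fun t => F (s, t)) 0 (2 * PI).
  move=> Hs t _. apply: rcont_ver. apply: holo_cont. exact: HF.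
set I := CI _ _ _ in Hv *.
suff : Cmod (I - (2 * PI)%R * f c)%C <= 0.
  move=> H. have : Cmod (I - (2 * PI)%R * f c)%C = 0 by have := Cmod_ge_0 (I - (2 * PI)%R * f c)%C; lra.
  move/Cmod_eq_0 => E. replace I with ((I - (2 * PI)%R * f c) + (2 * PI)%R * f c)%C by ring. rewrite E; ring.
apply: le_epsilon => e e0. rewrite Rplus_0_l.
have fc : ccont f c by apply: holo_cont; apply: Hf; replace (c - c)%C with (RtoC 0) by ring; rewrite Cmod_0; lra.
have [d [d0 K]] := fc (e / (2 * PI)) ltac:(apply: Rdiv_lt_0_compat; lra).
set s := Rmin (ln r) (ln (d / 2)).
have Hs : s <= ln r by exact: Rmin_l.
rewrite -(Hv s Hs).
have -> : ((2 * PI)%R * f c)%C = CI (fun _ => f c) 0 (2 * PI) by rewrite CI_const Rminus_0_r.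
rewrite -CI_minus; [|exact: FH|by move=> t _; exact: rcont_const].
replace e with (e / (2 * PI) * (2 * PI - 0)) by (field; lra).
apply: CI_bound; first lra.
- move=> t Ht. apply: (rcont_comp (fun w => w - f c)%C (fun t => F (s, t))); first exact: FH.
  apply: holo_cont; holo_tac.
- move=> t _. left. apply: K. replace (c + cexp (s, t) - c)%C with (cexp (s, t)) by ring.
  rewrite Cmod_cexp /=. apply: (Rle_lt_trans _ (exp (ln (d / 2)))).
    have : s <= ln (d / 2) by exact: Rmin_r. case=> [H|->]; [left; exact: exp_increasing | lra].
  rewrite exp_ln; lra.
Qed.

Lemma CI_bound_oriented (g : R -> C) a b M : rcont_on g a b -> (forall t, Rmin a b <= t <= Rmax a b -> Cmod (g t) <= M) ->
  Cmod (CI g a b) <= M * Rabs (b - a).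
Proof.
move=> Hc HM. case: (Rle_lt_dec a b) => ab.
- rewrite Rabs_pos_eq; last lra. apply: CI_bound => // t Ht. apply: HM. rewrite Rmin_left // Rmax_right //.
- have Hc' : rcont_on g b a by move=> t; rewrite Rmin_comm Rmax_comm; exact: Hc.
  have E := CI_chasles g a b a Hc Hc'.
  have E0 : CI g a a = 0%C by rewrite /CI RInt_point.
  have -> : CI g a b = (- CI g b a)%C.
    replace (CI g a b) with (CI g a b + CI g b a - CI g b a)%C by ring. rewrite E E0; ring.
  rewrite Cmod_opp Rabs_left; last lra. replace (- (b - a)) with (a - b) by ring.
  apply: CI_bound => //; first lra. move=> t Ht. apply: HM. rewrite Rmin_right ?Rmax_left; lra.
Qed.

(** The integral along the path that goes horizontally from c to the abscissa of z and then
    vertically to z. *)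
Definition prim (f : C -> C) (c z : C) : C :=
  (CI (fun s => f (s, snd c)) (fst c) (fst z) + Ci * CI (fun s => f (fst z, s)) (snd c) (snd z))%C.

Lemma CI_swap g a b : rcont_on g a b -> CI g b a = (- CI g a b)%C.
Proof.
move=> H. have H' : rcont_on g b a by move=> t; rewrite Rmin_comm Rmax_comm; exact: H.
have E := CI_chasles g a b a H H'. have E0 : CI g a a = 0%C by rewrite /CI RInt_point.
replace (CI g b a) with (CI g a b + CI g b a - CI g a b)%C by ring. rewrite E E0; ring.
Qed.

(** The increments in [prim_cder] may have either sign; vanishing for ordered corners is transferred
    to corners in any order by following the signs. *)
Lemma rectI_oriented f x1 x2 y1 y2 :
  (forall z, in_rect (Rmin x1 x2) (Rmax x1 x2) (Rmin y1 y2) (Rmax y1 y2) z -> ccont f z) ->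
  rectI f (Rmin x1 x2) (Rmax x1 x2) (Rmin y1 y2) (Rmax y1 y2) = 0%C -> rectI f x1 x2 y1 y2 = 0%C.
Proof.
move=> Hc.
have a1 := Rmin_l x1 x2. have a2 := Rmin_r x1 x2. have a3 := Rmax_l x1 x2. have a4 := Rmax_r x1 x2.
have b1 := Rmin_l y1 y2. have b2 := Rmin_r y1 y2. have b3 := Rmax_l y1 y2. have b4 := Rmax_r y1 y2.
have Hh y u v : Rmin y1 y2 <= y <= Rmax y1 y2 -> Rmin x1 x2 <= u <= Rmax x1 x2 -> Rmin x1 x2 <= v <= Rmax x1 x2 ->
   CI (fun s => f (s, y)) v u = (- CI (fun s => f (s, y)) u v)%C.
  move=> h1 h2 h3. apply: CI_swap. exact: (rcont_on_hor f _ _ _ _ y u v Hc).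
have Hv x u v : Rmin x1 x2 <= x <= Rmax x1 x2 -> Rmin y1 y2 <= u <= Rmax y1 y2 -> Rmin y1 y2 <= v <= Rmax y1 y2 ->
   CI (fun s => f (x, s)) v u = (- CI (fun s => f (x, s)) u v)%C.
  move=> h1 h2 h3. apply: CI_swap. exact: (rcont_on_ver f _ _ _ _ x u v Hc).
have Sx : rectI f x2 x1 y1 y2 = (- rectI f x1 x2 y1 y2)%C.
  rewrite /rectI (Hh y1 x1 x2) ?(Hh y2 x1 x2); try lra. ring.
have Sy : rectI f x1 x2 y2 y1 = (- rectI f x1 x2 y1 y2)%C.
  rewrite /rectI (Hv x1 y1 y2) ?(Hv x2 y1 y2); try lra. ring.
have Sxy : rectI f x2 x1 y2 y1 = rectI f x1 x2 y1 y2.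
  rewrite /rectI (Hv x1 y1 y2) ?(Hv x2 y1 y2) ?(Hh y1 x1 x2) ?(Hh y2 x1 x2); try lra. ring.
have opp0 (u : C) : (- u = 0)%C -> u = 0%C by move=> H; replace u with (- - u)%C by ring; rewrite H; ring.
case: (Rle_dec x1 x2) => hx; case: (Rle_dec y1 y2) => hy.
- rewrite !Rmin_left ?Rmax_right //; lra.
- rewrite (Rmin_left x1 x2) // (Rmax_right x1 x2) // (Rmin_right y1 y2) ?(Rmax_left y1 y2); try lra.
  rewrite Sy. exact: opp0.
- rewrite (Rmin_left y1 y2) // (Rmax_right y1 y2) // (Rmin_right x1 x2) ?(Rmax_left x1 x2); try lra.
  rewrite Sx. exact: opp0.
- rewrite !Rmin_right ?Rmax_left; try lra. by rewrite Sxy.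
Qed.

Lemma prim_cder f (c z : C) dl : 0 < dl ->
  (forall p, Rmin (fst c) (fst z) - dl < fst p < Rmax (fst c) (fst z) + dl -> snd p = snd c -> ccont f p) ->
  (forall p, Rabs (fst p - fst z) < dl -> Rmin (snd c) (snd z) - dl < snd p < Rmax (snd c) (snd z) + dl -> ccont f p) ->
  (forall x1 x2 y1 y2, x1 <= x2 -> y1 <= y2 -> Rabs (x1 - fst z) < dl -> Rabs (x2 - fst z) < dl ->
     Rmin (snd c) (snd z) <= y1 -> y2 <= Rmax (snd c) (snd z) -> rectI f x1 x2 y1 y2 = 0%C) ->
  is_cder (prim f c) z (f z).
Proof.
move: c z => [cx cy] [x y] d0 /= H1 H2 H3.
have hc := Rmin_l cx x. have hc2 := Rmin_r cx x. have hc3 := Rmax_l cx x. have hc4 := Rmax_r cx x.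
have hd := Rmin_l cy y. have hd2 := Rmin_r cy y. have hd3 := Rmax_l cy y. have hd4 := Rmax_r cy y.
have Cz : ccont f (x, y).
  apply: H2; rewrite /=; last lra. by rewrite Rminus_diag Rabs_R0.
move=> e e0. case: (Cz (e/2)) => [|d1 [d10 K]]; first lra.
exists (Rmin dl (d1 / 2)); split; first by apply: Rmin_glb_lt; lra.
move=> [h1 h2] Hh. have u1 := Rmin_l dl (d1 / 2). have u2 := Rmin_r dl (d1 / 2).
have := Rmax_Cmod (h1, h2) => /=. have := Rmax_l (Rabs h1) (Rabs h2). have := Rmax_r (Rabs h1) (Rabs h2) => m1 m2 m3.
set H := Cmod (h1, h2) in Hh m3 *.
have [p1 p2] := Rabs_def2 h1 dl ltac:(lra). have [p3 p4] := Rabs_def2 h2 dl ltac:(lra).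
have cont_v s u v : Rabs (s - x) < dl -> Rmin cy y - dl < Rmin u v -> Rmax u v < Rmax cy y + dl -> rcont_on (fun t => f (s, t)) u v.
  move=> hs h3 h4 t Ht. apply: rcont_ver. apply: H2 => //=. lra.
have cont_h u v : Rmin cx x - dl < Rmin u v -> Rmax u v < Rmax cx x + dl -> rcont_on (fun t => f (t, cy)) u v.
  move=> h3 h4 t Ht. apply: rcont_hor. apply: H1 => //=. lra.
have cont_hy u v : x - dl < Rmin u v -> Rmax u v < x + dl -> rcont_on (fun t => f (t, y)) u v.
  move=> h3 h4 t Ht. apply: rcont_hor. apply: H2 => /=; last lra. apply: Rabs_def1; lra.
have mm a b l u : l < a -> l < b -> a < u -> b < u -> l < Rmin a b /\ Rmax a b < u.
  by move=> *; split; [apply: Rmin_glb_lt | apply: Rmax_lub_lt].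
have E1 : CI (fun s => f (s, cy)) cx (x + h1) = (CI (fun s => f (s, cy)) cx x + CI (fun s => f (s, cy)) x (x + h1))%C.
  rewrite (CI_chasles _ cx x) //; apply: cont_h; case: (mm cx x (Rmin cx x - dl) (Rmax cx x + dl)); case: (mm x (x + h1) (Rmin cx x - dl) (Rmax cx x + dl)); lra.
have ax : Rabs (x + h1 - x) < dl by replace (x + h1 - x) with h1 by ring; lra.
have E2 : CI (fun s => f ((x + h1)%R, s)) cy (y + h2) = (CI (fun s => f ((x + h1)%R, s)) cy y + CI (fun s => f ((x + h1)%R, s)) y (y + h2))%C.
  rewrite (CI_chasles _ cy y) //; apply: cont_v => //; case: (mm cy y (Rmin cy y - dl) (Rmax cy y + dl)); case: (mm y (y + h2) (Rmin cy y - dl) (Rmax cy y + dl)); lra.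
have E3 : rectI f x (x + h1) cy y = 0%C.
  have b1 : x - dl < Rmin x (x + h1) by apply: Rmin_glb_lt; lra.
  have b2 : Rmax x (x + h1) < x + dl by apply: Rmax_lub_lt; lra.
  have b3 : Rmin x (x + h1) <= x := Rmin_l _ _. have b4 : x <= Rmax x (x + h1) := Rmax_l _ _.
  apply: rectI_oriented.
  - move=> p [Hp1 Hp2]. apply: H2; last lra. apply: Rabs_def1; lra.
  - apply: H3; try lra; apply: Rabs_def1; lra.
have Ehp : prim f (cx, cy) ((x, y) + (h1, h2))%C = (prim f (cx, cy) (x, y) + CI (fun s => f (s, y)) x (x + h1) + Ci * CI (fun s => f ((x + h1)%R, s)) y (y + h2))%C.
  rewrite /prim /= E1 E2. move: E3. rewrite /rectI.
  move: (CI (fun s => f (s, cy)) x (x + h1)) (CI (fun s => f ((x + h1)%R, s)) cy y) (CI (fun s => f (s, y)) x (x + h1)) (CI (fun s => f (x, s)) cy y) => A B D E G.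
  have -> : A = (D + Ci * E - Ci * B)%C.
    replace A with ((A + Ci * B - D - Ci * E) + (D + Ci * E - Ci * B))%C by ring. rewrite G; ring.
  ring.
rewrite Ehp.
have K' p : Cmod (p - (x, y))%C < d1 -> Cmod (f p - f (x, y))%C <= e / 2 by move=> Hp; left; exact: K.
have J1 : Cmod (CI (fun s => f (s, y)) x (x + h1) - h1 * f (x, y))%C <= e / 2 * Rabs h1.
  have b1 : x - dl < Rmin x (x + h1) by apply: Rmin_glb_lt; lra.
  have b2 : Rmax x (x + h1) < x + dl by apply: Rmax_lub_lt; lra.
  have -> : (h1 * f (x, y))%C = CI (fun _ => f (x, y)) x (x + h1) by rewrite CI_const; congr (RtoC _ * _)%C; ring.
  have hc' := cont_hy x (x + h1) b1 b2.
  rewrite -CI_minus //; last by move=> t _; exact: rcont_const.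
  have -> : Rabs h1 = Rabs (x + h1 - x) by congr Rabs; ring.
  apply: CI_bound_oriented.
  - move=> t Ht. apply: (rcont_comp (fun w => w - f (x, y))%C (fun t => f (t, y))); first exact: hc'.
    apply: holo_cont; holo_tac.
  - move=> t Ht. apply: K'. apply: Rle_lt_trans (Cmod_le_sum _) _ => /=.
    replace (y + - y) with 0 by ring. rewrite Rabs_R0 Rplus_0_r.
    have : Rabs (t + - x) <= Rabs h1.
      move: Ht; rewrite /Rmin /Rmax; case: Rle_dec => q [Ht1 Ht2].
      + rewrite !Rabs_pos_eq; lra.
      + rewrite !Rabs_left1; lra.
    lra.
have J2 : Cmod (CI (fun s => f ((x + h1)%R, s)) y (y + h2) - h2 * f (x, y))%C <= e / 2 * Rabs h2.
  have b1 : Rmin cy y - dl < Rmin y (y + h2) by apply: Rmin_glb_lt; lra.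
  have b2 : Rmax y (y + h2) < Rmax cy y + dl by apply: Rmax_lub_lt; lra.
  have -> : (h2 * f (x, y))%C = CI (fun _ => f (x, y)) y (y + h2) by rewrite CI_const; congr (RtoC _ * _)%C; ring.
  have hc' := cont_v (x + h1) y (y + h2) ax b1 b2.
  rewrite -CI_minus //; last by move=> t _; exact: rcont_const.
  have -> : Rabs h2 = Rabs (y + h2 - y) by congr Rabs; ring.
  apply: CI_bound_oriented.
  - move=> t Ht. apply: (rcont_comp (fun w => w - f (x, y))%C (fun t => f ((x + h1)%R, t))); first exact: hc'.
    apply: holo_cont; holo_tac.
  - move=> t Ht. apply: K'. apply: Rle_lt_trans (Cmod_le_sum _) _ => /=.
    replace (x + h1 + - x) with h1 by ring.
    have : Rabs (t + - y) <= Rabs h2.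
      move: Ht; rewrite /Rmin /Rmax; case: Rle_dec => q [Ht1 Ht2].
      + rewrite !Rabs_pos_eq; lra.
      + rewrite !Rabs_left1; lra.
    lra.
set I1 := CI (fun s => f (s, y)) _ _ in J1 *. set I2 := CI (fun s => f ((x + h1)%R, s)) _ _ in J2 *.
replace (prim f (cx, cy) (x, y) + I1 + Ci * I2 - prim f (cx, cy) (x, y) - f (x, y) * (h1, h2))%C with
  ((I1 - h1 * f (x, y)) + Ci * (I2 - h2 * f (x, y)))%C; last first.
  have -> : (h1, h2) = (h1 + Ci * h2)%C by apply: injective_projections; simpl; ring.
  ring.
have t1 := Cmod_triangle (I1 - h1 * f (x, y))%C (Ci * (I2 - h2 * f (x, y)))%C. rewrite Cmod_mult Cmod_Ci in t1.
nra.
Qed.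


(** * Cauchy's formula *)

Lemma Cconj_RtoC (x : R) : Cconj x = x.
Proof. apply: injective_projections; simpl; ring. Qed.

Lemma Cmod_fst (z : C) : Rabs (fst z) <= Cmod z.
Proof. apply: Rle_trans (Rmax_Cmod z). exact: Rmax_l. Qed.
Lemma Cmod_snd (z : C) : Rabs (snd z) <= Cmod z.
Proof. apply: Rle_trans (Rmax_Cmod z). exact: Rmax_r. Qed.

Lemma Cmod_mono (a b c d : R) : Rabs a <= Rabs c -> Rabs b <= Rabs d -> Cmod (a, b) <= Cmod (c, d).
Proof.
move=> h1 h2. rewrite /Cmod /=. apply: sqrt_le_1_alt. rewrite !Rmult_1_r.
have := Rsqr_le_abs_1 _ _ h1. have := Rsqr_le_abs_1 _ _ h2. rewrite /Rsqr. lra.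
Qed.

(** Everything outside a square of half side eta around w contributes 0, and by continuity at w the
    square contributes O(eta). *)
Lemma goursat_except f w a b c d : a <= b -> c <= d -> ccont_rect f a b c d ->
  (forall z, in_rect a b c d z -> z <> w -> holo f z) -> rectI f a b c d = 0%C.
Proof.
move=> ab cd Hc Hf.
case: (classic (in_rect a b c d w)) => Hw; last first.
  apply: goursat => // z Hz. apply: Hf => // E. by rewrite E in Hz.
have [dw [dw0 Kw]] := Hc w Hw 1 Rlt_0_1.
set M := Cmod (f w) + 1.
have M0 : 0 < M by rewrite /M; have := Cmod_ge_0 (f w); lra.
have small eta : 0 < eta -> eta < dw / 4 -> Cmod (rectI f a b c d) <= 2 * M * (4 * eta).
  move=> h0 h1. case: Hw => Hw1 Hw2.
  set a1 := Rmax a (fst w - eta). set b1 := Rmin b (fst w + eta).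
  set c1 := Rmax c (snd w - eta). set d1 := Rmin d (snd w + eta).
  have A : a <= a1 <= b1 /\ b1 <= b /\ fst w - eta <= a1 <= fst w /\ fst w <= b1 <= fst w + eta /\ (a < a1 -> a1 < fst w) /\ (b1 < b -> fst w < b1).
    rewrite /a1 /b1 /Rmax /Rmin. case: Rle_dec => ?; case: Rle_dec => ?; lra.
  have B : c <= c1 <= d1 /\ d1 <= d /\ snd w - eta <= c1 <= snd w /\ snd w <= d1 <= snd w + eta /\ (c < c1 -> c1 < snd w) /\ (d1 < d -> snd w < d1).
    rewrite /c1 /d1 /Rmax /Rmin. case: Rle_dec => ?; case: Rle_dec => ?; lra.
  have sub x1 x2 y1 y2 : a <= x1 -> x2 <= b -> c <= y1 -> y2 <= d -> ccont_rect f x1 x2 y1 y2.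
    move=> ? ? ? ? z [? ?]. apply: Hc. split; lra.
  have Z0 x y1 y2 : rectI f x x y1 y2 = 0%C by rewrite /rectI /CI !RInt_point; change (@zero C_R_CompleteNormedModule) with (RtoC 0); ring.
  have Z1 x1 x2 y : rectI f x1 x2 y y = 0%C by rewrite /rectI /CI !RInt_point; change (@zero C_R_CompleteNormedModule) with (RtoC 0); ring.
  have G x1 x2 y1 y2 : x1 <= x2 -> y1 <= y2 -> a <= x1 -> x2 <= b -> c <= y1 -> y2 <= d -> ~ in_rect x1 x2 y1 y2 w -> rectI f x1 x2 y1 y2 = 0%C.
    move=> ? ? ? ? ? ? N. apply: goursat => // z [Hz1 Hz2]. apply: Hf; first by split; lra. move=> E; apply: N; rewrite -E. by split.
  rewrite (rectI_split_h f a a1 b) //; last lra.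
  have -> : rectI f a a1 c d = 0%C.
    case: (Rle_lt_or_eq_dec a a1 ltac:(lra)) => [q|<-]; last exact: Z0.
    apply: G; try lra. move=> [? ?]; lra.
  rewrite (rectI_split_h f a1 b1 b); try lra; last by apply: sub; lra.
  have -> : rectI f b1 b c d = 0%C.
    case: (Rle_lt_or_eq_dec b1 b ltac:(lra)) => [q|->]; last exact: Z0.
    apply: G; try lra. move=> [? ?]; lra.
  rewrite (rectI_split_v f a1 b1 c c1 d); try lra; last by apply: sub; lra.
  have -> : rectI f a1 b1 c c1 = 0%C.
    case: (Rle_lt_or_eq_dec c c1 ltac:(lra)) => [q|<-]; last exact: Z1.
    apply: G; try lra. move=> [? ?]; lra.
  rewrite (rectI_split_v f a1 b1 c1 d1 d); try lra; last by apply: sub; lra.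
  have -> : rectI f a1 b1 d1 d = 0%C.
    case: (Rle_lt_or_eq_dec d1 d ltac:(lra)) => [q|->]; last exact: Z1.
    apply: G; try lra. move=> [? ?]; lra.
  replace (0 + (0 + (rectI f a1 b1 c1 d1 + 0) + 0))%C with (rectI f a1 b1 c1 d1) by ring.
  replace (0 + (0 + (rectI f a1 b1 c1 d1 + 0) + 0))%C with (rectI f a1 b1 c1 d1) by ring.
  apply: (Rle_trans _ (2 * M * ((b1 - a1) + (d1 - c1)))).
    apply: rectI_bound; try lra; first by apply: sub; lra.
    move=> z [Hz1 Hz2]. have := Kw z.
    have hz : Cmod (z - w)%C < dw.
      apply: Rle_lt_trans (Cmod_le_sum _) _ => /=.
      have : Rabs (fst z + - fst w) <= eta by apply: Rabs_le; lra.
      have : Rabs (snd z + - snd w) <= eta by apply: Rabs_le; lra. lra.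
    move/(_ hz). have := Cmod_rev (f z) (f w). rewrite /M. lra.
  apply: Rmult_le_compat_l; lra.
apply: Cmod_eq_0. apply: Rle_antisym; last exact: Cmod_ge_0.
apply: le_epsilon => e e0. rewrite Rplus_0_l.
set eta := Rmin (dw / 8) (e / (8 * M)).
have q0 : 0 < e / (8 * M) by apply: Rdiv_lt_0_compat; lra.
have eta0 : 0 < eta by apply: Rmin_glb_lt; lra.
have e1 : eta <= dw / 8 by exact: Rmin_l. have e2 : eta <= e / (8 * M) by exact: Rmin_r.
apply: Rle_trans (small eta eta0 ltac:(lra)) _.
replace e with (2 * M * (4 * (e / (8 * M)))) by (field; lra).
apply: Rmult_le_compat_l; lra.
Qed.

Lemma disc_prim f (c : C) r :
  (forall z, Cmod (z - c)%C < r -> ccont f z) ->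
  (forall x1 x2 y1 y2, x1 <= x2 -> y1 <= y2 -> (forall z, in_rect x1 x2 y1 y2 z -> Cmod (z - c)%C < r) -> rectI f x1 x2 y1 y2 = 0%C) ->
  forall z, Cmod (z - c)%C < r -> is_cder (prim f c) z (f z).
Proof.
move=> Hc HG z Hz.
(* Moving each coordinate by dl changes the distance from c by at most 2 dl, half of the room that
   is left. *)
set dl := (r - Cmod (z - c)%C) / 4.
have d0 : 0 < dl by rewrite /dl; lra.
have bet (u v w t : R) : Rmin u v - t < w < Rmax u v + t -> 0 < t -> Rabs (w - u) <= Rabs (v - u) + t.
  move=> H t0. move: H. rewrite /Rmin /Rmax. case: Rle_dec => q H.
  - rewrite (Rabs_pos_eq (v - u)); last lra. apply: Rabs_le; lra.
  - rewrite (Rabs_left1 (v - u)); last lra. apply: Rabs_le; lra.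
have key (p : C) : Rabs (fst p - fst c) <= Rabs (fst z - fst c) + dl -> Rabs (snd p - snd c) <= Rabs (snd z - snd c) + dl -> Cmod (p - c)%C < r.
  move=> h1 h2.
  have E : Cmod (p - c)%C <= Cmod (Rabs (fst z - fst c) + dl, Rabs (snd z - snd c) + dl).
    rewrite (_ : (p - c)%C = (fst p - fst c, snd p - snd c)); last by [].
    have := Rabs_pos (fst z - fst c). have := Rabs_pos (snd z - snd c) => q1 q2.
    apply: Cmod_mono; [rewrite (Rabs_pos_eq (_ + dl)) // | rewrite (Rabs_pos_eq (_ + dl)) //]; lra.
  have E2 : Cmod (Rabs (fst z - fst c) + dl, Rabs (snd z - snd c) + dl) <= Cmod (Rabs (fst z - fst c), Rabs (snd z - snd c)) + Cmod (dl, dl).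
    exact: (Cmod_triangle (Rabs (fst z - fst c), Rabs (snd z - snd c)) (dl, dl)).
  have E3 : Cmod (Rabs (fst z - fst c), Rabs (snd z - snd c)) <= Cmod (z - c)%C.
    apply: Cmod_mono; rewrite Rabs_Rabsolu; by right.
  have E4 := Cmod_le_sum (dl, dl). rewrite /= Rabs_pos_eq in E4; last lra.
  have D : 4 * dl = r - Cmod (z - c)%C by rewrite /dl; field. lra.
apply: (prim_cder f c z dl) => //.
- move=> p h1 h2. apply: Hc. apply: key; last by (rewrite h2 Rminus_diag Rabs_R0; have := Rabs_pos (snd z - snd c); lra).
  exact: bet.
- move=> p h1 h2. apply: Hc. apply: key; last exact: bet.
  have := Rabs_triang (fst p - fst z) (fst z - fst c). replace (fst p - fst z + (fst z - fst c)) with (fst p - fst c) by ring. lra.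
- move=> x1 x2 y1 y2 h1 h2 h3 h4 h5 h6. apply: HG => // p [Hp1 Hp2].
  have [a1 a2] := Rabs_def2 _ _ h3. have [a3 a4] := Rabs_def2 _ _ h4.
  apply: key.
  + have : Rabs (fst p - fst z) <= dl by apply: Rabs_le; lra.
    have := Rabs_triang (fst p - fst z) (fst z - fst c). replace (fst p - fst z + (fst z - fst c)) with (fst p - fst c) by ring. lra.
  + apply: bet => //. lra.
Qed.

Definition cderiv (f : C -> C) (z : C) : C := epsilon (inhabits (RtoC 0)) (fun l => is_cder f z l).
Lemma cderiv_correct f z : holo f z -> is_cder f z (cderiv f z).
Proof. move=> H. exact: (epsilon_spec (inhabits (RtoC 0)) _ H). Qed.

Definition dq (f : C -> C) (w z : C) : C :=
  match excluded_middle_informative (z = w) with left _ => cderiv f w | right _ => ((f z - f w) / (z - w))%C end.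

Lemma dq_diag f w : dq f w w = cderiv f w.
Proof. rewrite /dq. by case: excluded_middle_informative. Qed.
Lemma dq_off f w z : z <> w -> dq f w z = ((f z - f w) / (z - w))%C.
Proof. rewrite /dq. by case: excluded_middle_informative. Qed.

Lemma Csub_neq0 (z w : C) : z <> w -> (z - w)%C <> 0%C.
Proof. move=> H E. apply: H. replace z with ((z - w) + w)%C by ring. rewrite E; ring. Qed.

Lemma dq_mul f w z : ((z - w) * dq f w z)%C = (f z - f w)%C.
Proof.
case: (classic (z = w)) => [->|H].
  replace (w - w)%C with (RtoC 0) by ring. replace (f w - f w)%C with (RtoC 0) by ring. ring.
rewrite dq_off //. field. exact: Csub_neq0.
Qed.

Lemma dq_cont_diag f w : holo f w -> ccont (dq f w) w.
Proof.
move=> H e e0. have [d [d0 K]] := cderiv_correct f w H (e/2) ltac:(lra).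
exists d; split => // z Hz. rewrite dq_diag.
case: (classic (z = w)) => [->|N].
  rewrite dq_diag. replace (cderiv f w - cderiv f w)%C with (RtoC 0) by ring. rewrite Cmod_0. lra.
rewrite dq_off //. have := K (z - w)%C Hz. replace (w + (z - w))%C with z by ring.
have N' := Csub_neq0 z w N.
replace (f z - f w - cderiv f w * (z - w))%C with (((f z - f w) / (z - w) - cderiv f w) * (z - w))%C by (field; exact: N').
rewrite Cmod_mult => H1. have p := Cmod_pos _ N'.
have : Cmod ((f z - f w) / (z - w) - cderiv f w)%C <= e / 2 by apply: (Rmult_le_reg_r (Cmod (z - w)%C)).
lra.
Qed.

Lemma dq_holo_off f w z : z <> w -> holo f z -> holo (dq f w) z.
Proof.
move=> N H. have N' := Csub_neq0 z w N.
apply: (holo_ext_loc (fun u => (f u - f w) / (u - w))%C _ _ (Cmod (z - w)%C)); first exact: Cmod_pos.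
- move=> u Hu. rewrite dq_off // => E. rewrite E Cmod_sub_sym in Hu. lra.
- apply: holo_div => //; apply: holo_minus => //; try exact: holo_const. exact: holo_id.
Qed.

Lemma CI_conj f a b : rcont_on f a b -> CI (fun t => Cconj (f t)) a b = Cconj (CI f a b).
Proof.
move=> H. apply: (@is_RInt_unique C_R_CompleteNormedModule).
have := RInt_correct _ _ _ (CI_ex f a b H). rewrite -/(CI f a b). move: (CI f a b) => I HI.
have H1 := @is_RInt_fct_extend_fst R_NormedModule R_NormedModule f a b I HI.
have H2 := @is_RInt_fct_extend_snd R_NormedModule R_NormedModule f a b I HI.
apply: (@is_RInt_fct_extend_pair R_NormedModule R_NormedModule) => //.
exact: (@is_RInt_opp R_NormedModule).
Qed.

Lemma rcont_mult f g t : rcont f t -> rcont g t -> rcont (fun s => f s * g s)%C t.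
Proof.
move=> Hf Hg e e0.
set A := Cmod (f t). set B := Cmod (g t).
have A0 : 0 <= A by apply: Cmod_ge_0. have B0 : 0 <= B by apply: Cmod_ge_0.
set e1 := Rmin 1 (e / (A + B + 2)).
have q0 : 0 < e / (A + B + 2) by apply: Rdiv_lt_0_compat; lra.
have e10 : 0 < e1 by apply: Rmin_glb_lt; lra.
have e11 : e1 <= 1 by exact: Rmin_l.
have e12 : e1 * (A + B + 2) <= e.
  replace e with (e / (A + B + 2) * (A + B + 2)) by (field; lra). apply: Rmult_le_compat_r; [lra | exact: Rmin_r].
have [d1 [d10 K1]] := Hf e1 e10. have [d2 [d20 K2]] := Hg e1 e10.
exists (Rmin d1 d2); split; first exact: Rmin_glb_lt. move=> s Hs.
have := Rmin_l d1 d2. have := Rmin_r d1 d2 => u v.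
have {}K1 := K1 s ltac:(lra). have {}K2 := K2 s ltac:(lra).
replace (f s * g s - f t * g t)%C with ((f s - f t) * (g s - g t) + (f s - f t) * g t + f t * (g s - g t))%C by ring.
have := Cmod_triangle ((f s - f t) * (g s - g t) + (f s - f t) * g t)%C (f t * (g s - g t))%C.
have := Cmod_triangle ((f s - f t) * (g s - g t))%C ((f s - f t) * g t)%C.
rewrite !Cmod_mult -/A -/B. have := Cmod_ge_0 (f s - f t)%C. have := Cmod_ge_0 (g s - g t)%C.
move: (Cmod (f s - f t)%C) (Cmod (g s - g t)%C) K1 K2 => X Y K1 K2 Y0 X0 t1 t2.
have : X * Y <= e1 * 1 by apply: Rmult_le_compat; lra.
have : X * B <= e1 * B by apply: Rmult_le_compat_r; lra.
have : A * Y <= A * e1 by apply: Rmult_le_compat_l; lra. lra.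
Qed.

Lemma rcont_inv (f : R -> C) t : f t <> 0%C -> rcont f t -> rcont (fun s => / f s)%C t.
Proof. move=> H0 H. apply: (rcont_comp (fun w => / w)%C f) => //. apply: holo_cont. exists (- / (f t * f t))%C. exact: is_cder_inv. Qed.

(** With q = (w - c)/r the integrand is 1/(1 - q e^(-it)), the conjugate of 1/(1 - conj(q) u) at u =
    e^(it). The latter is holomorphic on a disc larger than the unit disc and has the value 1 at 0,
    so the mean value property applies. *)
Lemma mean_kernel (c w : C) r : Cmod (w - c)%C < r ->
  CI (fun t => ((r * cis t) / (c + r * cis t - w))%C) 0 (2 * PI) = (2 * PI)%R.
Proof.
move=> Hw. have r0 : 0 < r by have := Cmod_ge_0 (w - c)%C; lra. have pi0 := PI_RGT_0.
have rn : RtoC r <> 0%C by apply: Cneq_mod; rewrite Cmod_R Rabs_pos_eq; lra.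
set q := ((w - c) / r)%C.
have qm : Cmod q < 1.
  rewrite /q Cmod_div // Cmod_R Rabs_pos_eq; last lra.
  apply: (Rmult_lt_reg_r r) => //. rewrite /Rdiv Rmult_assoc Rinv_l; lra.
have cc t : (cis t * Cconj (cis t))%C = 1%C by have := sin2_cos2 t; rewrite /Rsqr /cis => h; apply: injective_projections; simpl; [lra | ring].
(* The maximum with 1/2 keeps the radius finite for q = 0 and still larger than 1. *)
have s0 u : Cmod u < / Rmax (Cmod q) (/2) -> (1 - Cconj q * u)%C <> 0%C.
  move=> Hu E.
  have : Cmod (Cconj q * u)%C = 1.
    replace (Cconj q * u)%C with (1 - (1 - Cconj q * u))%C by ring. rewrite E. replace (1 - 0)%C with (RtoC 1) by ring. exact: Cmod_1.
  rewrite Cmod_mult Cmod_conj.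
  have mq : 0 < Rmax (Cmod q) (/2) by apply: Rlt_le_trans (Rmax_r _ _); lra.
  have := Rmax_l (Cmod q) (/2). have := Cmod_ge_0 q. have := Cmod_ge_0 u.
  have : Cmod u * Rmax (Cmod q) (/2) < 1.
    rewrite -(Rinv_l (Rmax (Cmod q) (/2))); last lra. exact: Rmult_lt_compat_r. nra.
have mr : 1 < / Rmax (Cmod q) (/2).
  rewrite -Rinv_1. apply: Rinv_lt_contravar; last by apply: Rmax_lub_lt; lra.
  rewrite Rmult_1_r. apply: Rlt_le_trans (Rmax_r _ _); lra.
have S := mean_value (fun u => / (1 - Cconj q * u))%C 0 (/ Rmax (Cmod q) (/2)) 1.
have {}S := S ltac:(move=> z Hz; apply: holo_inv; [apply: s0; by replace (z - 0)%C with z in Hz by ring | holo_tac]) ltac:(lra).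
transitivity (CI (fun t => Cconj (/ (1 - Cconj q * (0 + 1%R * cis t)))%C) 0 (2 * PI)).
  apply: CI_ext => t _.
  have n1 : (c + r * cis t - w)%C <> 0%C.
    apply: Cneq_mod. have := Cmod_rev (c + r * cis t - c)%C (w - c)%C. rewrite Cmod_circle; last lra.
    replace (c + r * cis t - c - (w - c))%C with (c + r * cis t - w)%C by ring. lra.
  have n2 : (1 - Cconj q * (0 + 1%R * cis t))%C <> 0%C.
    apply: s0. replace (0 + 1%R * cis t)%C with (cis t) by ring. by rewrite Cmod_cis.
  have -> : Cconj (/ (1 - Cconj q * (0 + 1%R * cis t)))%C = (/ (1 - q * Cconj (cis t)))%C.
    have E : Cconj (1 - Cconj q * (0 + 1%R * cis t))%C = (1 - q * Cconj (cis t))%C.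
      rewrite Cminus_conj Cmult_conj Cplus_conj Cmult_conj Cconj_conj !Cconj_RtoC. ring.
    rewrite -E. rewrite Cinv_conj //.
  have n3 : (1 - q * Cconj (cis t))%C <> 0%C.
    have E : Cconj (1 - Cconj q * (0 + 1%R * cis t))%C = (1 - q * Cconj (cis t))%C.
      rewrite Cminus_conj Cmult_conj Cplus_conj Cmult_conj Cconj_conj !Cconj_RtoC. ring.
    rewrite -E. move=> E0. apply: n2. by rewrite -(Cconj_conj (1 - _)%C) E0 Cconj_RtoC.
  have E : (r * cis t * (1 - q * Cconj (cis t)))%C = (c + r * cis t - w)%C.
    transitivity (r * cis t - (r * q) * (cis t * Cconj (cis t)))%C; first ring.
    rewrite cc /q. field. exact: rn.
  have n4 : cis t <> 0%C by apply: Cneq_mod; rewrite Cmod_cis; lra.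
  rewrite -E. field. by split; [|split].
rewrite CI_conj.
  rewrite S. replace (1 - Cconj q * 0)%C with (RtoC 1) by ring.
  rewrite Cmult_conj Cconj_RtoC -(RtoC_inv 1) ?Cconj_RtoC ?Rinv_1; try lra. ring.
move=> t _. apply: (rcont_circle (fun u => / (1 - Cconj q * u))%C 0 1). apply: holo_cont.
apply: holo_inv; last holo_tac. apply: s0. replace (0 + 1%R * cis t)%C with (cis t) by ring. by rewrite Cmod_cis.
Qed.

(** The difference quotient of f at w has a primitive on the disc by [goursat_except], so its
    integral over the circle is 0. What remains is f(w) times the integral of the kernel, computed
    in [mean_kernel]. *)
Lemma cauchy_formula f (c w : C) R0 r : (forall z, Cmod (z - c)%C < R0 -> holo f z) -> r < R0 -> Cmod (w - c)%C < r ->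
  CI (fun t => (f (c + r * cis t) * (r * cis t) / (c + r * cis t - w))%C) 0 (2 * PI) = ((2 * PI)%R * f w)%C.
Proof.
move=> Hf rR Hw. have r0 : 0 < r by have := Cmod_ge_0 (w - c)%C; lra. have pi0 := PI_RGT_0.
have on t : Cmod (c + r * cis t - c)%C < R0 by rewrite Cmod_circle; lra.
have n1 t : (c + r * cis t - w)%C <> 0%C.
  apply: Cneq_mod. have := Cmod_rev (c + r * cis t - c)%C (w - c)%C. rewrite Cmod_circle; last lra.
  replace (c + r * cis t - c - (w - c))%C with (c + r * cis t - w)%C by ring. lra.
pose g := dq f w.
have hw : holo f w by apply: Hf; lra.
have gc z : Cmod (z - c)%C < R0 -> ccont g z.
  move=> Hz. case: (classic (z = w)) => [->|N]; first exact: dq_cont_diag.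
  apply: holo_cont. apply: dq_holo_off => //. exact: Hf.
have P : forall z, Cmod (z - c)%C < R0 -> is_cder (prim g c) z (g z).
  apply: disc_prim => // x1 x2 y1 y2 h1 h2 H. apply: (goursat_except g w) => //.
  - move=> z Hz; apply: gc; exact: H.
  - move=> z Hz N. apply: dq_holo_off => //. apply: Hf; exact: H.
have rc1 t : rcont (fun s => g (c + r * cis s)%C) t by apply: rcont_circle; apply: gc.
have rc2 t : rcont (fun s => (r * cis s)%C) t.
  apply: rcont_mult; [exact: rcont_const | apply: is_rder_rcont; exact: is_rder_cis].
have I0 : CI (fun t => (g (c + r * cis t) * (r * (Ci * cis t)))%C) 0 (2 * PI) = 0%C.
  rewrite (CI_FTC (fun t => prim g c (c + r * cis t)%C)).
  - replace (cis (2 * PI)) with (cis 0) by (rewrite -{1}(cis_2PI 0); congr cis; ring). ring.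
  - move=> t _. apply: (is_rder_comp (prim g c) (fun s => c + r * cis s)%C); [exact: is_rder_circle | exact: P].
  - move=> t _. apply: rcont_mult => //. apply: rcont_mult; first exact: rcont_const.
    apply: rcont_mult; [exact: rcont_const | apply: is_rder_rcont; exact: is_rder_cis].
have rcg t : rcont (fun s => (g (c + r * cis s) * (r * cis s))%C) t by apply: rcont_mult.
have I1 : CI (fun t => (g (c + r * cis t) * (r * cis t))%C) 0 (2 * PI) = 0%C.
  have : CI (fun t => (Ci * (g (c + r * cis t) * (r * cis t)))%C) 0 (2 * PI) = 0%C.
    rewrite -I0. apply: CI_ext => t _. ring.
  rewrite CI_scal; last by move=> t _. move=> E.
  have Q (u : C) : u = (- (Ci * (Ci * u)))%C by case: u => p q; apply: injective_projections; simpl; ring.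
  rewrite [LHS]Q E. ring.
have rck t : rcont (fun s => ((r * cis s) / (c + r * cis s - w))%C) t.
  apply: rcont_mult => //. apply: rcont_inv => //.
  apply: (rcont_circle (fun z => z - w)%C). apply: holo_cont. holo_tac.
transitivity (CI (fun t => (g (c + r * cis t) * (r * cis t) + f w * ((r * cis t) / (c + r * cis t - w)))%C) 0 (2 * PI)).
  apply: CI_ext => t _. rewrite /g dq_off; first by field; exact: n1.
  move=> E. apply: (n1 t). rewrite E. ring.
rewrite CI_plus.
- rewrite I1 CI_scal; last by move=> t _. rewrite mean_kernel //. ring.
- by move=> t _.
- move=> t _. apply: rcont_mult => //. exact: rcont_const.
Qed.


(** * Maximum principle and Cauchy estimates *)

Lemma CI_Re_le g a b m : a <= b -> rcont_on g a b -> (forall t, a <= t <= b -> Re (g t) <= m) ->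
  Re (CI g a b) <= m * (b - a).
Proof.
move=> ab Hc Hm. rewrite CI_Re //.
have -> : m * (b - a) = RInt (fun _ => m) a b by rewrite RInt_const /scal /= /mult /=; ring.
apply: RInt_le => //.
- exists (Re (CI g a b)).
  exact: (@is_RInt_fct_extend_fst R_NormedModule R_NormedModule g a b _ (RInt_correct _ _ _ (CI_ex g a b Hc))).
- exact: ex_RInt_const.
- move=> t Ht. apply: Hm. lra.
Qed.

Lemma Cmod_sq (z : C) : Cmod z * Cmod z = fst z * fst z + snd z * snd z.
Proof. have := Cmod2_alt z. rewrite /Re /Im. lra. Qed.

(** The function u = |f|^2 + eta |z|^2 is strictly subharmonic and cannot have an interior maximum.
    The boundary condition is a limit superior at each point outside D, so f may be undefined
    there. *)
Lemma max_principle (D : C -> Prop) (f : C -> C) M Rb : 0 <= M ->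
  (forall z, D z -> exists d, 0 < d /\ forall w, Cmod (w - z)%C < d -> D w) ->
  (forall z, D z -> Cmod z <= Rb) ->
  (forall z, D z -> holo f z) ->
  (forall p, ~ D p -> forall eta, 0 < eta -> exists d, 0 < d /\ forall w, D w -> Cmod (w - p)%C < d -> Cmod (f w) <= M + eta) ->
  forall z, D z -> Cmod (f z) <= M.
Proof.
move=> M0 Dop Dbd Hf Hbd z0 Dz0. apply: Rnot_lt_le => Hlt.
have Rb0 : 0 <= Rb by apply: Rle_trans (Dbd z0 Dz0); exact: Cmod_ge_0.
set m := Cmod (f z0) in Hlt.
set e1 := (m - M) / 2. have e10 : 0 < e1 by rewrite /e1; lra.
(* So small that near the boundary u stays below m^2, hence below its value at z0. *)
set eta := (m * m - (M + e1) * (M + e1)) / (Rb * Rb + 1).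
have gap : 0 < m * m - (M + e1) * (M + e1) by rewrite /e1; nra.
have den : 0 < Rb * Rb + 1 by nra.
have eta0 : 0 < eta by apply: Rdiv_lt_0_compat.
have etaE : eta * (Rb * Rb) <= m * m - (M + e1) * (M + e1).
  have : eta * (Rb * Rb + 1) = m * m - (M + e1) * (M + e1) by rewrite /eta; field; lra. nra.
pose u z := Cmod (f z) * Cmod (f z) + eta * (Cmod z * Cmod z).
have uz0 : m * m <= u z0 by rewrite /u -/m; have := Cmod_ge_0 z0; nra.
have [p [Dp Hp]] : exists p, D p /\ forall w, D w -> u w <= u p.
  apply: NNPP => N.
  (* Without a maximum every point p has a small rectangle dominated by a single point of D: by a
     better q if p lies in D, by z0 otherwise. Bisection then produces a maximum after all. *)
  pose good a b c d := exists q, D q /\ forall w, D w -> in_rect a b c d w -> u w <= u q.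
  have : good (- Rb) Rb (- Rb) Rb.
    apply: rect_ind; try lra.
    - move=> a b c d ab cd [q1 [d1 h1]] [q2 [d2 h2]] [q3 [d3 h3]] [q4 [d4 h4]].
      have [q [Dq [k1 [k2 [k3 k4]]]]] : exists q, D q /\ u q1 <= u q /\ u q2 <= u q /\ u q3 <= u q /\ u q4 <= u q.
        have mx q q' : D q -> D q' -> exists r, D r /\ u q <= u r /\ u q' <= u r.
          move=> h h'. case: (Rle_dec (u q) (u q')) => H; [exists q' | exists q]; split => //; lra.
        have [r1 [? [? ?]]] := mx q1 q2 d1 d2. have [r2 [? [? ?]]] := mx q3 q4 d3 d4.
        have [r3 [? [? ?]]] := mx r1 r2 ltac:(assumption) ltac:(assumption). exists r3; split => //; lra.
      exists q; split => // w Dw [[w1 w2] [w3 w4]].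
      case: (Rle_dec (fst w) ((a + b) / 2)) => X; case: (Rle_dec (snd w) ((c + d) / 2)) => Y.
      + apply: Rle_trans k1. apply: h1; [exact: Dw | split; lra].
      + apply: Rle_trans k3. apply: h3; [exact: Dw | split; lra].
      + apply: Rle_trans k2. apply: h2; [exact: Dw | split; lra].
      + apply: Rle_trans k4. apply: h4; [exact: Dw | split; lra].
    - move=> x y _ _. set p : C := (x, y).
      have near (dl : R) a b c d w : a <= x <= b -> c <= y <= d -> b - a < dl / 2 -> d - c < dl / 2 -> in_rect a b c d w -> Cmod (w - p)%C < dl.
        move=> h1 h2 h3 h4 [h5 h6]. apply: Rle_lt_trans (Cmod_le_sum _) _ => /=.
        have : Rabs (fst w + - x) <= b - a by apply: Rabs_le; lra.
        have : Rabs (snd w + - y) <= d - c by apply: Rabs_le; lra. lra.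
      case: (classic (D p)) => Dp.
      + have [q [Dq Hq]] : exists q, D q /\ u p < u q.
          apply: NNPP => N'. apply: N. exists p; split => // w Dw. apply: Rnot_lt_le => H. apply: N'. by exists w.
        have cu : exists dl, 0 < dl /\ forall w, Cmod (w - p)%C < dl -> u w < u q.
          have fc := holo_cont f p (Hf p Dp).
          set A := Cmod (f p). set B := Cmod p. have A0 : 0 <= A by exact: Cmod_ge_0. have B0 : 0 <= B by exact: Cmod_ge_0.
          set dd := (u q - u p) / (2 * A + 1 + eta * (2 * B + 1)).
          have dn : 0 < 2 * A + 1 + eta * (2 * B + 1) by nra.
          have dd0 : 0 < dd by apply: Rdiv_lt_0_compat; lra.
          set t := Rmin 1 (dd / 2). have t0 : 0 < t by apply: Rmin_glb_lt; lra.
          have t1 : t <= 1 by exact: Rmin_l. have t2 : t <= dd / 2 by exact: Rmin_r.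
          have [d1 [d10 K]] := fc t t0.
          exists (Rmin d1 t); split; first exact: Rmin_glb_lt. move=> w Hw.
          have := Rmin_l d1 t. have := Rmin_r d1 t => v1 v2.
          have k := K w ltac:(lra).
          have a1 : Cmod (f w) <= A + t by have := Cmod_rev (f w) (f p); rewrite -/A; lra.
          have b1 : Cmod w <= B + t by have := Cmod_rev w p; rewrite -/B; lra.
          have c1 : Cmod (f w) * Cmod (f w) <= (A + t) * (A + t) by apply: Rmult_le_compat => //; exact: Cmod_ge_0.
          have c2 : Cmod w * Cmod w <= (B + t) * (B + t) by apply: Rmult_le_compat => //; exact: Cmod_ge_0.
          have c3 : eta * (Cmod w * Cmod w) <= eta * ((B + t) * (B + t)) by apply: Rmult_le_compat_l => //; lra.
          have : u w <= (A + t) * (A + t) + eta * ((B + t) * (B + t)) by rewrite /u; lra.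
          have -> : (A + t) * (A + t) + eta * ((B + t) * (B + t)) = u p + t * (2 * A + t + eta * (2 * B + t)) by rewrite /u -/A -/B; ring.
          have : t * (2 * A + t + eta * (2 * B + t)) <= (dd / 2) * (2 * A + 1 + eta * (2 * B + 1)).
            apply: Rmult_le_compat => //; try lra.
            * have : 0 <= eta * (2 * B + t) by apply: Rmult_le_pos; lra. lra.
            * have : eta * (2 * B + t) <= eta * (2 * B + 1) by apply: Rmult_le_compat_l; lra. lra.
          have -> : dd / 2 * (2 * A + 1 + eta * (2 * B + 1)) = (u q - u p) / 2 by rewrite /dd; field; lra.
          lra.
        have [dl [dl0 K]] := cu. exists (dl / 2); split; first lra.
        move=> a b c d _ _ _ _ h1 h2 h3 h4. exists q; split => // w Dw Hw. left. apply: K. exact: (near dl a b c d).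
      + have [dl [dl0 K]] := Hbd p Dp e1 e10. exists (dl / 2); split; first lra.
        move=> a b c d _ _ _ _ h1 h2 h3 h4. exists z0; split => // w Dw Hw.
        have := K w Dw (near dl a b c d w h1 h2 h3 h4 Hw) => k.
        apply: Rle_trans uz0. rewrite /u.
        have c1 : Cmod (f w) * Cmod (f w) <= (M + e1) * (M + e1) by apply: Rmult_le_compat => //; exact: Cmod_ge_0.
        have c2 : Cmod w * Cmod w <= Rb * Rb by apply: Rmult_le_compat; try exact: Cmod_ge_0; exact: Dbd.
        have : eta * (Cmod w * Cmod w) <= eta * (Rb * Rb) by apply: Rmult_le_compat_l => //; lra.
        lra.
  move=> [q [Dq Hq]]. apply: N. exists q; split => // w Dw. apply: Hq => //.
  have h1 := Cmod_fst w. have h2 := Cmod_snd w. have h3 := Dbd w Dw.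
  have := Rabs_le_between (fst w) Rb. have := Rabs_le_between (snd w) Rb. split; lra.
have [d [d0 Kd]] := Dop p Dp.
(* By the identity 2 Re(conj(a) b) = |a|^2 + |b|^2 - |a - b|^2, on the circle of radius r the real
   part of H is at most u(p) - eta r^2 / 2, whereas its mean is H(p) = u(p). *)
pose H z := (Cconj (f p) * f z + eta * Cconj p * z)%C.
set r := d / 2. have r0 : 0 < r by rewrite /r; lra. have pi0 := PI_RGT_0.
have HH z : Cmod (z - p)%C < d -> holo H z.
  move=> Hz. rewrite /H. holo_tac. apply: Hf. exact: Kd.
have MV := mean_value H p d r HH ltac:(rewrite /r; lra).
have := CI_Re_le (fun t => H (p + r * cis t)%C) 0 (2 * PI) (u p - eta * (r * r) / 2) ltac:(lra).
have onD t : Cmod (p + r * cis t - p)%C < d by rewrite Cmod_circle /r; lra.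
case.
- move=> t _. apply: rcont_circle. apply: holo_cont. exact: HH.
- move=> t _. set z := (p + r * cis t)%C. have := Hp z (Kd z (onD t)).
  have : Cmod (z - p)%C * Cmod (z - p)%C = r * r by rewrite Cmod_circle //; lra.
  clearbody z. rewrite /u /H !Cmod_sq /Re /=.
  move: (fst (f p)) (snd (f p)) (fst (f z)) (snd (f z)) (fst p) (snd p) (fst z) (snd z) => a b a' b' x y x' y'.
  have := pow2_ge_0 (a - a'). have := pow2_ge_0 (b - b').
  move=> s1 s2 s3 s4.
  have : eta * ((x' - x) * (x' - x) + (y' - y) * (y' - y)) = eta * (r * r) by rewrite -s3; ring.
  nra.
- rewrite MV. have -> : Re ((2 * PI)%R * H p)%C = 2 * PI * u p.
    rewrite /H /u !Cmod_sq /Re /=. ring.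
  have : 0 < eta * (r * r) by apply: Rmult_lt_0_compat => //; nra.
  nra.
- rewrite MV. have -> : Re ((2 * PI)%R * H p)%C = 2 * PI * u p.
    rewrite /H /u !Cmod_sq /Re /=. ring.
  have : 0 < eta * (r * r) by apply: Rmult_lt_0_compat => //; nra.
  nra.
Qed.

Lemma cder_quad f (w l : C) K d : 0 < d -> 0 <= K ->
  (forall h, Cmod h < d -> Cmod (f (w + h) - f w - l * h)%C <= K * (Cmod h * Cmod h)) -> is_cder f w l.
Proof.
move=> d0 K0 H e e0. exists (Rmin d (e / (K + 1))).
have q0 : 0 < e / (K + 1) by apply: Rdiv_lt_0_compat; lra.
split; first exact: Rmin_glb_lt. move=> h Hh.
have := Rmin_l d (e / (K + 1)). have := Rmin_r d (e / (K + 1)) => u v.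
apply: Rle_trans (H h ltac:(lra)) _.
have h0 := Cmod_ge_0 h.
have : Cmod h * (K + 1) <= e.
  replace e with (e / (K + 1) * (K + 1)) by (field; lra). apply: Rmult_le_compat_r; lra.
nra.
Qed.


Lemma rcont_minus f g t : rcont f t -> rcont g t -> rcont (fun s => f s - g s)%C t.
Proof.
move=> Hf Hg e e0. have [d1 [d10 K1]] := Hf (e/2) ltac:(lra). have [d2 [d20 K2]] := Hg (e/2) ltac:(lra).
exists (Rmin d1 d2); split; first exact: Rmin_glb_lt. move=> s Hs.
have := Rmin_l d1 d2. have := Rmin_r d1 d2 => u v.
have := K1 s ltac:(lra). have := K2 s ltac:(lra).
replace (f s - g s - (f t - g t))%C with ((f s - f t) - (g s - g t))%C by ring.
have := Cmod_sub (f s - f t)%C (g s - g t)%C. lra.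
Qed.

Lemma inv_pos_le a b : 0 < a -> a <= b -> 0 < / b <= / a.
Proof. move=> a0 ab. split; [apply: Rinv_0_lt_compat; lra | exact: Rinv_le_contravar]. Qed.

Section Kernel.
Variables (phi : R -> C) (c : C) (r M : R).
Hypothesis phic : forall t, rcont phi t.
Hypothesis phiM : forall t, 0 <= t <= 2 * PI -> Cmod (phi t) <= M.

Definition pole (w : C) t : C := (c + r * cis t - w)%C.

Lemma pole_low w t : Cmod (w - c)%C < r -> r - Cmod (w - c)%C <= Cmod (pole w t).
Proof.
move=> H. have r0 : 0 <= r by have := Cmod_ge_0 (w - c)%C; lra.
have := Cmod_rev (c + r * cis t - c)%C (w - c)%C. rewrite Cmod_circle //.
by replace (c + r * cis t - c - (w - c))%C with (pole w t) by (rewrite /pole; ring).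
Qed.

Lemma pole_neq0 w t : Cmod (w - c)%C < r -> pole w t <> 0%C.
Proof. move=> H. apply: Cneq_mod. have := pole_low w t H. lra. Qed.

Lemma rcont_pole w t : rcont (pole w) t.
Proof. apply: (rcont_circle (fun z => z - w)%C). apply: holo_cont. holo_tac. Qed.

Lemma phi_bound_ge0 : 0 <= M.
Proof. apply: Rle_trans (phiM 0 _); first exact: Cmod_ge_0. have := PI_RGT_0; lra. Qed.

Lemma rcont_k1 w t : Cmod (w - c)%C < r -> rcont (fun t => phi t / pole w t)%C t.
Proof. move=> H. apply: rcont_mult => //. apply: rcont_inv; [exact: pole_neq0 | exact: rcont_pole]. Qed.

Lemma rcont_k2 w t : Cmod (w - c)%C < r -> rcont (fun t => phi t / (pole w t * pole w t))%C t.
Proof. move=> H. apply: rcont_mult => //. apply: rcont_inv; first by apply: Cmult_neq_0; exact: pole_neq0.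
apply: rcont_mult; exact: rcont_pole. Qed.

Lemma rcont_k3 w t : Cmod (w - c)%C < r -> rcont (fun t => phi t / (pole w t * pole w t * pole w t))%C t.
Proof. move=> H. apply: rcont_mult => //. apply: rcont_inv; first by do 2 (try apply: Cmult_neq_0; try exact: pole_neq0).
apply: rcont_mult; last exact: rcont_pole. apply: rcont_mult; exact: rcont_pole. Qed.

Lemma pole_shift w h t : pole (w + h) t = (pole w t - h)%C.
Proof. rewrite /pole. ring. Qed.

(** Differentiation under the integral with explicit remainder: it equals phi h^2 / (p^2 (p - h)), p
    being the distance vector to the circle, and |h| < d/2 keeps both denominators away from 0. *)
Lemma kernel1_cder w : Cmod (w - c)%C < r ->
  is_cder (fun w => CI (fun t => phi t / pole w t)%C 0 (2 * PI)) w (CI (fun t => phi t / (pole w t * pole w t))%C 0 (2 * PI)).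
Proof.
move=> Hw. have pi0 := PI_RGT_0. have M0 := phi_bound_ge0.
set d := r - Cmod (w - c)%C. have d0 : 0 < d by rewrite /d; lra.
have p0 : 0 <= M * (/ d * / d * / (d / 2)).
  apply: Rmult_le_pos => //. left. repeat apply: Rmult_lt_0_compat; apply: Rinv_0_lt_compat; lra.
apply: (cder_quad _ _ _ (M * (/ d * / d * / (d / 2)) * (2 * PI)) (d / 2)); first lra.
  by apply: Rmult_le_pos; lra.
move=> h Hh.
have Hwh : Cmod (w + h - c)%C < r.
  replace (w + h - c)%C with ((w - c) + h)%C by ring. have := Cmod_triangle (w - c)%C h. rewrite /d in Hh d0. lra.
have rch t : rcont (fun t => h * (phi t / (pole w t * pole w t)))%C t.
  apply: rcont_mult; [exact: rcont_const | exact: rcont_k2].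
rewrite (Cmult_comm _ h) -CI_scal; last by move=> t _; exact: rcont_k2.
rewrite -CI_minus; [|by move=> t _; exact: rcont_k1..].
rewrite -CI_minus; [|by move=> t _; apply: rcont_minus; exact: rcont_k1 |by move=> t _].
replace (M * (/ d * / d * / (d / 2)) * (2 * PI) * (Cmod h * Cmod h)) with (M * (/ d * / d * / (d / 2)) * (Cmod h * Cmod h) * (2 * PI - 0)) by ring.
apply: CI_bound; first lra.
  move=> t _. apply: rcont_minus => //. apply: rcont_minus; exact: rcont_k1.
move=> t Ht. rewrite pole_shift. have n0 := pole_neq0 w t Hw. have n1 := pole_neq0 (w + h)%C t Hwh. rewrite pole_shift in n1.
set u := pole w t in n0 n1 *.
have u0 : d <= Cmod u by exact: pole_low.
have u1 : d / 2 <= Cmod (u - h)%C by have := Cmod_rev u h; lra.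
replace (phi t / (u - h) - phi t / u - h * (phi t / (u * u)))%C with (phi t * (/ u * / u * / (u - h)) * (h * h))%C by (field; by repeat split).
rewrite !Cmod_mult !Cmod_inv //.
have [i1 i2] := inv_pos_le _ _ d0 u0. have [i3 i4] := inv_pos_le (d/2) _ ltac:(lra) u1.
apply: Rmult_le_compat_r; first by have := Cmod_ge_0 h; nra.
apply: Rmult_le_compat; [exact: Cmod_ge_0 | | exact: phiM |].
  by left; repeat apply: Rmult_lt_0_compat.
apply: Rmult_le_compat; [by left; apply: Rmult_lt_0_compat | lra | | lra].
apply: Rmult_le_compat; lra.
Qed.

Lemma kernel2_cder w : Cmod (w - c)%C < r ->
  is_cder (fun w => CI (fun t => phi t / (pole w t * pole w t))%C 0 (2 * PI)) w (2 * CI (fun t => phi t / (pole w t * pole w t * pole w t))%C 0 (2 * PI))%C.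
Proof.
move=> Hw. have pi0 := PI_RGT_0. have M0 := phi_bound_ge0.
set d := r - Cmod (w - c)%C. have d0 : 0 < d by rewrite /d; lra.
have p0 : 0 <= M * (4 * (/ d * / d * (/ (d / 2) * / (d / 2)))).
  apply: Rmult_le_pos => //. left. apply: Rmult_lt_0_compat; first lra. repeat apply: Rmult_lt_0_compat; apply: Rinv_0_lt_compat; lra.
apply: (cder_quad _ _ _ (M * (4 * (/ d * / d * (/ (d / 2) * / (d / 2)))) * (2 * PI)) (d / 2)); first lra.
  by apply: Rmult_le_pos; lra.
move=> h Hh.
have Hwh : Cmod (w + h - c)%C < r.
  replace (w + h - c)%C with ((w - c) + h)%C by ring. have := Cmod_triangle (w - c)%C h. rewrite /d in Hh d0. lra.
have rch t : rcont (fun t => (2 * h) * (phi t / (pole w t * pole w t * pole w t)))%C t.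
  apply: rcont_mult; [exact: rcont_const | exact: rcont_k3].
replace (2 * CI (fun t => phi t / (pole w t * pole w t * pole w t))%C 0 (2 * PI) * h)%C with ((2 * h) * CI (fun t => phi t / (pole w t * pole w t * pole w t))%C 0 (2 * PI))%C by ring.
rewrite -CI_scal; last by move=> t _; exact: rcont_k3.
rewrite -CI_minus; [|by move=> t _; exact: rcont_k2..].
rewrite -CI_minus; [|by move=> t _; apply: rcont_minus; exact: rcont_k2 |by move=> t _].
replace (M * (4 * (/ d * / d * (/ (d / 2) * / (d / 2)))) * (2 * PI) * (Cmod h * Cmod h)) with (M * (4 * (/ d * / d * (/ (d / 2) * / (d / 2)))) * (Cmod h * Cmod h) * (2 * PI - 0)) by ring.
apply: CI_bound; first lra.
  move=> t _. apply: rcont_minus => //. apply: rcont_minus; exact: rcont_k2.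
move=> t Ht. rewrite pole_shift. have n0 := pole_neq0 w t Hw. have n1 := pole_neq0 (w + h)%C t Hwh. rewrite pole_shift in n1.
set u := pole w t in n0 n1 *.
have u0 : d <= Cmod u by exact: pole_low.
have u1 : d / 2 <= Cmod (u - h)%C by have := Cmod_rev u h; lra.
replace (phi t / ((u - h) * (u - h)) - phi t / (u * u) - 2 * h * (phi t / (u * u * u)))%C with
  (phi t * ((3 * u - 2 * h) / u * (/ u * / u * (/ (u - h) * / (u - h)))) * (h * h))%C by (field; by repeat split).
rewrite !Cmod_mult !Cmod_inv //.
have [i1 i2] := inv_pos_le _ _ d0 u0. have [i3 i4] := inv_pos_le (d/2) _ ltac:(lra) u1.
apply: Rmult_le_compat_r; first by have := Cmod_ge_0 h; nra.
have up : 0 < Cmod u by lra.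
(* Here |h| < d/2 <= |u|/2, whence the factor 4. *)
have q4 : Cmod (3 * u - 2 * h)%C * / Cmod u <= 4.
  have := Cmod_sub (3 * u)%C (2 * h)%C. rewrite !Cmod_mult !Cmod_R !Rabs_pos_eq; try lra. move=> q.
  apply: (Rmult_le_reg_r (Cmod u)) => //. rewrite Rmult_assoc Rinv_l; lra.
have pp : 0 < / Cmod u * / Cmod u by apply: Rmult_lt_0_compat.
have pp2 : 0 < / Cmod (u - h)%C * / Cmod (u - h)%C by apply: Rmult_lt_0_compat.
apply: Rmult_le_compat; [exact: Cmod_ge_0 | | exact: phiM |].
  apply: Rmult_le_pos; first by apply: Rmult_le_pos; [exact: Cmod_ge_0 | lra]. by left; apply: Rmult_lt_0_compat.
apply: Rmult_le_compat => //.
- apply: Rmult_le_pos; [exact: Cmod_ge_0 | lra].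
- by left; apply: Rmult_lt_0_compat.
- apply: Rmult_le_compat; try lra; apply: Rmult_le_compat; lra.
Qed.
End Kernel.

Definition ckern f (c : C) r t : C := (f (c + r * cis t) * (r * cis t))%C.

Lemma rcont_ckern f c R0 r t : (forall z, Cmod (z - c)%C < R0 -> holo f z) -> 0 < r < R0 -> rcont (ckern f c r) t.
Proof.
move=> Hf Hr. apply: rcont_mult.
- apply: rcont_circle. apply: holo_cont. apply: Hf. rewrite Cmod_circle; lra.
- apply: rcont_mult; [exact: rcont_const | apply: is_rder_rcont; exact: is_rder_cis].
Qed.

Lemma rcont_bounded (g : R -> C) a b : a <= b -> (forall t, rcont g t) -> exists M, forall t, a <= t <= b -> Cmod (g t) <= M.
Proof.
move=> ab Hg.
have [|M HM] := continuity_ab_maj (fun t => Cmod (g t)) a b ab.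
  move=> t _ e e0. have [d [d0 K]] := Hg t e e0. exists d; split => // s [_ Hs].
  have := K s Hs. rewrite /= /Rdist => H. apply: Rle_lt_trans H. apply: Rabs_le.
  have := Cmod_rev (g s) (g t). have := Cmod_rev (g t) (g s). rewrite (Cmod_sub_sym (g t)). lra.
exists (Cmod (g M)). by case: HM.
Qed.

Lemma PI2_neq0 : RtoC (2 * PI)%R <> 0%C.
Proof. apply: Cneq_mod. rewrite Cmod_R Rabs_pos_eq; have := PI_RGT_0; lra. Qed.

Lemma holo_kernel f c R0 r : (forall z, Cmod (z - c)%C < R0 -> holo f z) -> 0 < r < R0 ->
  forall w, Cmod (w - c)%C < r ->
   f w = (CI (fun t => ckern f c r t / pole c r w t)%C 0 (2 * PI) / (2 * PI)%R)%C /\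
   is_cder f w (CI (fun t => ckern f c r t / (pole c r w t * pole c r w t))%C 0 (2 * PI) / (2 * PI)%R)%C.
Proof.
move=> Hf Hr.
have F w : Cmod (w - c)%C < r -> f w = (CI (fun t => ckern f c r t / pole c r w t)%C 0 (2 * PI) / (2 * PI)%R)%C.
  move=> Hw. have := cauchy_formula f c w R0 r Hf ltac:(lra) Hw.
  rewrite /ckern /pole => ->. field. exact: PI2_neq0.
move=> w Hw; split; first exact: F.
have pi0 := PI_RGT_0.
have [M HM] := rcont_bounded (ckern f c r) 0 (2 * PI) ltac:(lra) (fun t => rcont_ckern f c R0 r t Hf Hr).
apply: (is_cder_ext_loc (fun w => CI (fun t => ckern f c r t / pole c r w t)%C 0 (2 * PI) * / (2 * PI)%R)%C _ _ _ (r - Cmod (w - c)%C)); first lra.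
  move=> w' Hw'. symmetry. apply: F.
  replace (w' - c)%C with ((w' - w) + (w - c))%C by ring. have := Cmod_triangle (w' - w)%C (w - c)%C. lra.
have K := kernel1_cder (ckern f c r) c r M (fun t => rcont_ckern f c R0 r t Hf Hr) HM w Hw.
have := is_cder_mult _ _ _ _ _ K (is_cder_const (/ (2 * PI)%R) w).
set X := CI _ _ _. set Y := CI _ _ _.
by replace (X * / (2 * PI)%R + Y * 0)%C with (X / (2 * PI)%R)%C by (rewrite /Cdiv; ring).
Qed.

Lemma cderiv_eq f z l : is_cder f z l -> cderiv f z = l.
Proof. move=> H. apply: (is_cder_unique f z) => //. apply: cderiv_correct. by exists l. Qed.

Lemma holo_cderiv f c R0 : 0 < R0 -> (forall z, Cmod (z - c)%C < R0 -> holo f z) -> holo (cderiv f) c.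
Proof.
move=> R00 Hf. set r := R0 / 2. have Hr : 0 < r < R0 by rewrite /r; lra.
have pi0 := PI_RGT_0.
have [M HM] := rcont_bounded (ckern f c r) 0 (2 * PI) ltac:(lra) (fun t => rcont_ckern f c R0 r t Hf Hr).
apply: (holo_ext_loc (fun w => CI (fun t => ckern f c r t / (pole c r w t * pole c r w t))%C 0 (2 * PI) * / (2 * PI)%R)%C _ _ r); first lra.
  move=> w Hw. symmetry. apply: cderiv_eq. by case: (holo_kernel f c R0 r Hf Hr w Hw).
apply: holo_mult; last exact: holo_const.
eexists. apply: (kernel2_cder (ckern f c r) c r M (fun t => rcont_ckern f c R0 r t Hf Hr) HM c).
replace (c - c)%C with (RtoC 0) by ring. rewrite Cmod_0. lra.
Qed.

Lemma Cmod_self (c : C) : Cmod (c - c)%C = 0.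
Proof. replace (c - c)%C with (RtoC 0) by ring. exact: Cmod_0. Qed.

(** The integration is over the circle of radius R0/2, since the hypotheses concern the open disc
    only; this accounts for the factor 2. *)
Lemma cauchy_estimate f c R0 M : 0 < R0 -> (forall z, Cmod (z - c)%C < R0 -> holo f z) ->
  (forall z, Cmod (z - c)%C < R0 -> Cmod (f z) <= M) -> Cmod (cderiv f c) <= 2 * M / R0.
Proof.
move=> R00 Hf HM. set r := R0 / 2. have Hr : 0 < r < R0 by rewrite /r; lra.
have pi0 := PI_RGT_0. have M0 : 0 <= M by apply: Rle_trans (HM c _); [exact: Cmod_ge_0 | rewrite Cmod_self].
have Hc : Cmod (c - c)%C < r by rewrite Cmod_self; lra.
have [_ H] := holo_kernel f c R0 r Hf Hr c Hc.
rewrite (cderiv_eq _ _ _ H) Cmod_div; last exact: PI2_neq0.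
rewrite Cmod_R Rabs_pos_eq; last lra.
apply: (Rmult_le_reg_r (2 * PI)); first lra. rewrite /Rdiv Rmult_assoc Rinv_l; last lra. rewrite Rmult_1_r.
replace (2 * M * / R0 * (2 * PI)) with (M / r * (2 * PI - 0)) by (rewrite /r; field; lra).
apply: CI_bound; first lra.
- move=> t _. apply: rcont_k2 => //. move=> s. exact: (rcont_ckern f c R0).
- move=> t _. have pE : pole c r c t = (r * cis t)%C by rewrite /pole; ring.
  rewrite pE /ckern.
  have rn : RtoC r <> 0%C by apply: Cneq_mod; rewrite Cmod_R Rabs_pos_eq; lra.
  have cn : cis t <> 0%C by apply: Cneq_mod; rewrite Cmod_cis; lra.
  replace (f (c + r * cis t) * (r * cis t) / (r * cis t * (r * cis t)))%C with (f (c + r * cis t) * / (r * cis t))%C by (field; by repeat split).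
  rewrite Cmod_mult Cmod_inv; last by apply: Cmult_neq_0.
  rewrite Cmod_mult Cmod_cis Cmod_R Rmult_1_r Rabs_pos_eq; last lra.
  apply: Rmult_le_compat_r; first by left; apply: Rinv_0_lt_compat; lra. apply: HM. rewrite Cmod_circle; lra.
Qed.

(** A quantitative form of differentiability whose constant depends on f only through its bound M.
    It is applied for each real t with M depending on t, which lets it pass through a bounded
    functional in [functional_holo]. *)
Lemma quotient_lipschitz f c R0 M (h k : C) : 0 < R0 -> (forall z, Cmod (z - c)%C < R0 -> holo f z) ->
  (forall z, Cmod (z - c)%C < R0 -> Cmod (f z) <= M) -> h <> 0%C -> k <> 0%C -> Cmod h < R0 / 4 -> Cmod k < R0 / 4 ->
  Cmod ((f (c + h) - f c) / h - (f (c + k) - f c) / k)%C <= 16 * M / (R0 * R0) * Cmod (h - k)%C.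
Proof.
move=> R00 Hf HM h0 k0 hh hk. set r := R0 / 2. have Hr : 0 < r < R0 by rewrite /r; lra.
have pi0 := PI_RGT_0. have M0 : 0 <= M by apply: Rle_trans (HM c _); [exact: Cmod_ge_0 | rewrite Cmod_self].
have sm (u : C) : Cmod u < R0 / 4 -> Cmod (c + u - c)%C < r by move=> H; replace (c + u - c)%C with u by ring; rewrite /r; lra.
have Hc : Cmod (c - c)%C < r by rewrite Cmod_self; lra.
have rk t : rcont (ckern f c r) t by exact: (rcont_ckern f c R0).
have rn : RtoC r <> 0%C by apply: Cneq_mod; rewrite Cmod_R Rabs_pos_eq; lra.
have cn t : cis t <> 0%C by apply: Cneq_mod; rewrite Cmod_cis; lra.
have pE t : pole c r c t = (r * cis t)%C by rewrite /pole; ring.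
have rcf t : rcont (fun t => f (c + r * cis t)%C) t by apply: rcont_circle; apply: holo_cont; apply: Hf; rewrite Cmod_circle; lra.
have rcp u t : Cmod u < R0 / 4 -> rcont (fun t => f (c + r * cis t) / pole c r (c + u) t)%C t.
  move=> Hu. apply: (rcont_k1 (fun t => f (c + r * cis t)%C)) => //. exact: sm.
have key (u : C) : u <> 0%C -> Cmod u < R0 / 4 -> ((f (c + u) - f c) / u)%C = (CI (fun t => f (c + r * cis t) / pole c r (c + u) t)%C 0 (2 * PI) / (2 * PI)%R)%C.
  move=> u0 Hu.
  have [-> _] := holo_kernel f c R0 r Hf Hr (c + u)%C (sm u Hu). have [-> _] := holo_kernel f c R0 r Hf Hr c Hc.
  have E : (CI (fun t => ckern f c r t / pole c r (c + u) t)%C 0 (2 * PI) - CI (fun t => ckern f c r t / pole c r c t)%C 0 (2 * PI))%C =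
     (u * CI (fun t => f (c + r * cis t) / pole c r (c + u) t)%C 0 (2 * PI))%C.
    rewrite -CI_minus; [| by move=> t _; apply: rcont_k1 => //; exact: sm | by move=> t _; apply: rcont_k1].
    rewrite -CI_scal; last by move=> t _; exact: rcp.
    apply: CI_ext => t _. have n1 := pole_neq0 c r (c + u)%C t (sm u Hu). rewrite pole_shift pE in n1 *. rewrite /ckern.
    field. split; [exact: n1 | by split].
  set X := CI _ _ _ in E *. set Y := CI _ _ _ in E *. set Z := CI _ _ _ in E *.
  have T0 := PI2_neq0. transitivity ((X - Y) / u / (2 * PI)%R)%C; first by field; split.
  rewrite E. by field; split.
rewrite !key //.
have -> : (CI (fun t => f (c + r * cis t) / pole c r (c + h) t)%C 0 (2 * PI) / (2 * PI)%R -
   CI (fun t => f (c + r * cis t) / pole c r (c + k) t)%C 0 (2 * PI) / (2 * PI)%R)%C =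
   (CI (fun t => f (c + r * cis t) / pole c r (c + h) t - f (c + r * cis t) / pole c r (c + k) t)%C 0 (2 * PI) / (2 * PI)%R)%C.
  rewrite CI_minus; [|by move=> t _; exact: rcp..]. field. exact: PI2_neq0.
rewrite Cmod_div; last exact: PI2_neq0. rewrite Cmod_R Rabs_pos_eq; last lra.
apply: (Rmult_le_reg_r (2 * PI)); first lra. rewrite /Rdiv Rmult_assoc Rinv_l; last lra. rewrite Rmult_1_r.
replace (16 * M * / (R0 * R0) * Cmod (h - k)%C * (2 * PI)) with (M * (/ (R0 / 4) * / (R0 / 4)) * Cmod (h - k)%C * (2 * PI - 0)) by (field; lra).
apply: CI_bound; first lra.
  move=> t _. apply: rcont_minus; exact: rcp.
move=> t _. have n1 := pole_neq0 c r (c + h)%C t (sm h hh). have n2 := pole_neq0 c r (c + k)%C t (sm k hk).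
have l1 := pole_low c r (c + h)%C t (sm h hh). have l2 := pole_low c r (c + k)%C t (sm k hk).
replace (c + h - c)%C with h in l1 by ring. replace (c + k - c)%C with k in l2 by ring.
have -> : (f (c + r * cis t) / pole c r (c + h) t - f (c + r * cis t) / pole c r (c + k) t)%C =
  (f (c + r * cis t) * (/ pole c r (c + h) t * / pole c r (c + k) t) * (h - k))%C.
  rewrite !pole_shift in n1 n2 *. field. by split.
rewrite !Cmod_mult !Cmod_inv //. apply: Rmult_le_compat_r; first exact: Cmod_ge_0.
have [i1 i2] := inv_pos_le (R0/4) (Cmod (pole c r (c + h) t)) ltac:(lra) ltac:(rewrite /r in l1 *; lra).
have [i3 i4] := inv_pos_le (R0/4) (Cmod (pole c r (c + k) t)) ltac:(lra) ltac:(rewrite /r in l2 *; lra).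
apply: Rmult_le_compat; [exact: Cmod_ge_0 | by left; apply: Rmult_lt_0_compat | by apply: HM; rewrite Cmod_circle; lra |].
apply: Rmult_le_compat; lra.
Qed.

Lemma morera f c r : 0 < r -> (forall z, Cmod (z - c)%C < r -> ccont f z) ->
  (forall x1 x2 y1 y2, x1 <= x2 -> y1 <= y2 -> (forall z, in_rect x1 x2 y1 y2 z -> Cmod (z - c)%C < r) -> rectI f x1 x2 y1 y2 = 0%C) ->
  holo f c.
Proof.
move=> r0 Hc HG. have P := disc_prim f c r Hc HG.
apply: (holo_ext_loc (cderiv (prim f c)) _ _ r) => //.
- move=> w Hw. apply: cderiv_eq. exact: P.
- apply: (holo_cderiv _ c r) => // z Hz. eexists; exact: P.
Qed.

(** The quotient is continuous at w and holomorphic elsewhere. Goursat's theorem tolerates such a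
    point, and Morera's theorem removes it. *)
Lemma dq_holo f w R0 : 0 < R0 -> (forall z, Cmod (z - w)%C < R0 -> holo f z) -> forall z, holo f z -> holo (dq f w) z.
Proof.
move=> R00 Hf z Hz. case: (classic (z = w)) => [->|N]; last exact: dq_holo_off.
have gc u : Cmod (u - w)%C < R0 -> ccont (dq f w) u.
  move=> Hu. case: (classic (u = w)) => [->|N]; first by apply: dq_cont_diag; apply: Hf; rewrite Cmod_self.
  apply: holo_cont. apply: dq_holo_off => //. exact: Hf.
apply: (morera _ _ R0) => // x1 x2 y1 y2 h1 h2 H. apply: (goursat_except _ w) => //.
- move=> u Hu. apply: gc. exact: H.
- move=> u Hu N. apply: dq_holo_off => //. apply: Hf. exact: H.
Qed.

Lemma path_bound P g a b M : (forall t, 0 <= t <= 1 -> is_cder P (a + t * (b - a))%C (g (a + t * (b - a))%C)) ->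
  (forall t, 0 <= t <= 1 -> ccont g (a + t * (b - a))%C) -> (forall t, 0 <= t <= 1 -> Cmod (g (a + t * (b - a))%C) <= M) ->
  Cmod (P b - P a)%C <= M * Cmod (b - a)%C.
Proof.
move=> HP Hg HM.
have rg t : 0 <= t <= 1 -> rcont (fun t => g (a + t * (b - a)) * (b - a))%C t.
  move=> Ht. apply: rcont_mult; last exact: rcont_const.
  apply: (rcont_comp g (fun t => a + t * (b - a))%C); last exact: Hg. apply: is_rder_rcont. exact: is_rder_affine.
have := CI_FTC (fun t => P (a + t * (b - a))%C) (fun t => g (a + t * (b - a)) * (b - a))%C 0 1.
rewrite Rmin_left ?Rmax_right; try lra.
have H1 (t : R) : 0 <= t <= 1 -> is_rder (fun t => P (a + t * (b - a))%C) t (g (a + t * (b - a)) * (b - a))%C.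
  move=> Ht. apply: (is_rder_comp P (fun t => a + t * (b - a))%C); [exact: is_rder_affine | exact: HP].
have H2 : rcont_on (fun t => g (a + t * (b - a)) * (b - a))%C 0 1.
  move=> t. rewrite Rmin_left ?Rmax_right; try lra. exact: rg.
move/(_ H1 H2).
replace (a + 1 * (b - a))%C with b by ring. replace (a + 0 * (b - a))%C with a by ring.
replace (M * Cmod (b - a)%C) with (M * Cmod (b - a)%C * (1 - 0)) by ring.
move=> <-. apply: CI_bound; first lra.
- move=> t. rewrite Rmin_left ?Rmax_right; try lra. exact: rg.
- move=> t Ht. rewrite Cmod_mult. apply: Rmult_le_compat_r; [exact: Cmod_ge_0 | exact: HM].
Qed.

Lemma liouville f M : (forall z, holo f z) -> (forall z, Cmod (f z) <= M) -> forall z w, f z = f w.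
Proof.
move=> Hf HM z w.
have M0 : 0 <= M by apply: Rle_trans (HM z); exact: Cmod_ge_0.
have D0 u : cderiv f u = 0%C.
  apply: Cmod_eq_0. apply: Rle_antisym; last exact: Cmod_ge_0.
  apply: le_epsilon => e e0. rewrite Rplus_0_l.
  have R00 : 0 < 2 * (M + 1) / e by apply: Rdiv_lt_0_compat; lra.
  apply: Rle_trans (cauchy_estimate f u (2 * (M + 1) / e) M R00 (fun v _ => Hf v) (fun v _ => HM v)) _.
  replace (2 * M / (2 * (M + 1) / e)) with (M / (M + 1) * e) by (field; lra).
  have : M / (M + 1) <= 1 by apply: (Rmult_le_reg_r (M + 1)); [lra | rewrite /Rdiv Rmult_assoc Rinv_l; lra]. nra.
have := path_bound f (cderiv f) w z 0 (fun t _ => cderiv_correct f _ (Hf _)).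
have H1 (t : R) : 0 <= t <= 1 -> ccont (cderiv f) (w + t * (z - w))%C.
  move=> _. apply: holo_cont. apply: (holo_cderiv f _ 1); first lra. by move=> v _.
have H2 (t : R) : 0 <= t <= 1 -> Cmod (cderiv f (w + t * (z - w))%C) <= 0.
  move=> _. rewrite D0 Cmod_0. lra.
move/(_ H1 H2) => H. rewrite Rmult_0_l in H. have E : Cmod (f z - f w)%C = 0 by have := Cmod_ge_0 (f z - f w)%C; lra.
  have := Cmod_eq_0 _ E => E2. replace (f z) with (f z - f w + f w)%C by ring. rewrite E2; ring.
Qed.

(** Integrals over rectangles pass to uniform limits, so Morera's theorem applies. *)
Lemma holo_unif_lim (F : nat -> C -> C) f c r : 0 < r -> (forall n z, Cmod (z - c)%C < r -> holo (F n) z) ->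
  (forall e, 0 < e -> exists n, forall z, Cmod (z - c)%C < r -> Cmod (F n z - f z)%C <= e) -> holo f c.
Proof.
move=> r0 HF Hu.
have fc z : Cmod (z - c)%C < r -> ccont f z.
  move=> Hz e e0. have [n Hn] := Hu (e/4) ltac:(lra).
  have [d [d0 K]] := holo_cont _ _ (HF n z Hz) (e/4) ltac:(lra).
  exists (Rmin d (r - Cmod (z - c)%C)); split; first by apply: Rmin_glb_lt; lra. move=> w Hw.
  have := Rmin_l d (r - Cmod (z - c)%C). have := Rmin_r d (r - Cmod (z - c)%C) => u v.
  have Hwr : Cmod (w - c)%C < r.
    replace (w - c)%C with ((w - z) + (z - c))%C by ring. have := Cmod_triangle (w - z)%C (z - c)%C. lra.
  have k1 := K w ltac:(lra). have k2 := Hn w Hwr. have k3 := Hn z Hz.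
  replace (f w - f z)%C with ((F n w - F n z) - (F n w - f w) + (F n z - f z))%C by ring.
  have := Cmod_triangle ((F n w - F n z) - (F n w - f w))%C (F n z - f z)%C.
  have := Cmod_sub (F n w - F n z)%C (F n w - f w)%C. lra.
apply: (morera f c r) => // x1 x2 y1 y2 h1 h2 H.
apply: Cmod_eq_0. apply: Rle_antisym; last exact: Cmod_ge_0.
apply: le_epsilon => e e0. rewrite Rplus_0_l.
set L := (x2 - x1) + (y2 - y1). have L0 : 0 <= L by rewrite /L; lra.
have [n Hn] := Hu (e / (2 * (L + 1))) ltac:(apply: Rdiv_lt_0_compat; lra).
have c1 : ccont_rect (F n) x1 x2 y1 y2 by move=> z Hz; apply: holo_cont; apply: HF; exact: H.
have c2 : ccont_rect f x1 x2 y1 y2 by move=> z Hz; apply: fc; exact: H.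
have E := rectI_minus (F n) f x1 x2 y1 y2 h1 h2 c1 c2.
rewrite (goursat (F n)) in E => //; last by move=> z Hz; apply: HF; exact: H.
replace (rectI f x1 x2 y1 y2) with (- rectI (fun z => F n z - f z)%C x1 x2 y1 y2)%C by (rewrite E; ring).
rewrite Cmod_opp. apply: (Rle_trans _ (2 * (e / (2 * (L + 1))) * L)).
  apply: rectI_bound => //; last by move=> z Hz; apply: Hn; exact: H.
  move=> z Hz e' e'0. have [d1 [d10 K1]] := c1 z Hz (e'/2) ltac:(lra). have [d2 [d20 K2]] := c2 z Hz (e'/2) ltac:(lra).
  exists (Rmin d1 d2); split; first exact: Rmin_glb_lt. move=> w Hw.
  have := Rmin_l d1 d2; have := Rmin_r d1 d2 => u1 u2.
  have := K1 w ltac:(lra). have := K2 w ltac:(lra).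
  replace (F n w - f w - (F n z - f z))%C with ((F n w - F n z) - (f w - f z))%C by ring.
  have := Cmod_sub (F n w - F n z)%C (f w - f z)%C. lra.
replace (2 * (e / (2 * (L + 1))) * L) with (e * (L / (L + 1))) by (field; lra).
have : L / (L + 1) <= 1 by apply: (Rmult_le_reg_r (L + 1)); [lra | rewrite /Rdiv Rmult_assoc Rinv_l; lra]. nra.
Qed.


(** * Harnack's inequality and quotients of bounded functions *)

Lemma disc_open (c : C) r z : Cmod (z - c)%C < r -> exists d, 0 < d /\ forall w, Cmod (w - z)%C < d -> Cmod (w - c)%C < r.
Proof.
move=> H. exists (r - Cmod (z - c)%C); split; first lra. move=> w Hw.
replace (w - c)%C with ((w - z) + (z - c))%C by ring. have := Cmod_triangle (w - z)%C (z - c)%C. lra.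
Qed.

Lemma Csub0 (z : C) : (z - 0)%C = z. Proof. ring. Qed.

Lemma disc_max f R0 M : 0 <= M -> (forall z, Cmod z < R0 -> holo f z) ->
  (forall eta, 0 < eta -> exists r, r < R0 /\ forall w, r < Cmod w -> Cmod w < R0 -> Cmod (f w) <= M + eta) ->
  forall z, Cmod z < R0 -> Cmod (f z) <= M.
Proof.
move=> M0 Hf Hb z Hz.
apply: (max_principle (fun z => Cmod z < R0) f M R0) => //.
- move=> w Hw. have := disc_open 0 R0 w. rewrite Csub0 => /(_ Hw) [d [d0 K]]. exists d; split => // u Hu.
  have := K u Hu. by rewrite Csub0.
- move=> w Hw. lra.
- move=> p Hp eta eta0. have [r [rR K]] := Hb eta eta0.
  exists (R0 - r); split; first lra. move=> w Dw Hw. apply: K => //.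
  have := Cmod_rev p w. rewrite Cmod_sub_sym. have : R0 <= Cmod p by apply: Rnot_lt_le. lra.
Qed.

Lemma schwarz f R0 : 0 < R0 -> (forall z, Cmod z < R0 -> holo f z) -> (forall z, Cmod z < R0 -> Cmod (f z) <= 1) ->
  f 0%C = 0%C -> forall z, Cmod z < R0 -> Cmod (f z) <= Cmod z / R0.
Proof.
move=> R00 Hf Hb f0 z Hz.
have i0 : 0 < / R0 by apply: Rinv_0_lt_compat.
have H : forall z, Cmod z < R0 -> Cmod (dq f 0 z) <= / R0.
  apply: disc_max; first lra.
  - move=> w Hw. apply: (dq_holo f 0 R0) => //; last exact: Hf. move=> u; rewrite Csub0; exact: Hf.
  - move=> eta eta0. exists (/ (/ R0 + eta)); split.
      rewrite -{2}(Rinv_inv R0). apply: Rinv_lt_contravar; last lra. apply: Rmult_lt_0_compat; lra.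
    move=> w h1 h2. have p0 : 0 < / (/ R0 + eta) by apply: Rinv_0_lt_compat; lra.
    have w0 : w <> 0%C by apply: Cneq_mod; lra.
    rewrite dq_off // Csub0 f0 Csub0 Cmod_div //.
    have := Hb w h2. have wp := Cmod_pos w w0.
    have : / Cmod w <= / R0 + eta.
      rewrite -(Rinv_inv (/ R0 + eta)). apply: Rinv_le_contravar; lra.
    have : 0 < / Cmod w by apply: Rinv_0_lt_compat. have := Cmod_ge_0 (f w). rewrite /Rdiv. nra.
have := dq_mul f 0 z. rewrite f0 !Csub0 => <-. rewrite Cmod_mult /Rdiv.
apply: Rmult_le_compat_l; [exact: Cmod_ge_0 | exact: H].
Qed.

(** With k the primitive of g'/g that vanishes at 0, the derivative of g exp(-k) is zero. *)
Lemma disc_log g R0 : (forall z, Cmod z < R0 -> holo g z) -> (forall z, Cmod z < R0 -> g z <> 0%C) ->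
  exists k : C -> C, k 0%C = 0%C /\ forall z, Cmod z < R0 -> holo k z /\ g z = (g 0%C * cexp (k z))%C.
Proof.
move=> Hg Hn.
have opn z : Cmod z < R0 -> exists d, 0 < d /\ forall w, Cmod (w - z)%C < d -> Cmod w < R0.
  move=> Hz. have := disc_open 0 R0 z. rewrite Csub0 => /(_ Hz) [d [d0 K]]. exists d; split => // w Hw. have := K w Hw. by rewrite Csub0.
pose q z := (cderiv g z / g z)%C.
have hq z : Cmod z < R0 -> holo q z.
  move=> Hz. have [d [d0 K]] := opn z Hz. apply: holo_div; [exact: Hn | | exact: Hg].
  apply: (holo_cderiv g z d) => // w Hw. apply: Hg. exact: K.
have P z : Cmod z < R0 -> is_cder (prim q 0) z (q z).
  move=> Hz. apply: (disc_prim q 0 R0); last by rewrite Csub0.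
  - move=> w; rewrite Csub0 => Hw. apply: holo_cont. exact: hq.
  - move=> x1 x2 y1 y2 h1 h2 H. apply: goursat => // w Hw. apply: hq. have := H w Hw. by rewrite Csub0.
exists (prim q 0); split.
  rewrite /prim /CI !RInt_point. change (@zero C_R_CompleteNormedModule) with (RtoC 0). ring.
move=> z Hz. split; first by eexists; exact: P.
pose F w := (g w * cexp (- prim q 0 w))%C.
have DF w : Cmod w < R0 -> is_cder F w 0%C.
  move=> Hw.
  replace (RtoC 0) with (cderiv g w * cexp (- prim q 0 w) + g w * (cexp (- prim q 0 w) * (- q w)))%C.
    apply: is_cder_mult; first by apply: cderiv_correct; exact: Hg.
    apply: (is_cder_comp cexp (fun w => - prim q 0 w)%C); last exact: is_cder_cexp.
    apply: (is_cder_ext (fun w => (-1) * prim q 0 w)%C); first by move=> u; ring.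
    replace (- q w)%C with (0 * prim q 0 w + (-1) * q w)%C by ring.
    apply: (is_cder_mult (fun _ => (-1)%C)); [exact: is_cder_const | exact: P].
  rewrite /q. field. exact: Hn.
have seg t : 0 <= t <= 1 -> Cmod (0 + t * (z - 0))%C < R0.
  move=> Ht. replace (0 + t * (z - 0))%C with (t * z)%C by ring. rewrite Cmod_mult Cmod_R Rabs_pos_eq; last lra.
  have := Cmod_ge_0 z. nra.
have := path_bound F (fun _ => 0%C) 0 z 0 (fun t Ht => DF _ (seg t Ht)) (fun t _ => holo_cont _ _ (holo_const _ _)).
have H1 (t : R) : 0 <= t <= 1 -> Cmod 0 <= 0 by move=> _; rewrite Cmod_0; right.
move/(_ H1). rewrite Rmult_0_l => H2.
have {H2} : Cmod (F z - F 0%C)%C = 0 by apply: Rle_antisym => //; exact: Cmod_ge_0.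
move/Cmod_eq_0. rewrite /F.
have -> : prim q 0 0 = 0%C.
  rewrite /prim /CI !RInt_point. change (@zero C_R_CompleteNormedModule) with (RtoC 0). ring.
replace (- 0)%C with (RtoC 0) by ring. rewrite cexp_0 => E.
have -> : g 0%C = (g z * cexp (- prim q 0 z))%C.
  replace (g z * cexp (- prim q 0 z))%C with (g z * cexp (- prim q 0 z) - g 0%C * 1 + g 0%C)%C by ring. rewrite E; ring.
rewrite -Cmult_assoc -cexp_plus. replace (- prim q 0 z + prim q 0 z)%C with (RtoC 0) by ring. rewrite cexp_0; ring.
Qed.

(** Let k be the logarithm of g/g(0), so that Re k <= c = -ln |g(0)|. The half plane below c is
    mapped to the unit disc by k -> k/(2c - k), and Schwarz' lemma bounds |k(z)|. *)
Lemma harnack g R0 z : (forall z, Cmod z < R0 -> holo g z) -> (forall z, Cmod z < R0 -> g z <> 0%C) ->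
  (forall z, Cmod z < R0 -> Cmod (g z) <= 1) -> Cmod z < R0 ->
  exp (ln (Cmod (g 0%C)) * ((R0 + Cmod z) / (R0 - Cmod z))) <= Cmod (g z).
Proof.
move=> Hg Hn Hb Hz. have z0 := Cmod_ge_0 z. have R00 : 0 < R0 by lra.
have m0 : Cmod 0 < R0 by rewrite Cmod_0.
have g0 := Cmod_pos _ (Hn 0%C m0).
have [k [k0 Hk]] := disc_log g R0 Hg Hn.
set c := - ln (Cmod (g 0%C)).
have c0 : 0 <= c by rewrite /c; have := ln_le _ _ g0 (Hb 0%C m0); rewrite ln_1; lra.
have gE w : Cmod w < R0 -> Cmod (g w) = exp (Re (k w) - c).
  move=> Hw. have [_ ->] := Hk w Hw. rewrite Cmod_mult Cmod_cexp /c /Re.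
  replace (fst (k w) - - ln (Cmod (g 0%C))) with (ln (Cmod (g 0%C)) + fst (k w)) by ring. by rewrite exp_plus exp_ln.
have kc w : Cmod w < R0 -> Re (k w) <= c.
  move=> Hw. have := Hb w Hw. rewrite gE // -{1}exp_0 => H. apply: Rnot_lt_le => H'.
  have := exp_increasing 0 (Re (k w) - c) ltac:(lra). rewrite exp_0 in H *; lra.
rewrite (gE z) //.
set s := Cmod z / R0.
have s0 : 0 <= s by apply: Rmult_le_pos => //; left; exact: Rinv_0_lt_compat.
have s1 : s < 1 by rewrite /s; apply: (Rmult_lt_reg_r R0) => //; rewrite /Rdiv Rmult_assoc Rinv_l; lra.
have main : Cmod (k z) * (1 - s) <= 2 * c * s.
  apply: le_epsilon => e e0.
  (* The constant c may be 0, where the map to the disc degenerates; e tends to 0 afterwards. *)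
  set c' := c + e / 2. have c'0 : 0 < c' by rewrite /c'; lra.
  have Hd w : Cmod w < R0 -> Cmod (k w) <= Cmod (2 * c' - k w)%C /\ 0 < Cmod (2 * c' - k w)%C.
    move=> Hw. have := kc w Hw => H. split.
    - apply: Rsqr_incr_0_var; last exact: Cmod_ge_0. rewrite /Rsqr !Cmod_sq /=. rewrite /Re in H. rewrite /c'. nra.
    - apply: Rlt_le_trans (Cmod_fst _) => /=. rewrite /Re in H. rewrite Rabs_pos_eq; rewrite /c'; lra.
  pose ph w := (k w / (2 * c' - k w))%C.
  have ps := schwarz ph R0 R00.
  have {}ps : Cmod (ph z) <= s.
    apply: ps => //.
    - move=> w Hw. have [hk _] := Hk w Hw. apply: holo_div => //; first by apply: Cneq_mod; exact: (proj2 (Hd w Hw)).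
      holo_tac. exact: hk.
    - move=> w Hw. have [h1 h2] := Hd w Hw. rewrite /ph Cmod_div; last exact: Cneq_mod.
      apply: (Rmult_le_reg_r (Cmod (2 * c' - k w)%C)) => //. rewrite /Rdiv Rmult_assoc Rinv_l; lra.
    - rewrite /ph k0. rewrite /Cdiv. ring.
  have [h1 h2] := Hd z Hz.
  have : Cmod (k z) <= s * Cmod (2 * c' - k z)%C.
    move: ps. rewrite /ph Cmod_div; last exact: Cneq_mod.
    move/(Rmult_le_compat_r _ _ _ (Rlt_le _ _ h2)). by rewrite /Rdiv Rmult_assoc Rinv_l; [rewrite Rmult_1_r | lra].
  have := Cmod_sub (2 * c')%C (k z). rewrite Cmod_mult !Cmod_R !Rabs_pos_eq; try lra.
  move=> h3 h4. have : s * Cmod (2 * c' - k z)%C <= s * (2 * c' + Cmod (k z)) by apply: Rmult_le_compat_l.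
  have -> : s * (2 * c' + Cmod (k z)) = 2 * c * s + e * s + s * Cmod (k z) by rewrite /c'; field.
  have : e * s <= e * 1 by apply: Rmult_le_compat_l; lra.
  lra.
have re : - Cmod (k z) <= Re (k z).
  have := Cmod_fst (k z). rewrite /Re. have := Rle_abs (- fst (k z)). rewrite Rabs_Ropp. lra.
have -> : ln (Cmod (g 0%C)) * ((R0 + Cmod z) / (R0 - Cmod z)) = - c * ((1 + s) / (1 - s)).
  rewrite /c /s. field. repeat split; lra.
have kb : Cmod (k z) <= 2 * c * s / (1 - s).
  apply: (Rmult_le_reg_r (1 - s)); first lra. rewrite /Rdiv Rmult_assoc Rinv_l; lra.
have : - c * ((1 + s) / (1 - s)) <= Re (k z) - c.
  have -> : - c * ((1 + s) / (1 - s)) = - c - 2 * c * s / (1 - s) by field; lra. lra.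
case=> [H|->]; [left; exact: exp_increasing | by right].
Qed.

Lemma blaschke_id (a z : C) : Cmod (1 - Cconj a * z)%C * Cmod (1 - Cconj a * z)%C =
  Cmod (z - a)%C * Cmod (z - a)%C + (1 - Cmod a * Cmod a) * (1 - Cmod z * Cmod z).
Proof. rewrite !Cmod_sq /=. ring. Qed.

(* Dividing g by Blaschke factors increases |g 0| by at least the factor 1/R' per zero, so only finitely many divisions are possible. *)
Lemma quotient_bound L g : (forall z, Cmod z < 1 -> holo L z) -> (forall z, Cmod z < 1 -> holo g z) ->
  (forall z, Cmod z < 1 -> Cmod (g z) <= 1) -> (forall z, Cmod z < 1 -> Cmod (L z * g z)%C <= 1) -> g 0%C <> 0%C ->
  forall z, Cmod z < 1 -> Cmod (L z) <= exp (- ln (Cmod (g 0%C)) * (4 / (1 - Cmod z))).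
Proof.
move=> HL Hg Hb HLg g0 z Hz. have z0 := Cmod_ge_0 z.
(* Zeros are divided out up to the radius halfway between |z| and 1. Harnack's inequality on that
   disc has the factor (R' + rho)/(R' - rho) = (1 + 3 rho)/(1 - rho) <= 4/(1 - rho). *)
set rho := Cmod z in Hz z0 *. set R' := (1 + rho) / 2.
have R'1 : rho < R' < 1 by rewrite /R'; lra. have R'0 : 0 < R' by lra.
pose S n g1 := (forall z, Cmod z < 1 -> holo g1 z) /\ (forall z, Cmod z < 1 -> Cmod (g1 z) <= 1) /\
   (forall z, Cmod z < 1 -> Cmod (L z * g1 z)%C <= 1) /\ Cmod (g 0%C) <= R' ^ n * Cmod (g1 0%C).
have g0p := Cmod_pos _ g0.
have [n [g1 [[S1 [S2 [S3 S4]]] nz]]] : exists n g1, S n g1 /\ forall w, Cmod w < R' -> g1 w <> 0%C.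
  apply: NNPP => N.
  have all n : exists g1, S n g1.
    elim: n => [|n [g1 [S1 [S2 [S3 S4]]]]].
      exists g; split; [|split; [|split]] => //. simpl. lra.
    have [a [ha ga]] : exists a, Cmod a < R' /\ g1 a = 0%C.
      apply: NNPP => N'. apply: N. exists n, g1; split; first by split.
      move=> w Hw E. apply: N'. by exists w.
    have a1 : Cmod a < 1 by lra.
    have a0 : a <> 0%C.
      move=> E. rewrite E in ga. rewrite ga Cmod_0 Rmult_0_r in S4. lra.
    pose g2 w := ((1 - Cconj a * w) * dq g1 a w)%C.
    have hg2 w : Cmod w < 1 -> holo g2 w.
      move=> Hw. apply: holo_mult; first holo_tac.
      have := disc_open 0 1 a. rewrite Csub0 => /(_ a1) [d [d0 K]].
      apply: (dq_holo g1 a d) => //; last exact: S1. move=> u Hu. apply: S1. have := K u Hu. by rewrite Csub0.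
    have E2 w : w <> a -> ((w - a) * g2 w)%C = ((1 - Cconj a * w) * g1 w)%C.
      move=> _. rewrite /g2. transitivity ((1 - Cconj a * w) * ((w - a) * dq g1 a w))%C; first ring.
      rewrite dq_mul ga. ring.
    set da := (1 - Cmod a) / 2. have da0 : 0 < da by rewrite /da; lra.
    (* Near the unit circle the Blaschke factor has modulus close to 1, so the bound 1 survives the
       division by the maximum principle. This is needed for the denominator and for its product
       with L. *)
    have bound (h h2 : C -> C) : (forall w, Cmod w < 1 -> holo h2 w) -> (forall w, Cmod w < 1 -> Cmod (h w) <= 1) ->
       (forall w, w <> a -> ((w - a) * h2 w)%C = ((1 - Cconj a * w) * h w)%C) -> forall w, Cmod w < 1 -> Cmod (h2 w) <= 1.
      move=> hh hb hE. apply: disc_max; [lra | exact: hh |].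
      move=> eta eta0.
      set kap := Rmin (1/2) (eta * (da * da)).
      have kap0 : 0 < kap by apply: Rmin_glb_lt; [lra | apply: Rmult_lt_0_compat => //; nra].
      have kap1 : kap <= 1/2 by exact: Rmin_l. have kap2 : kap <= eta * (da * da) by exact: Rmin_r.
      exists (Rmax (1 - kap / 2) (Cmod a + da)); split.
        apply: Rmax_lub_lt; [lra | rewrite /da; lra].
      move=> w h1 h2'. have := Rmax_l (1 - kap / 2) (Cmod a + da). have := Rmax_r (1 - kap / 2) (Cmod a + da) => u1 u2.
      have wa : da <= Cmod (w - a)%C by have := Cmod_rev w a; lra.
      have wn : w <> a by move=> E; rewrite E Cmod_self in wa; lra.
      have E := hE w wn. have Em : Cmod (w - a)%C * Cmod (h2 w) = Cmod (1 - Cconj a * w)%C * Cmod (h w) by rewrite -!Cmod_mult E.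
      have B := blaschke_id a w.
      set X := Cmod (w - a)%C in wa Em B. set Y := Cmod (1 - Cconj a * w)%C in Em B.
      have Y0 : 0 <= Y by exact: Cmod_ge_0.
      have hw := hb w h2'. have hw0 := Cmod_ge_0 (h w). have q0 := Cmod_ge_0 (h2 w).
      have a0' := Cmod_ge_0 a.
      have YX : Y * Y <= X * X + kap.
        rewrite B. have : (1 - Cmod a * Cmod a) * (1 - Cmod w * Cmod w) <= 1 * kap by apply: Rmult_le_compat; nra. lra.
      have YX2 : Y <= X * (1 + eta).
        apply: Rsqr_incr_0_var; last by nra. rewrite /Rsqr.
        have : eta * (da * da) <= eta * (X * X) by apply: Rmult_le_compat_l; nra.
        have : 0 <= X * X * (eta * eta) by nra. nra.
      apply: (Rmult_le_reg_l X); first lra. rewrite Em. nra.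
    exists g2; split; [exact: hg2 | split; [|split]].
    - exact: (bound g1 g2).
    - apply: (bound (fun w => L w * g1 w)%C (fun w => L w * g2 w)%C) => //.
      + move=> w Hw. apply: holo_mult; [exact: HL | exact: hg2].
      + move=> w wa. transitivity (L w * ((w - a) * g2 w))%C; first ring. rewrite E2 //. ring.
    - have := E2 0%C (fun E => a0 (eq_sym E)). move: (g2 0%C) => G. move/(f_equal Cmod). rewrite !Cmod_mult.
      replace (0 - a)%C with (- a)%C by ring. replace (1 - Cconj a * 0)%C with (RtoC 1) by ring. rewrite Cmod_opp Cmod_1 => E.
      have {}E : Cmod (g1 0%C) = Cmod a * Cmod G by lra.
      rewrite E in S4. have := Cmod_ge_0 G. have p0 : 0 < R' ^ n by exact: pow_lt.
      simpl. move=> q. apply: Rle_trans S4 _.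
      have : Cmod a * Cmod G <= R' * Cmod G by apply: Rmult_le_compat_r; lra.
      move/(Rmult_le_compat_l _ _ _ (Rlt_le _ _ p0)). lra.
  have [K HK] := pow_lt_1_zero R' ltac:(rewrite Rabs_pos_eq; lra) (Cmod (g 0%C)) g0p.
  have [g1 [S1 [S2 [S3 S4]]]] := all K. have := HK K (le_n _). rewrite Rabs_pos_eq; last by apply: pow_le; lra.
  have := S2 0%C ltac:(rewrite Cmod_0; lra). have p0 : 0 < R' ^ K by exact: pow_lt. nra.
have H := harnack g1 R' z (fun w Hw => S1 w ltac:(lra)) nz (fun w Hw => S2 w ltac:(lra)) (proj1 R'1).
have gz := S3 z Hz. rewrite Cmod_mult in gz.
have g1p : 0 < Cmod (g1 0%C) by apply: Cmod_pos; apply: nz; rewrite Cmod_0.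
have lnle : ln (Cmod (g 0%C)) <= ln (Cmod (g1 0%C)).
  apply: ln_le => //. have : R' ^ n <= 1 by rewrite -(pow1 n); apply: pow_incr; lra. nra.
have ln0 : ln (Cmod (g1 0%C)) <= 0.
  have : ln (Cmod (g1 0%C)) <= ln 1 by apply: ln_le => //; apply: S2; rewrite Cmod_0; lra.
  rewrite ln_1. lra.
set A := ln (Cmod (g1 0%C)) * ((R' + Cmod z) / (R' - Cmod z)) in H.
have A1 : ln (Cmod (g 0%C)) * (4 / (1 - rho)) <= A.
  have -> : A = ln (Cmod (g1 0%C)) * ((1 + 3 * rho) / (1 - rho)) by rewrite /A -/rho /R'; field; lra.
  have i0 : 0 < / (1 - rho) by apply: Rinv_0_lt_compat; lra.
  apply: (Rle_trans _ (ln (Cmod (g1 0%C)) * (4 / (1 - rho)))).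
    apply: Rmult_le_compat_r => //. rewrite /Rdiv; nra.
  apply: Rmult_le_compat_neg_l => //. rewrite /Rdiv. apply: Rmult_le_compat_r; lra.
have ep := exp_pos A.
have gp : 0 < Cmod (g1 z) by lra.
have : Cmod (L z) <= / Cmod (g1 z).
  apply: (Rmult_le_reg_r (Cmod (g1 z))) => //. rewrite Rinv_l; lra.
have : / Cmod (g1 z) <= exp (- A) by rewrite exp_Ropp; apply: Rinv_le_contravar.
have : exp (- A) <= exp (- ln (Cmod (g 0%C)) * (4 / (1 - rho))).
  have : - A <= - ln (Cmod (g 0%C)) * (4 / (1 - rho)) by lra.
  case=> [h|->]; [left; exact: exp_increasing | by right].
lra.
Qed.

Lemma cont_bounded_rect f a b c d : a <= b -> c <= d -> ccont_rect f a b c d ->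
  exists M, forall z, in_rect a b c d z -> Cmod (f z) <= M.
Proof.
move=> ab cd Hc.
apply: (rect_ind (fun a b c d => exists M, forall z, in_rect a b c d z -> Cmod (f z) <= M)) => //.
- move=> a' b' c' d' h1 h2 [M1 H1] [M2 H2] [M3 H3] [M4 H4].
  exists (Rmax (Rmax M1 M2) (Rmax M3 M4)) => w [[w1 w2] [w3 w4]].
  have := Rmax_l (Rmax M1 M2) (Rmax M3 M4). have := Rmax_r (Rmax M1 M2) (Rmax M3 M4).
  have := Rmax_l M1 M2. have := Rmax_r M1 M2. have := Rmax_l M3 M4. have := Rmax_r M3 M4 => m1 m2 m3 m4 m5 m6.
  case: (Rle_dec (fst w) ((a' + b') / 2)) => X; case: (Rle_dec (snd w) ((c' + d') / 2)) => Y.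
  + have : Cmod (f w) <= M1 by apply: H1; split; lra. lra.
  + have : Cmod (f w) <= M3 by apply: H3; split; lra. lra.
  + have : Cmod (f w) <= M2 by apply: H2; split; lra. lra.
  + have : Cmod (f w) <= M4 by apply: H4; split; lra. lra.
- move=> x y Hx Hy. have [dl [dl0 K]] := Hc (x, y) (conj Hx Hy) 1 Rlt_0_1.
  exists (dl / 2); split; first lra. move=> a' b' c' d' _ _ _ _ h1 h2 h3 h4. exists (Cmod (f (x, y)) + 1) => w [w1 w2].
  have := K w. have hw : Cmod (w - (x, y))%C < dl.
    apply: Rle_lt_trans (Cmod_le_sum _) _ => /=.
    have : Rabs (fst w + - x) <= b' - a' by apply: Rabs_le; lra.
    have : Rabs (snd w + - y) <= d' - c' by apply: Rabs_le; lra. lra.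
  move/(_ hw). have := Cmod_rev (f w) (f (x, y)). lra.
Qed.

Lemma entire_bounded_disc f r : (forall z, holo f z) -> exists M, 0 < M /\ forall z, Cmod z <= r -> Cmod (f z) <= M.
Proof.
move=> Hf. case: (Rle_dec 0 r) => r0; last first.
  exists 1; split; first lra. move=> z Hz. have := Cmod_ge_0 z. lra.
have [M HM] := cont_bounded_rect f (-r) r (-r) r ltac:(lra) ltac:(lra) (fun z _ => holo_cont f z (Hf z)).
exists (Rmax M 1); split; first by apply: Rlt_le_trans (Rmax_r _ _); lra.
move=> z Hz. apply: Rle_trans (Rmax_l _ _). apply: HM.
have h1 := Cmod_fst z. have h2 := Cmod_snd z.
have := Rabs_le_between (fst z) r. have := Rabs_le_between (snd z) r. split; lra.
Qed.

Definition type_zero (f : C -> C) := forall e, 0 < e -> exists K, 0 < K /\ forall z, Cmod (f z) <= K * exp (e * Cmod z).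

Lemma holo_scale f (a : C) z : holo f (a * z)%C -> holo (fun w => f (a * w)%C) z.
Proof. move=> H. apply: (holo_comp f (fun w => a * w)%C) => //. holo_tac. Qed.

(** For given z the estimate [quotient_bound] is rescaled to the disc of radius 2|z| + 1, where H
    and L H are at most M. At the point z/rr of modulus at most 1/2 the factor 4/(1 - |w|) is at
    most 8; as ln M contains (e/16)(2|z| + 1), the exponent becomes e|z| plus a constant. *)
Lemma quotient_type_zero L H : (forall z, holo L z) -> (forall z, holo H z) -> H 0%C <> 0%C ->
  type_zero H -> type_zero (fun z => L z * H z)%C -> type_zero L.
Proof.
move=> HL HH H0 T1 T2 e e0.
have [K1 [K10 B1]] := T1 (e/16) ltac:(lra). have [K2 [K20 B2]] := T2 (e/16) ltac:(lra).
set K := Rmax 1 (Rmax K1 K2).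
have k0 : 1 <= K by exact: Rmax_l.
have k1 : K1 <= K by apply: Rle_trans (Rmax_r _ _); exact: Rmax_l.
have k2 : K2 <= K by apply: Rle_trans (Rmax_r _ _); exact: Rmax_r.
have h0 := Cmod_pos _ H0.
exists (exp (8 * (ln K + e / 8 - ln (Cmod (H 0%C))))); split; first exact: exp_pos.
move=> z. rewrite -exp_plus. have z0 := Cmod_ge_0 z.
set rr := 2 * Cmod z + 1. have rr0 : 0 < rr by rewrite /rr; lra.
set M := K * exp (e / 16 * rr).
have M0 : 0 < M by apply: Rmult_lt_0_compat; [lra | exact: exp_pos].
have Mn : RtoC M <> 0%C by apply: Cneq_mod; rewrite Cmod_R Rabs_pos_eq; lra.
have rn : RtoC rr <> 0%C by apply: Cneq_mod; rewrite Cmod_R Rabs_pos_eq; lra.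
pose g w := (H (rr * w) * / M)%C. pose L' w := L (rr * w)%C.
have bnd K' w : 0 < K' -> K' <= K -> Cmod w < 1 -> K' * exp (e / 16 * Cmod (rr * w)%C) <= M.
  move=> p1 p2 hw. rewrite /M. apply: Rmult_le_compat; try lra; first by left; exact: exp_pos.
  rewrite Cmod_mult Cmod_R Rabs_pos_eq; last lra.
  have : e / 16 * (rr * Cmod w) <= e / 16 * rr by apply: Rmult_le_compat_l; [lra | nra].
  case=> [h|->]; [left; exact: exp_increasing | by right].
have div w : Cmod w <= M -> Cmod w * / M <= 1.
  move=> h. apply: (Rmult_le_reg_r M) => //. rewrite Rmult_assoc Rinv_l; lra.
have Q := quotient_bound L' g.
have zz : Cmod (z / rr)%C <= 1 / 2.
  rewrite Cmod_div // Cmod_R Rabs_pos_eq; last lra. apply: (Rmult_le_reg_r rr) => //. rewrite /Rdiv Rmult_assoc Rinv_l; [rewrite /rr; lra | lra].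
have := Q _ _ _ _ _ (z / rr)%C ltac:(lra).
have E0 : Cmod (g 0%C) = Cmod (H 0%C) * / M.
  rewrite /g. replace (rr * 0)%C with (RtoC 0) by ring. rewrite Cmod_mult Cmod_inv // Cmod_R Rabs_pos_eq //; lra.
have zE : L' (z / rr)%C = L z by rewrite /L'; congr L; field.
move=> {}Q. rewrite -zE.
apply: Rle_trans (Q _ _ _ _ _) _.
- move=> w _. exact: holo_scale.
- move=> w _. apply: holo_mult; [exact: holo_scale | exact: holo_const].
- move=> w hw. rewrite /g Cmod_mult Cmod_inv // Cmod_R (Rabs_pos_eq M); last lra. apply: div.
  apply: Rle_trans (B1 _) _. exact: bnd.
- move=> w hw. rewrite /g /L' Cmult_assoc Cmod_mult Cmod_inv // Cmod_R (Rabs_pos_eq M); last lra. apply: div.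
  apply: Rle_trans (B2 _) _. exact: bnd.
- apply: Cneq_mod. rewrite E0. apply: Rmult_lt_0_compat => //. exact: Rinv_0_lt_compat.
have i0 : 0 < / M by exact: Rinv_0_lt_compat.
rewrite E0 ln_mult // ln_Rinv // /M ln_mult; [|lra|exact: exp_pos]. rewrite ln_exp.
set c := - (ln (Cmod (H 0%C)) + - (ln K + e / 16 * rr)).
have c0 : 0 <= c.
  have : ln (Cmod (H 0%C)) <= ln M.
    apply: ln_le => //. have -> : H 0%C = H (rr * 0)%C by congr H; ring. apply: Rle_trans (B1 _) _. apply: bnd => //. rewrite Cmod_0; lra.
  rewrite /M ln_mult; [|lra|exact: exp_pos]. rewrite ln_exp /c. lra.
have : c * (4 / (1 - Cmod (z / rr)%C)) <= c * 8.
  apply: Rmult_le_compat_l => //. apply: (Rmult_le_reg_r (1 - Cmod (z / rr)%C)); first lra. rewrite /Rdiv Rmult_assoc Rinv_l; lra.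
move=> h. have : c * (4 / (1 - Cmod (z / rr)%C)) <= 8 * (ln K + e / 8 - ln (Cmod (H 0%C))) + e * Cmod z.
  apply: Rle_trans h _. rewrite /c /rr. lra.
case=> [h'|->]; [left; exact: exp_increasing | by right].
Qed.


(** * Wirtinger's inequality *)

Lemma exRc (f : R -> R) a b : (forall x, continuous f x) -> ex_RInt f a b.
Proof. move=> H. apply: (@ex_RInt_continuous R_CompleteNormedModule) => z _. exact: H. Qed.

Lemma RInt_nonneg f a b : a <= b -> (forall x, continuous f x) -> (forall x, a < x < b -> 0 <= f x) -> 0 <= RInt f a b.
Proof. move=> ab Hc H. apply: RInt_ge_0 => //. exact: exRc. Qed.

Lemma continuous_Rmult (f g : R -> R) x : continuous f x -> continuous g x -> continuous (fun y => f y * g y) x.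
Proof. exact: (@continuous_mult R_UniformSpace R_AbsRing). Qed.
Lemma continuous_Rplus (f g : R -> R) x : continuous f x -> continuous g x -> continuous (fun y => f y + g y) x.
Proof. exact: (@continuous_plus R_UniformSpace R_AbsRing R_NormedModule). Qed.
Lemma continuous_Rminus (f g : R -> R) x : continuous f x -> continuous g x -> continuous (fun y => f y - g y) x.
Proof. exact: (@continuous_minus R_UniformSpace R_AbsRing R_NormedModule). Qed.

Ltac cont_tac := repeat match goal with
  | |- continuous (fun _ => ?c) _ => exact: continuous_const
  | |- continuous (fun y => Rmult (@?f y) (@?g y)) _ => refine (continuous_Rmult f g _ _ _)
  | |- continuous (fun y => Rplus (@?f y) (@?g y)) _ => refine (continuous_Rplus f g _ _ _)
  | |- continuous (fun y => Rminus (@?f y) (@?g y)) _ => refine (continuous_Rminus f g _ _ _)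
  end.

Section Wirtinger.
Variables w dw : R -> R.
Hypothesis wd : forall x, is_derive w x (dw x).
Hypothesis dwc : forall x, continuous dw x.

Lemma wirtinger_continuous x : continuous w x.
Proof. apply: (@ex_derive_continuous R_AbsRing R_NormedModule). by exists (dw x). Qed.

(* Jacobi's trick: (w')^2 - l^2 w^2 + (l tan(l(x-m)) w^2)' is a square. *)
Lemma wirtinger_interval l p q : 0 < l -> p <= q -> (q - p) * l < PI -> w p = 0 -> w q = 0 ->
  l * l * RInt (fun x => w x * w x) p q <= RInt (fun x => dw x * dw x) p q.
Proof.
move=> l0 pq lpq wp wq. set m := (p + q) / 2.
have cpos x : p <= x <= q -> 0 < cos (l * (x - m)).
  move=> Hx. apply: cos_gt_0; rewrite /m; nra.
pose T x := sin (l * (x - m)) / cos (l * (x - m)).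
pose H x := l * T x * (w x * w x).
pose dH x := l * (l * (1 + T x * T x)) * (w x * w x) + l * T x * (2 * w x * dw x).
have dT x : p <= x <= q -> is_derive T x (l * (1 + T x * T x)).
  move=> Hx. have c0 := cpos x Hx. rewrite /T. auto_derive; change (x + - m) with (x - m); first lra.
  field. lra.
have cT x : p <= x <= q -> continuous T x.
  move=> Hx. apply: (@ex_derive_continuous R_AbsRing R_NormedModule). exists (l * (1 + T x * T x)). exact: dT.
have dHH x : p <= x <= q -> is_derive H x (dH x).
  move=> Hx. rewrite /H /dH.
  have dd := dT x Hx. have ww := wd x.
  have e1 : ex_derive T x by exists (l * (1 + T x * T x)). have e2 : ex_derive w x by exists (dw x).
  clearbody T. auto_derive; first by repeat split.
  rewrite (is_derive_unique _ _ _ dd) (is_derive_unique _ _ _ ww). ring.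
have cc := continuous_Rmult. have wc := wirtinger_continuous.
have cdH x : p <= x <= q -> continuous dH x.
  move=> Hx. have e1 := cT x Hx. have e2 := wc x. have e3 := dwc x. rewrite /dH. clearbody T. cont_tac; assumption.
have I0 : is_RInt dH p q 0.
  have E : minus (H q) (H p) = 0 by rewrite /H wp wq /minus /plus /opp /=; ring.
  rewrite -E. apply: (is_RInt_derive H dH) => y; rewrite Rmin_left // Rmax_right // => Hy; [exact: dHH | exact: cdH].
have I1 : is_RInt (fun x => w x * w x) p q (RInt (fun x => w x * w x) p q).
  apply: RInt_correct. apply: exRc => x. by apply: cc.
have I2 : is_RInt (fun x => dw x * dw x) p q (RInt (fun x => dw x * dw x) p q).
  apply: RInt_correct. apply: exRc => x. by apply: cc.
set X := RInt (fun x => w x * w x) p q in I1 *. set Y := RInt (fun x => dw x * dw x) p q in I2 *.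
have I3 := is_RInt_plus _ _ _ _ _ _ (is_RInt_minus _ _ _ _ _ _ I2 (is_RInt_scal _ _ _ (l * l) _ I1)) I0.
have := is_RInt_le (fun _ => 0) _ p q _ _ pq (is_RInt_const p q 0) I3.
rewrite /scal /plus /minus /opp /= /mult /=.
suff S : forall x, p < x < q -> 0 <= dw x * dw x + - (l * l * (w x * w x)) + dH x.
  move/(_ S). rewrite /plus /opp /=. lra.
move=> x Hx. rewrite /dH. have := pow2_ge_0 (dw x + l * T x * w x). nra.
Qed.

Lemma wirtinger_zero l p q : 0 <= l -> p <= q -> (q - p) * l < PI -> w p = 0 -> w q = 0 ->
  l * l * RInt (fun x => w x * w x) p q <= RInt (fun x => dw x * dw x) p q.
Proof.
move=> [l0|<-]; first exact: wirtinger_interval.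
move=> pq _ _ _. rewrite Rmult_0_l Rmult_0_l. apply: RInt_nonneg => //.
- move=> x. exact: continuous_Rmult.
- move=> x _. nra.
Qed.

(** Says that arcs free of zeros of w are no longer than L, in a form monotone in L. *)
Definition zero_windows L := forall x, exists y, x <= y <= x + L /\ w y = 0.

(** From a zero p the next one is sought in [p + eta, p + eta + L]: each step advances by at least
    eta, so n steps suffice, and has length at most L + eta, so [wirtinger_zero] covers it. *)
Lemma wirtinger_chain l L eta n p q : 0 <= l -> 0 < eta -> 0 <= L -> (L + eta) * l < PI -> zero_windows L ->
  p <= q -> q - p <= INR n * eta -> w p = 0 -> w q = 0 ->
  l * l * RInt (fun x => w x * w x) p q <= RInt (fun x => dw x * dw x) p q.
Proof.
move=> l0 e0 L0 HL W. elim: n p => [|n IH] p pq Hn wp wq.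
  apply: wirtinger_zero => //. simpl in Hn. have := PI_RGT_0. nra.
case: (Rle_dec (q - p) (L + eta)) => D.
  apply: wirtinger_zero => //. nra.
have [z [Hz wz]] := W (p + eta).
have hz : z <= q by lra. have pz : p <= z by lra.
have cw x : continuous (fun x => w x * w x) x by apply: continuous_Rmult; exact: wirtinger_continuous.
have cd x : continuous (fun x => dw x * dw x) x by apply: continuous_Rmult; exact: dwc.
rewrite -(RInt_Chasles (fun x => w x * w x) p z q); try exact: exRc.
rewrite -(RInt_Chasles (fun x => dw x * dw x) p z q); try exact: exRc.
rewrite /plus /=.
have h1 := wirtinger_zero l p z l0 pz ltac:(nra) wp wz.
have h2 := IH z hz ltac:(rewrite S_INR in Hn; lra) wz wq.
lra.
Qed.

Hypothesis wper : forall x, w (x + 2 * PI) = w x.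
Hypothesis dwper : forall x, dw (x + 2 * PI) = dw x.

Lemma RInt_period (g : R -> R) p : (forall x, continuous g x) -> (forall x, g (x + 2 * PI) = g x) -> RInt g p (p + 2 * PI) = RInt g 0 (2 * PI).
Proof.
move=> gc gp.
rewrite -(RInt_Chasles g p 0 (p + 2 * PI)); try exact: exRc.
rewrite -(RInt_Chasles g 0 (2 * PI) (p + 2 * PI)); try exact: exRc.
have -> : RInt g (2 * PI) (p + 2 * PI) = RInt g 0 p.
  have := RInt_comp_lin g 1 (2 * PI) 0 p. rewrite Rmult_0_r Rplus_0_l Rmult_1_l.
  rewrite (Rplus_comm p) => <-; last first.
    rewrite (Rplus_comm _ p). exact: exRc.
  apply: RInt_ext => x _. rewrite /scal /= /mult /= !Rmult_1_l. exact: gp.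
have := opp_RInt_swap g p 0 (exRc g p 0 gc). rewrite /plus /opp /= => <-. ring.
Qed.

Lemma wirtinger_periodic l L eta : 0 <= l -> 0 < eta -> 0 <= L -> (L + eta) * l < PI -> zero_windows L ->
  l * l * RInt (fun x => w x * w x) 0 (2 * PI) <= RInt (fun x => dw x * dw x) 0 (2 * PI).
Proof.
move=> l0 e0 L0 HL W. have [p [_ wp]] := W 0. have pi0 := PI_RGT_0.
rewrite -(RInt_period (fun x => w x * w x) p) -?(RInt_period (fun x => dw x * dw x) p).
- have [n Hn] := nfloor_ex (2 * PI / eta) ltac:(left; apply: Rdiv_lt_0_compat; lra).
  apply: (wirtinger_chain l L eta (S n)) => //; try lra; last by rewrite wper.
  rewrite S_INR. replace (p + 2 * PI - p) with (2 * PI / eta * eta) by (field; lra).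
  apply: Rmult_le_compat_r; lra.
- move=> x. by apply: continuous_Rmult.
- move=> x. by rewrite dwper.
- move=> x. apply: continuous_Rmult; exact: wirtinger_continuous.
- move=> x. by rewrite wper.
Qed.
End Wirtinger.

(** * Gaps between the zeros of two periodic functions *)

Lemma sin_lower d : 0 <= d <= 1 -> d / 2 <= sin d.
Proof.
move=> Hd. have [H _] := sin_bound d 0 ltac:(lra) ltac:(have := PI2_3_2; lra).
move: H. rewrite /sin_approx /sum_f_R0 /sin_term /=. nra.
Qed.

Section Gap.
Variables (u v : R -> R) (s : R).
Hypothesis uper : forall x, u (x + 2 * PI) = u x.
Hypothesis vper : forall x, v (x + 2 * PI) = v x.
Hypothesis s0 : 0 < s.
Hypothesis s1 : s <= 1 / 40.
Hypothesis uv : forall x, s <= Rabs (sin x) -> u x = 0 \/ v x = 0.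

Let d := 4 * s.

(** If sin x and sin(x + d) were both below s in modulus, then sin d = sin(x + d) cos x - cos(x + d)
    sin x would be below 2s = d/2, against [sin_lower]. Thus a shift by d always reaches the region
    where u or v vanishes. *)
Lemma good_shift x : s <= Rabs (sin x) \/ s <= Rabs (sin (x + d)).
Proof.
apply: NNPP => N. have h1 : Rabs (sin x) < s by apply: Rnot_le_lt => H; apply: N; left.
have h2 : Rabs (sin (x + d)) < s by apply: Rnot_le_lt => H; apply: N; right.
have := sin_lower d ltac:(rewrite /d; lra).
have E : sin d = sin (x + d) * cos x - cos (x + d) * sin x.
  rewrite -sin_minus. congr sin. ring.
have := COS_bound x. have := COS_bound (x + d).
move=> [b1 b2] [b3 b4].
have c1 : Rabs (cos x) <= 1 by apply: Rabs_le; lra. have c2 : Rabs (cos (x + d)) <= 1 by apply: Rabs_le; lra.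
have m1 : Rabs (sin (x + d) * cos x) <= Rabs (sin (x + d)) * 1 by rewrite Rabs_mult; apply: Rmult_le_compat_l => //; exact: Rabs_pos.
have m2 : Rabs (cos (x + d) * sin x) <= 1 * Rabs (sin x) by rewrite Rabs_mult; apply: Rmult_le_compat_r => //; exact: Rabs_pos.
have n1 := Rle_abs (sin (x + d) * cos x). have n2 := Rle_abs (- (cos (x + d) * sin x)). rewrite Rabs_Ropp in n2.
rewrite E /d in m1 m2 n1 n2 h2 *. lra.
Qed.
End Gap.

Lemma periodic_IZR (u : R -> R) : (forall x, u (x + 2 * PI) = u x) -> forall (k : Z) x, u (x + IZR k * (2 * PI)) = u x.
Proof.
move=> H.
have P (n : nat) x : u (x + INR n * (2 * PI)) = u x.
  elim: n x => [|n IH] x; first by simpl; congr u; ring.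
  rewrite S_INR. transitivity (u (x + INR n * (2 * PI) + 2 * PI)); [congr u; ring | by rewrite H IH].
move=> k x. case: (Z_le_gt_dec 0 k) => hk.
- have E : IZR k = INR (Z.to_nat k) by rewrite INR_IZR_INZ Z2Nat.id.
  by rewrite E P.
- have E : IZR k = - INR (Z.to_nat (- k)) by rewrite INR_IZR_INZ Z2Nat.id ?opp_IZR; [ring | lia].
  rewrite E -(P (Z.to_nat (- k))). congr u. ring.
Qed.

Lemma zero_windows_mono w L L' : L <= L' -> zero_windows w L -> zero_windows w L'.
Proof. move=> h W x. have [y [Hy wy]] := W x. exists y; split => //; lra. Qed.

Lemma zero_windows_2pi (u : R -> R) x0 : (forall x, u (x + 2 * PI) = u x) -> u x0 = 0 -> zero_windows u (2 * PI).
Proof.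
move=> H u0 x. have pi0 := PI_RGT_0.
pose k := (up ((x - x0) / (2 * PI)))%Z.
have [k1 k2] := archimed ((x - x0) / (2 * PI)).
exists (x0 + IZR k * (2 * PI)). rewrite (periodic_IZR u H) u0. split => //.
have E : (x - x0) = (x - x0) / (2 * PI) * (2 * PI) by field; lra.
rewrite /k. set t := (x - x0) / (2 * PI) in k1 k2 E *. nra.
Qed.

Section Gap2.
Variables (u v : R -> R) (s : R).
Hypothesis uper : forall x, u (x + 2 * PI) = u x.
Hypothesis vper : forall x, v (x + 2 * PI) = v x.
Hypothesis s0 : 0 < s.
Hypothesis s1 : s <= 1 / 100.
Hypothesis uv : forall x, s <= Rabs (sin x) -> u x = 0 \/ v x = 0.

(* The gaps between zeros of u and v overlap only near the zeros of sin, so their lengths add up to at most 2 PI + O(s). *)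
Lemma gap_pair : exists L1 L2, 0 <= L1 /\ 0 <= L2 /\
  ((zero_windows u L1 /\ zero_windows v L2 /\ L1 + L2 <= 2 * PI + 32 * s) \/
   (zero_windows u L1 /\ L1 <= 16 * s) \/ (zero_windows v L2 /\ L2 <= 16 * s)).
Proof.
have pi0 := PI_RGT_0. have pi3 : 3 < PI by have := PI2_3_2; lra.
set d := 4 * s. have d0 : 0 < d by rewrite /d; lra.
have gs x := good_shift s s0 ltac:(lra) x.
case: (classic (exists x, u x = 0)) => [[x0 ux0]|Nu]; last first.
  exists 0, d. split; first lra. split; first lra. right; right. split; last by rewrite /d; lra.
  move=> x. case: (gs x) => H; [exists x | exists (x + d)]; (split; first by rewrite /d; lra).
  - case: (uv _ H) => // E. case: Nu. by exists x.
  - case: (uv _ H) => // E. case: Nu. by exists (x + d).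
case: (classic (exists x, v x = 0)) => [[y0 vy0]|Nv]; last first.
  exists d, 0. split; first lra. split; first lra. right; left. split; last by rewrite /d; lra.
  move=> x. case: (gs x) => H; [exists x | exists (x + d)]; (split; first by rewrite /d; lra).
  - case: (uv _ H) => // E. case: Nv. by exists x.
  - case: (uv _ H) => // E. case: Nv. by exists (x + d).
have W2 : zero_windows u (2 * PI) by apply: (zero_windows_2pi u x0).
have V2 : zero_windows v (2 * PI) by apply: (zero_windows_2pi v y0).
(* Only multiples of d are considered, so that a least admissible one exists. Just below it there is
   an interval of length (n - 1) d free of zeros of u, on which v vanishes wherever |sin| >= s. *)
have [n [Wn Nn]] : exists n, zero_windows u (INR n * d) /\ (forall m, (m < n)%nat -> ~ zero_windows u (INR m * d)).
  have [N HN] : exists N, zero_windows u (INR N * d).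
    have [N HN] := nfloor_ex (2 * PI / d) ltac:(left; apply: Rdiv_lt_0_compat; lra).
    exists (S N). apply: zero_windows_mono W2. rewrite S_INR. replace (2 * PI) with (2 * PI / d * d) by (field; lra).
    apply: Rmult_le_compat_r; lra.
  apply: NNPP => C.
  have all m : ~ zero_windows u (INR m * d).
    elim/(well_founded_induction lt_wf): m => m IH W. apply: C. by exists m.
  exact: (all N HN).
case: (Nat.le_gt_cases n 3) => hn.
  exists (INR n * d), 0. split; first by apply: Rmult_le_pos; [exact: pos_INR | lra]. split; first lra.
  right; left; split => //. have := le_INR n 3 hn. rewrite /= /d. nra.
have n1 : INR (n - 1) = INR n - 1 by rewrite minus_INR; [simpl; ring | lia].
have n4 : 4 <= INR n by have := le_INR 4 n hn; simpl; lra.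
have Nw := Nn (n - 1)%nat ltac:(lia).
have [x Hx] : exists x, forall y, x <= y <= x + INR (n - 1) * d -> u y <> 0.
  apply: NNPP => C. apply: Nw => x. apply: NNPP => C'. apply: C. exists x => y Hy E. apply: C'. by exists y.
rewrite n1 in Hx. set j := (INR n - 1) * d in Hx. have jd : 3 * d <= j by rewrite /j; nra.
have j2 : j < 2 * PI.
  apply: Rnot_le_lt => C. have [y [Hy uy]] := W2 x. apply: (Hx y) => //. lra.
(* A window for v has to cross the complement of the interval just found, of length 2 PI - j, up to
   a margin; the two lengths add up to 2 PI + 5 d = 2 PI + 20 s. *)
exists (INR n * d), (2 * PI - j + 4 * d). split; first by apply: Rmult_le_pos; [exact: pos_INR | lra].
split; first lra. left. split => //. split; last by rewrite /j /d; lra.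
move=> y.
(* Translates the interval so that its left end a satisfies a <= y <= a + 2 PI. *)
pose k := (up ((y - x) / (2 * PI)) - 1)%Z.
have [k1 k2] := archimed ((y - x) / (2 * PI)).
have kE : IZR k = IZR (up ((y - x) / (2 * PI))) - 1 by rewrite /k minus_IZR.
set a := x + IZR k * (2 * PI).
have E : (y - x) = (y - x) / (2 * PI) * (2 * PI) by field; lra.
set t := (y - x) / (2 * PI) in k1 k2 kE E.
have ay : a <= y <= a + 2 * PI by rewrite /a kE; nra.
have Hxa b : a <= b <= a + j -> u b <> 0.
  move=> Hb. replace b with ((b - IZR k * (2 * PI)) + IZR k * (2 * PI)) by ring. rewrite (periodic_IZR u uper).
  apply: Hx. rewrite /a in Hb. lra.
have Hxa2 b : a + 2 * PI <= b <= a + 2 * PI + j -> u b <> 0.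
  move=> Hb. replace b with ((b - 2 * PI) + 2 * PI) by ring. rewrite uper. apply: Hxa. lra.
case: (Rle_dec y (a + j - d)) => Y.
- case: (gs y) => H.
  + exists y; split; first lra. case: (uv _ H) => // C. case: (Hxa y) => //; lra.
  + exists (y + d); split; first (rewrite -/d; lra). case: (uv _ H) => // C. case: (Hxa (y + d)) => //; lra.
- case: (gs (a + 2 * PI)) => H.
  + exists (a + 2 * PI); split; first lra. case: (uv _ H) => // C. case: (Hxa2 (a + 2 * PI)) => //; lra.
  + exists (a + 2 * PI + d); split; first (rewrite -/d; lra). case: (uv _ H) => // C. case: (Hxa2 (a + 2 * PI + d)) => //; lra.
Qed.

(** The exponents are PI/a and PI/b with a, b slightly larger than the two window lengths. Their sum
    is at least 4 PI/(a + b), and a + b <= 2 PI + 36 s. When one function has zeros in all windows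
    of length 16 s, the exponents 2 and 0 do. *)
Lemma wirtinger_pair du dv : (forall x, is_derive u x (du x)) -> (forall x, continuous du x) -> (forall x, du (x + 2 * PI) = du x) ->
  (forall x, is_derive v x (dv x)) -> (forall x, continuous dv x) -> (forall x, dv (x + 2 * PI) = dv x) ->
  exists l1 l2, 0 <= l1 /\ 0 <= l2 /\ 2 - 30 * s <= l1 + l2 /\
  l1 * l1 * RInt (fun x => u x * u x) 0 (2 * PI) <= RInt (fun x => du x * du x) 0 (2 * PI) /\
  l2 * l2 * RInt (fun x => v x * v x) 0 (2 * PI) <= RInt (fun x => dv x * dv x) 0 (2 * PI).
Proof.
move=> hu1 hu2 hu3 hv1 hv2 hv3. have pi0 := PI_RGT_0. have pi3 : 3 < PI by have := PI2_3_2; lra.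
have triv (w dw : R -> R) : (forall x, continuous dw x) -> 0 * 0 * RInt (fun x => w x * w x) 0 (2 * PI) <= RInt (fun x => dw x * dw x) 0 (2 * PI).
  move=> h. rewrite !Rmult_0_l. apply: RInt_nonneg; [lra | | move=> x _; nra]. move=> x. by apply: continuous_Rmult.
have [L1 [L2 [l10 [l20 [[W [V LL]]|[[W LL]|[V LL]]]]]]] := gap_pair.
- have i1 : 0 < L1 + 2 * s by lra. have i2 : 0 < L2 + 2 * s by lra.
  exists (PI / (L1 + 2 * s)), (PI / (L2 + 2 * s)).
  split; first by left; apply: Rdiv_lt_0_compat. split; first by left; apply: Rdiv_lt_0_compat.
  have key L : 0 <= L -> (L + s) * (PI / (L + 2 * s)) < PI.
    move=> hL. replace PI with (PI / (L + 2 * s) * (L + 2 * s)) at 2 by (field; lra).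
    rewrite Rmult_comm. apply: Rmult_lt_compat_l; last lra. apply: Rdiv_lt_0_compat; lra.
  split; [|split].
  + set a := L1 + 2 * s in i1 *. set b := L2 + 2 * s in i2 *.
    have ab : a + b <= 2 * PI + 36 * s by rewrite /a /b; lra.
    have : 4 * PI / (a + b) <= PI / a + PI / b.
      apply: (Rmult_le_reg_r (a * b * (a + b))); first by apply: Rmult_lt_0_compat; [exact: Rmult_lt_0_compat | lra].
      replace (4 * PI / (a + b) * (a * b * (a + b))) with (PI * (4 * (a * b))) by (field; lra).
      replace ((PI / a + PI / b) * (a * b * (a + b))) with (PI * ((a + b) * (a + b))) by (field; lra).
      apply: Rmult_le_compat_l; [lra | have := pow2_ge_0 (a - b); nra].
    have : 2 - 30 * s <= 4 * PI / (a + b).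
      apply: (Rmult_le_reg_r (a + b)); first lra. rewrite /Rdiv Rmult_assoc Rinv_l; last lra. rewrite Rmult_1_r.
      apply: (Rle_trans _ ((2 - 30 * s) * (2 * PI + 36 * s))); first by apply: Rmult_le_compat_l; lra. nra.
    lra.
  + apply: (wirtinger_periodic u du hu1 hu2 uper hu3 _ L1 s) => //; [by left; apply: Rdiv_lt_0_compat | exact: key].
  + apply: (wirtinger_periodic v dv hv1 hv2 vper hv3 _ L2 s) => //; [by left; apply: Rdiv_lt_0_compat | exact: key].
- exists 2, 0. split; first lra. split; first lra. split; first lra. split; last exact: triv.
  apply: (wirtinger_periodic u du hu1 hu2 uper hu3 2 L1 1) => //; lra.
- exists 0, 2. split; first lra. split; first lra. split; first lra. split; first exact: triv.
  apply: (wirtinger_periodic v dv hv1 hv2 vper hv3 2 L2 1) => //; lra.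
Qed.
End Gap2.


(** * Carleman's lemma *)

(* [chi (|f|^2)] is a subharmonic function of class C^2 that vanishes where [|f| <= 1] and is at most of the order of ln |f|. *)
Definition kap (x : R) := let s := ln (1 + x) in s - atan s.
Definition kap1 (x : R) := let s := ln (1 + x) in s * s / (1 + s * s) / (1 + x).
Definition kap2 (x : R) := let s := ln (1 + x) in
  (2 * s / ((1 + s * s) * (1 + s * s)) - s * s / (1 + s * s)) / ((1 + x) * (1 + x)).

Lemma kap_derive x : -1 < x -> is_derive kap x (kap1 x).
Proof.
move=> Hx. rewrite /kap /kap1. auto_derive; first lra.
set s := ln (1 + x). have : 0 < 1 + s * s by nra. rewrite /Rsqr /= => h. field. split; nra.
Qed.

Lemma kap1_derive x : -1 < x -> is_derive kap1 x (kap2 x).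
Proof.
move=> Hx. rewrite /kap1 /kap2. auto_derive.
  have h : 0 < 1 + ln (1 + x) * ln (1 + x) by nra. repeat split; lra.
set s := ln (1 + x). have : 0 < 1 + s * s by nra. move=> h. field. split; nra.
Qed.

Definition pos1 (r : R) := Rmax 0 (r - 1).

Lemma pos1_ge0 r : 0 <= pos1 r. Proof. exact: Rmax_l. Qed.

(** At r = 1 the constant branch and the branch K(r - 1) fit together because K'(0) = 0. *)
Lemma pos1_derive (K K' : R -> R) r : (forall x, -1 < x -> is_derive K x (K' x)) -> K' 0 = 0 ->
  is_derive (fun r => K (pos1 r)) r (K' (pos1 r)).
Proof.
move=> HK K0. case: (Rtotal_order r 1) => [H|[->|H]].
- have -> : pos1 r = 0 by rewrite /pos1 Rmax_left; lra. rewrite K0.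
  apply: (is_derive_ext_loc (fun _ => K 0)); last by exact: is_derive_const.
  exists (mkposreal (1 - r) ltac:(lra)) => y Hy. rewrite /pos1 Rmax_left //.
  have [h1 h2] := Rabs_def2 _ _ Hy. rewrite /minus /plus /opp /= in h1. lra.
- have -> : pos1 1 = 0 by rewrite /pos1 Rmax_left; lra. rewrite K0.
  apply/is_derive_Reals => e e0.
  have /is_derive_Reals := HK 0 ltac:(lra). rewrite K0 => /(_ e e0) [d Kd].
  exists d => h h0 Hh. have -> : pos1 1 = 0 by rewrite /pos1 Rmax_left; lra.
  case: (Rle_dec 0 h) => hh.
  + have -> : pos1 (1 + h) = 0 + h by rewrite /pos1 Rmax_right; lra. exact: Kd.
  + have -> : pos1 (1 + h) = 0 by rewrite /pos1 Rmax_left; lra.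
    replace ((K 0 - K 0) / h - 0) with 0 by (field; lra). by rewrite Rabs_R0.
- have E : pos1 r = r - 1 by rewrite /pos1 Rmax_right; lra.
  apply: (is_derive_ext_loc (fun r => K (r - 1))).
    exists (mkposreal (r - 1) ltac:(lra)) => y Hy. rewrite /pos1 Rmax_right //.
    have [h1 h2] := Rabs_def2 _ _ Hy. rewrite /minus /plus /opp /= in h2. lra.
  rewrite E. have := HK (r - 1) ltac:(lra) => D.
  have := is_derive_comp K (fun r => r - 1) r _ 1 D.
  rewrite /scal /= /mult /= Rmult_1_l. apply. auto_derive => //; lra.
Qed.

Definition chi r := kap (pos1 r).
Definition chi1 r := kap1 (pos1 r).
Definition chi2 r := kap2 (pos1 r).

Lemma chi_derive r : is_derive chi r (chi1 r).
Proof. apply: pos1_derive; first exact: kap_derive. rewrite /kap1 Rplus_0_r ln_1. field. Qed.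
Lemma chi1_derive r : is_derive chi1 r (chi2 r).
Proof. apply: pos1_derive; first exact: kap1_derive. rewrite /kap2 Rplus_0_r ln_1. field. Qed.

Lemma pos1_continuous r : continuous pos1 r.
Proof.
apply/continuity_pt_filterlim. apply: (continuity_pt_ext (fun r => (r - 1 + Rabs (r - 1)) / 2)).
  move=> x. rewrite /pos1 /Rmax. case: Rle_dec => h; [rewrite Rabs_pos_eq | rewrite Rabs_left]; lra.
apply/continuity_pt_filterlim.
have c1 : continuous (fun r => r - 1) r by apply: continuous_Rminus; [exact: continuous_id | exact: continuous_const].
apply: continuous_Rmult; last exact: continuous_const. apply: continuous_Rplus => //.
apply: continuous_comp => //. exact: continuous_Rabs.
Qed.

Lemma chi2_continuous r : continuous chi2 r.
Proof.
apply: (continuous_comp pos1 kap2); first exact: pos1_continuous.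
apply: (@ex_derive_continuous R_AbsRing R_NormedModule). rewrite /kap2. auto_derive.
have := pos1_ge0 r => p. have h : 0 < 1 + ln (1 + pos1 r) * ln (1 + pos1 r) by nra.
have h2 : 0 < (1 + ln (1 + pos1 r) * ln (1 + pos1 r)) * (1 + ln (1 + pos1 r) * ln (1 + pos1 r)) by nra.
have h3 : 0 < (1 + pos1 r) * (1 + pos1 r) by nra.
repeat split; lra.
Qed.
Lemma chi1_continuous r : continuous chi1 r.
Proof. apply: (@ex_derive_continuous R_AbsRing R_NormedModule). eexists. exact: chi1_derive. Qed.
Lemma chi_continuous r : continuous chi r.
Proof. apply: (@ex_derive_continuous R_AbsRing R_NormedModule). eexists. exact: chi_derive. Qed.

Lemma atan_le x : 0 <= x -> atan x <= x.
Proof.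
move=> x0. case: (Req_dec x 0) => [->|xn]; first by rewrite atan_0; lra.
have D c : 0 <= c <= x -> derivable_pt_lim atan c (/ (1 + c * c)).
  move=> _. apply/is_derive_Reals. exact: is_derive_atan.
have [c [Hc [h1 h2]]] := MVT_cor2 atan (fun c => / (1 + c * c)) 0 x ltac:(lra) D.
move: Hc. rewrite atan_0 !Rminus_0_r => ->.
have : / (1 + c * c) <= 1 by rewrite -Rinv_1; apply: Rinv_le_contravar; nra.
nra.
Qed.

Lemma ln1_ge0 x : 0 <= x -> 0 <= ln (1 + x).
Proof. move=> x0. rewrite -ln_1. apply: ln_le; lra. Qed.

Lemma chi_ge0 r : 0 <= chi r.
Proof. rewrite /chi /kap. have := atan_le _ (ln1_ge0 _ (pos1_ge0 r)). lra. Qed.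

Lemma chi_small r : r <= 1 -> chi r = 0.
Proof. move=> h. rewrite /chi /kap. have -> : pos1 r = 0 by rewrite /pos1 Rmax_left; lra. rewrite Rplus_0_r ln_1 atan_0. ring. Qed.

Lemma atan_ge0 x : 0 <= x -> 0 <= atan x.
Proof. move=> [h|<-]; [rewrite -atan_0; left; exact: atan_increasing | rewrite atan_0; lra]. Qed.

Lemma chi_le r : chi r <= ln (1 + pos1 r).
Proof. rewrite /chi /kap. have := atan_ge0 _ (ln1_ge0 _ (pos1_ge0 r)). lra. Qed.

Lemma chi_ge r : ln (1 + pos1 r) - 2 <= chi r.
Proof. rewrite /chi /kap. have := atan_bound (ln (1 + pos1 r)). have := PI_4. lra. Qed.

(** The expression is the derivative of r chi'(r). For r > 1 and s = ln r, this product is s^2/(1 +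
    s^2), which increases with s; this dictates the form of [kap1]. *)
Lemma chi_convex r : 0 <= r -> 0 <= r * chi2 r + chi1 r.
Proof.
move=> r0. rewrite /chi2 /chi1. case: (Rle_dec r 1) => h.
  have -> : pos1 r = 0 by rewrite /pos1 Rmax_left; lra. rewrite /kap1 /kap2 Rplus_0_r ln_1.
  right. field.
have -> : pos1 r = r - 1 by rewrite /pos1 Rmax_right; lra. rewrite /kap1 /kap2.
have -> : 1 + (r - 1) = r by ring.
have s0 : 0 <= ln r by rewrite -ln_1; apply: ln_le; lra.
set s := ln r in s0 *. have p : 0 < 1 + s * s by nra.
have -> : r * ((2 * s / ((1 + s * s) * (1 + s * s)) - s * s / (1 + s * s)) / (r * r)) + s * s / (1 + s * s) / r = 2 * s / ((1 + s * s) * (1 + s * s)) / r by field; split; lra.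
apply: Rmult_le_pos; last by left; apply: Rinv_0_lt_compat; lra.
apply: Rmult_le_pos; first lra. left; apply: Rinv_0_lt_compat; nra.
Qed.

(** * Integrals over circles in logarithmic coordinates *)

Definition log_polar (t h : R) : C := cexp (t, h).

Lemma fst_derive (g : R -> C) t l : is_rder g t l -> is_derive (fun s => fst (g s)) t (fst l) /\ is_derive (fun s => snd (g s)) t (snd l).
Proof.
move=> H. split; apply/is_derive_Reals => e e0; have [d [d0 K]] := H (e/2) ltac:(lra); exists (mkposreal d d0) => h h0 /= Hh;
 have := K h Hh; [have := Cmod_fst (g (t + h)%R - g t - h * l)%C | have := Cmod_snd (g (t + h)%R - g t - h * l)%C]; simpl.
- move=> h1 h2. replace ((fst (g (t + h)) - fst (g t)) / h - fst l) with ((fst (g (t + h)) + - fst (g t) + - (h * fst l - 0 * snd l)) / h) by (field; auto).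
  rewrite Rabs_div //. have hp := Rabs_pos_lt h h0. apply: (Rmult_lt_reg_r (Rabs h)) => //. rewrite /Rdiv Rmult_assoc Rinv_l; last lra. nra.
- move=> h1 h2. replace ((snd (g (t + h)) - snd (g t)) / h - snd l) with ((snd (g (t + h)) + - snd (g t) + - (h * snd l + 0 * fst l)) / h) by (field; auto).
  rewrite Rabs_div //. have hp := Rabs_pos_lt h h0. apply: (Rmult_lt_reg_r (Rabs h)) => //. rewrite /Rdiv Rmult_assoc Rinv_l; last lra. nra.
Qed.

Definition contC (phi : C -> R) := forall z : C, @continuous (prod_UniformSpace R_UniformSpace R_UniformSpace) R_UniformSpace phi z.

Lemma ball_C (z w : C) (d : posreal) : @ball (prod_UniformSpace R_UniformSpace R_UniformSpace) z d w -> Cmod (w - z)%C < 2 * d.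
Proof.
move=> [h1 h2]. apply: Rle_lt_trans (Cmod_le_sum _) _.
have q1 : Rabs (fst (w - z)%C) < d by exact: h1. have q2 : Rabs (snd (w - z)%C) < d by exact: h2. lra.
Qed.

Lemma ccont_contC f : (forall z, ccont f z) -> contC (fun z => fst (f z)) /\ contC (fun z => snd (f z)).
Proof.
move=> H; split=> z P [e He]; have [d [d0 K]] := H z e (cond_pos e);
  exists (mkposreal (d/2) (is_pos_div_2 (mkposreal d d0))) => w Hw; apply: He;
  have hw := ball_C _ _ _ Hw; rewrite /= in hw; have q := K w ltac:(lra).
- change (Rabs (fst (f w - f z)%C) < e). exact: Rle_lt_trans (Cmod_fst _) q.
- change (Rabs (snd (f w - f z)%C) < e). exact: Rle_lt_trans (Cmod_snd _) q.
Qed.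

Lemma contC_mult f g : contC f -> contC g -> contC (fun z => f z * g z).
Proof. move=> Hf Hg z. apply: (@continuous_mult (prod_UniformSpace R_UniformSpace R_UniformSpace) R_AbsRing); [exact: Hf | exact: Hg]. Qed.
Lemma contC_plus f g : contC f -> contC g -> contC (fun z => f z + g z).
Proof. move=> Hf Hg z. apply: (@continuous_plus (prod_UniformSpace R_UniformSpace R_UniformSpace) R_AbsRing R_NormedModule); [exact: Hf | exact: Hg]. Qed.
Lemma contC_minus f g : contC f -> contC g -> contC (fun z => f z - g z).
Proof. move=> Hf Hg z. apply: (@continuous_minus (prod_UniformSpace R_UniformSpace R_UniformSpace) R_AbsRing R_NormedModule); [exact: Hf | exact: Hg]. Qed.
Lemma contC_const c : contC (fun _ => c).
Proof. move=> z. exact: continuous_const. Qed.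
Lemma contC_comp (k : R -> R) f : (forall x, continuous k x) -> contC f -> contC (fun z => k (f z)).
Proof. move=> Hk Hf z. apply: (@continuous_comp (prod_UniformSpace R_UniformSpace R_UniformSpace) R_UniformSpace R_UniformSpace f k); [exact: Hf | exact: Hk]. Qed.

Ltac contC_tac := repeat match goal with
  | |- contC (fun _ => ?c) => exact: (contC_const c)
  | |- contC (fun y => Rmult (@?f y) (@?g y)) => refine (contC_mult f g _ _)
  | |- contC (fun y => Rplus (@?f y) (@?g y)) => refine (contC_plus f g _ _)
  | |- contC (fun y => Rminus (@?f y) (@?g y)) => refine (contC_minus f g _ _)
  end.

Lemma contC_Pt g : contC g -> forall t h, continuity_2d_pt (fun t h => g (log_polar t h)) t h.
Proof.
move=> Hg t h. apply/continuity_2d_pt_filterlim.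
have [p1 p2] := ccont_contC cexp (fun z => holo_cont _ _ (holo_cexp z)).
apply: (@continuous_comp_2 (prod_UniformSpace R_UniformSpace R_UniformSpace) R_UniformSpace R_UniformSpace R_UniformSpace
   (fun z => fst (cexp z)) (fun z => snd (cexp z)) (fun x y => g (x, y)) (t, h)).
- exact: p1.
- exact: p2.
- move: (Hg (cexp (t, h))). case: (cexp (t, h)) => p q /= H.
  apply: (continuous_ext g) => [[x y]|]; [by [] | exact: H].
Qed.

Lemma contC_h g t h : contC g -> continuous (fun h => g (log_polar t h)) h.
Proof.
move=> Hg. have := contC_Pt g Hg t h. move/continuity_2d_pt_filterlim => H.
apply: (@continuous_comp_2 R_UniformSpace R_UniformSpace R_UniformSpace R_UniformSpace (fun _ => t) (fun h => h) (fun t h => g (log_polar t h)) h); [exact: continuous_const | exact: continuous_id | exact: H].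
Qed.

Lemma mean_derive g gt : contC g -> contC gt -> (forall t h, is_derive (fun t => g (log_polar t h)) t (gt (log_polar t h))) ->
  forall t, is_derive (fun t => RInt (fun h => g (log_polar t h)) 0 (2 * PI)) t (RInt (fun h => gt (log_polar t h)) 0 (2 * PI)).
Proof.
move=> Hg Hgt D t.
have E s h : Derive (fun s => g (log_polar s h)) s = gt (log_polar s h) by apply: is_derive_unique; exact: D.
have -> : RInt (fun h => gt (log_polar t h)) 0 (2 * PI) = RInt (fun h => Derive (fun s => g (log_polar s h)) t) 0 (2 * PI).
  apply: RInt_ext => x _. by rewrite E.
apply: is_derive_RInt_param.
- apply: filter_forall => s h _. eexists. exact: D.
- move=> h _. apply: (continuity_2d_pt_ext (fun t h => gt (log_polar t h))); first by move=> x y; rewrite E.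
  exact: contC_Pt.
- apply: filter_forall => s. apply: exRc => h. exact: contC_h.
Qed.

(* In the coordinates z = e^(t + i h) the suffixes t and h stand for partial derivatives, cN is [|f|^2] and cu is [chi (|f|^2)]; euler f = z f' is the derivative in t. *)
Section Sub.
Variable f : C -> C.
Hypothesis fe : forall z, holo f z.

Definition euler (g : C -> C) z := (z * cderiv g z)%C.
Let f1 := euler f.
Let f2 := euler f1.

Lemma euler_holo g : (forall z, holo g z) -> forall z, holo (euler g) z.
Proof. move=> H z. apply: holo_mult; first exact: holo_id. apply: (holo_cderiv g z 1); [lra | by move=> w _]. Qed.

Lemma euler_t g t h : (forall z, holo g z) -> is_rder (fun t => g (log_polar t h)) t (euler g (log_polar t h)).
Proof.
move=> H. have := is_rder_comp g (fun t => log_polar t h) t (log_polar t h * 1)%C (cderiv g (log_polar t h)).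
rewrite /euler. replace (cderiv g (log_polar t h) * (log_polar t h * 1))%C with (log_polar t h * cderiv g (log_polar t h))%C by ring.
apply; last by apply: cderiv_correct.
apply: (is_rder_comp cexp (fun t => (t, h))); [exact: is_rder_hor | exact: is_cder_cexp].
Qed.

Lemma euler_h g t h : (forall z, holo g z) -> is_rder (fun h => g (log_polar t h)) h (Ci * euler g (log_polar t h))%C.
Proof.
move=> H. have := is_rder_comp g (fun h => log_polar t h) h (log_polar t h * Ci)%C (cderiv g (log_polar t h)).
rewrite /euler. replace (cderiv g (log_polar t h) * (log_polar t h * Ci))%C with (Ci * (log_polar t h * cderiv g (log_polar t h)))%C by ring.
apply; last by apply: cderiv_correct.
apply: (is_rder_comp cexp (fun h => (t, h))); [exact: is_rder_ver | exact: is_cder_cexp].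
Qed.

Let f1e := euler_holo f fe.
Let f2e := euler_holo f1 f1e.

Let a z := fst (f z). Let b z := snd (f z).
Let a1 z := fst (f1 z). Let b1 z := snd (f1 z).
Let a2 z := fst (f2 z). Let b2 z := snd (f2 z).

Definition cN z := a z * a z + b z * b z.
Definition cNt z := 2 * (a z * a1 z + b z * b1 z).
Definition cNh z := 2 * (b z * a1 z - a z * b1 z).
Definition cNtt z := 2 * (a1 z * a1 z + b1 z * b1 z + a z * a2 z + b z * b2 z).
Definition cNhh z := 2 * (a1 z * a1 z + b1 z * b1 z - a z * a2 z - b z * b2 z).

Lemma ab_t t h : is_derive (fun t => a (log_polar t h)) t (a1 (log_polar t h)) /\ is_derive (fun t => b (log_polar t h)) t (b1 (log_polar t h)).
Proof. exact: (fst_derive _ _ _ (euler_t f t h fe)). Qed.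
Lemma ab1_t t h : is_derive (fun t => a1 (log_polar t h)) t (a2 (log_polar t h)) /\ is_derive (fun t => b1 (log_polar t h)) t (b2 (log_polar t h)).
Proof. exact: (fst_derive _ _ _ (euler_t f1 t h f1e)). Qed.
Lemma ab_h t h : is_derive (fun h => a (log_polar t h)) h (- b1 (log_polar t h)) /\ is_derive (fun h => b (log_polar t h)) h (a1 (log_polar t h)).
Proof.
have [h1 h2] := fst_derive _ _ _ (euler_h f t h fe). rewrite /= in h1 h2. split.
- by replace (- b1 (log_polar t h)) with (0 * fst (euler f (log_polar t h)) - 1 * snd (euler f (log_polar t h))) by (rewrite /b1 /f1; ring).
- by replace (a1 (log_polar t h)) with (0 * snd (euler f (log_polar t h)) + 1 * fst (euler f (log_polar t h))) by (rewrite /a1 /f1; ring).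
Qed.
Lemma ab1_h t h : is_derive (fun h => a1 (log_polar t h)) h (- b2 (log_polar t h)) /\ is_derive (fun h => b1 (log_polar t h)) h (a2 (log_polar t h)).
Proof.
have [h1 h2] := fst_derive _ _ _ (euler_h f1 t h f1e). rewrite /= in h1 h2. split.
- by replace (- b2 (log_polar t h)) with (0 * fst (euler f1 (log_polar t h)) - 1 * snd (euler f1 (log_polar t h))) by (rewrite /b2 /f2; ring).
- by replace (a2 (log_polar t h)) with (0 * snd (euler f1 (log_polar t h)) + 1 * fst (euler f1 (log_polar t h))) by (rewrite /a2 /f2; ring).
Qed.

Lemma der_mul (p q : R -> R) x p' q' : is_derive p x p' -> is_derive q x q' -> is_derive (fun x => p x * q x) x (p' * q x + p x * q').
Proof. move=> H1 H2. have := is_derive_mult p q x p' q' H1 H2 Rmult_comm. by []. Qed.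
Lemma der_add (p q : R -> R) x p' q' : is_derive p x p' -> is_derive q x q' -> is_derive (fun x => p x + q x) x (p' + q').
Proof. exact: (@is_derive_plus R_AbsRing R_NormedModule). Qed.
Lemma der_sub (p q : R -> R) x p' q' : is_derive p x p' -> is_derive q x q' -> is_derive (fun x => p x - q x) x (p' - q').
Proof. exact: (@is_derive_minus R_AbsRing R_NormedModule). Qed.
Lemma der_cst c (p : R -> R) x p' : is_derive p x p' -> is_derive (fun x => c * p x) x (c * p').
Proof. exact: (@is_derive_scal p x c p'). Qed.
Lemma der_comp (k p : R -> R) x k' p' : is_derive p x p' -> is_derive k (p x) k' -> is_derive (fun x => k (p x)) x (k' * p').
Proof. move=> H1 H2. rewrite Rmult_comm. exact: (is_derive_comp k p x k' p' H2 H1). Qed.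
Lemma der_eq (p : R -> R) (x d d' : R) : is_derive p x d -> d = d' -> is_derive p x d'. Proof. by move=> H <-. Qed.

Lemma cN_t t h : is_derive (fun t => cN (log_polar t h)) t (cNt (log_polar t h)).
Proof. have [h1 h2] := ab_t t h. refine (der_eq _ _ _ _ (der_add _ _ _ _ _ (der_mul _ _ _ _ _ h1 h1) (der_mul _ _ _ _ _ h2 h2)) _). rewrite /cNt. ring. Qed.
Lemma cN_h t h : is_derive (fun h => cN (log_polar t h)) h (cNh (log_polar t h)).
Proof. have [h1 h2] := ab_h t h. refine (der_eq _ _ _ _ (der_add _ _ _ _ _ (der_mul _ _ _ _ _ h1 h1) (der_mul _ _ _ _ _ h2 h2)) _). rewrite /cNh. ring. Qed.
Lemma cNt_t t h : is_derive (fun t => cNt (log_polar t h)) t (cNtt (log_polar t h)).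
Proof. have [h1 h2] := ab_t t h. have [h3 h4] := ab1_t t h. refine (der_eq _ _ _ _ (der_cst 2 _ _ _ (der_add _ _ _ _ _ (der_mul _ _ _ _ _ h1 h3) (der_mul _ _ _ _ _ h2 h4))) _). rewrite /cNtt. ring. Qed.
Lemma cNh_h t h : is_derive (fun h => cNh (log_polar t h)) h (cNhh (log_polar t h)).
Proof. have [h1 h2] := ab_h t h. have [h3 h4] := ab1_h t h. refine (der_eq _ _ _ _ (der_cst 2 _ _ _ (der_sub _ _ _ _ _ (der_mul _ _ _ _ _ h2 h3) (der_mul _ _ _ _ _ h1 h4))) _). rewrite /cNhh. ring. Qed.

Definition cu z := chi (cN z).
Definition cut z := chi1 (cN z) * cNt z.
Definition cuh z := chi1 (cN z) * cNh z.
Definition cutt z := chi2 (cN z) * (cNt z * cNt z) + chi1 (cN z) * cNtt z.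
Definition cuhh z := chi2 (cN z) * (cNh z * cNh z) + chi1 (cN z) * cNhh z.

Lemma cu_t t h : is_derive (fun t => cu (log_polar t h)) t (cut (log_polar t h)).
Proof. exact: (der_comp chi _ _ _ _ (cN_t t h) (chi_derive _)). Qed.
Lemma cu_h t h : is_derive (fun h => cu (log_polar t h)) h (cuh (log_polar t h)).
Proof. exact: (der_comp chi _ _ _ _ (cN_h t h) (chi_derive _)). Qed.
Lemma cut_t t h : is_derive (fun t => cut (log_polar t h)) t (cutt (log_polar t h)).
Proof. refine (der_eq _ _ _ _ (der_mul _ _ _ _ _ (der_comp chi1 _ _ _ _ (cN_t t h) (chi1_derive _)) (cNt_t t h)) _). rewrite /cutt. ring. Qed.
Lemma cuh_h t h : is_derive (fun h => cuh (log_polar t h)) h (cuhh (log_polar t h)).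
Proof. refine (der_eq _ _ _ _ (der_mul _ _ _ _ _ (der_comp chi1 _ _ _ _ (cN_h t h) (chi1_derive _)) (cNh_h t h)) _). rewrite /cuhh. ring. Qed.

(** In the Laplacian of chi(|f|^2) the terms with the second derivative of f cancel, and 4 |z f'|^2
    (N chi''(N) + chi'(N)) with N = |f|^2 is left. *)
Lemma subharmonic z : 0 <= cutt z + cuhh z.
Proof.
have -> : cutt z + cuhh z = 4 * (a1 z * a1 z + b1 z * b1 z) * (cN z * chi2 (cN z) + chi1 (cN z)).
  rewrite /cutt /cuhh. move: (chi1 (cN z)) (chi2 (cN z)) => c1 c2. rewrite /cNt /cNh /cNtt /cNhh /cN. ring.
apply: Rmult_le_pos; first nra. apply: chi_convex. rewrite /cN; nra.
Qed.

Lemma aC : contC a. Proof. exact: (proj1 (ccont_contC f (fun z => holo_cont _ _ (fe z)))). Qed.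
Lemma bC : contC b. Proof. exact: (proj2 (ccont_contC f (fun z => holo_cont _ _ (fe z)))). Qed.
Lemma a1C : contC a1. Proof. exact: (proj1 (ccont_contC f1 (fun z => holo_cont _ _ (f1e z)))). Qed.
Lemma b1C : contC b1. Proof. exact: (proj2 (ccont_contC f1 (fun z => holo_cont _ _ (f1e z)))). Qed.
Lemma a2C : contC a2. Proof. exact: (proj1 (ccont_contC f2 (fun z => holo_cont _ _ (f2e z)))). Qed.
Lemma b2C : contC b2. Proof. exact: (proj2 (ccont_contC f2 (fun z => holo_cont _ _ (f2e z)))). Qed.

Lemma cNC : contC cN. Proof. rewrite /cN; contC_tac; first [exact: aC | exact: bC]. Qed.
Lemma cNtC : contC cNt. Proof. rewrite /cNt; contC_tac; first [exact: aC | exact: bC | exact: a1C | exact: b1C]. Qed.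
Lemma cNhC : contC cNh. Proof. rewrite /cNh; contC_tac; first [exact: aC | exact: bC | exact: a1C | exact: b1C]. Qed.
Lemma cNttC : contC cNtt. Proof. rewrite /cNtt; contC_tac; first [exact: aC | exact: bC | exact: a1C | exact: b1C | exact: a2C | exact: b2C]. Qed.
Lemma cNhhC : contC cNhh. Proof. rewrite /cNhh; contC_tac; first [exact: aC | exact: bC | exact: a1C | exact: b1C | exact: a2C | exact: b2C]. Qed.
Lemma cuC : contC cu. Proof. apply: (contC_comp chi); [exact: chi_continuous | exact: cNC]. Qed.
Lemma c1C : contC (fun z => chi1 (cN z)). Proof. apply: (contC_comp chi1); [exact: chi1_continuous | exact: cNC]. Qed.
Lemma c2C : contC (fun z => chi2 (cN z)). Proof. apply: (contC_comp chi2); [exact: chi2_continuous | exact: cNC]. Qed.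
Lemma cutC : contC cut. Proof. apply: contC_mult; [exact: c1C | exact: cNtC]. Qed.
Lemma cuhC : contC cuh. Proof. apply: contC_mult; [exact: c1C | exact: cNhC]. Qed.
Lemma cuttC : contC cutt. Proof. rewrite /cutt; contC_tac; first [exact: c1C | exact: c2C | exact: cNtC | exact: cNttC]. Qed.
Lemma cuhhC : contC cuhh. Proof. rewrite /cuhh; contC_tac; first [exact: c1C | exact: c2C | exact: cNhC | exact: cNhhC]. Qed.

Definition circle_int (g : C -> R) t := RInt (fun h => g (log_polar t h)) 0 (2 * PI).

Lemma circle_int_le g1 g2 t : contC g1 -> contC g2 -> (forall h, g1 (log_polar t h) <= g2 (log_polar t h)) -> circle_int g1 t <= circle_int g2 t.
Proof.
move=> h1 h2 H. apply: RInt_le; [have := PI_RGT_0; lra | by apply: exRc => x; exact: contC_h | by apply: exRc => x; exact: contC_h | by move=> x _; exact: H].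
Qed.

Lemma circle_int_plus g1 g2 t : contC g1 -> contC g2 -> circle_int (fun z => g1 z + g2 z) t = circle_int g1 t + circle_int g2 t.
Proof. move=> h1 h2. apply: (@RInt_plus R_CompleteNormedModule); apply: exRc => x; exact: contC_h. Qed.

Lemma circle_int_scal c g t : contC g -> circle_int (fun z => c * g z) t = c * circle_int g t.
Proof. move=> h1. apply: (@RInt_scal R_CompleteNormedModule). apply: exRc => x; exact: contC_h. Qed.

Definition circle_uut t := circle_int (fun z => cu z * cut z) t.
Definition circle_uut' t := circle_int (fun z => cut z * cut z + cu z * cutt z) t.

Lemma log_polar_periodic t h : log_polar t (h + 2 * PI) = log_polar t h.
Proof. by rewrite /log_polar /cexp /= cis_2PI. Qed.

Lemma circle_uut_derive t : is_derive circle_uut t (circle_uut' t).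
Proof.
apply: (mean_derive (fun z => cu z * cut z) (fun z => cut z * cut z + cu z * cutt z)).
- contC_tac; [exact: cuC | exact: cutC].
- contC_tac; first [exact: cuC | exact: cutC | exact: cuttC].
- move=> s h. exact: (der_mul _ _ _ _ _ (cu_t s h) (cut_t s h)).
Qed.

Lemma angular_parts t : circle_int (fun z => cuh z * cuh z + cu z * cuhh z) t = 0.
Proof.
have I : is_RInt (fun h => cuh (log_polar t h) * cuh (log_polar t h) + cu (log_polar t h) * cuhh (log_polar t h)) 0 (2 * PI)
   (minus (cu (log_polar t (2 * PI)) * cuh (log_polar t (2 * PI))) (cu (log_polar t 0) * cuh (log_polar t 0))).
  apply: (is_RInt_derive (fun h => cu (log_polar t h) * cuh (log_polar t h))) => h _.
  - exact: (der_mul _ _ _ _ _ (cu_h t h) (cuh_h t h)).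
  - apply: (contC_h (fun z => cuh z * cuh z + cu z * cuhh z)). contC_tac; first [exact: cuC | exact: cuhC | exact: cuhhC].
rewrite /circle_int (is_RInt_unique _ _ _ _ I).
have -> : log_polar t (2 * PI) = log_polar t 0 by rewrite -{1}(Rplus_0_l (2 * PI)) log_polar_periodic.
by rewrite minus_eq_zero.
Qed.

(** By subharmonicity u u_tt >= -u u_hh, and integration by parts over a period turns the integral
    of -u u_hh into that of u_h^2. *)
Lemma circle_uut'_lower t : circle_int (fun z => cut z * cut z + cuh z * cuh z) t <= circle_uut' t.
Proof.
have C1 : contC (fun z => cut z * cut z) by contC_tac; exact: cutC.
have C2 : contC (fun z => cuh z * cuh z) by contC_tac; exact: cuhC.
have C3 : contC (fun z => cu z * cutt z) by contC_tac; [exact: cuC | exact: cuttC].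
have C4 : contC (fun z => cu z * cuhh z) by contC_tac; [exact: cuC | exact: cuhhC].
have := angular_parts t. rewrite circle_int_plus // => E.
rewrite /circle_uut' !circle_int_plus //.
have : 0 <= circle_int (fun z => cu z * cutt z + cu z * cuhh z) t.
  have <- : circle_int (fun _ => 0) t = 0 by rewrite /circle_int RInt_const /scal /= /mult /= Rmult_0_r.
  apply: circle_int_le; [exact: contC_const | by apply: contC_plus |].
  move=> h. have := subharmonic (log_polar t h). have := chi_ge0 (cN (log_polar t h)). rewrite -/(cu (log_polar t h)). nra.
rewrite circle_int_plus //. lra.
Qed.

(** The hypothesis replaces u_h^2 by l^2 u^2 under the integral, and u_t^2 + l^2 u^2 >= 2 l u
    u_t. *)
Lemma circle_uut'_lambda t l : 0 <= l ->
  l * l * circle_int (fun z => cu z * cu z) t <= circle_int (fun z => cuh z * cuh z) t -> 2 * l * circle_uut t <= circle_uut' t.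
Proof.
move=> l0 H.
have C1 : contC (fun z => cut z * cut z) by contC_tac; exact: cutC.
have C2 : contC (fun z => cuh z * cuh z) by contC_tac; exact: cuhC.
have C3 : contC (fun z => cu z * cu z) by contC_tac; exact: cuC.
have C4 : contC (fun z => cu z * cut z) by contC_tac; [exact: cuC | exact: cutC].
apply: Rle_trans (circle_uut'_lower t). rewrite circle_int_plus //.
have : circle_int (fun z => 2 * l * (cu z * cut z)) t <= circle_int (fun z => cut z * cut z + l * l * (cu z * cu z)) t.
  apply: circle_int_le; [by contC_tac; first [exact: cuC | exact: cutC] | by contC_tac; first [exact: cuC | exact: cutC] |].
  move=> h. have := pow2_ge_0 (cut (log_polar t h) - l * cu (log_polar t h)). nra.
rewrite circle_int_scal // circle_int_plus //; last by contC_tac; exact: cuC.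
rewrite circle_int_scal // /circle_uut. lra.
Qed.

Lemma circle_uut'_ge0 t : 0 <= circle_uut' t.
Proof.
apply: Rle_trans (circle_uut'_lower t).
have <- : circle_int (fun _ => 0) t = 0 by rewrite /circle_int RInt_const /scal /= /mult /= Rmult_0_r.
apply: circle_int_le; [exact: contC_const | by contC_tac; first [exact: cutC | exact: cuhC] |].
move=> h. nra.
Qed.

Lemma circle_uut_mono s t : s <= t -> circle_uut s <= circle_uut t.
Proof.
move=> [st|->]; last lra.
have [c [E _]] := MVT_cor2 circle_uut circle_uut' s t st (fun c _ => proj1 (is_derive_Reals circle_uut c (circle_uut' c)) (circle_uut_derive c)).
have := circle_uut'_ge0 c. nra.
Qed.

Lemma log_polar_small d : 0 < d -> exists T, forall t h, t <= T -> Cmod (log_polar t h) < d.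
Proof.
move=> d0. exists (ln (d / 2)) => t h Ht. rewrite /log_polar Cmod_cexp /=.
apply: (Rle_lt_trans _ (exp (ln (d / 2)))); last by rewrite exp_ln; lra.
case: Ht => [H|->]; [left; exact: exp_increasing | lra].
Qed.

Lemma contC_0 g e : contC g -> 0 < e -> exists d, 0 < d /\ forall z, Cmod z < d -> Rabs (g z - g 0%C) < e.
Proof.
move=> Hg e0. have := Hg 0%C (fun y => Rabs (y - g 0%C) < e).
case; first by exists (mkposreal e e0) => y Hy; exact: Hy.
move=> d Hd. exists d; split; first exact: cond_pos. move=> z Hz. apply: Hd.
have h1 := Cmod_fst z. have h2 := Cmod_snd z.
split; rewrite /ball /= /AbsRing_ball /abs /minus /plus /opp /=; rewrite Ropp_0 Rplus_0_r; lra.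
Qed.

Lemma cut_0 : cut 0%C = 0.
Proof. rewrite /cut /cNt /a1 /b1 /f1 /euler /=. ring. Qed.

(** The integral increases with t, and it tends to 0 as the circle shrinks to the origin, where u_t
    vanishes. *)
Lemma circle_uut_ge0 t : 0 <= circle_uut t.
Proof.
apply: Rnot_lt_le => Hn. have pi0 := PI_RGT_0.
have C4 : contC (fun z => cu z * cut z) by contC_tac; [exact: cuC | exact: cutC].
have [d [d0 K]] := contC_0 _ (- circle_uut t / (4 * PI)) C4 ltac:(apply: Rdiv_lt_0_compat; lra).
have [T HT] := log_polar_small d d0.
set s := Rmin t T. have st : s <= t by exact: Rmin_l. have sT : s <= T by exact: Rmin_r.
have := circle_uut_mono s t st.
have : circle_int (fun _ => - (- circle_uut t / (4 * PI))) s <= circle_uut s.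
  apply: circle_int_le => //; first exact: contC_const. move=> h. have := K (log_polar s h) (HT s h sT).
  rewrite cut_0 Rmult_0_r Rminus_0_r => H. have [h1 h2] := Rabs_def2 _ _ H. lra.
rewrite /circle_int RInt_const /scal /= /mult /=.
replace ((2 * PI - 0) * - (- circle_uut t / (4 * PI))) with (circle_uut t / 2) by (field; lra). lra.
Qed.

Definition circle_uu t := circle_int (fun z => cu z * cu z) t.
Lemma circle_uu_derive t : is_derive circle_uu t (2 * circle_uut t).
Proof.
have C4 : contC (fun z => cu z * cut z) by contC_tac; [exact: cuC | exact: cutC].
rewrite /circle_uut -circle_int_scal //.
apply: (mean_derive (fun z => cu z * cu z) (fun z => 2 * (cu z * cut z))).
- contC_tac; exact: cuC.
- contC_tac; [exact: cuC | exact: cutC].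
- move=> s h. refine (der_eq _ _ _ _ (der_mul _ _ _ _ _ (cu_t s h) (cu_t s h)) _). ring.
Qed.

(** Twice the monotone quantity is the derivative of the integral of u^2, so one unit of t later
    that integral has grown at least as much. A bound for u alone thereby controls u u_t. *)
Lemma circle_uut_growth t : 2 * circle_uut t <= circle_uu (t + 1).
Proof.
have [c [E Hc]] := MVT_cor2 circle_uu (fun t => 2 * circle_uut t) t (t + 1) ltac:(lra) (fun c _ => proj1 (is_derive_Reals circle_uu c (2 * circle_uut c)) (circle_uu_derive c)).
have : 0 <= circle_uu t.
  have <- : circle_int (fun _ => 0) t = 0 by rewrite /circle_int RInt_const /scal /= /mult /= Rmult_0_r.
  apply: circle_int_le; [exact: contC_const | by contC_tac; exact: cuC |]. move=> h; nra.
have := circle_uut_mono t c ltac:(lra). nra.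
Qed.

Lemma cN_mod z : cN z = Cmod (f z) * Cmod (f z).
Proof. by rewrite Cmod_sq. Qed.

(** For f of type zero, u is at most of the order of ln |f| and hence o(e^t). The constants: u <= 8
    e1 e^t on the next circle, and 128 PI e1^2 <= 512 e/1000. *)
Lemma circle_uut_type_zero : type_zero f -> forall e, 0 < e -> exists T, forall t, T <= t -> circle_uut t <= e * (exp t * exp t).
Proof.
move=> H e e0. have pi0 := PI_RGT_0. have pi4 := PI_4.
set e1 := Rmin 1 (e / 1000). have e10 : 0 < e1 by apply: Rmin_glb_lt; lra.
have e11 : e1 <= 1 by exact: Rmin_l. have e12 : e1 <= e / 1000 by exact: Rmin_r.
have [K [K0 HK]] := H e1 e10.
set K1 := Rmax 1 K. have k1 : 1 <= K1 by exact: Rmax_l. have k2 : K <= K1 by exact: Rmax_r.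
have lk : 0 <= ln K1 by rewrite -ln_1; apply: ln_le; lra.
exists (ln ((ln K1 + 1) / e1)) => t Ht.
have Et : ln K1 <= e1 * exp t.
  have : (ln K1 + 1) / e1 <= exp t.
    rewrite -(exp_ln ((ln K1 + 1) / e1)); last by apply: Rdiv_lt_0_compat; lra.
    case: Ht => [h|->]; [left; exact: exp_increasing | by right].
  move/(Rmult_le_compat_l e1 _ _ (Rlt_le _ _ e10)). replace (e1 * ((ln K1 + 1) / e1)) with (ln K1 + 1) by (field; lra). lra.
have ub h : cu (log_polar (t + 1) h) <= 8 * e1 * exp t.
  apply: Rle_trans (chi_le _) _.
  set z := log_polar (t + 1) h.
  have mz : Cmod z <= 3 * exp t.
    rewrite /z /log_polar Cmod_cexp /= exp_plus. have := exp_le_3. have := exp_pos t. nra.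
  have fz : Cmod (f z) <= K1 * exp (e1 * (3 * exp t)).
    apply: Rle_trans (HK z) _. apply: Rmult_le_compat => //; [lra | by left; exact: exp_pos |].
    have : e1 * Cmod z <= e1 * (3 * exp t) by apply: Rmult_le_compat_l; lra.
    case=> [h'|->]; [left; exact: exp_increasing | by right].
  set Q := K1 * exp (e1 * (3 * exp t)) in fz.
  have Q1 : 1 <= Q.
    have : 1 <= exp (e1 * (3 * exp t)).
      rewrite -exp_0. have : 0 <= e1 * (3 * exp t) by have := exp_pos t; nra.
      case=> [h'|<-]; [left; exact: exp_increasing | by right].
    rewrite /Q; nra.
  have pq : 1 + pos1 (cN z) <= Q * Q.
    rewrite cN_mod /pos1. have := Cmod_ge_0 (f z) => f0. apply: (Rle_trans _ (1 + (Q * Q - 1))); last lra.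
    apply: Rplus_le_compat_l. apply: Rmax_lub; nra.
  apply: (Rle_trans _ (ln (Q * Q))); first by apply: ln_le => //; have := pos1_ge0 (cN z); lra.
  rewrite ln_mult; try lra. rewrite /Q ln_mult ?ln_exp; [|lra|exact: exp_pos]. lra.
have u0 h : 0 <= cu (log_polar (t + 1) h) by exact: chi_ge0.
have := circle_uut_growth t.
have : circle_uu (t + 1) <= circle_int (fun _ => (8 * e1 * exp t) * (8 * e1 * exp t)) (t + 1).
  apply: circle_int_le; [by contC_tac; exact: cuC | exact: contC_const |]. move=> h. have := ub h. have := u0 h. nra.
rewrite /circle_int RInt_const /scal /= /mult /= Rminus_0_r.
set X := exp t * exp t. have X0 : 0 < X by apply: Rmult_lt_0_compat; exact: exp_pos.
have -> : 2 * PI * (8 * e1 * exp t * (8 * e1 * exp t)) = 128 * (PI * (e1 * (e1 * X))) by rewrite /X; ring.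
have q1 : e1 * X <= e / 1000 * X by apply: Rmult_le_compat_r; lra.
have q2 : e1 * (e1 * X) <= 1 * (e1 * X) by apply: Rmult_le_compat_r; nra.
have q3 : PI * (e1 * (e1 * X)) <= 4 * (e / 1000 * X) by apply: Rmult_le_compat; try lra; nra.
nra.
Qed.

Lemma RInt_zero (g : R -> R) p q : (forall x, continuous g x) -> (forall x, 0 <= g x) -> RInt g p q <= 0 -> forall x, p < x < q -> g x = 0.
Proof.
move=> gc g0 HI x Hx.
have E y z w : p <= y -> y <= z -> z <= w -> RInt g y w = RInt g y z + RInt g z w.
  move=> *. symmetry. apply: (RInt_Chasles g y z w); exact: exRc.
have Z y : p <= y <= q -> RInt g p y = 0.
  move=> Hy. have := E p y q ltac:(lra) ltac:(lra) ltac:(lra).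
  have := RInt_nonneg g p y ltac:(lra) gc (fun z _ => g0 z). have := RInt_nonneg g y q ltac:(lra) gc (fun z _ => g0 z). lra.
have D : is_derive (fun y => RInt g p y) x (g x).
  apply: (is_derive_RInt g (fun y => RInt g p y) p); last exact: gc.
  apply: filter_forall => y. apply: RInt_correct. exact: exRc.
have D0 : is_derive (fun y => RInt g p y) x 0.
  apply: (is_derive_ext_loc (fun _ => 0)); last exact: is_derive_const.
  exists (mkposreal (Rmin (x - p) (q - x)) ltac:(apply: Rmin_glb_lt; lra)) => y Hy.
  have [h1 h2] := Rabs_def2 _ _ Hy. rewrite /minus /plus /opp /= in h1 h2.
  have := Rmin_l (x - p) (q - x). have := Rmin_r (x - p) (q - x) => u v. rewrite Z //. lra.
by rewrite -(is_derive_unique _ _ _ D) (is_derive_unique _ _ _ D0).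
Qed.

(** If the integral vanished for all t, so would its derivative, hence u_t. Then u would be constant
    along rays and bounded by its values near 0, which makes f bounded and contradicts Liouville's
    theorem. The excluded ray h = 0 is reached by continuity. *)
Lemma circle_uut_pos : (exists z w, f z <> f w) -> exists t, 0 < circle_uut t.
Proof.
move=> [z1 [w1 N]]. apply: NNPP => Nex. apply: N.
have A0 t : circle_uut t = 0.
  apply: Rle_antisym; last exact: circle_uut_ge0. apply: Rnot_lt_le => H. apply: Nex. by exists t.
have A'0 t : circle_uut' t = 0.
  rewrite -(is_derive_unique _ _ _ (circle_uut_derive t)). rewrite (Derive_ext _ (fun _ => 0)) ?Derive_const //.
have ut0 t h : 0 < h < 2 * PI -> cut (log_polar t h) = 0.
  move=> Hh. have := circle_uut'_lower t. rewrite A'0 => H.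
  have Q := RInt_zero (fun h => cut (log_polar t h) * cut (log_polar t h) + cuh (log_polar t h) * cuh (log_polar t h)) 0 (2 * PI) _ _ H h Hh.
  have : cut (log_polar t h) * cut (log_polar t h) + cuh (log_polar t h) * cuh (log_polar t h) = 0.
    apply: Q.
    - move=> x. apply: (contC_h (fun z => cut z * cut z + cuh z * cuh z)). contC_tac; first [exact: cutC | exact: cuhC].
    - move=> x. nra.
  nra.
have ub t h : 0 < h < 2 * PI -> cu (log_polar t h) <= cu 0%C + 1.
  move=> Hh. have [d [d0 K]] := contC_0 _ 1 cuC Rlt_0_1.
  have [T HT] := log_polar_small d d0. set s := Rmin (t - 1) T. have st : s <= t - 1 by exact: Rmin_l. have sT : s <= T by exact: Rmin_r.
  have [c [E _]] := MVT_cor2 (fun t => cu (log_polar t h)) (fun t => cut (log_polar t h)) s t ltac:(lra) (fun c _ => proj1 (is_derive_Reals _ c _) (cu_t c h)).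
  rewrite ut0 // Rmult_0_l in E.
  have [h1 h2] := Rabs_def2 _ _ (K (log_polar s h) (HT s h sT)). lra.
have fb z : Cmod (f z) <= exp (cu 0%C + 4).
  have onray t h : 0 < h < 2 * PI -> Cmod (f (log_polar t h)) <= exp (cu 0%C + 3).
    move=> Hh. have h1 := ub t h Hh. have h2 := chi_ge (cN (log_polar t h)). rewrite -/(cu _) in h2.
    have p1 := pos1_ge0 (cN (log_polar t h)).
    have : 1 + pos1 (cN (log_polar t h)) <= exp (cu 0%C + 3).
      rewrite -(exp_ln (1 + pos1 (cN (log_polar t h)))); last lra.
      have : ln (1 + pos1 (cN (log_polar t h))) <= cu 0%C + 3 by lra. case=> [h'|->]; [left; exact: exp_increasing | by right].
    have : cN (log_polar t h) - 1 <= pos1 (cN (log_polar t h)) by exact: Rmax_r.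
    rewrite cN_mod. have := Cmod_ge_0 (f (log_polar t h)). have := chi_ge0 (cN 0%C). rewrite -/(cu 0%C) => c0.
    have : 1 <= exp (cu 0%C + 3) by have := exp_ineq1_le (cu 0%C + 3); lra.
    nra.
  apply: (Rle_trans _ (exp (cu 0%C + 3) + 1)); last first.
    have := exp_ineq1_le (cu 0%C + 3). have := chi_ge0 (cN 0%C). rewrite -/(cu 0%C) => c0.
    have -> : exp (cu 0%C + 4) = exp (cu 0%C + 3) * exp 1 by rewrite -exp_plus; congr exp; ring.
    have := exp_ineq1 1 ltac:(lra). have := exp_pos (cu 0%C + 3). nra.
  have [d [d0 K]] := holo_cont f z (fe z) 1 Rlt_0_1.
  have [w [Hw [t [h [Hh E]]]]] : exists w, Cmod (w - z)%C < d /\ exists t h, 0 < h < 2 * PI /\ w = log_polar t h.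
    have polar (w : C) : snd w <> 0 -> exists t h, 0 < h < 2 * PI /\ w = log_polar t h.
      case: w => x y /= y0. have pi0 := PI_RGT_0.
      set r := Cmod (x, y). have r0 : 0 < r by apply: Cmod_pos => E; apply: y0; exact: (f_equal snd E).
      have rr : r * r = x * x + y * y by rewrite /r Cmod_sq.
      set cc := x / r. have cr : cc * r = x by rewrite /cc; field; lra.
      have y2 : 0 < y * y by nra.
      have cc1 : cc * cc < 1.
        apply: (Rmult_lt_reg_r (r * r)); first nra. replace (cc * cc * (r * r)) with ((cc * r) * (cc * r)) by ring. rewrite cr. lra.
      have cb : -1 < cc < 1 by split; nra.
      have sq : sqrt (1 - cc²) = Rabs y / r.
        apply: sqrt_lem_1; [rewrite /Rsqr; nra | apply: Rmult_le_pos; [exact: Rabs_pos | left; exact: Rinv_0_lt_compat] |].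
        have ya : Rabs y * Rabs y = y * y by rewrite -Rabs_mult Rabs_pos_eq //; nra.
        replace (Rabs y / r * (Rabs y / r)) with (Rabs y * Rabs y / (r * r)) by (field; lra). rewrite ya /Rsqr /cc.
        have -> : y * y = r * r - x * x by lra. field. lra.
      have ab := acos_bound cc. have s1 := cos_acos cc ltac:(lra). have s2 := sin_acos cc ltac:(lra). rewrite sq in s2.
      have ap : 0 < acos cc.
        apply: Rnot_le_lt => q. have E : acos cc = 0 by lra. rewrite E cos_0 in s1. lra.
      have ap2 : acos cc < PI.
        apply: Rnot_le_lt => q. have E : acos cc = PI by lra. rewrite E cos_PI in s1. lra.
      exists (ln r). case: (Rle_dec 0 y) => hy.
      + exists (acos cc); split; first lra. rewrite /log_polar /cexp /= exp_ln // /cis s1 s2 Rabs_pos_eq //.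
        apply: injective_projections; simpl; rewrite /cc; field; lra.
      + exists (2 * PI - acos cc); split; first lra. rewrite /log_polar /cexp /= exp_ln // /cis.
        have -> : cos (2 * PI - acos cc) = cc by rewrite cos_minus cos_2PI sin_2PI s1; ring.
        have -> : sin (2 * PI - acos cc) = y / r by rewrite sin_minus cos_2PI sin_2PI s2 Rabs_left; [field|]; lra.
        apply: injective_projections; simpl; rewrite /cc; field; lra.
    case: (Req_dec (snd z) 0) => z0.
    - exists (z + (0, (d / 2)%R))%C. split; last by apply: polar => /=; lra.
      replace (z + (0, (d / 2)%R) - z)%C with ((0, d / 2) : C); last by apply: injective_projections; simpl; ring.
      apply: Rle_lt_trans (Cmod_le_sum _) _ => /=. rewrite Rabs_R0 Rabs_pos_eq; lra.
    - exists z; split; first by rewrite Cmod_self. exact: polar.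
  have := K w Hw. have := onray t h Hh. rewrite -E. have := Cmod_rev (f z) (f w). rewrite (Cmod_sub_sym (f z)). lra.
exact: (liouville f _ fe fb).
Qed.
End Sub.

Lemma cu_eq0 f : forall z, Cmod (f z) <= 1 -> cu f z = 0.
Proof. move=> z H. apply: chi_small. rewrite cN_mod. have := Cmod_ge_0 (f z). nra. Qed.

(* Let A and B be the integrals of u u_t over the circle |z| = e^t for f and for g. Then A' >= 2 lambda A with lambda from Wirtinger's
   inequality on the arcs where u does not vanish; the two lambdas add up to at least 2 - O(e^-t), so that A B would grow like e^(4t). *)
Lemma carleman_pair f g c : (forall z, holo f z) -> (forall z, holo g z) -> type_zero f -> type_zero g -> 0 < c ->
  (forall z, c <= Rabs (snd z) -> Cmod (f z) <= 1 \/ Cmod (g z) <= 1) ->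
  (forall z w, f z = f w) \/ (forall z w, g z = g w).
Proof.
move=> hf hg Tf Tg c0 H. apply: NNPP => N.
have [ta Ha] : exists t, 0 < circle_uut f t.
  apply: (circle_uut_pos f hf). apply: NNPP => C. apply: N. left => z w. apply: NNPP => C'. apply: C. by exists z, w.
have [tb Hb] : exists t, 0 < circle_uut g t.
  apply: (circle_uut_pos g hg). apply: NNPP => C. apply: N. right => z w. apply: NNPP => C'. apply: C. by exists z, w.
set T0 := Rmax (ln (100 * c)) (Rmax ta tb).
have T1 : ln (100 * c) <= T0 by exact: Rmax_l.
have T2 : ta <= T0 by apply: Rle_trans (Rmax_r _ _); exact: Rmax_l.
have T3 : tb <= T0 by apply: Rle_trans (Rmax_r _ _); exact: Rmax_r.
(* The product grows at the rate 2 (l1 + l2) >= 4 - 60 s with s = c e^(-t); the weight is the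
   exponential of minus a primitive of this rate, so Z increases. *)
pose Z t := circle_uut f t * circle_uut g t * exp (- 4 * t - 60 * c * exp (- t)).
pose Z' t := (circle_uut' f t * circle_uut g t + circle_uut f t * circle_uut' g t) * exp (- 4 * t - 60 * c * exp (- t)) +
   circle_uut f t * circle_uut g t * ((-4 + 60 * c * exp (- t)) * exp (- 4 * t - 60 * c * exp (- t))).
have DZ t : is_derive Z t (Z' t).
  apply: der_mul; first by apply: der_mul; exact: circle_uut_derive.
  auto_derive => //. rewrite /Rminus. ring.
have Z'0 t : T0 <= t -> 0 <= Z' t.
  move=> Ht. set s := c * exp (- t).
  have et : 100 * c <= exp t.
    rewrite -(exp_ln (100 * c)); last lra. have : ln (100 * c) <= t by lra. case=> [h|->]; [left; exact: exp_increasing | by right].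
  have s0 : 0 < s by apply: Rmult_lt_0_compat => //; exact: exp_pos.
  have see : s * exp t = c by rewrite /s Rmult_assoc -exp_plus Rplus_opp_l exp_0 Rmult_1_r.
  have s1 : s <= 1 / 100 by have := exp_pos t; nra.
  have uv x : s <= Rabs (sin x) -> cu f (log_polar t x) = 0 \/ cu g (log_polar t x) = 0.
    move=> Hx. have := H (log_polar t x). case.
    - rewrite /log_polar /cexp /=. replace (exp t * sin x + 0 * cos x) with (exp t * sin x) by ring.
      rewrite Rabs_mult Rabs_pos_eq; last by left; exact: exp_pos. have := exp_pos t. nra.
    - left. exact: cu_eq0.
    - right. exact: cu_eq0.
  have per (k : (C -> C) -> C -> R) (q : C -> C) x : k q (log_polar t (x + 2 * PI)) = k q (log_polar t x) by rewrite log_polar_periodic.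
  have [l1 [l2 [l10 [l20 [ll [W1 W2]]]]]] := wirtinger_pair (fun x => cu f (log_polar t x)) (fun x => cu g (log_polar t x)) s (per cu f) (per cu g) s0 s1 uv
     (fun x => cuh f (log_polar t x)) (fun x => cuh g (log_polar t x)) (cu_h f hf t) (fun x => contC_h _ t x (cuhC f hf)) (per cuh f)
     (cu_h g hg t) (fun x => contC_h _ t x (cuhC g hg)) (per cuh g).
  have L1 := circle_uut'_lambda f hf t l1 l10 W1. have L2 := circle_uut'_lambda g hg t l2 l20 W2.
  have A0 := circle_uut_ge0 f hf t. have B0 := circle_uut_ge0 g hg t.
  rewrite /Z'. set X := exp (- 4 * t - 60 * c * exp (- t)). have X0 : 0 < X by exact: exp_pos.
  have -> : 60 * c * exp (- t) = 60 * s by rewrite /s; ring.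
  set a := circle_uut f t in L1 A0 *. set b := circle_uut g t in L2 B0 *. set a' := circle_uut' f t in L1 *. set b' := circle_uut' g t in L2 *.
  have m1 : 2 * l1 * a * b <= a' * b by apply: Rmult_le_compat_r.
  have m2 : a * (2 * l2 * b) <= a * b' by apply: Rmult_le_compat_l.
  have ab : 0 <= a * b by exact: Rmult_le_pos.
  have m3 : (4 - 60 * s) * (a * b) <= 2 * (l1 + l2) * (a * b) by apply: Rmult_le_compat_r => //; lra.
  have : 0 <= ((a' * b + a * b') + a * b * (-4 + 60 * s)) * X by apply: Rmult_le_pos; lra.
  lra.
have Zm t : T0 <= t -> Z T0 <= Z t.
  move=> [ht|<-]; last lra.
  have [x [E Hx]] := MVT_cor2 Z Z' T0 t ht (fun x _ => proj1 (is_derive_Reals Z x (Z' x)) (DZ x)).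
  have := Z'0 x ltac:(lra). nra.
have A0 : 0 < circle_uut f T0 by apply: Rlt_le_trans Ha _; exact: circle_uut_mono.
have B0 : 0 < circle_uut g T0 by apply: Rlt_le_trans Hb _; exact: circle_uut_mono.
have Z0 : 0 < Z T0 by apply: Rmult_lt_0_compat; [exact: Rmult_lt_0_compat | exact: exp_pos].
set e := Rmin 1 (Z T0 / 2). have e0 : 0 < e by apply: Rmin_glb_lt; lra.
have e1 : e <= 1 by exact: Rmin_l. have e2 : e <= Z T0 / 2 by exact: Rmin_r.
have [Ta GA] := circle_uut_type_zero f hf Tf e e0. have [Tb GB] := circle_uut_type_zero g hg Tg e e0.
set t := Rmax T0 (Rmax Ta Tb).
have t1 : T0 <= t by exact: Rmax_l.
have ga := GA t ltac:(apply: Rle_trans (Rmax_r _ _); exact: Rmax_l).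
have gb := GB t ltac:(apply: Rle_trans (Rmax_r _ _); exact: Rmax_r).
have := Zm t t1. rewrite {2}/Z.
have A1 := circle_uut_ge0 f hf t. have B1 := circle_uut_ge0 g hg t.
set y := exp t * exp t in ga gb. have y0 : 0 < y by apply: Rmult_lt_0_compat; exact: exp_pos.
have X1 : exp (- 4 * t - 60 * c * exp (- t)) * (y * y) <= 1.
  rewrite /y -!exp_plus -exp_0.
  have : - 4 * t - 60 * c * exp (- t) + (t + t + (t + t)) <= 0 by have := exp_pos (- t); nra.
  case=> [h|->]; [left; exact: exp_increasing | by right].
set X := exp (- 4 * t - 60 * c * exp (- t)) in X1 *. have X0 : 0 < X by exact: exp_pos.
have : circle_uut f t * circle_uut g t <= (e * y) * (e * y) by apply: Rmult_le_compat.
move/(Rmult_le_compat_r X _ _ (Rlt_le _ _ X0)).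
have -> : e * y * (e * y) * X = e * e * (X * (y * y)) by ring.
have : e * e * (X * (y * y)) <= e * e * 1 by apply: Rmult_le_compat_l => //; nra.
nra.
Qed.


(** * Phragmen-Lindelof principles and the Hardy space estimate *)

Lemma exp_le_mono x y : x <= y -> exp x <= exp y.
Proof. case=> [h|->]; [left; exact: exp_increasing | by right]. Qed.

Lemma Cinv_Re (z : C) : z <> 0%C -> Re (Ci * / z)%C = snd z / (Cmod z * Cmod z).
Proof.
move=> z0. rewrite Cmod_sq /Re /=.
have p : 0 < fst z * fst z + snd z * snd z by rewrite -Cmod_sq; have := Cmod_pos z z0; nra.
field. lra.
Qed.

Section PhragmenLindelof.
Variables (S : C -> Prop) (q : C -> C) (n : nat).
Hypothesis n1 : (1 <= n)%nat.
Hypothesis qe : forall z, holo q z.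
Hypothesis qm : forall z, Cmod (q z) = Cmod z ^ n.
Hypothesis Sop : forall z, S z -> exists d, 0 < d /\ forall w, Cmod (w - z)%C < d -> S w.
Hypothesis Sq : forall z, S z -> 0 < snd (q z).
Variables (f : C -> C) (M : R).
Hypothesis M0 : 0 < M.
Hypothesis fS : forall z, S z -> holo f z.
Hypothesis fb : forall p, ~ S p -> forall eta, 0 < eta -> exists d, 0 < d /\ forall w, S w -> Cmod (w - p)%C < d -> Cmod (f w) <= M + eta.
Hypothesis fg : forall kap R0, 0 < kap -> exists R1, R0 <= R1 /\ forall z, S z -> Cmod z = R1 -> Cmod (f z) <= exp (kap * (R1 ^ n * R1 ^ n) / snd (q z)).

(* The majorant U = k T^2 Im q (1/|q-T|^2 + 1/|q+T|^2) equals k T^2 / Im q on |q| = T and stays bounded by 8 k Im q at fixed points. *)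
Lemma phragmen_lindelof z : S z -> Cmod (f z) <= M.
Proof.
move=> Sz. apply: Rnot_lt_le => Hlt. have yq := Sq z Sz. set y := snd (q z) in yq.
have fz0 : 0 < Cmod (f z) by lra.
(* Chosen so that 16 kap y is half of ln(|f(z)|/M), which makes the bound M exp(16 kap y)
   contradictory. *)
set kap := ln (Cmod (f z) / M) / (32 * y).
have lp : 0 < ln (Cmod (f z) / M).
  rewrite -ln_1. apply: ln_increasing; first lra. apply: (Rmult_lt_reg_r M) => //. rewrite /Rdiv Rmult_assoc Rinv_l; lra.
have kap0 : 0 < kap by apply: Rdiv_lt_0_compat; lra.
suff : Cmod (f z) <= M * exp (16 * kap * y).
  have -> : 16 * kap * y = ln (Cmod (f z) / M) / 2 by rewrite /kap; field; lra.
  have : exp (ln (Cmod (f z) / M) / 2) < exp (ln (Cmod (f z) / M)) by apply: exp_increasing; lra.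
  rewrite exp_ln; last by apply: Rdiv_lt_0_compat.
  move/(Rmult_lt_compat_l M _ _ M0). replace (M * (Cmod (f z) / M)) with (Cmod (f z)) by (field; lra). lra.
(* The first lower bound on R1 gives |q(z)| <= T/2. The second makes exp(-kap T) <= M, which settles
   the arc |q| = T. *)
have [R1 [hR gR]] := fg kap (Rmax (2 * Cmod z + 1) (/ (kap * M))) kap0.
have z0 := Cmod_ge_0 z.
have r1 : 2 * Cmod z + 1 <= R1 by apply: Rle_trans hR; exact: Rmax_l.
have r2 : / (kap * M) <= R1 by apply: Rle_trans hR; exact: Rmax_r.
set T := R1 ^ n in gR.
have TR : R1 <= T by rewrite /T -{1}(pow_1 R1); apply: Rle_pow => //; lra.
have T0 : 0 < T by lra.
have qz : Cmod (q z) <= T / 2.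
  rewrite qm /T. have : (2 * Cmod z) ^ n <= R1 ^ n by apply: pow_incr; lra.
  rewrite Rpow_mult_distr. have : 2 <= 2 ^ n by rewrite -{1}(pow_1 2); apply: Rle_pow => //; lra.
  have : 0 <= Cmod z ^ n by apply: pow_le. nra.
pose U w := 2 * kap * (T * T) * (snd (q w) / (Cmod (q w - T)%C * Cmod (q w - T)%C) + snd (q w) / (Cmod (q w + T)%C * Cmod (q w + T)%C)).
pose W w := ((2 * kap * (T * T))%R * (Ci * / (q w - T) + Ci * / (q w + T)))%C.
have nz w : S w -> (q w - T)%C <> 0%C /\ (q w + T)%C <> 0%C.
  move=> Sw. have := Sq w Sw => yw. split=> E; have := f_equal snd E; rewrite /= => E2; lra.
have WU w : S w -> Re (W w) = U w.
  move=> Sw. have [h1 h2] := nz w Sw. have e1 := Cinv_Re _ h1. have e2 := Cinv_Re _ h2.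
  rewrite /W /U. have -> : snd (q w) / (Cmod (q w - T)%C * Cmod (q w - T)%C) = snd (q w - T)%C / (Cmod (q w - T)%C * Cmod (q w - T)%C) by simpl; congr (_ / _); ring.
  have -> : snd (q w) / (Cmod (q w + T)%C * Cmod (q w + T)%C) = snd (q w + T)%C / (Cmod (q w + T)%C * Cmod (q w + T)%C) by simpl; congr (_ / _); ring.
  rewrite -e1 -e2 /Re. move: (Ci * / (q w - T))%C (Ci * / (q w + T))%C => u v. simpl. ring.
have U0 w : S w -> 0 <= U w.
  move=> Sw. have [h1 h2] := nz w Sw. have yw := Sq w Sw. have c1 := Cmod_pos _ h1. have c2 := Cmod_pos _ h2.
  apply: Rmult_le_pos; first by apply: Rmult_le_pos; nra.
  apply: Rplus_le_le_0_compat; left; apply: Rdiv_lt_0_compat => //; exact: Rmult_lt_0_compat.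
pose F w := (f w * cexp (- W w))%C.
have FM w : S w -> Cmod (F w) = Cmod (f w) * exp (- U w).
  move=> Sw. rewrite /F Cmod_mult Cmod_cexp -(WU w Sw). congr (_ * exp _).
have FH w : S w -> holo F w.
  move=> Sw. have [h1 h2] := nz w Sw. apply: holo_mult; first exact: fS.
  apply: (holo_comp cexp (fun w => - W w)%C); last exact: holo_cexp.
  apply: holo_opp. apply: holo_mult; first exact: holo_const.
  apply: holo_plus; (apply: holo_mult; first exact: holo_const); apply: holo_inv => //; [apply: holo_minus | apply: holo_plus] => //; exact: holo_const.
have main : forall w, S w /\ Cmod w < R1 -> Cmod (F w) <= M.
  apply: (max_principle (fun w => S w /\ Cmod w < R1) F M R1); first lra.
  - move=> w [Sw Rw]. have [d [d0 Hd]] := Sop w Sw. exists (Rmin d (R1 - Cmod w)); split; first by apply: Rmin_glb_lt; lra.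
    move=> u Hu. have := Rmin_l d (R1 - Cmod w). have := Rmin_r d (R1 - Cmod w) => a b. split; first by apply: Hd; lra.
    have := Cmod_triangle (u - w)%C w. replace (u - w + w)%C with u by ring. lra.
  - move=> w [_ ?]. lra.
  - move=> w [Sw _]. exact: FH.
  - move=> p Np eta eta0. case: (classic (S p)) => Sp; last first.
      have [d [d0 Hd]] := fb p Sp eta eta0. exists d; split => // w [Sw _] Hw.
      rewrite FM //. have := Hd w Sw Hw. have := Cmod_ge_0 (f w) => f0.
      have : exp (- U w) <= 1 by rewrite -exp_0; apply: exp_le_mono; have := U0 w Sw; lra.
      have := exp_pos (- U w). nra.
    have Rp : R1 <= Cmod p by apply: Rnot_lt_le => h; apply: Np.
    case: Rp => Rp.
      exists (Cmod p - R1); split; first lra. move=> w [Sw Rw] Hw. have := Cmod_rev p w. rewrite Cmod_sub_sym. lra.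
    have Fp : Cmod (F p) <= M.
      rewrite FM //. have yp := Sq p Sp. have gp := gR p Sp (eq_sym Rp). have mp : Cmod (q p) = T by rewrite qm -Rp.
      have [h1 h2] := nz p Sp. have c1 := Cmod_pos _ h1. have c2 := Cmod_pos _ h2.
      have UE : U p = 2 * kap * (T * T) / snd (q p).
        have s1 := Cmod_sq (q p). rewrite mp in s1.
        rewrite /U !Cmod_sq. rewrite /= . set a := fst (q p) in s1 *. set b := snd (q p) in s1 yp *.
        have k1 : (a + - T) * (a + - T) + (b + - 0) * (b + - 0) = 2 * T * (T - a) by nra.
        have k2 : (a + T) * (a + T) + (b + 0) * (b + 0) = 2 * T * (T + a) by nra.
        rewrite k1 k2. have bb : b * b = (T - a) * (T + a) by lra.
        have ta : 0 < T - a by nra. have tb : 0 < T + a by nra.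
        have : b / (2 * T * (T - a)) + b / (2 * T * (T + a)) = b / ((T - a) * (T + a)) by field; lra.
        move=> ->. rewrite -bb. field. lra.
      rewrite UE.
      have yT : snd (q p) <= T by have := Cmod_snd (q p); rewrite mp; have := Rle_abs (snd (q p)); lra.
      have iy : 0 < / snd (q p) by exact: Rinv_0_lt_compat.
      have e1 : / M <= exp (kap * (T * T) / snd (q p)).
        have : kap * T <= kap * (T * T) / snd (q p).
          apply: (Rmult_le_reg_r (snd (q p))) => //. have -> : kap * (T * T) / snd (q p) * snd (q p) = kap * T * T by field; lra.
          apply: Rmult_le_compat_l => //. left; exact: Rmult_lt_0_compat.
        have := exp_ineq1_le (kap * (T * T) / snd (q p)).
        have : / M <= kap * T.
          have -> : / M = kap * / (kap * M) by field; lra. apply: Rmult_le_compat_l; lra.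
        lra.
      apply: (Rle_trans _ (exp (kap * (T * T) / snd (q p)) * exp (- (2 * kap * (T * T) / snd (q p))))).
        apply: Rmult_le_compat_r => //. left; exact: exp_pos.
      have -> : - (2 * kap * (T * T) / snd (q p)) = - (kap * (T * T) / snd (q p)) + - (kap * (T * T) / snd (q p)) by field; lra.
      rewrite exp_plus -Rmult_assoc -exp_plus Rplus_opp_r exp_0 Rmult_1_l exp_Ropp.
      rewrite -(Rinv_inv M). apply: Rinv_le_contravar => //. exact: Rinv_0_lt_compat.
    have [d [d0 Hd]] := holo_cont F p (FH p Sp) eta eta0. exists d; split => // w [Sw _] Hw.
    have := Hd w Hw. have := Cmod_rev (F w) (F p). lra.
have zR : Cmod z < R1 by lra. have := main z (conj Sz zR). rewrite FM // => H.
have Uz : U z <= 16 * kap * y.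
  have c1 : T / 2 <= Cmod (q z - T)%C.
    have := Cmod_rev T (q z). rewrite Cmod_sub_sym Cmod_R Rabs_pos_eq; lra.
  have c2 : T / 2 <= Cmod (q z + T)%C.
    have := Cmod_rev T (- q z)%C. replace (T - - q z)%C with (q z + T)%C by ring. rewrite Cmod_opp Cmod_R Rabs_pos_eq; lra.
  have b (X : R) : T / 2 <= X -> y / (X * X) <= y * (4 / (T * T)).
    move=> hX. apply: Rmult_le_compat_l; first lra. have -> : 4 / (T * T) = / (T / 2 * (T / 2)) by field; lra.
    apply: Rinv_le_contravar; nra.
  rewrite /U -/y. have := b _ c1. have := b _ c2 => b1 b2.
  have : 2 * kap * (T * T) * (y / (Cmod (q z - T)%C * Cmod (q z - T)%C) + y / (Cmod (q z + T)%C * Cmod (q z + T)%C)) <= 2 * kap * (T * T) * (y * (4 / (T * T)) + y * (4 / (T * T))).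
    apply: Rmult_le_compat_l; last lra. apply: Rmult_le_pos; nra.
  have -> : 2 * kap * (T * T) * (y * (4 / (T * T)) + y * (4 / (T * T))) = 16 * kap * y by field; lra.
  by [].
have e0 := exp_pos (U z).
have -> : Cmod (f z) = Cmod (f z) * exp (- U z) * exp (U z) by rewrite Rmult_assoc -exp_plus Rplus_opp_l exp_0 Rmult_1_r.
apply: Rmult_le_compat => //; [|lra|exact: exp_le_mono].
apply: Rmult_le_pos; [exact: Cmod_ge_0 | left; exact: exp_pos].
Qed.
End PhragmenLindelof.

Lemma snd_le_Cmod (z : C) : snd z <= Cmod z.
Proof. have := Cmod_snd z. have := Rle_abs (snd z). lra. Qed.

Lemma cont_boundary f p M : ccont f p -> Cmod (f p) <= M -> forall (S : C -> Prop) eta, 0 < eta -> exists d, 0 < d /\ forall w, S w -> Cmod (w - p)%C < d -> Cmod (f w) <= M + eta.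
Proof.
move=> Hc Hp S eta eta0. have [d [d0 K]] := Hc eta eta0. exists d; split => // w _ Hw.
have := K w Hw. have := Cmod_rev (f w) (f p). lra.
Qed.

(** The case q(z) = z, n = 1. The growth condition concerns only some arbitrarily large half circles
    and may blow up near the real line like exp(kap R^2 / Im z), which is what functions of bounded
    type can do. *)
Lemma pl_half f M : 0 < M -> (forall z, 0 < snd z -> holo f z) -> (forall x : R, ccont f x /\ Cmod (f x) <= M) ->
  (forall kap R0, 0 < kap -> exists R1, R0 <= R1 /\ forall z, 0 < snd z -> Cmod z = R1 -> Cmod (f z) <= exp (kap * (R1 * R1) / snd z)) ->
  forall z, 0 < snd z -> Cmod (f z) <= M.
Proof.
move=> M0 Hf Hb Hg.
apply: (phragmen_lindelof (fun z => 0 < snd z) (fun z => z) 1%nat) => //.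
- by move=> z; exact: holo_id.
- move=> z. by rewrite pow_1.
- move=> z Hz. exists (snd z); split => // w Hw. have := Cmod_snd (w - z)%C => /= h.
  have [h1 h2] := Rabs_def2 (snd w + - snd z) (snd z) ltac:(lra). lra.
- move=> p Np eta eta0. case: (Rtotal_order (snd p) 0) => [h|[h|h]].
  + exists (- snd p); split; first lra. move=> w Sw Hw. have := Cmod_snd (w - p)%C => /= h'.
    have [h1 h2] := Rabs_def2 (snd w + - snd p) (- snd p) ltac:(lra). lra.
  + have -> : p = RtoC (fst p) by apply: injective_projections.
    have [h1 h2] := Hb (fst p). exact: cont_boundary.
  + by case: Np.
- move=> kap R0 k0. have [R1 [h1 h2]] := Hg kap R0 k0. exists R1; split => // z Hz E. rewrite pow_1. exact: h2.
Qed.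

(* sg = 1 is the right quarter plane, sg = -1 the left one. *)
Lemma pl_quarter (sg : R) f M : sg * sg = 1 -> 0 < M -> (forall z, 0 < snd z -> holo f z) -> (forall x : R, ccont f x /\ Cmod (f x) <= M) ->
  (forall y, 0 < y -> Cmod (f (0, y)) <= M) ->
  (forall kap R0, 0 < kap -> exists R1, 0 < R1 /\ R0 <= R1 /\ forall z, 0 < snd z -> Cmod z = R1 -> Cmod (f z) <= exp (kap * (R1 * R1 * R1) / snd z)) ->
  forall z, 0 < snd z -> 0 < sg * fst z -> Cmod (f z) <= M.
Proof.
move=> sg1 M0 Hf Hb Hi Hg z Hz Hz2.
have sga : Rabs sg = 1.
  have := Rabs_pos sg. have : Rabs sg * Rabs sg = 1 by rewrite -Rabs_mult sg1 Rabs_R1. nra.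
apply: (phragmen_lindelof (fun z => 0 < snd z /\ 0 < sg * fst z) (fun z => sg * (z * z))%C 2%nat) => //.
- by lia.
- move=> w. holo_tac.
- move=> w. rewrite !Cmod_mult Cmod_R sga. ring.
- move=> w [h1 h2]. exists (Rmin (snd w) (sg * fst w)); split; first exact: Rmin_glb_lt.
  move=> u Hu. have := Rmin_l (snd w) (sg * fst w). have := Rmin_r (snd w) (sg * fst w) => a b.
  have := Cmod_snd (u - w)%C => /= h. have [h3 h4] := Rabs_def2 (snd u + - snd w) (snd w) ltac:(lra).
  split; first lra. have := Cmod_fst (u - w)%C => /= h'.
  have : Rabs (sg * (fst u + - fst w)) < sg * fst w by rewrite Rabs_mult sga; lra.
  move=> k. have [k1 k2] := Rabs_def2 _ _ k. lra.
- move=> w [h1 h2] /=. nra.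
- move=> w [h1 _]. exact: Hf.
- move=> p Np eta eta0.
  case: (Rlt_le_dec (snd p) 0) => h.
    exists (- snd p); split; first lra. move=> w [Sw _] Hw. have := Cmod_snd (w - p)%C => /= h'.
    have [h1 h2] := Rabs_def2 (snd w + - snd p) (- snd p) ltac:(lra). lra.
  case: (Rlt_le_dec (sg * fst p) 0) => h'.
    exists (- (sg * fst p)); split; first lra. move=> w [_ Sw] Hw. have := Cmod_fst (w - p)%C => /= h1.
    have : Rabs (sg * (fst w + - fst p)) < - (sg * fst p) by rewrite Rabs_mult sga; lra.
    move=> k. have [k1 k2] := Rabs_def2 _ _ k. lra.
  case: (Req_dec (snd p) 0) => h1.
    have -> : p = RtoC (fst p) by apply: injective_projections.
    have [k1 k2] := Hb (fst p). exact: (cont_boundary f (fst p) M k1 k2 (fun z => 0 < snd z /\ 0 < sg * fst z)).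
  have sp : 0 < snd p by have [q|q] := Rle_lt_or_eq_dec _ _ h; [lra | case: h1].
  have f0 : fst p = 0.
    have h2 : ~ 0 < sg * fst p by move=> h2; apply: Np; split; lra.
    have E : sg * fst p = 0 by lra. have : sg * (sg * fst p) = 0 by rewrite E; ring. rewrite -Rmult_assoc sg1. lra.
  have -> : p = (0, snd p) by apply: injective_projections.
  apply: (cont_boundary f (0, snd p) M _ _ (fun z => 0 < snd z /\ 0 < sg * fst z)) => //.
  + apply: holo_cont. apply: Hf => /=. lra.
  + apply: Hi. lra.
- move=> kap R0 k0. have [R1 [r0 [h1 h2]]] := Hg (kap / 2) R0 ltac:(lra). exists R1; split => // w [w1 w2] E.
  apply: Rle_trans (h2 w w1 E) _. apply: exp_le_mono.
  have wf : sg * fst w <= R1.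
    have := Rle_abs (sg * fst w). rewrite Rabs_mult sga. have := Cmod_fst w. lra.
  have -> : snd (sg * (w * w))%C = 2 * (sg * fst w) * snd w by simpl; ring.
  have d0 : 0 < 2 * (sg * fst w) * snd w by nra.
  move: (sg * fst w) w2 wf d0 => P w2 wf d0.
  apply: (Rmult_le_reg_r (2 * P * snd w)) => //.
  have -> : kap / 2 * (R1 * R1 * R1) / snd w * (2 * P * snd w) = kap * (R1 * R1 * R1) * P by field; lra.
  have -> : kap * (R1 ^ 2 * R1 ^ 2) / (2 * P * snd w) * (2 * P * snd w) = kap * (R1 * R1 * R1) * R1 by field; lra.
  apply: Rmult_le_compat_l => //. left. repeat apply: Rmult_lt_0_compat => //.
Qed.

(** * Estimates for the Hardy space *)

Lemma CI_norm_le g a b (h : R -> R) : a <= b -> (forall t, rcont g t) -> (forall t, continuous h t) -> (forall t, a <= t <= b -> Cmod (g t) <= h t) ->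
  Cmod (CI g a b) <= RInt h a b.
Proof.
move=> ab Hg Hh H. rewrite Cmod_norm.
refine (@norm_RInt_le C_R_NormedModule g h a b (CI g a b) (RInt h a b) ab _ _ _).
- move=> x Hx. rewrite -Cmod_norm. exact: H.
- exact: (@RInt_correct C_R_CompleteNormedModule g a b (CI_ex g a b (fun t _ => Hg t))).
- apply: RInt_correct. exact: exRc.
Qed.

Lemma poisson_mass x0 y0 a b : 0 < y0 -> RInt (fun t => / ((t - x0) * (t - x0) + y0 * y0)) a b <= PI / y0.
Proof.
move=> y00. have pos t : 0 < (t - x0) * (t - x0) + y0 * y0 by have := Rle_0_sqr (t - x0); rewrite /Rsqr; nra.
have I : is_RInt (fun t => / ((t - x0) * (t - x0) + y0 * y0)) a b (minus (atan ((b - x0) / y0) / y0) (atan ((a - x0) / y0) / y0)).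
  apply: (is_RInt_derive (fun t => atan ((t - x0) / y0) / y0)) => t _.
  - auto_derive => //. rewrite /Rsqr. have := pos t => p. field. split; first nra. lra.
  - apply: (@ex_derive_continuous R_AbsRing R_NormedModule). auto_derive. have := pos t. rewrite /Rminus. lra.
rewrite (is_RInt_unique _ _ _ _ I) /minus /plus /opp /=.
have := atan_bound ((b - x0) / y0). have := atan_bound ((a - x0) / y0) => h1 h2.
have -> : atan ((b - x0) / y0) / y0 + - (atan ((a - x0) / y0) / y0) = (atan ((b - x0) / y0) - atan ((a - x0) / y0)) / y0 by field; lra.
apply: Rmult_le_compat_r; [left; exact: Rinv_0_lt_compat | lra].
Qed.

(* Psi is a primitive of f(z) (2 y0 / (z - conj z0))^2. It is bounded on the line by the Cauchy-Schwarz inequality, hence on the half plane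
   by Phragmen-Lindelof, and the Cauchy estimate for Psi at z0 bounds f(z0). *)
Section HardyEstimate.
Variable f : C -> C.
Hypothesis fh : forall z, 0 <= snd z -> exists d, 0 < d /\ forall w, Cmod (w - z)%C < d -> holo f w.
Variable A : R.
Hypothesis A0 : 0 <= A.
Hypothesis fgrow : forall z, 0 < snd z -> Cmod (f z) <= exp (A * (1 + Cmod z * Cmod z) / snd z).
Hypothesis fmt : forall e, 0 < e -> exists Y, forall y, Y <= y -> Cmod (f (0, y)) <= exp (e * y).
Variables (x0 y0 : R).
Hypothesis y00 : 0 < y0.
Variable J : R.
Let ker t := / ((t - x0) * (t - x0) + y0 * y0).
Hypothesis J0 : 0 <= J.
Hypothesis fJ : forall a b, a <= b -> RInt (fun t => Cmod (f (RtoC t)) * Cmod (f (RtoC t)) * ker t) a b <= J.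

Let zb : C := (x0, - y0).
Let f1 (z : C) : C := (f z * ((2 * y0) * (2 * y0))%R / ((z - zb) * (z - zb)))%C.

Lemma f1_den z : 0 <= snd z -> y0 <= Cmod (z - zb)%C.
Proof. move=> Hz. have := snd_le_Cmod (z - zb)%C. simpl. lra. Qed.

Lemma holo_at z : 0 <= snd z -> holo f z.
Proof. move=> Hz. have [d [d0 K]] := fh z Hz. apply: K. by rewrite Cmod_self. Qed.

Lemma f1_holo_gen z : (z - zb)%C <> 0%C -> holo f z -> holo f1 z.
Proof.
move=> n0 H. apply: holo_div; first exact: Cmult_neq_0.
- apply: holo_mult => //. exact: holo_const.
- holo_tac.
Qed.

Lemma f1_nbhd z : 0 <= snd z -> exists d, 0 < d /\ forall w, Cmod (w - z)%C < d -> holo f1 w.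
Proof.
move=> Hz. have [d [d0 K]] := fh z Hz. exists (Rmin d y0); split; first exact: Rmin_glb_lt.
move=> w Hw. have := Rmin_l d y0. have := Rmin_r d y0 => a b. apply: f1_holo_gen; last by apply: K; lra.
apply: Cneq_mod. have := f1_den z Hz. have := Cmod_rev (z - zb)%C (z - w)%C. replace (z - zb - (z - w))%C with (w - zb)%C by ring.
rewrite (Cmod_sub_sym z w). lra.
Qed.

Lemma f1_holo z : 0 <= snd z -> holo f1 z.
Proof. move=> Hz. have [d [d0 K]] := f1_nbhd z Hz. apply: K. by rewrite Cmod_self. Qed.

Lemma f1_le z : 0 <= snd z -> Cmod (f1 z) <= 4 * Cmod (f z).
Proof.
move=> Hz. have h := f1_den z Hz. have n0 : (z - zb)%C <> 0%C by apply: Cneq_mod; lra.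
rewrite /f1 Cmod_div; last exact: Cmult_neq_0. rewrite !Cmod_mult Cmod_R Rabs_pos_eq; last nra.
set X := Cmod (z - zb)%C in h *. have xx : 0 < X * X by nra.
apply: (Rmult_le_reg_r (X * X)) => //. rewrite /Rdiv Rmult_assoc Rinv_l; last lra. rewrite Rmult_1_r.
have := Cmod_ge_0 (f z). have : y0 * y0 <= X * X by nra. nra.
Qed.

Let Psi := prim f1 0.

Lemma Psi_cder z : 0 <= snd z -> is_cder Psi z (f1 z).
Proof.
move=> Hz. have [d1 [d10 K1]] := f1_nbhd z Hz. have [d2 [d20 K2]] := f1_nbhd (RtoC (fst z)) ltac:(simpl; lra).
set dl := Rmin d1 d2 / 2. have m0 : 0 < Rmin d1 d2 by exact: Rmin_glb_lt.
have dl0 : 0 < dl by rewrite /dl; lra. have a := Rmin_l d1 d2. have b := Rmin_r d1 d2.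
apply: (prim_cder f1 0 z dl) => //.
- move=> p _ /= E. apply: holo_cont. apply: f1_holo. lra.
- move=> p h1 /= h2. rewrite Rmin_left in h2; last lra.
  case: (Rle_lt_dec 0 (snd p)) => hp; first by apply: holo_cont; exact: f1_holo.
  apply: holo_cont. apply: K2. apply: Rle_lt_trans (Cmod_le_sum _) _ => /=.
  have : Rabs (snd p + - 0) < dl by apply: Rabs_def1; lra. rewrite /dl in h1 h2 *. change (fst p + - fst z) with (fst p - fst z). lra.
- move=> a1 a2 b1 b2 h1 h2 h3 h4 h5 h6. apply: goursat => // w [Hw1 Hw2]. apply: f1_holo.
  rewrite /= Rmin_left in h5; lra.
Qed.

Lemma Psi_0 : Psi 0%C = 0%C.
Proof. rewrite /Psi /prim /CI !RInt_point. change (@zero C_R_CompleteNormedModule) with (RtoC 0). ring. Qed.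

Lemma f1_real t : Cmod (f1 (RtoC t)) = 4 * (y0 * y0) * (Cmod (f (RtoC t)) * ker t).
Proof.
have h := f1_den (RtoC t) ltac:(simpl; lra). have n0 : (RtoC t - zb)%C <> 0%C by apply: Cneq_mod; lra.
rewrite /f1 Cmod_div; last exact: Cmult_neq_0. rewrite !Cmod_mult Cmod_R Rabs_pos_eq; last nra.
rewrite Cmod_sq /ker /=. have -> : (t + - x0) * (t + - x0) + (0 + - - y0) * (0 + - - y0) = (t - x0) * (t - x0) + y0 * y0 by ring.
rewrite /Rdiv. ring.
Qed.

Lemma rcont_f1 t : rcont (fun s => f1 (RtoC s)) t.
Proof. apply: (rcont_hor f1 t 0). apply: holo_cont. apply: f1_holo => /=. lra. Qed.

Lemma ker_den t : 0 < (t - x0) * (t - x0) + y0 * y0.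
Proof. have := Rle_0_sqr (t - x0); rewrite /Rsqr; nra. Qed.

Lemma ker_pos t : 0 < ker t. Proof. apply: Rinv_0_lt_compat. exact: ker_den. Qed.

Lemma ker_cont t : continuous ker t.
Proof. apply: (@ex_derive_continuous R_AbsRing R_NormedModule). rewrite /ker. auto_derive. have := ker_den t. rewrite /Rminus. lra. Qed.

Lemma f_real_cont t : continuous (fun t => Cmod (f (RtoC t))) t.
Proof.
have H : rcont (fun s => f (RtoC s)) t by apply: (rcont_hor f t 0); apply: holo_cont; apply: holo_at => /=; lra.
move=> P [e He]. have [d [d0 K]] := H e (cond_pos e). exists (mkposreal d d0) => s Hs. apply: He.
have k := K s Hs. apply: Rle_lt_trans k. change (Rabs (Cmod (f s) - Cmod (f t)) <= Cmod (f s - f t)%C).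
apply: Rabs_le. have := Cmod_rev (f s) (f t). have := Cmod_rev (f t) (f s). rewrite (Cmod_sub_sym (f t)). lra.
Qed.

(** The Cauchy-Schwarz inequality with a free weight, 2X <= s + X^2/s: the first term is integrated
    against the Poisson kernel, the second gives J. The weight s is chosen only in
    [hardy_estimate]. *)
Let Ms s := 2 * (y0 * y0) * (s * (PI / y0) + J / s).

Lemma Ms_pos s : 0 < s -> 0 < Ms s.
Proof.
move=> s0. have pi0 := PI_RGT_0. have h : 0 < PI / y0 by exact: Rdiv_lt_0_compat.
have h2 : 0 <= J / s by apply: Rmult_le_pos => //; left; exact: Rinv_0_lt_compat.
apply: Rmult_lt_0_compat; [nra | nra].
Qed.

Lemma f1_int s a b : 0 < s -> a <= b -> Cmod (CI (fun t => f1 (RtoC t)) a b) <= Ms s.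
Proof.
move=> s0 ab.
have ck := ker_cont. have cf := f_real_cont.
set h := fun t => 2 * (y0 * y0) * (s * ker t + / s * (Cmod (f (RtoC t)) * Cmod (f (RtoC t)) * ker t)).
have ch t : continuous h t by rewrite /h; cont_tac; first [exact: ck | exact: cf].
apply: Rle_trans (CI_norm_le _ a b h ab rcont_f1 ch _) _.
- move=> t _. rewrite f1_real /h. have k0 := ker_pos t. set X := Cmod (f (RtoC t)).
  have : 2 * X <= s + / s * (X * X).
    apply: (Rmult_le_reg_l s) => //. have -> : s * (s + / s * (X * X)) = s * s + X * X by field; lra. have := pow2_ge_0 (s - X). nra.
  move=> q. have : 2 * X * ker t <= (s + / s * (X * X)) * ker t by apply: Rmult_le_compat_r; lra.
  move/(Rmult_le_compat_l (2 * (y0 * y0)) _ _ ltac:(nra)). lra.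
- have c1 t : continuous (fun t => s * ker t) t by cont_tac; exact: ck.
  have c2 t : continuous (fun t => Cmod (f (RtoC t)) * Cmod (f (RtoC t)) * ker t) t by cont_tac; first [exact: ck | exact: cf].
  have c3 t : continuous (fun t => / s * (Cmod (f (RtoC t)) * Cmod (f (RtoC t)) * ker t)) t by cont_tac; first [exact: ck | exact: cf].
  have -> : RInt h a b = 2 * (y0 * y0) * (s * RInt ker a b + / s * RInt (fun t => Cmod (f (RtoC t)) * Cmod (f (RtoC t)) * ker t) a b).
    rewrite /h (@RInt_scal R_CompleteNormedModule) ?(@RInt_plus R_CompleteNormedModule) ?(@RInt_scal R_CompleteNormedModule) //; apply: exRc => t; cont_tac; first [exact: ck | exact: cf].
  apply: Rmult_le_compat_l; first nra. apply: Rplus_le_compat.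
  + apply: Rmult_le_compat_l; first lra. exact: poisson_mass.
  + rewrite /Rdiv (Rmult_comm J). apply: Rmult_le_compat_l; [left; exact: Rinv_0_lt_compat | exact: fJ].
Qed.

Lemma Psi_real s x : 0 < s -> Cmod (Psi (RtoC x)) <= Ms s.
Proof.
move=> s0. rewrite /Psi /prim /=.
have -> : CI (fun t => f1 (x, t)) 0 0 = 0%C by rewrite /CI RInt_point.
rewrite Cmult_0_r Cplus_0_r. case: (Rle_dec 0 x) => h; first exact: f1_int.
rewrite (CI_swap _ x 0) ?Cmod_opp; last by move=> t _; exact: rcont_f1.
apply: f1_int => //. lra.
Qed.

(** Mean type gives |f| <= N exp(e y) on the axis, and integration costs a factor y, which the
    second exponential absorbs. *)
Lemma Psi_imag e : 0 < e -> exists K, 0 < K /\ forall y, 0 <= y -> Cmod (Psi (0, y)) <= K * exp (2 * e * y).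
Proof.
move=> e0. have [Y HY] := fmt e e0.
set Y1 := Rmax 0 Y. have y1 : 0 <= Y1 by exact: Rmax_l. have y2 : Y <= Y1 by exact: Rmax_r.
have [N HN] := cont_bounded_rect f 0 0 0 Y1 ltac:(lra) y1 (fun z Hz => holo_cont f z (holo_at z (proj1 (proj2 Hz)))).
set N1 := Rmax 1 N. have n1 : 1 <= N1 by exact: Rmax_l. have n2 : N <= N1 by exact: Rmax_r.
have fi y : 0 <= y -> Cmod (f (0, y)) <= N1 * exp (e * y).
  move=> Hy. have ey := exp_pos (e * y). case: (Rle_dec y Y1) => h.
  - have h1 : Cmod (f (0, y)) <= N by apply: HN; split => /=; lra.
    have : 1 <= exp (e * y) by rewrite -exp_0; apply: exp_le_mono; nra. nra.
  - have := HY y ltac:(lra). nra.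
exists (4 * N1 / e); split; first by apply: Rdiv_lt_0_compat; lra.
move=> y Hy.
have seg (t : R) : 0 <= t <= 1 -> ((0 + t * ((0, y) - 0))%C = (0, t * y)) by move=> _; apply: injective_projections; simpl; ring.
have ty t : 0 <= t <= 1 -> 0 <= t * y <= y by nra.
have := path_bound Psi f1 0%C (0, y) (4 * (N1 * exp (e * y))) .
rewrite Psi_0 !Csub0. move=> H.
have Hm : Cmod (0, y) = y by rewrite /Cmod /=; replace (0 * (0 * 1) + y * (y * 1)) with (y * y) by ring; rewrite sqrt_square.
apply: (Rle_trans _ (4 * (N1 * exp (e * y)) * y)).
- rewrite Hm in H. apply: H => t Ht; have E := seg t Ht; rewrite (Csub0 (0, y)) in E; rewrite E; have := ty t Ht => h.
  + apply: Psi_cder => /=. lra.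
  + apply: holo_cont. apply: f1_holo => /=. lra.
  + apply: Rle_trans (f1_le _ _) _ => /=; first lra. apply: Rmult_le_compat_l; first lra.
    apply: Rle_trans (fi _ _) _; first lra. apply: Rmult_le_compat_l; first lra. apply: exp_le_mono. apply: Rmult_le_compat_l; lra.
- have -> : 2 * e * y = e * y + e * y by ring. rewrite exp_plus. have p := exp_pos (e * y). have q := exp_ineq1_le (e * y).
  have : e * y <= exp (e * y) by lra. move=> q2.
  have -> : 4 * (N1 * exp (e * y)) * y = 4 * N1 / e * (exp (e * y) * (e * y)) by field; lra.
  apply: Rmult_le_compat_l; first by left; apply: Rdiv_lt_0_compat; lra. apply: Rmult_le_compat_l; lra.
Qed.

Lemma Psi_bound s z : 0 < s -> 0 < snd z -> Cmod (Psi z) <= Ms s.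
Proof.
move=> s0 Hz. have M0 := Ms_pos s s0. set M := Ms s in M0 *.
suff H e : 0 < e -> Cmod (Psi z) <= M * exp (2 * e * snd z).
  apply: Rnot_lt_le => Hlt.
  have lp : 0 < ln (Cmod (Psi z) / M).
    rewrite -ln_1. apply: ln_increasing; first lra. apply: (Rmult_lt_reg_r M) => //. rewrite /Rdiv Rmult_assoc Rinv_l; lra.
  have := H (ln (Cmod (Psi z) / M) / (4 * snd z)) ltac:(apply: Rdiv_lt_0_compat; lra).
  have -> : 2 * (ln (Cmod (Psi z) / M) / (4 * snd z)) * snd z = ln (Cmod (Psi z) / M) / 2 by field; lra.
  have : exp (ln (Cmod (Psi z) / M) / 2) < exp (ln (Cmod (Psi z) / M)) by apply: exp_increasing; lra.
  rewrite exp_ln; last by apply: Rdiv_lt_0_compat; lra.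
  move/(Rmult_lt_compat_l M _ _ M0). replace (M * (Cmod (Psi z) / M)) with (Cmod (Psi z)) by (field; lra). lra.
move=> e0. have [K [K0 HK]] := Psi_imag e e0.
pose G w := (Psi w * cexp (Ci * ((2 * e)%R * w)))%C.
have GM w : Cmod (G w) = Cmod (Psi w) * exp (- (2 * e * snd w)).
  rewrite /G Cmod_mult Cmod_cexp /=. congr (_ * exp _). ring.
have GH w : 0 <= snd w -> holo G w.
  move=> Hw. apply: holo_mult; first by eexists; exact: Psi_cder.
  apply: (holo_comp cexp (fun w => Ci * ((2 * e)%R * w))%C); [holo_tac | exact: holo_cexp].
have GPsi w : 0 <= snd w -> Cmod (G w) <= Cmod (Psi w).
  move=> Hw. rewrite GM. have : exp (- (2 * e * snd w)) <= 1 by rewrite -exp_0; apply: exp_le_mono; nra.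
  have := Cmod_ge_0 (Psi w). nra.
have Greal x : ccont G (RtoC x) /\ Cmod (G (RtoC x)) <= M.
  split; first by apply: holo_cont; apply: GH => /=; lra.
  apply: Rle_trans (GPsi _ _) _ => /=; first lra. exact: Psi_real.
have Gimag y : 0 < y -> Cmod (G (0, y)) <= K.
  move=> Hy. rewrite GM /=. have := HK y ltac:(lra) => h.
  have : Cmod (Psi (0, y)) * exp (- (2 * e * y)) <= K * exp (2 * e * y) * exp (- (2 * e * y)) by apply: Rmult_le_compat_r => //; left; exact: exp_pos.
  by rewrite (Rmult_assoc K) -exp_plus Rplus_opp_r exp_0 Rmult_1_r.
set M' := Rmax M K. have m1 : M <= M' by exact: Rmax_l. have m2 : K <= M' by exact: Rmax_r.
(* The growth hypothesis on f has order R^2 / Im z with a fixed constant. This is admissible on a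
   quarter plane, where kap R^3 / Im z is allowed, but not on the half plane. The quarter planes
   give the bound max(M, K); a bounded function is admissible on the half plane, where only M
   remains. *)
have Q (sg : R) : sg * sg = 1 -> forall w, 0 < snd w -> 0 < sg * fst w -> Cmod (G w) <= M'.
  move=> sg1. apply: pl_quarter => //; first lra.
  - move=> w Hw. apply: GH. lra.
  - move=> x. have [h1 h2] := Greal x. split => //; lra.
  - move=> y Hy. have := Gimag y Hy. lra.
  - move=> kap R0 k0. set B := 8 + K + 2 * e + 2 * A.
    set R1 := Rmax (Rmax R0 1) (B / kap).
    have r1 : 1 <= R1 by apply: Rle_trans (Rmax_l _ _); exact: Rmax_r.
    have r0 : R0 <= R1 by apply: Rle_trans (Rmax_l _ _); exact: Rmax_l.
    have r2 : B <= kap * R1.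
      have -> : B = kap * (B / kap) by field; lra. apply: Rmult_le_compat_l; [lra | exact: Rmax_r].
    exists R1; split; first lra. split => // w Hw E. apply: Rle_trans (GPsi w ltac:(lra)) _.
    have wy : snd w <= R1 by have := snd_le_Cmod w; lra.
    have iR : Cmod (0, R1) = R1.
      rewrite /Cmod /=. have -> : 0 * (0 * 1) + R1 * (R1 * 1) = R1 * R1 by ring. rewrite sqrt_square; lra.
    have p1 : Cmod (Psi w - Psi (0, R1))%C <= 4 * exp (A * (1 + R1 * R1) / snd w) * Cmod (w - (0, R1))%C.
      (* The segment from i R1 to w remains in |z| <= R1 and above the height of w, so the growth
         hypothesis is uniform on it. *)
      have seg (t : R) : 0 <= t <= 1 -> snd w <= snd ((0, R1) + t * (w - (0, R1)))%C /\ Cmod ((0, R1) + t * (w - (0, R1)))%C <= R1.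
        move=> Ht. split; first by simpl; nra.
        have -> : ((0, R1) + t * (w - (0, R1)))%C = ((1 - t)%R * (0, R1) + t * w)%C by rewrite RtoC_minus; ring.
        apply: Rle_trans (Cmod_triangle _ _) _. rewrite !Cmod_mult !Cmod_R iR E (Rabs_pos_eq t) ?(Rabs_pos_eq (1 - t)); [|lra|lra].
        right. ring.
      apply: (path_bound Psi f1) => t Ht; have [h1 h2] := seg t Ht.
      - apply: Psi_cder. lra.
      - apply: holo_cont. apply: f1_holo. lra.
      - apply: Rle_trans (f1_le _ _) _; first lra. apply: Rmult_le_compat_l; first lra.
        apply: Rle_trans (fgrow _ _) _; first lra. apply: exp_le_mono.
        set u := ((0, R1) + t * (w - (0, R1)))%C in h1 h2 *. have u0 := Cmod_ge_0 u.
        have uu : Cmod u * Cmod u <= R1 * R1 by apply: Rmult_le_compat.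
        have iu := Rinv_0_lt_compat (snd u) ltac:(lra).
        apply: Rmult_le_compat; [nra | lra | by apply: Rmult_le_compat_l; lra |]. apply: Rinv_le_contravar; lra.
    have p2 : Cmod (w - (0, R1))%C <= 2 * R1 by have := Cmod_sub w (0, R1); lra.
    have p3 := HK R1 ltac:(lra).
    have p4 : Cmod (Psi w) <= Cmod (Psi w - Psi (0, R1))%C + Cmod (Psi (0, R1)) by have := Cmod_rev (Psi w) (Psi (0, R1)); lra.
    set a := A * (1 + R1 * R1) / snd w in p1.
    have a0 : 0 <= a by apply: Rmult_le_pos; [nra | left; exact: Rinv_0_lt_compat].
    set b := 2 * e * R1 in p3. have b0 : 0 <= b by rewrite /b; nra.
    have ea : exp a <= exp (a + b) by apply: exp_le_mono; lra. have eb : exp b <= exp (a + b) by apply: exp_le_mono; lra.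
    have p5 : Cmod (Psi w) <= (8 * R1 + K) * exp (a + b).
      have q1 : 4 * exp a * Cmod (w - (0, R1))%C <= 4 * exp a * (2 * R1) by apply: Rmult_le_compat_l => //; have := exp_pos a; lra.
      have q2 : R1 * exp a <= R1 * exp (a + b) by apply: Rmult_le_compat_l; lra.
      have q3 : K * exp b <= K * exp (a + b) by apply: Rmult_le_compat_l; lra. lra.
    apply: Rle_trans p5 _. apply: (Rle_trans _ (exp (8 * R1 + K) * exp (a + b))).
      apply: Rmult_le_compat_r; first by left; exact: exp_pos. have := exp_ineq1_le (8 * R1 + K). lra.
    rewrite -exp_plus. apply: exp_le_mono.
    apply: (Rmult_le_reg_r (snd w)) => //.
    have -> : (8 * R1 + K + (a + b)) * snd w = (8 * R1 + K + b) * snd w + A * (1 + R1 * R1) by rewrite /a; field; lra.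
    have -> : kap * (R1 * R1 * R1) / snd w * snd w = (kap * R1) * (R1 * R1) by field; lra.
    apply: (Rle_trans _ (B * (R1 * R1))); last by apply: Rmult_le_compat_r; nra.
    have q1 : (8 * R1 + K + b) * snd w <= (8 * R1 + K * R1 + b) * R1 by apply: Rmult_le_compat; nra.
    have q2 : A * (1 + R1 * R1) <= A * (2 * (R1 * R1)) by apply: Rmult_le_compat_l; nra.
    rewrite /B /b in q1 *. nra.
have G1 w : 0 < snd w -> Cmod (G w) <= M'.
  move=> Hw. case: (Rtotal_order (fst w) 0) => [h|[h|h]].
  - apply: (Q (-1)) => //; lra.
  - have -> : w = (0, snd w) by apply: injective_projections. have := Gimag (snd w) Hw. lra.
  - apply: (Q 1) => //; lra.
have G2 : Cmod (G z) <= M.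
  apply: (pl_half G M) => //.
  - move=> w Hw. apply: GH. lra.
  - move=> kap R0 k0. exists (Rmax R0 (Rmax 1 (M' / kap))); split; first exact: Rmax_l.
    set R1 := Rmax R0 (Rmax 1 (M' / kap)). move=> w Hw E.
    have r1 : 1 <= R1 by apply: Rle_trans (Rmax_r _ _); exact: Rmax_l.
    have r2 : M' <= kap * R1.
      have -> : M' = kap * (M' / kap) by field; lra. apply: Rmult_le_compat_l; first lra. apply: Rle_trans (Rmax_r _ _); exact: Rmax_r.
    have wy : snd w <= R1 by have := snd_le_Cmod w; lra.
    apply: Rle_trans (G1 w Hw) _. have := exp_ineq1_le (kap * R1).
    have : exp (kap * R1) <= exp (kap * (R1 * R1) / snd w); last lra.
    apply: exp_le_mono. apply: (Rmult_le_reg_r (snd w)) => //.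
    have -> : kap * (R1 * R1) / snd w * snd w = kap * R1 * R1 by field; lra. apply: Rmult_le_compat_l; nra.
rewrite GM in G2.
have -> : Cmod (Psi z) = Cmod (Psi z) * exp (- (2 * e * snd z)) * exp (2 * e * snd z) by rewrite (Rmult_assoc (Cmod _)) -exp_plus Rplus_opp_l exp_0 Rmult_1_r.
apply: Rmult_le_compat_r => //. left; exact: exp_pos.
Qed.

Lemma hardy_estimate : Cmod (f (x0, y0)) * Cmod (f (x0, y0)) <= 64 * PI * y0 * J.
Proof.
set X := Cmod (f (x0, y0)). have pi0 := PI_RGT_0.
have X0 : 0 <= X by exact: Cmod_ge_0.
have key s : 0 < s -> X <= 4 * PI * s + 4 * y0 * J / s.
  move=> s0.
  have disc w : Cmod (w - (x0, y0))%C < y0 -> 0 < snd w.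
    move=> Hw. have := Cmod_snd (w - (x0, y0))%C => /= h. have [h1 h2] := Rabs_def2 (snd w + - y0) y0 ltac:(lra). lra.
  have := cauchy_estimate Psi (x0, y0) y0 (Ms s) y00.
  have H1 w : Cmod (w - (x0, y0))%C < y0 -> holo Psi w.
    move=> Hw. eexists. apply: Psi_cder. have := disc w Hw. lra.
  have H2 w : Cmod (w - (x0, y0))%C < y0 -> Cmod (Psi w) <= Ms s.
    move=> Hw. apply: Psi_bound => //. exact: disc.
  move/(_ H1 H2). rewrite (cderiv_eq _ _ _ (Psi_cder (x0, y0) ltac:(simpl; lra))).
  have -> : f1 (x0, y0) = (- f (x0, y0))%C.
    rewrite /f1. have -> : ((x0, y0) - zb)%C = (Ci * (2 * y0)%R)%C by apply: injective_projections; simpl; ring.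
    have -> : (Ci * (2 * y0)%R * (Ci * (2 * y0)%R))%C = (- ((2 * y0) * (2 * y0))%R)%C by apply: injective_projections; simpl; ring.
    field. apply: Cneq_mod. rewrite Cmod_R Rabs_pos_eq; nra.
  rewrite Cmod_opp -/X.
  have -> : 2 * Ms s / y0 = 4 * PI * s + 4 * y0 * J / s by rewrite /Ms; field; lra. by [].
case: (Req_dec X 0) => hX.
  rewrite hX. have : 0 <= 64 * PI * y0 * J by apply: Rmult_le_pos => //; apply: Rmult_le_pos; lra. lra.
have Xp : 0 < X by lra.
(* With this weight the first term is X/2 and can be absorbed. *)
have := key (X / (8 * PI)) ltac:(apply: Rdiv_lt_0_compat; lra).
have -> : 4 * PI * (X / (8 * PI)) + 4 * y0 * J / (X / (8 * PI)) = X / 2 + 32 * PI * y0 * J / X by field; lra.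
move=> h. have : X * X <= (X / 2 + 32 * PI * y0 * J / X) * X by apply: Rmult_le_compat_r.
have -> : (X / 2 + 32 * PI * y0 * J / X) * X = X * X / 2 + 32 * PI * y0 * J by field; lra. lra.
Qed.
End HardyEstimate.


(** * Zeros, growth and functions of bounded type *)

Lemma pow_small x e : 0 <= x < 1 -> 0 < e -> exists k, x ^ k < e.
Proof.
move=> Hx e0. have [N HN] := pow_lt_1_zero x ltac:(rewrite Rabs_pos_eq; lra) e e0.
exists N. have := HN N (le_n _). rewrite Rabs_pos_eq //. apply: pow_le; lra.
Qed.

Lemma inv_pow_near k eta : 0 < eta -> exists r, 0 < r < 1 /\ forall x, r < x -> / x ^ k <= 1 + eta.
Proof.
move=> e0.
suff [r [Hr H]] : exists r, 0 < r < 1 /\ / (1 + eta) <= r ^ k.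
  exists r; split => // x Hx.
  have i0 : 0 < / (1 + eta) by apply: Rinv_0_lt_compat; lra.
  rewrite -(Rinv_inv (1 + eta)). apply: Rinv_le_contravar => //. apply: Rle_trans H _. apply: pow_incr; lra.
exists (1 - Rmin (1/2) (eta / ((1 + eta) * (INR k + 1)))).
have k0 := pos_INR k. set q := eta / ((1 + eta) * (INR k + 1)).
have q0 : 0 < q by apply: Rdiv_lt_0_compat => //; nra.
set d := Rmin (1/2) q. have d0 : 0 < d by apply: Rmin_glb_lt; lra.
have d1 : d <= 1/2 by exact: Rmin_l. have d2 : d <= q by exact: Rmin_r.
split; first lra.
have B : 1 - INR k * d <= (1 - d) ^ k.
  elim: k {k0 q q0 d2} d d0 d1 => [|k IH] d d0 d1; first by simpl; lra.
  rewrite S_INR. have := IH d d0 d1. have := pos_INR k. simpl. nra.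
apply: Rle_trans B.
have : INR k * d <= eta / (1 + eta).
  apply: (Rle_trans _ ((INR k + 1) * q)); first nra. right. rewrite /q. field. lra.
have -> : / (1 + eta) = 1 - eta / (1 + eta) by field; lra. lra.
Qed.

(* By the maximum principle |G| <= M |z|^k for all k. *)
Lemma flat_zero G M : (forall z, Cmod z < 1 -> holo G z) -> (forall z, Cmod z < 1 -> Cmod (G z) <= M) ->
  (forall k : nat, exists H, (forall z, Cmod z < 1 -> holo H z) /\ forall z, Cmod z < 1 -> G z = (z ^ k * H z)%C) ->
  forall z, Cmod z < 1 -> G z = 0%C.
Proof.
move=> HG HM Hdiv z Hz.
have M0 : 0 <= M by apply: Rle_trans (HM 0%C _); [exact: Cmod_ge_0 | rewrite Cmod_0; lra].
have B k : Cmod (G z) <= M * Cmod z ^ k.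
  have [H [hH E]] := Hdiv k. rewrite E // Cmod_mult Cmod_pow Rmult_comm.
  apply: Rmult_le_compat_r; first by apply: pow_le; exact: Cmod_ge_0.
  apply: (disc_max H 1 M) => // eta eta0.
  have [r [Hr K]] := inv_pow_near k (eta / (M + 1)) ltac:(apply: Rdiv_lt_0_compat; lra).
  exists r; split; first lra. move=> w h1 h2.
  have wp : 0 < Cmod w ^ k by apply: pow_lt; lra.
  have -> : Cmod (H w) = Cmod (G w) * / Cmod w ^ k.
    rewrite E // Cmod_mult Cmod_pow. field. lra.
  apply: (Rle_trans _ (M * (1 + eta / (M + 1)))).
    apply: Rmult_le_compat; [exact: Cmod_ge_0 | left; exact: Rinv_0_lt_compat | exact: HM | exact: K].
  have : M * (eta / (M + 1)) <= eta.
    have -> : M * (eta / (M + 1)) = eta * (M / (M + 1)) by field; lra.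
    have : M / (M + 1) <= 1 by apply: (Rmult_le_reg_r (M + 1)); [lra | rewrite /Rdiv Rmult_assoc Rinv_l; lra]. nra.
  lra.
apply: Cmod_eq_0. apply: Rle_antisym; last exact: Cmod_ge_0.
apply: le_epsilon => e e0. have z0 := Cmod_ge_0 z.
have [k Hk] := pow_small (Cmod z) (e / (M + 1)) ltac:(lra) ltac:(apply: Rdiv_lt_0_compat; lra).
apply: Rle_trans (B k) _. rewrite Rplus_0_l.
apply: (Rle_trans _ ((M + 1) * (e / (M + 1)))); last by right; field; lra.
have := pow_le (Cmod z) k z0 => p. nra.
Qed.

(** A function that is 0 near the origin can be divided by any power of z and remains holomorphic,
    so [flat_zero] applies. *)
Lemma vanish_near G M d : 0 < d -> (forall z, Cmod z < 1 -> holo G z) -> (forall z, Cmod z < 1 -> Cmod (G z) <= M) ->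
  (forall z, Cmod z < d -> G z = 0%C) -> forall z, Cmod z < 1 -> G z = 0%C.
Proof.
move=> d0 HG HM H0. apply: (flat_zero G M) => // k.
exists (fun z => G z / z ^ k)%C; split.
- move=> z Hz. case: (Rlt_le_dec (Cmod z) d) => h.
  + apply: (holo_ext_loc (fun _ => 0%C) _ _ (d - Cmod z)); first lra; last exact: holo_const.
    move=> w Hw. rewrite H0; first by rewrite /Cdiv; ring.
    have := Cmod_triangle (w - z)%C z. replace (w - z + z)%C with w by ring. lra.
  + have zp (j : nat) : holo (fun z => z ^ j)%C z.
      elim: j => [|j IH] /=; first exact: holo_const. apply: holo_mult => //. exact: holo_id.
    apply: holo_div => //; last exact: HG. apply: Cneq_mod. rewrite Cmod_pow. apply: pow_lt. lra.
- move=> z Hz. case: (classic (z = 0%C)) => [->|N].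
  + rewrite H0; last by rewrite Cmod_0. rewrite /Cdiv. ring.
  + field. apply: Cneq_mod. rewrite Cmod_pow. apply: pow_lt. exact: Cmod_pos.
Qed.

Lemma holo_affine f (a b : C) z : holo f (a + b * z)%C -> holo (fun w => f (a + b * w)%C) z.
Proof. move=> H. apply: (holo_comp f (fun w => a + b * w)%C) => //. holo_tac. Qed.

Lemma entire_flat_zero G w : (forall z, holo G z) ->
  (forall k : nat, exists H, (forall z, holo H z) /\ forall z, G z = ((z - w) ^ k * H z)%C) -> forall z, G z = 0%C.
Proof.
move=> HG Hdiv z. set r := Cmod (z - w)%C + 1. have r0 : 0 < r by rewrite /r; have := Cmod_ge_0 (z - w)%C; lra.
have rn : RtoC r <> 0%C by apply: Cneq_mod; rewrite Cmod_R Rabs_pos_eq; lra.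
have [M [M0 HM]] := entire_bounded_disc (fun u => G (w + r * u)%C) 1 (fun u => holo_affine G w r u (HG _)).
have := flat_zero (fun u => G (w + r * u)%C) M (fun u _ => holo_affine G w r u (HG _)) (fun u Hu => HM u (Rlt_le _ _ Hu)).
move=> F. have := F _ ((z - w) / r)%C. have -> : (w + r * ((z - w) / r))%C = z by field.
apply.
- move=> k. have [H [h1 h2]] := Hdiv k. exists (fun u => r ^ k * H (w + r * u))%C; split.
  + move=> u _. apply: holo_mult; [exact: holo_const | exact: holo_affine].
  + move=> u _. rewrite h2. replace (w + r * u - w)%C with (r * u)%C by ring. rewrite Cpow_mult_l. ring.
- rewrite Cmod_div // Cmod_R Rabs_pos_eq; last lra. apply: (Rmult_lt_reg_r r) => //. rewrite /Rdiv Rmult_assoc Rinv_l; [rewrite Rmult_1_r Rmult_1_l /r; lra | lra].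
Qed.

(** As long as the cofactor vanishes at w, one more factor can be split off; by [entire_flat_zero]
    this ends unless G = 0. *)
Lemma factor_zero G w : (forall z, holo G z) -> (exists z, G z <> 0%C) ->
  exists (k : nat) H, (forall z, holo H z) /\ H w <> 0%C /\ forall z, G z = ((z - w) ^ k * H z)%C.
Proof.
move=> HG [z0 nz]. apply: NNPP => N. apply: nz.
apply: (entire_flat_zero G w) => //. elim=> [|k [H [h1 h2]]].
  exists G; split => // z. simpl. ring.
have H0 : H w = 0%C.
  apply: NNPP => Hn. apply: N. by exists k, H.
exists (dq H w); split.
- move=> z. apply: (dq_holo H w 1) => //; lra.
- move=> z. rewrite h2. have := dq_mul H w z. rewrite H0. move=> E.
  replace (H z) with (H z - 0)%C by ring. rewrite -E. simpl. ring.
Qed.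

Lemma isolated_zeros G w : (forall z, holo G z) -> (exists z, G z <> 0%C) ->
  exists d, 0 < d /\ forall z, z <> w -> Cmod (z - w)%C < d -> G z <> 0%C.
Proof.
move=> HG nz. have [k [H [h1 [h2 h3]]]] := factor_zero G w HG nz.
have p := Cmod_pos _ h2. have [d [d0 K]] := holo_cont H w (h1 w) (Cmod (H w)) p.
exists d; split => // z zw Hz. rewrite h3. apply: Cmult_neq_0.
- apply: Cneq_mod. rewrite Cmod_pow. apply: pow_lt. apply: Cmod_pos. exact: Csub_neq0.
- move=> E. have := K z Hz. rewrite E. replace (0 - H w)%C with (- H w)%C by ring. rewrite Cmod_opp. lra.
Qed.

Lemma identity_segment G : (forall z, holo G z) -> (forall x : R, 0 < x < 1 -> G (RtoC x) = 0%C) -> forall z, G z = 0%C.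
Proof.
move=> HG H0 z. apply: NNPP => N. have [d [d0 K]] := isolated_zeros G (RtoC (1/2)) HG (ex_intro _ z N).
set h := Rmin (1/4) (d/2). have h0 : 0 < h by apply: Rmin_glb_lt; lra.
have h1 : h <= 1/4 by exact: Rmin_l. have h2 : h <= d/2 by exact: Rmin_r.
apply: (K (RtoC (1/2 + h))).
- move=> E. have := f_equal fst E. simpl. lra.
- have -> : (RtoC (1/2 + h) - RtoC (1/2))%C = RtoC h by rewrite -RtoC_minus; congr RtoC; ring. rewrite Cmod_R Rabs_pos_eq; lra.
- apply: H0. lra.
Qed.

(* Multiplying by (z - x)^2 - 4, which is O(|Im z|) on |z - x| = 2, removes the singularity 1/|Im z| of the bound. *)
Lemma offaxis_bound F K z : (forall z, holo F z) -> 0 <= K ->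
  (forall w, snd w <> 0 -> Cmod w <= Cmod z + 3 -> Cmod (F w) <= K * (1 + / Rabs (snd w))) -> Cmod (F z) <= 4 * K.
Proof.
move=> HF K0 H.
case: (Rle_lt_dec 1 (Rabs (snd z))) => hy.
  have := H z ltac:(move=> E; rewrite E Rabs_R0 in hy; lra) ltac:(lra) => h.
  have : / Rabs (snd z) <= 1 by rewrite -Rinv_1; apply: Rinv_le_contravar; lra. nra.
set x := fst z. pose P (w : C) := (F w * ((w - x) * (w - x) - 4))%C.
have zx : Cmod (z - x)%C <= 1.
  have -> : (z - x)%C = (0, snd z) by apply: injective_projections; simpl; rewrite /x; ring.
  apply: Rle_trans (Cmod_le_sum _) _. rewrite /= Rabs_R0. lra.
have PH w : holo P w by apply: holo_mult => //; holo_tac.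
(* On the circle the bound K (4|b| + 4) with |b| <= 2 gives 12 K. At z the polynomial has modulus at
   least 3, and 12/3 is the constant 4 of the statement. *)
have P4 : Cmod (P z) <= 12 * K.
  apply: (max_principle (fun w => Cmod (w - x)%C < 2) P (12 * K) (Cmod x + 2)); try lra.
  - move=> w Hw. exact: disc_open.
  - move=> w Hw. have := Cmod_rev w x. lra.
  - move=> w _. exact: PH.
  - move=> p Np eta eta0. case: (Rtotal_order (Cmod (p - x)%C) 2) => [h|[h|h]]; first by case: Np.
    + apply: (cont_boundary P p (12 * K) (holo_cont _ _ (PH p)) _ (fun w => Cmod (w - x)%C < 2)) => //.
      have h2 := Cmod_sq (p - x)%C. rewrite h /= in h2. set a := fst p in h2. set b := snd p in h2.
      have mod4 : Cmod ((p - x) * (p - x) - 4)%C = 4 * Rabs b.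
        have e : Cmod ((p - x) * (p - x) - 4)%C * Cmod ((p - x) * (p - x) - 4)%C = (4 * Rabs b) * (4 * Rabs b).
          have bb : Rabs b * Rabs b = b * b by rewrite -Rabs_mult Rabs_pos_eq //; nra.
          rewrite Cmod_sq /= -/a -/b. nra.
        apply: Rsqr_inj; [exact: Cmod_ge_0 | have := Rabs_pos b; lra | exact: e].
      rewrite /P Cmod_mult mod4. case: (Req_dec b 0) => hb.
        rewrite hb Rabs_R0 !Rmult_0_r. lra.
      have ba : Rabs b <= 2.
        apply: Rsqr_incr_0_var; last lra. rewrite -Rsqr_abs /Rsqr. have := Rle_0_sqr (a + - x). rewrite /Rsqr. nra.
      have bp : 0 < Rabs b by apply: Rabs_pos_lt.
      have := H p hb. have : Cmod p <= Cmod z + 3.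
        have := Cmod_triangle (p - x)%C x. replace (p - x + x)%C with p by ring. rewrite h Cmod_R. have := Cmod_fst z. rewrite -/x. lra.
      move=> q /(_ q). rewrite -/b => h3.
      have : Cmod (F p) * (4 * Rabs b) <= K * (1 + / Rabs b) * (4 * Rabs b) by apply: Rmult_le_compat_r; lra.
      have -> : K * (1 + / Rabs b) * (4 * Rabs b) = K * (4 * Rabs b + 4) by field; lra. nra.
    + exists (Cmod (p - x)%C - 2); split; first lra. move=> w Sw Hw.
      have := Cmod_triangle (p - w)%C (w - x)%C. replace (p - w + (w - x))%C with (p - x)%C by ring. rewrite (Cmod_sub_sym p w). lra.
have q3 : 3 <= Cmod ((z - x) * (z - x) - 4)%C.
  have := Cmod_rev 4 ((z - x) * (z - x))%C. rewrite Cmod_sub_sym Cmod_mult Cmod_R Rabs_pos_eq; last lra. have := Cmod_ge_0 (z - x)%C. nra.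
rewrite /P Cmod_mult in P4. have := Cmod_ge_0 (F z). nra.
Qed.

(** On |w| <= |z| + 3 the hypothesis has the shape of [offaxis_bound]; enlarging the disc costs the
    constant exp(3e). *)
Lemma type_zero_offaxis F : (forall z, holo F z) ->
  (forall e, 0 < e -> exists K, 0 < K /\ forall z, snd z <> 0 -> Cmod (F z) <= K * exp (e * Cmod z) * (1 + / Rabs (snd z))) -> type_zero F.
Proof.
move=> HF H e e0. have [K [K0 HK]] := H e e0.
exists (4 * (K * exp (3 * e))); split; first by have := exp_pos (3 * e); nra.
move=> z. have -> : 4 * (K * exp (3 * e)) * exp (e * Cmod z) = 4 * (K * exp (e * (Cmod z + 3))).
  have -> : e * (Cmod z + 3) = 3 * e + e * Cmod z by ring. rewrite exp_plus. ring.
apply: offaxis_bound => //; first by left; apply: Rmult_lt_0_compat => //; exact: exp_pos.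
move=> w wn Hw. apply: Rle_trans (HK w wn) _.
have ip : 0 < / Rabs (snd w) by apply: Rinv_0_lt_compat; exact: Rabs_pos_lt.
apply: Rmult_le_compat_r; first lra. apply: Rmult_le_compat_l; first lra. apply: exp_le_mono. apply: Rmult_le_compat_l; lra.
Qed.

(* Phragmen-Lindelof in the left and right half planes. *)
Lemma type_zero_axis_const L M : (forall z, holo L z) -> type_zero L -> 0 < M -> (forall y, Cmod (L (0, y)) <= M) -> forall z w, L z = L w.
Proof.
move=> HL T M0 Hax. apply: (liouville L M HL).
have side (s : C) : Cmod s = 1 -> (forall x : R, fst (s * x)%C = 0) -> forall z, 0 < snd z -> Cmod (L (s * z)%C) <= M.
  move=> s1 sx. apply: (pl_half (fun z => L (s * z)%C)) => //.
  - move=> z _. exact: holo_scale.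
  - move=> x. split; first by apply: holo_cont; exact: holo_scale.
    have -> : (s * x)%C = (0, snd (s * x)%C) by apply: injective_projections => //=; have := sx x. exact: Hax.
  - move=> kap R0 k0. have [K [K0 HK]] := T (kap / 2) ltac:(lra).
    set R1 := Rmax R0 (Rmax 1 (2 * K / kap)). exists R1; split; first exact: Rmax_l.
    have r1 : 1 <= R1 by apply: Rle_trans (Rmax_r _ _); exact: Rmax_l.
    have r2 : 2 * K <= kap * R1.
      have -> : 2 * K = kap * (2 * K / kap) by field; lra. apply: Rmult_le_compat_l; first lra. apply: Rle_trans (Rmax_r _ _); exact: Rmax_r.
    move=> z Hz E. apply: Rle_trans (HK _) _. rewrite Cmod_mult s1 Rmult_1_l E.
    apply: (Rle_trans _ (exp (kap * R1 / 2) * exp (kap / 2 * R1))).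
      apply: Rmult_le_compat_r; first by left; exact: exp_pos. have := exp_ineq1_le (kap * R1 / 2). lra.
    rewrite -exp_plus. apply: exp_le_mono.
    have zy : snd z <= R1 by have := snd_le_Cmod z; lra.
    apply: (Rmult_le_reg_r (snd z)) => //. have -> : kap * (R1 * R1) / snd z * snd z = kap * R1 * R1 by field; lra.
    have -> : (kap * R1 / 2 + kap / 2 * R1) * snd z = kap * R1 * snd z by field. apply: Rmult_le_compat_l; nra.
move=> z. case: (Rtotal_order (fst z) 0) => [h|[h|h]].
- have E : z = (Ci * ((snd z, (- fst z)%R) : C))%C by apply: injective_projections; simpl; ring.
  rewrite E. apply: side => /=; [exact: Cmod_Ci | by move=> x; ring | lra].
- have -> : z = (0, snd z) by apply: injective_projections. exact: Hax.
- have E : z = (- Ci * (((- snd z)%R, fst z) : C))%C by apply: injective_projections; simpl; ring.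
  rewrite E. apply: side => /=; [by rewrite Cmod_opp Cmod_Ci | by move=> x; ring | lra].
Qed.

(** * Growth of functions of bounded type *)

Section BoundedTypeGrowth.
Variables (f h : C -> C) (z0 : C) (M : R).
Hypothesis y0 : 0 < snd z0.
Hypothesis fh : forall z, 0 < snd z -> holo f z.
Hypothesis hh : forall z, 0 < snd z -> holo h z.
Hypothesis hM : forall z, 0 < snd z -> Cmod (h z) <= M.
Hypothesis fhM : forall z, 0 < snd z -> Cmod (f z * h z)%C <= M.
Hypothesis h0 : h z0 <> 0%C.

(** The conformal map of the unit disc onto the upper half plane that takes 0 to z0. *)
Definition cayley (z0 u : C) : C := ((z0 - Cconj z0 * u) / (1 - u))%C.

Lemma one_minus_neq0 (u : C) : Cmod u < 1 -> (1 - u)%C <> 0%C.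
Proof. move=> Hu. apply: Cneq_mod. have := Cmod_rev 1 u. rewrite Cmod_1. lra. Qed.

Lemma cayley_im u : Cmod u < 1 -> 0 < snd (cayley z0 u).
Proof.
move=> Hu. have n := one_minus_neq0 u Hu. have p := Cmod_pos _ n.
have m := Cmod_sq (1 - u)%C. have m2 := Cmod_sq u.
have E : snd (cayley z0 u) * (Cmod (1 - u)%C * Cmod (1 - u)%C) = snd z0 * (1 - Cmod u * Cmod u).
  have d : Cmod (1 - u)%C * Cmod (1 - u)%C <> 0 by apply: Rgt_not_eq; nra.
  rewrite m in d *. rewrite m2 /cayley /=. simpl in d. field. move=> q. apply: d. lra.
have : 0 < snd z0 * (1 - Cmod u * Cmod u) by apply: Rmult_lt_0_compat => //; have := Cmod_ge_0 u; nra.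
have : 0 < Cmod (1 - u)%C * Cmod (1 - u)%C by nra. nra.
Qed.

Lemma cayley_holo u : Cmod u < 1 -> holo (cayley z0) u.
Proof. move=> Hu. refine (holo_div (fun u => z0 - Cconj z0 * u)%C (fun u => 1 - u)%C _ (one_minus_neq0 u Hu) _ _); holo_tac. Qed.

Lemma cayley_0 : cayley z0 0 = z0.
Proof. rewrite /cayley. field. Qed.

(** From 1 - |u|^2 = 4 Im z0 Im z / |z - conj(z0)|^2. The bound for 1/(1 - |u|) translates
    [quotient_bound] from the disc to the half plane. *)
Lemma cayley_inv z : 0 < snd z -> exists u, cayley z0 u = z /\ Cmod u < 1 /\ / (1 - Cmod u) <= (1 + Cmod z0 * Cmod z0) * (1 + Cmod z * Cmod z) / (snd z0 * snd z).
Proof.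
move=> Hz. set u := ((z - z0) / (z - Cconj z0))%C.
have nz : (z - Cconj z0)%C <> 0%C.
  move=> E. have := f_equal snd E. simpl. lra.
have nz2 : (z0 - Cconj z0)%C <> 0%C.
  move=> E. have := f_equal snd E. simpl. lra.
have dp := Cmod_pos _ nz.
have um : Cmod u * Cmod (z - Cconj z0)%C = Cmod (z - z0)%C.
  rewrite -Cmod_mult. congr Cmod. rewrite /u. field. exact: nz.
have s1 := Cmod_sq (z - Cconj z0)%C. have s2 := Cmod_sq (z - z0)%C. rewrite /= in s1 s2.
set D := Cmod (z - Cconj z0)%C in dp um s1.
have key : (1 - Cmod u * Cmod u) * (D * D) = 4 * (snd z0 * snd z).
  have -> : (1 - Cmod u * Cmod u) * (D * D) = D * D - (Cmod u * D) * (Cmod u * D) by ring. rewrite um s1 s2. ring.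
have yy : 0 < snd z0 * snd z by exact: Rmult_lt_0_compat.
have u0 := Cmod_ge_0 u. have DD : 0 < D * D by nra.
have uu : 0 < 1 - Cmod u * Cmod u by apply: (Rmult_lt_reg_r (D * D)); [exact: DD | rewrite key; lra].
have u1 : Cmod u < 1 by nra.
exists u; split; [|split => //].
- rewrite /cayley /u. field. split; [exact: nz|].
  replace (z - Cconj z0 - (z - z0))%C with (z0 - Cconj z0)%C by ring. exact: nz2.
- have D2 : D * D <= 2 * ((1 + Cmod z0 * Cmod z0) * (1 + Cmod z * Cmod z)).
    have : D <= Cmod z + Cmod z0 by have := Cmod_sub z (Cconj z0); rewrite Cmod_conj.
    have := Cmod_ge_0 z. have := Cmod_ge_0 z0. move: (Cmod z) (Cmod z0) => a b b0 a0 hD.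
    have : D * D <= (a + b) * (a + b) by apply: Rmult_le_compat; lra.
    have := pow2_ge_0 (a - b). have : 0 <= (b * b) * (a * a) by apply: Rmult_le_pos; nra. nra.
  have i1 : / (1 - Cmod u) <= 2 * / (1 - Cmod u * Cmod u).
    have -> : 2 * / (1 - Cmod u * Cmod u) = / ((1 - Cmod u * Cmod u) / 2) by field; nra.
    apply: Rinv_le_contravar; nra.
  apply: Rle_trans i1 _.
  have -> : / (1 - Cmod u * Cmod u) = D * D / (4 * (snd z0 * snd z)) by rewrite -key; field; split; apply: Rgt_not_eq; nra.
  have -> : 2 * (D * D / (4 * (snd z0 * snd z))) = (D * D / 2) / (snd z0 * snd z) by field; split; lra.
  apply: Rmult_le_compat_r; [left; exact: Rinv_0_lt_compat | lra].
Qed.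

(** Transports [quotient_bound] by [cayley]; the resulting growth is the hypothesis [fgrow] of the
    Hardy estimate. *)
Lemma bounded_type_growth : exists A, 0 <= A /\ forall z, 0 < snd z -> Cmod (f z) <= exp (A * (1 + Cmod z * Cmod z) / snd z).
Proof.
have hp := Cmod_pos _ h0. have M0 : 0 < M by have := hM z0 y0; lra.
have Mn : RtoC M <> 0%C by apply: Cneq_mod; rewrite Cmod_R Rabs_pos_eq; lra.
pose g u := (h (cayley z0 u) * / M)%C. pose L u := f (cayley z0 u).
have gE u : Cmod (g u) = Cmod (h (cayley z0 u)) / M by rewrite /g Cmod_mult Cmod_inv // Cmod_R Rabs_pos_eq //; lra.
have div x : x <= M -> x / M <= 1 by move=> hx; apply: (Rmult_le_reg_r M) => //; rewrite /Rdiv Rmult_assoc Rinv_l; lra.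
have g0 : g 0%C <> 0%C by apply: Cneq_mod; rewrite gE cayley_0; exact: Rdiv_lt_0_compat.
have Q := quotient_bound L g _ _ _ _ g0.
set c := - ln (Cmod (g 0%C)).
have c0 : 0 <= c.
  have : ln (Cmod (g 0%C)) <= ln 1 by apply: ln_le; [exact: Cmod_pos | rewrite gE cayley_0; apply: div; exact: hM].
  rewrite ln_1 /c. lra.
exists (c * 4 * (1 + Cmod z0 * Cmod z0) / snd z0); split.
  apply: Rmult_le_pos; last by left; exact: Rinv_0_lt_compat. apply: Rmult_le_pos; first lra. have := Cmod_ge_0 z0. nra.
move=> z Hz. have [u [uz [u1 ub]]] := cayley_inv z Hz.
have -> : f z = L u by rewrite /L uz.
apply: Rle_trans (Q _ _ _ _ u u1) _.
- move=> w Hw. apply: (holo_comp f (cayley z0)); [exact: cayley_holo | apply: fh; exact: cayley_im].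
- move=> w Hw. apply: holo_mult; last exact: holo_const. apply: (holo_comp h (cayley z0)); [exact: cayley_holo | apply: hh; exact: cayley_im].
- move=> w Hw. rewrite gE. apply: div. apply: hM. exact: cayley_im.
- move=> w Hw. rewrite /g /L Cmult_assoc Cmod_mult Cmod_inv // Cmod_R (Rabs_pos_eq M); last lra. apply: div. apply: fhM. exact: cayley_im.
- apply: exp_le_mono. rewrite -/c.
  have : c * (4 / (1 - Cmod u)) <= c * 4 * ((1 + Cmod z0 * Cmod z0) * (1 + Cmod z * Cmod z) / (snd z0 * snd z)).
    rewrite /Rdiv -Rmult_assoc. apply: Rmult_le_compat_l; [lra | exact: ub].
  move=> h1. apply: Rle_trans h1 _. right. field. split; lra.
Qed.
End BoundedTypeGrowth.

(** Supplies the common denominator of a sum. If the product were 0 everywhere, h2 would vanish near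
    z1, where h1 does not, and hence on the whole half plane, seen as a disc through [cayley]. *)
Lemma upper_product_neq0 h1 h2 (z1 z2 : C) M : (forall z, 0 < snd z -> holo h1 z) -> (forall z, 0 < snd z -> holo h2 z) ->
  (forall z, 0 < snd z -> Cmod (h2 z) <= M) -> 0 < snd z1 -> 0 < snd z2 -> h1 z1 <> 0%C -> h2 z2 <> 0%C ->
  exists z, 0 < snd z /\ (h1 z * h2 z)%C <> 0%C.
Proof.
move=> H1 H2 HM y1 y2 n1 n2. apply: NNPP => N. apply: n2.
have [d [d0 K]] := holo_cont h1 z1 (H1 z1 y1) (Cmod (h1 z1)) (Cmod_pos _ n1).
have cc : ccont (cayley z1) 0 by apply: holo_cont; apply: cayley_holo; rewrite Cmod_0; lra.
have [e [e0 Ke]] := cc d d0.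
have e1 : 0 < Rmin e 1 by apply: Rmin_glb_lt; lra.
have V := vanish_near (fun u => h2 (cayley z1 u)) M (Rmin e 1) e1.
have [u [uz [u1 _]]] := cayley_inv z1 y1 z2 y2.
rewrite -uz. apply: V => //.
- move=> w Hw. apply: (holo_comp h2 (cayley z1)); [exact: cayley_holo | apply: H2; exact: cayley_im].
- move=> w Hw. apply: HM. exact: cayley_im.
- move=> w Hw. have := Rmin_l e 1. have := Rmin_r e 1 => a b.
  have w1 : Cmod w < 1 by lra. have wy := cayley_im z1 y1 w w1.
  have k := Ke w ltac:(rewrite Csub0; lra). rewrite cayley_0 in k => //.
  have k2 := K _ k. apply: NNPP => n. apply: N. exists (cayley z1 w); split => //. apply: Cmult_neq_0 => //.
  move=> E. rewrite E in k2. replace (0 - h1 z1)%C with (- h1 z1)%C in k2 by ring. rewrite Cmod_opp in k2. lra.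
Qed.


(** * Separating functionals on L2 spaces *)

(* Abstract properties of the square-integrable functions of a measure on R, with the real part of the inner product. *)
Record L2space (Lp : (R -> C) -> Prop) (ip : (R -> C) -> (R -> C) -> R) : Prop := {
  l2_add : forall f g, Lp f -> Lp g -> Lp (fun t => f t + g t)%C;
  l2_scal : forall c f, Lp f -> Lp (fun t => c * f t)%C;
  ip_sym : forall f g, ip f g = ip g f;
  ip_add : forall f g h, Lp f -> Lp g -> Lp h -> ip (fun t => f t + g t)%C h = ip f h + ip g h;
  ip_scal : forall (r : R) f g, Lp f -> Lp g -> ip (fun t => r * f t)%C g = r * ip f g;
  ip_Ci : forall f, ip (fun t => Ci * f t)%C (fun t => Ci * f t)%C = ip f f;
  ip_ge0 : forall f, 0 <= ip f f;
  ip_pointwise : forall f g f' g', (forall t, fst (f t) * fst (g t) + snd (f t) * snd (g t) = fst (f' t) * fst (g' t) + snd (f' t) * snd (g' t)) ->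
    ip f g = ip f' g';
  l2_dom : forall phi kappa c, (forall t, rcont phi t) -> Lp kappa -> 0 <= c -> (forall t, Cmod (phi t) <= c * Cmod (kappa t)) ->
    Lp phi /\ ip phi phi <= c * c * ip kappa kappa;
  l2_tail : forall G, (forall t, rcont G t) -> Lp G -> forall e, 0 < e -> exists Y, forall y, Y <= Rabs y ->
    ip (fun t => t * G t / (t - (0, y)))%C (fun t => t * G t / (t - (0, y)))%C <= e }.

Record functional (Lp : (R -> C) -> Prop) (ip : (R -> C) -> (R -> C) -> R) (ell : (R -> C) -> C) : Prop := {
  fn_add : forall f g, Lp f -> Lp g -> ell (fun t => f t + g t)%C = (ell f + ell g)%C;
  fn_scal : forall c f, Lp f -> ell (fun t => c * f t)%C = (c * ell f)%C;
  fn_bd : exists K, 0 <= K /\ forall f, Lp f -> Cmod (ell f) <= K * sqrt (ip f f) }.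

Section L2.
Variables (Lp : (R -> C) -> Prop) (ip : (R -> C) -> (R -> C) -> R).
Hypothesis LI : L2space Lp ip.

Lemma l2_scal_add (r : C) f g : Lp f -> Lp g -> Lp (fun t => f t + r * g t)%C.
Proof. move=> hf hg. apply: (l2_add _ _ LI f (fun t => r * g t)%C) => //. exact: (l2_scal _ _ LI). Qed.

Lemma ip_lin (r : R) f g h : Lp f -> Lp g -> Lp h -> ip (fun t => f t + r * g t)%C h = ip f h + r * ip g h.
Proof.
move=> hf hg hh. rewrite (ip_add _ _ LI f (fun t => r * g t)%C) //; last exact: (l2_scal _ _ LI).
by rewrite (ip_scal _ _ LI).
Qed.

Lemma ip_expand (r : R) f g : Lp f -> Lp g ->
  ip (fun t => f t + r * g t)%C (fun t => f t + r * g t)%C = ip f f + 2 * r * ip f g + r * r * ip g g.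
Proof.
move=> hf hg. have hs := l2_scal_add r f g hf hg. rewrite ip_lin // (ip_sym _ _ LI f) (ip_sym _ _ LI g) !ip_lin // (ip_sym _ _ LI g f). ring.
Qed.

Lemma discriminant_ineq a b c : 0 <= c -> (forall r, 0 <= a + 2 * r * b + r * r * c) -> b * b <= a * c.
Proof.
move=> c0 H. case: (Req_dec c 0) => hc.
  case: (Req_dec b 0) => hb; first by rewrite hc hb; lra.
  (* For c = 0 and b nonzero this r makes the left side equal to -1. *)
  have := H (- (a + 1) / (2 * b)). rewrite hc.
  have -> : a + 2 * (- (a + 1) / (2 * b)) * b + - (a + 1) / (2 * b) * (- (a + 1) / (2 * b)) * 0 = -1 by field. lra.
have := H (- b / c). have -> : a + 2 * (- b / c) * b + - b / c * (- b / c) * c = (a * c - b * b) / c by field.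
move=> h. have : 0 <= (a * c - b * b) / c * c by apply: Rmult_le_pos.
have -> : (a * c - b * b) / c * c = a * c - b * b by field. lra.
Qed.

Lemma ip_CS f g : Lp f -> Lp g -> ip f g * ip f g <= ip f f * ip g g.
Proof.
move=> hf hg. apply: discriminant_ineq; first exact: (ip_ge0 _ _ LI). move=> r. rewrite -ip_expand //. exact: (ip_ge0 _ _ LI).
Qed.

Lemma ip_parallelogram f g : Lp f -> Lp g -> ip (fun t => f t + g t)%C (fun t => f t + g t)%C <= 2 * ip f f + 2 * ip g g.
Proof.
move=> hf hg.
have E1 := ip_expand 1 f g hf hg. have E2 := ip_expand (-1) f g hf hg.
have E : (fun t => f t + 1 * g t)%C = (fun t => f t + g t)%C by apply: functional_extensionality => t; ring.
rewrite E in E1. have := ip_ge0 _ _ LI (fun t => f t + (-1)%R * g t)%C. lra.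
Qed.

Lemma INR1_inv n : 0 < / (INR n + 1).
Proof. apply: Rinv_0_lt_compat. have := pos_INR n. lra. Qed.

Lemma inv_INR_lim c : is_lim_seq (fun n => c * / (INR n + 1)) 0.
Proof.
have -> : Finite 0 = Rbar_mult c (Finite 0) by rewrite /= Rmult_0_r.
apply: is_lim_seq_scal_l. apply/is_lim_seq_spec => e.
have [N HN] := INR_unbounded (/ e). exists N => n Hn.
rewrite Rminus_0_r Rabs_pos_eq; last by left; exact: INR1_inv. rewrite -(Rinv_inv e).
have e0 := Rinv_0_lt_compat _ (cond_pos e). have := le_INR _ _ Hn => h.
apply: Rinv_lt_contravar; [apply: Rmult_lt_0_compat|]; lra.
Qed.

Lemma cauchy_rate u c : 0 <= c -> (forall n k, (u n - u k) * (u n - u k) <= c * (/ (INR n + 1) + / (INR k + 1))) -> ex_finite_lim_seq u.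
Proof.
move=> c0 H. apply/ex_lim_seq_cauchy_corr => e. have e0 := cond_pos e.
have := inv_INR_lim (2 * c). move/is_lim_seq_spec. move=> /(_ (mkposreal (e * e) (Rmult_lt_0_compat _ _ e0 e0))) [N HN]. simpl in HN.
exists N => n k hn hk. have h1 := H n k. have h2 := HN N (le_n _). rewrite Rminus_0_r in h2.
have N0 := INR1_inv N. rewrite Rabs_pos_eq in h2; last by apply: Rmult_le_pos; lra.
have le i : (N <= i)%nat -> / (INR i + 1) <= / (INR N + 1).
  move=> hi. apply: Rinv_le_contravar; first by have := pos_INR N; lra. have := le_INR _ _ hi. lra.
have l1 := le n hn. have l2 := le k hk.
have h3 : (u n - u k) * (u n - u k) < e * e.
  apply: Rle_lt_trans h1 _. apply: Rle_lt_trans h2. nra.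
apply: Rabs_def1; nra.
Qed.

(** A complex linear functional is determined by its real part l as f -> l(f) - i l(i f). *)
Lemma functional_of_real (lR : (R -> C) -> R) (K : R) : 0 <= K ->
  (forall f g, Lp f -> Lp g -> lR (fun t => f t + g t)%C = lR f + lR g) ->
  (forall (r : R) f, Lp f -> lR (fun t => r * f t)%C = r * lR f) ->
  (forall f, Lp f -> Rabs (lR f) <= K * sqrt (ip f f)) -> functional Lp ip (fun f => (lR f, - lR (fun t => Ci * f t)%C)).
Proof.
move=> K0 l_add l_scal l_bd.
have negf f : Lp f -> lR (fun t => Ci * (Ci * f t))%C = - lR f.
  move=> hf. have -> : (fun t => Ci * (Ci * f t))%C = (fun t => (-1)%R * f t)%C.
    apply: functional_extensionality => t. apply: injective_projections; simpl; ring.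
  rewrite l_scal //. ring.
have iL f : Lp f -> Lp (fun t => Ci * f t)%C by exact: (l2_scal _ _ LI).
split.
- move=> f g hf hg. rewrite l_add //.
  have -> : (fun t => Ci * (f t + g t))%C = (fun t => Ci * f t + Ci * g t)%C by apply: functional_extensionality => t; ring.
  rewrite (l_add (fun t => Ci * f t)%C (fun t => Ci * g t)%C); [apply: injective_projections; simpl; ring | exact: iL | exact: iL].
- move=> [a b] f hf. have hi := iL f hf.
  have E1 : lR (fun t => (a, b) * f t)%C = a * lR f + b * lR (fun t => Ci * f t)%C.
    rewrite -!l_scal // -(l_add (fun t => a * f t)%C (fun t => b * (Ci * f t))%C); try exact: (l2_scal _ _ LI).
    f_equal. apply: functional_extensionality => t. apply: injective_projections; simpl; ring.
  have E2 : lR (fun t => Ci * ((a, b) * f t))%C = a * lR (fun t => Ci * f t)%C - b * lR f.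
    have -> : a * lR (fun t => Ci * f t)%C - b * lR f = a * lR (fun t => Ci * f t)%C + b * lR (fun t => Ci * (Ci * f t))%C by rewrite negf //; ring.
    rewrite -!l_scal // -?(l_add (fun t => a * (Ci * f t))%C (fun t => b * (Ci * (Ci * f t)))%C); try exact: (l2_scal _ _ LI).
    f_equal. apply: functional_extensionality => t. apply: injective_projections; simpl; ring. all: do ?[exact: hf | apply: (l2_scal _ _ LI)].
  rewrite E1 E2. apply: injective_projections; simpl; ring.
- exists (2 * K); split; first lra.
  move=> f hf. apply: Rle_trans (Cmod_le_sum _) _. rewrite /= Rabs_Ropp. have := l_bd f hf. have := l_bd _ (iL f hf). rewrite (ip_Ci _ _ LI). lra.
Qed.

Section Separation.
Variables (S : (R -> C) -> Prop) (x0 : R -> C) (d : R).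
Hypothesis S_Lp : forall s, S s -> Lp s.
Hypothesis S_add : forall f g, S f -> S g -> S (fun t => f t + g t)%C.
Hypothesis S_scal : forall c f, S f -> S (fun t => c * f t)%C.
Hypothesis S_ne : exists s, S s.
Hypothesis x0_Lp : Lp x0.
Hypothesis d0 : 0 < d.
Hypothesis S_dist : forall s, S s -> d <= ip (fun t => x0 t - s t)%C (fun t => x0 t - s t)%C.

Lemma error_Lp s : S s -> Lp (fun t => x0 t - s t)%C.
Proof.
move=> hs. have -> : (fun t => x0 t - s t)%C = (fun t => x0 t + (-1)%R * s t)%C by apply: functional_extensionality => t; apply: injective_projections; simpl; ring.
apply: l2_scal_add => //. exact: S_Lp.
Qed.

Lemma minimizing_sequence : exists m (s : nat -> R -> C), d <= m /\ (forall n, S (s n)) /\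
  (forall f, S f -> m <= ip (fun t => x0 t - f t)%C (fun t => x0 t - f t)%C) /\
  forall n, ip (fun t => x0 t - s n t)%C (fun t => x0 t - s n t)%C <= m + / (INR n + 1).
Proof.
pose Q s := ip (fun t => x0 t - s t)%C (fun t => x0 t - s t)%C.
have [s1 hs1] := S_ne.
have [m [m1 m2]] : {m | is_lub (fun x => exists s, S s /\ x = - Q s) m}.
  apply: completeness; last by exists (- Q s1), s1.
  exists (- d) => x [s [hs ->]]. have := S_dist s hs. rewrite -/(Q s). lra.
have dm : m <= - d by apply: m2 => x [s [hs ->]]; have := S_dist s hs; rewrite -/(Q s); lra.
have ex n : exists s, S s /\ Q s <= - m + / (INR n + 1).
  apply: NNPP => N. have i0 := INR1_inv n.
  have : m <= m - / (INR n + 1); last lra.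
  apply: m2 => x [s [hs ->]]. apply: Rnot_lt_le => h. apply: N. exists s; split => //. lra.
exists (- m), (fun n => proj1_sig (constructive_indefinite_description _ (ex n))).
split; first lra. split; [|split].
- move=> n. by case: (constructive_indefinite_description _ _) => s [].
- move=> f hf. have := m1 (- Q f) (ex_intro _ f (conj hf eq_refl)). rewrite -/(Q f). lra.
- move=> n. by case: (constructive_indefinite_description _ _) => s [].
Qed.

(* The functional is the inner product with the component of x0 orthogonal to S. *)
Lemma separating_functional : exists ell, functional Lp ip ell /\ (forall s, S s -> ell s = 0%C) /\ ell x0 <> 0%C.
Proof.
have [m [s [dm [hs [mS ms]]]]] := minimizing_sequence.
pose e n t := (x0 t - s n t)%C.
have eL n : Lp (e n) by apply: error_Lp.
have Qe n : ip (e n) (e n) <= m + / (INR n + 1) by exact: ms.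
(* Moving s n within S by a multiple of f lowers the squared distance by at most 1/(n + 1), which
   makes e n almost orthogonal to f. *)
have orth n f : S f -> ip (e n) f * ip (e n) f <= / (INR n + 1) * ip f f.
  move=> hf. have fL := S_Lp f hf. apply: discriminant_ineq; first exact: (ip_ge0 _ _ LI). move=> r.
  have := mS (fun t => s n t + (- r)%R * f t)%C (S_add (s n) (fun t => (- r)%R * f t)%C (hs n) (S_scal _ _ hf)).
  have -> : (fun t => x0 t - (s n t + (- r)%R * f t))%C = (fun t => e n t + r * f t)%C.
    apply: functional_extensionality => t. rewrite /e. apply: injective_projections; simpl; ring.
  rewrite ip_expand //. have := Qe n. lra.
(* The parallelogram law: the midpoint of s n and s k lies in S and is no closer to x0 than the
   infimum. *)
have cau n k : ip (fun t => e n t - e k t)%C (fun t => e n t - e k t)%C <= 2 * (/ (INR n + 1) + / (INR k + 1)).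
  have -> : (fun t => e n t - e k t)%C = (fun t => e n t + (-1)%R * e k t)%C by apply: functional_extensionality => t; apply: injective_projections; simpl; ring.
  have E1 := ip_expand (-1) (e n) (e k) (eL n) (eL k). have E2 := ip_expand 1 (e n) (e k) (eL n) (eL k).
  have hh : S (fun t => / 2 * (s n t + s k t))%C by apply: S_scal; apply: S_add.
  have := mS _ hh.
  have -> : (fun t => x0 t - / 2 * (s n t + s k t))%C = (fun t => (/2)%R * (e n t + 1 * e k t))%C.
    apply: functional_extensionality => t. rewrite /e. apply: injective_projections; simpl; field.
  have hL := l2_scal_add 1 (e n) (e k) (eL n) (eL k).
  rewrite (ip_scal _ _ LI) //; last exact: (l2_scal _ _ LI).
  rewrite (ip_sym _ _ LI (fun t => e n t + 1 * e k t)%C) (ip_scal _ _ LI) //.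
  have := Qe n. have := Qe k. lra.
(* The errors e n need not converge within [Lp], but their inner products with a fixed f do, by the
   Cauchy-Schwarz inequality; these limits define the functional. *)
pose lR f := real (Lim_seq (fun n => ip f (e n))).
have lim f : Lp f -> is_lim_seq (fun n => ip f (e n)) (lR f).
  move=> hf. apply: Lim_seq_correct'. have f0 := ip_ge0 _ _ LI f. apply: (cauchy_rate _ (2 * ip f f)); first lra.
  move=> n k. have hL : Lp (fun t => e n t - e k t)%C.
    have -> : (fun t => e n t - e k t)%C = (fun t => e n t + (-1)%R * e k t)%C by apply: functional_extensionality => t; apply: injective_projections; simpl; ring.
    exact: l2_scal_add.
  have -> : ip f (e n) - ip f (e k) = ip f (fun t => e n t - e k t)%C.
    have -> : (fun t => e n t - e k t)%C = (fun t => e n t + (-1)%R * e k t)%C by apply: functional_extensionality => t; apply: injective_projections; simpl; ring.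
    rewrite (ip_sym _ _ LI f (e n)) (ip_sym _ _ LI f (e k)) (ip_sym _ _ LI f (fun t => e n t + (-1)%R * e k t)%C) ip_lin //. ring.
  apply: Rle_trans (ip_CS _ _ hf hL) _. have := cau n k. nra.
have lim_u f l : Lp f -> is_lim_seq (fun n => ip f (e n)) (Finite l) -> lR f = l.
  move=> hf h. by rewrite /lR (is_lim_seq_unique _ _ h).
have l_add f g : Lp f -> Lp g -> lR (fun t => f t + g t)%C = lR f + lR g.
  move=> hf hg. apply: lim_u; first exact: (l2_add _ _ LI).
  apply: (is_lim_seq_ext (fun n => ip f (e n) + ip g (e n))); first by move=> n; rewrite (ip_add _ _ LI).
  by apply: is_lim_seq_plus'; apply: lim.
have l_scal (r : R) f : Lp f -> lR (fun t => r * f t)%C = r * lR f.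
  move=> hf. apply: lim_u; first exact: (l2_scal _ _ LI).
  apply: (is_lim_seq_ext (fun n => r * ip f (e n))); first by move=> n; rewrite (ip_scal _ _ LI).
  apply: (is_lim_seq_scal_l _ _ (Finite (lR f))). exact: lim.
have m1 : 0 <= m + 1 by lra.
have sq_le x c : 0 <= c -> x * x <= c -> Rabs x <= sqrt c.
  move=> c0 h. rewrite -sqrt_Rsqr_abs. exact: sqrt_le_1_alt.
have l_bd f : Lp f -> Rabs (lR f) <= sqrt (m + 1) * sqrt (ip f f).
  move=> hf. have f0 := ip_ge0 _ _ LI f. have b n : Rabs (ip f (e n)) <= sqrt (m + 1) * sqrt (ip f f).
    rewrite -sqrt_mult //. apply: sq_le; first exact: Rmult_le_pos.
    apply: Rle_trans (ip_CS _ _ hf (eL n)) _. rewrite Rmult_comm. apply: Rmult_le_compat_r => //.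
    have : / (INR n + 1) <= 1 by rewrite -Rinv_1; apply: Rinv_le_contravar; have := pos_INR n; lra. have := Qe n. lra.
  exact: (is_lim_seq_le _ _ _ _ b (is_lim_seq_abs _ _ (lim f hf)) (is_lim_seq_const _)).
have l_S f : S f -> lR f = 0.
  move=> hf. have fL := S_Lp f hf. have h := lim f fL.
  have : lR f * lR f <= 0; last nra.
  apply: (is_lim_seq_le (fun n => ip f (e n) * ip f (e n)) (fun n => ip f f * / (INR n + 1)) (lR f * lR f) 0).
  - move=> n. rewrite (ip_sym _ _ LI f). have := orth n f hf. lra.
  - exact: is_lim_seq_mult'.
  - exact: inv_INR_lim.
(* The inner product of x0 with e n is the square of e n, at least d, plus v, the one of e n with s
   n. The latter is small by [orth], used as -v <= (2/d) v^2 + d/2. *)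
have l_x : 0 < lR x0.
  have c0 : 0 <= 2 * ip x0 x0 + 2 * (m + 1) by have := ip_ge0 _ _ LI x0; lra.
  set c := 2 * ip x0 x0 + 2 * (m + 1) in c0.
  have L : is_lim_seq (fun n => d / 2 + - (2 * c / d) * / (INR n + 1)) (d / 2).
    have -> : Finite (d / 2) = Finite (d / 2 + 0) by rewrite Rplus_0_r. apply: is_lim_seq_plus'; [exact: is_lim_seq_const | exact: inv_INR_lim].
  have : d / 2 <= lR x0; last lra.
  apply: (is_lim_seq_le _ _ _ _ _ L (lim x0 x0_Lp)) => n.
  have sL := S_Lp _ (hs n). have i0 := INR1_inv n.
  have E : ip x0 (e n) = ip (e n) (e n) + ip (e n) (s n).
    rewrite (ip_sym _ _ LI (e n) (s n)) -(ip_add _ _ LI) //. f_equal. apply: functional_extensionality => t. rewrite /e. ring.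
  have Qs : ip (s n) (s n) <= c.
    have -> : s n = (fun t => x0 t + (-1)%R * e n t)%C by apply: functional_extensionality => t; rewrite /e; apply: injective_projections; simpl; ring.
    apply: Rle_trans (ip_parallelogram x0 (fun t => (-1)%R * e n t)%C _ _) _ => //; first exact: (l2_scal _ _ LI).
    rewrite (ip_scal _ _ LI) //; last exact: (l2_scal _ _ LI). rewrite (ip_sym _ _ LI (e n)) (ip_scal _ _ LI) //.
    have : / (INR n + 1) <= 1 by rewrite -Rinv_1; apply: Rinv_le_contravar; have := pos_INR n; lra.
    have := Qe n. rewrite /c. lra.
  have o := orth n _ (hs n). have Qd : d <= ip (e n) (e n) by exact: S_dist.
  rewrite E. set v := ip (e n) (s n) in o *.
  have : - v <= v * v * (2 / d) + d / 2.
    have : 0 <= (v * (2 / d) + 1) * (v * (2 / d) + 1) * (d / 2) by apply: Rmult_le_pos; [exact: Rle_0_sqr | lra].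
    have -> : (v * (2 / d) + 1) * (v * (2 / d) + 1) * (d / 2) = v * v * (2 / d) + 2 * v + d / 2 by field; lra.
    have : 0 <= v * v * (2 / d) + d / 2. apply: Rplus_le_le_0_compat; last lra. apply: Rmult_le_pos; first exact: Rle_0_sqr. left. apply: Rdiv_lt_0_compat; lra. lra.
  have : v * v * (2 / d) <= / (INR n + 1) * c * (2 / d).
    apply: Rmult_le_compat_r; first by left; apply: Rdiv_lt_0_compat; lra. nra.
  have -> : / (INR n + 1) * c * (2 / d) = 2 * c / d * / (INR n + 1) by field; have := pos_INR n; lra. lra.
exists (fun f => (lR f, - lR (fun t => Ci * f t)%C)). split; last split.
- apply: (functional_of_real lR (sqrt (m + 1))) => //. exact: sqrt_pos.
- move=> f hf. rewrite !l_S //; last exact: S_scal. rewrite Ropp_0. done.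
- move=> h. have := f_equal fst h. simpl. lra.
Qed.
End Separation.

(** The quotients along the real increments h n form a Cauchy sequence, and every other quotient
    differs from their limit by at most a multiple of its increment. *)
Lemma quotient_cauchy_holo f c r K : 0 < r -> 0 <= K ->
  (forall h k : C, h <> 0%C -> k <> 0%C -> Cmod h < r -> Cmod k < r ->
    Cmod ((f (c + h) - f c) / h - (f (c + k) - f c) / k)%C <= K * Cmod (h - k)%C) -> holo f c.
Proof.
move=> r0 K0 H.
pose h (n : nat) : C := RtoC (r / 2 * / (INR n + 1)).
have ipos n := INR1_inv n.
have ile n : / (INR n + 1) <= 1 by rewrite -Rinv_1; apply: Rinv_le_contravar; have := pos_INR n; lra.
have hm n : Cmod (h n) = r / 2 * / (INR n + 1) by rewrite /h Cmod_R Rabs_pos_eq //; apply: Rmult_le_pos; have := ipos n; lra.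
have hn n : h n <> 0%C by apply: Cneq_mod; rewrite hm; apply: Rmult_lt_0_compat; have := ipos n; lra.
have hr n : Cmod (h n) < r by rewrite hm; have := ile n; have := ipos n; nra.
pose q n := ((f (c + h n) - f c) / h n)%C.
have Q n k : Cmod (q n - q k)%C <= K * (r / 2) * Rabs (/ (INR n + 1) - / (INR k + 1)).
  apply: Rle_trans (H _ _ (hn n) (hn k) (hr n) (hr k)) _. rewrite Rmult_assoc. apply: Rmult_le_compat_l => //.
  rewrite /h -RtoC_minus Cmod_R -Rmult_minus_distr_l Rabs_mult (Rabs_pos_eq (r/2)); lra.
have ex (p : C -> R) : (forall z, Rabs (p z) <= Cmod z) -> (forall z w, p (z - w)%C = p z - p w) -> ex_finite_lim_seq (fun n => p (q n)).
  move=> hp pm. set D := K * (r / 2) in Q. have D0 : 0 <= D by apply: Rmult_le_pos; lra.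
  apply: (cauchy_rate _ (D * D)); first nra. move=> n k. rewrite -pm.
  have a := hp (q n - q k)%C. have b := Q n k. have i1 := ipos n. have i2 := ipos k. have j1 := ile n. have j2 := ile k.
  set x := / (INR n + 1) in b i1 j1 *. set y := / (INR k + 1) in b i2 j2 *.
  have ab : Rabs (p (q n - q k)%C) <= D * Rabs (x - y) by lra.
  have E1 u : u * u = Rabs u * Rabs u by rewrite -Rabs_mult Rabs_pos_eq //; nra.
  rewrite (E1 (p _)). apply: (Rle_trans _ (D * Rabs (x - y) * (D * Rabs (x - y)))); first by apply: Rmult_le_compat => //; exact: Rabs_pos.
  have -> : D * Rabs (x - y) * (D * Rabs (x - y)) = D * D * ((x - y) * (x - y)) by rewrite (E1 (x - y)); ring.
  apply: Rmult_le_compat_l; nra.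
have [a Ha] := ex fst Cmod_fst (fun z w => eq_refl). have [b Hb] := ex snd Cmod_snd (fun z w => eq_refl).
exists (a, b).
have lim (k : C) : k <> 0%C -> Cmod k < r -> Cmod ((f (c + k) - f c) / k - (a, b))%C <= 2 * K * Cmod k.
  move=> kn kr.
  have comp (p : C -> R) l : (forall z, Rabs (p z) <= Cmod z) -> (forall z w, p (z - w)%C = p z - p w) -> is_lim_seq (fun n => p (q n)) (Finite l) ->
     Rabs (l - p ((f (c + k) - f c) / k)%C) <= K * Cmod k.
    move=> hp pm hl. set w := ((f (c + k) - f c) / k)%C.
    have L1 : is_lim_seq (fun n => Rabs (p (q n) - p w)) (Rabs (l - p w)).
      apply: (is_lim_seq_abs _ (Finite (l - p w))). apply: is_lim_seq_minus' => //. exact: is_lim_seq_const.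
    have L2 : is_lim_seq (fun n => K * Cmod k + K * (r / 2) * / (INR n + 1)) (K * Cmod k).
      have -> : Finite (K * Cmod k) = Finite (K * Cmod k + 0) by rewrite Rplus_0_r. apply: is_lim_seq_plus'; [exact: is_lim_seq_const | exact: inv_INR_lim].
    apply: (is_lim_seq_le _ _ _ _ _ L1 L2) => n. rewrite -pm. apply: Rle_trans (hp _) _.
    have h0 := H _ _ (hn n) kn (hr n) kr. apply: (Rle_trans _ (K * Cmod (h n - k)%C)); first exact: h0. have := Cmod_sub (h n) k. rewrite hm => h1.
    have -> : K * Cmod k + K * (r / 2) * / (INR n + 1) = K * (r / 2 * / (INR n + 1) + Cmod k) by ring. exact: Rmult_le_compat_l.
  rewrite Cmod_sub_sym. apply: Rle_trans (Cmod_le_sum _) _.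
  have := comp fst a Cmod_fst (fun z w => eq_refl) Ha. have := comp snd b Cmod_snd (fun z w => eq_refl) Hb. simpl. rewrite /Rminus. lra.
move=> e e0. exists (Rmin r (e / (2 * K + 1))).
have ee : 0 < e / (2 * K + 1) by apply: Rdiv_lt_0_compat; lra.
split; first exact: Rmin_glb_lt. move=> k Hk.
case: (classic (k = 0%C)) => [->|kn].
  rewrite Cplus_0_r Cmult_0_r (_ : (f c - f c - 0)%C = 0%C); [rewrite Cmod_0; lra | ring].
have k1 : Cmod k < r by apply: Rlt_le_trans Hk (Rmin_l _ _). have k2 : Cmod k < e / (2 * K + 1) by apply: Rlt_le_trans Hk (Rmin_r _ _).
have -> : (f (c + k) - f c - (a, b) * k)%C = (((f (c + k) - f c) / k - (a, b)) * k)%C by field.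
rewrite Cmod_mult. apply: Rmult_le_compat_r; first exact: Cmod_ge_0.
apply: Rle_trans (lim k kn k1) _. apply: (Rle_trans _ ((2 * K + 1) * (e / (2 * K + 1)))); last by right; field; lra.
have := Cmod_ge_0 k. nra.
Qed.

(** The difference of two difference quotients in z is, for every t, at most a multiple of |h - k|
    |kappa(t)| by [quotient_lipschitz]; boundedness of ell carries this over to ell (Phi z), and
    [quotient_cauchy_holo] concludes. *)
Lemma functional_holo ell (Phi : C -> R -> C) z0 r kappa : functional Lp ip ell -> 0 < r -> Lp kappa ->
  (forall z t, Cmod (z - z0)%C < r -> holo (fun z => Phi z t) z) ->
  (forall z t, Cmod (z - z0)%C < r -> Cmod (Phi z t) <= Cmod (kappa t)) ->
  (forall z t, Cmod (z - z0)%C < r -> rcont (Phi z) t) -> holo (fun z => ell (Phi z)) z0.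
Proof.
move=> [f_add f_scal [K0 [K00 f_bd]]] r0 kL Hh Hb Hc.
have sk := sqrt_pos (ip kappa kappa).
have PL z : Cmod (z - z0)%C < r -> Lp (Phi z).
  move=> hz. apply: (proj1 (l2_dom _ _ LI (Phi z) kappa 1 _ kL Rle_0_1 _)); first by move=> t; apply: Hc.
  move=> t. rewrite Rmult_1_l. exact: Hb.
have c0 : Cmod (z0 - z0)%C < r by rewrite (_ : (z0 - z0)%C = 0%C); [rewrite Cmod_0 | ring].
have r2 : 0 < / (r * r) by apply: Rinv_0_lt_compat; nra.
apply: (quotient_cauchy_holo _ _ (r / 4) (K0 * (16 / (r * r) * sqrt (ip kappa kappa)))); first lra.
  apply: Rmult_le_pos => //. apply: Rmult_le_pos => //. rewrite /Rdiv. lra.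
move=> h k hn kn hr kr.
have hin : Cmod (z0 + h - z0)%C < r by (replace (z0 + h - z0)%C with h by ring); lra.
have kin : Cmod (z0 + k - z0)%C < r by (replace (z0 + k - z0)%C with k by ring); lra.
pose psi t := ((Phi (z0 + h)%C t - Phi z0 t) / h - (Phi (z0 + k)%C t - Phi z0 t) / k)%C.
have psiE : psi = (fun t => / h * (Phi (z0 + h)%C t + (-1) * Phi z0 t) + (- / k) * (Phi (z0 + k)%C t + (-1) * Phi z0 t))%C.
  apply: functional_extensionality => t. rewrite /psi. field. by split.
have L1 : Lp (fun t => Phi (z0 + h)%C t + (-1) * Phi z0 t)%C by apply: (l2_add _ _ LI (Phi (z0 + h)%C) (fun t => (-1) * Phi z0 t)%C); [exact: PL | apply: (l2_scal _ _ LI); exact: PL].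
have L2 : Lp (fun t => Phi (z0 + k)%C t + (-1) * Phi z0 t)%C by apply: (l2_add _ _ LI (Phi (z0 + k)%C) (fun t => (-1) * Phi z0 t)%C); [exact: PL | apply: (l2_scal _ _ LI); exact: PL].
have E : ((ell (Phi (z0 + h)%C) - ell (Phi z0)) / h - (ell (Phi (z0 + k)%C) - ell (Phi z0)) / k)%C = ell psi.
  rewrite psiE (f_add (fun t => / h * (Phi (z0 + h)%C t + (-1) * Phi z0 t))%C (fun t => (- / k) * (Phi (z0 + k)%C t + (-1) * Phi z0 t))%C);
    [|exact: (l2_scal _ _ LI)|exact: (l2_scal _ _ LI)].
  rewrite !(f_scal _ (fun t => _)) // (f_add (Phi (z0 + h)%C) (fun t => (-1) * Phi z0 t)%C) ?(f_add (Phi (z0 + k)%C) (fun t => (-1) * Phi z0 t)%C);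
    try exact: PL; try (apply: (l2_scal _ _ LI); exact: PL).
  rewrite !f_scal; [|exact: PL]. field. by split.
rewrite E.
have D := l2_dom _ _ LI psi kappa (16 / (r * r) * Cmod (h - k)%C) _ kL _ _.
have hk0 := Cmod_ge_0 (h - k)%C.
have cc : 0 <= 16 / (r * r) * Cmod (h - k)%C by apply: Rmult_le_pos => //; rewrite /Rdiv; lra.
have [pL pQ] : Lp psi /\ ip psi psi <= 16 / (r * r) * Cmod (h - k)%C * (16 / (r * r) * Cmod (h - k)%C) * ip kappa kappa.
  apply: D => // t.
  - rewrite /psi. apply: rcont_minus; (apply: rcont_mult; [apply: rcont_minus; apply: Hc => // | exact: rcont_const]).
  - apply: Rle_trans (quotient_lipschitz (fun z => Phi z t) z0 r (Cmod (kappa t)) h k r0 _ _ hn kn hr kr) _.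
    + move=> z hz. exact: Hh.
    + move=> z hz. exact: Hb.
    + right. field. lra.
apply: Rle_trans (f_bd _ pL) _. rewrite (Rmult_assoc K0). apply: Rmult_le_compat_l => //.
apply: Rle_trans (sqrt_le_1_alt _ _ pQ) _.
rewrite sqrt_mult; [|exact: Rmult_le_pos|exact: (ip_ge0 _ _ LI)]. rewrite sqrt_square //. right. ring.
Qed.
End L2.


(** * Quotients of associated functions *)

Lemma dq_sym f w z : dq f w z = dq f z w.
Proof.
case: (classic (z = w)) => [->|n] //. rewrite !dq_off //; last by move=> E; apply: n.
have a := Csub_neq0 _ _ n. have b : (w - z)%C <> 0%C by apply: Csub_neq0 => E; apply: n. by field.
Qed.

Lemma dq_lin (a b : C) f g w z : (forall u, holo f u) -> (forall u, holo g u) ->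
  dq (fun u => a * f u + b * g u)%C w z = (a * dq f w z + b * dq g w z)%C.
Proof.
move=> hf hg. case: (classic (z = w)) => [->|n].
- rewrite !dq_diag. apply: cderiv_eq.
  have := is_cder_plus (fun u => a * f u)%C (fun u => b * g u)%C w _ _
    (is_cder_mult (fun _ => a) f w _ _ (is_cder_const a w) (cderiv_correct f w (hf w)))
    (is_cder_mult (fun _ => b) g w _ _ (is_cder_const b w) (cderiv_correct g w (hg w))).
  congr is_cder. ring.
- rewrite !dq_off //. have := Csub_neq0 _ _ n => h. by field.
Qed.

Lemma rcont_real f t : ccont f (RtoC t) -> rcont (fun t : R => f (RtoC t)) t.
Proof. exact: rcont_hor. Qed.

Lemma rcont_Cmod g t : rcont g t -> rcont (fun t => RtoC (Cmod (g t))) t.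
Proof.
move=> H e e0. have [d [d0 K]] := H e e0. exists d; split => // s Hs. apply: Rle_lt_trans (K s Hs).
rewrite -RtoC_minus Cmod_R. apply: Rabs_le. have := Cmod_rev (g s) (g t). have := Cmod_rev (g t) (g s). rewrite (Cmod_sub_sym (g t)). lra.
Qed.

Lemma rcont_plus f g t : rcont f t -> rcont g t -> rcont (fun t => f t + g t)%C t.
Proof.
move=> Hf Hg e e0. have [d1 [p1 K1]] := Hf (e/2) ltac:(lra). have [d2 [p2 K2]] := Hg (e/2) ltac:(lra).
exists (Rmin d1 d2); split; first exact: Rmin_glb_lt. move=> s Hs.
have h1 := K1 s (Rlt_le_trans _ _ _ Hs (Rmin_l _ _)). have h2 := K2 s (Rlt_le_trans _ _ _ Hs (Rmin_r _ _)).
replace (f s + g s - (f t + g t))%C with ((f s - f t) + (g s - g t))%C by ring.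
apply: Rle_lt_trans (Cmod_triangle _ _) _. lra.
Qed.

Lemma real_sub_neq0 (z : C) (t : R) : snd z <> 0 -> (t - z)%C <> 0%C.
Proof. move=> h E. have := f_equal snd E. simpl. lra. Qed.

Lemma real_sub_im (z : C) (t : R) : Rabs (snd z) <= Cmod (t - z)%C.
Proof. have := Cmod_snd (t - z)%C. rewrite /= Rplus_0_l Rabs_Ropp. done. Qed.

Lemma rcont_sub_inv (z : C) t : snd z <> 0 -> rcont (fun t : R => / (t - z))%C t.
Proof.
move=> h. apply: rcont_inv; first exact: real_sub_neq0. apply: rcont_minus; last exact: rcont_const.
move=> e e0. exists e; split => // s Hs. by rewrite -RtoC_minus Cmod_R.
Qed.

Section Kernel.
Variables (Lp : (R -> C) -> Prop) (ip : (R -> C) -> (R -> C) -> R).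
Hypothesis LI : L2space Lp ip.

Lemma kernel_Lp phi z : (forall t, rcont phi t) -> Lp phi -> snd z <> 0 -> Lp (fun t : R => phi t / (t - z))%C /\
  ip (fun t : R => phi t / (t - z))%C (fun t : R => phi t / (t - z))%C <= / Rabs (snd z) * / Rabs (snd z) * ip phi phi.
Proof.
move=> hc hL hz. have y0 : 0 < Rabs (snd z) by exact: Rabs_pos_lt. have i0 := Rinv_0_lt_compat _ y0.
apply: (l2_dom _ _ LI) => //; last first.
- move=> t. have n := real_sub_neq0 z t hz. rewrite Cmod_div // Rmult_comm. apply: Rmult_le_compat_l; first exact: Cmod_ge_0.
  apply: Rinv_le_contravar => //. exact: real_sub_im.
- lra.
- move=> t. apply: rcont_mult => //. exact: rcont_sub_inv.
Qed.

Variable ell : (R -> C) -> C.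
Hypothesis Fn : functional Lp ip ell.

Definition cauchyT (phi : R -> C) (z : C) : C := ell (fun t : R => phi t / (t - z))%C.

Lemma cauchyT_bound : exists K, 0 <= K /\ forall phi z, (forall t, rcont phi t) -> Lp phi -> snd z <> 0 ->
  Cmod (cauchyT phi z) <= K * sqrt (ip phi phi) / Rabs (snd z).
Proof.
have [_ _ [K [K0 HK]]] := Fn. exists K; split => // phi z hc hL hz. have [h1 h2] := kernel_Lp phi z hc hL hz.
apply: Rle_trans (HK _ h1) _. rewrite /Rdiv Rmult_assoc. apply: Rmult_le_compat_l => //.
apply: Rle_trans (sqrt_le_1_alt _ _ h2) _.
have i0 : 0 <= / Rabs (snd z) by left; apply: Rinv_0_lt_compat; exact: Rabs_pos_lt.
rewrite sqrt_mult; [|nra|exact: (ip_ge0 _ _ LI)]. rewrite sqrt_square //. lra.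
Qed.

(** Because z/(t - z) = t/(t - z) - 1, the sum is ell of t phi/(t - z), and [l2_tail] makes this
    small on the imaginary axis. *)
Lemma cauchyT_axis phi e : (forall t, rcont phi t) -> Lp phi -> 0 < e -> exists Y, forall y, Y <= Rabs y -> y <> 0 ->
  Cmod ((0, y) * cauchyT phi (0, y) + ell phi)%C <= e.
Proof.
move=> hc hL e0. have [f_add f_scal [K [K0 HK]]] := Fn.
have ek : 0 < e / (K + 1) by apply: Rdiv_lt_0_compat; lra.
have [Y HY] := l2_tail _ _ LI phi hc hL (e / (K + 1) * (e / (K + 1))) ltac:(nra).
exists Y => y hy yn. have hz : snd ((0, y) : C) <> 0 by [].
have [k1 _] := kernel_Lp phi (0, y) hc hL hz.
have E : (fun t : R => t * phi t / (t - (0, y)))%C = (fun t : R => (0, y) * (phi t / (t - (0, y))) + phi t)%C.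
  apply: functional_extensionality => t. have n := real_sub_neq0 (0, y) t hz. by field.
have k2 := l2_scal _ _ LI (0, y) _ k1.
have E2 : ((0, y) * cauchyT phi (0, y) + ell phi)%C = ell (fun t : R => t * phi t / (t - (0, y)))%C.
  by rewrite E (f_add (fun t : R => (0, y) * (phi t / (t - (0, y))))%C phi) // f_scal.
rewrite E2. have L : Lp (fun t : R => t * phi t / (t - (0, y)))%C by rewrite E; exact: (l2_add _ _ LI).
apply: Rle_trans (HK _ L) _. have := sqrt_le_1_alt _ _ (HY y hy). rewrite sqrt_square; last lra. move=> h.
apply: (Rle_trans _ ((K + 1) * (e / (K + 1)))); last by right; field; lra.
apply: Rmult_le_compat => //; [exact: sqrt_pos | lra].
Qed.

Lemma Lp_real_dom G H M : (forall z, holo G z) -> (forall z, holo H z) -> Lp (fun t : R => G t) -> Lp (fun t : R => H t) ->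
  Lp (fun t : R => RtoC (M * (Cmod (G t) + Cmod (H t)))).
Proof.
move=> hG hH LG LH.
have L F : (forall z, holo F z) -> Lp (fun t : R => F t) -> Lp (fun t : R => RtoC (Cmod (F t))).
  move=> hF LF. apply: (proj1 (l2_dom _ _ LI _ (fun t : R => F t) 1 _ LF Rle_0_1 _)).
  - move=> t. apply: rcont_Cmod. apply: rcont_real. apply: holo_cont. exact: hF.
  - move=> t. rewrite Cmod_R Rabs_pos_eq; [lra | exact: Cmod_ge_0].
have -> : (fun t : R => RtoC (M * (Cmod (G t) + Cmod (H t)))) = (fun t : R => M * (RtoC (Cmod (G t)) + RtoC (Cmod (H t))))%C.
  by apply: functional_extensionality => t; rewrite RtoC_mult RtoC_plus.
apply: (l2_scal _ _ LI). apply: (l2_add _ _ LI (fun t : R => RtoC (Cmod (G t)))); exact: L.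
Qed.

(** The function (H(z) G(t) - G(z) H(t))/(t - z), written with difference quotients so as to make
    sense at t = z as well. *)
Definition Phi (G H : C -> C) (z : C) (t : R) : C := (H z * dq G z t - G z * dq H z t)%C.

Lemma Phi_off G H z t : z <> RtoC t -> Phi G H z t = ((H z * G t - G z * H t) / (t - z))%C.
Proof. move=> n. have n' : RtoC t <> z by move=> E; apply: n. rewrite /Phi !dq_off //. have := Csub_neq0 _ _ n'. by move=> h; field. Qed.

Lemma Phi_holo G H t z : (forall z, holo G z) -> (forall z, holo H z) -> holo (fun z => Phi G H z t) z.
Proof.
move=> hG hH.
apply: (holo_ext (fun z => H z * dq G t z - G z * dq H t z)%C); first by move=> w; rewrite /Phi !(dq_sym _ w).
refine (holo_minus (fun z => H z * dq G t z)%C (fun z => G z * dq H t z)%C _ _ _); apply: holo_mult => //; by apply: (dq_holo _ _ 1) => //; lra.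
Qed.

(** For |t - z| >= 1 the quotient is estimated directly. If t is within 2 of z0, the circle |z - z0|
    = 4 has this distance from t, and the maximum principle in z carries the bound inside. The
    outcome is a majorant uniform in z, as [functional_holo] requires. *)
Lemma Phi_dom G H z0 : (forall z, holo G z) -> (forall z, holo H z) -> exists M, 0 <= M /\
  forall z t, Cmod (z - z0)%C < 1 -> Cmod (Phi G H z t) <= M * (Cmod (G t) + Cmod (H t)).
Proof.
move=> hG hH.
have [M1 [p1 B1]] := entire_bounded_disc G (Cmod z0 + 4) hG. have [M2 [p2 B2]] := entire_bounded_disc H (Cmod z0 + 4) hH.
have near z r : Cmod (z - z0)%C <= r -> Cmod z <= Cmod z0 + r.
  have := Cmod_triangle (z - z0)%C z0. replace (z - z0 + z0)%C with z by ring. lra.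
have off z (t : R) : Cmod (z - z0)%C <= 4 -> 1 <= Cmod (t - z)%C -> Cmod (Phi G H z t) <= (M1 + M2) * (Cmod (G t) + Cmod (H t)).
  move=> hz ht. have n : (t - z)%C <> 0%C by apply: Cneq_mod; lra.
  rewrite Phi_off; last by move=> E; apply: n; rewrite E; ring.
  have b1 := B1 z (near z _ hz). have b2 := B2 z (near z _ hz). rewrite Cmod_div //.
  have gp := Cmod_ge_0 (G t). have hp := Cmod_ge_0 (H t).
  have num : Cmod (H z * G t - G z * H t)%C <= (M1 + M2) * (Cmod (G t) + Cmod (H t)).
    apply: Rle_trans (Cmod_sub _ _) _. rewrite !Cmod_mult. have := Cmod_ge_0 (G z). have := Cmod_ge_0 (H z). nra.
  apply: Rle_trans num. rewrite -[X in _ <= X]Rmult_1_r. apply: Rmult_le_compat_l; first exact: Cmod_ge_0.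
  rewrite -Rinv_1. apply: Rinv_le_contravar; lra.
exists (M1 + M2); split; first lra. move=> z t hz.
have gp := Cmod_ge_0 (G t). have hp := Cmod_ge_0 (H t).
case: (Rle_lt_dec 2 (Cmod (t - z0)%C)) => ht.
  apply: off; first lra. have := Cmod_rev (t - z0)%C (z - z0)%C. replace (t - z0 - (z - z0))%C with (t - z)%C by ring. lra.
apply: (max_principle (fun w => Cmod (w - z0)%C < 4) (fun z => Phi G H z t) _ (Cmod z0 + 4)).
- apply: Rmult_le_pos; lra.
- move=> w hw. exact: disc_open.
- move=> w hw. apply: near. lra.
- move=> w _. exact: Phi_holo.
- move=> p Np eta eta0. case: (Rtotal_order (Cmod (p - z0)%C) 4) => [h|[h|h]]; first by case: Np.
  + apply: cont_boundary => //; first by apply: holo_cont; exact: Phi_holo.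
    apply: off; first lra. have := Cmod_rev (p - z0)%C (t - z0)%C. replace (p - z0 - (t - z0))%C with (p - t)%C by ring. rewrite (Cmod_sub_sym t p). lra.
  + exists (Cmod (p - z0)%C - 4); split; first lra. move=> w Sw Hw.
    have := Cmod_triangle (p - w)%C (w - z0)%C. replace (p - w + (w - z0))%C with (p - z0)%C by ring. rewrite (Cmod_sub_sym p w). lra.
- lra.
Qed.

Lemma Phi_rcont G H z t : (forall z, holo G z) -> (forall z, holo H z) -> rcont (Phi G H z) t.
Proof.
move=> hG hH. have c F : (forall z, holo F z) -> rcont (fun t : R => dq F z t) t.
  move=> hF. apply: rcont_real. apply: holo_cont. apply: (dq_holo _ _ 1) => //; lra.
rewrite /Phi. apply: rcont_minus; apply: rcont_mult; [exact: rcont_const | exact: c | exact: rcont_const | exact: c].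
Qed.

Lemma Phi_Lp G H z : (forall z, holo G z) -> (forall z, holo H z) -> Lp (fun t : R => G t) -> Lp (fun t : R => H t) -> Lp (Phi G H z).
Proof.
move=> hG hH LG LH. have [M [M0 HM]] := Phi_dom G H z hG hH.
apply: (proj1 (l2_dom _ _ LI _ _ 1 _ (Lp_real_dom G H M hG hH LG LH) Rle_0_1 _)).
- move=> t. exact: Phi_rcont.
- move=> t. rewrite Rmult_1_l Cmod_R Rabs_pos_eq; last by have := Cmod_ge_0 (G t); have := Cmod_ge_0 (H t) => a b; apply: Rmult_le_pos; lra.
  apply: HM. rewrite (_ : (z - z)%C = 0%C); [rewrite Cmod_0; lra | ring].
Qed.

Lemma ell_Phi_holo G H z0 : (forall z, holo G z) -> (forall z, holo H z) -> Lp (fun t : R => G t) -> Lp (fun t : R => H t) ->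
  holo (fun z => ell (Phi G H z)) z0.
Proof.
move=> hG hH LG LH. have [M [M0 HM]] := Phi_dom G H z0 hG hH.
apply: (functional_holo _ _ LI ell (Phi G H) z0 1 _ Fn Rlt_0_1 (Lp_real_dom G H M hG hH LG LH)).
- move=> z t _. exact: Phi_holo.
- move=> z t hz. rewrite Cmod_R Rabs_pos_eq; last by have := Cmod_ge_0 (G t); have := Cmod_ge_0 (H t) => a b; apply: Rmult_le_pos; lra. exact: HM.
- move=> z t _. exact: Phi_rcont.
Qed.

Lemma ell_Phi_off G H z : (forall z, holo G z) -> (forall z, holo H z) -> Lp (fun t : R => G t) -> Lp (fun t : R => H t) -> snd z <> 0 ->
  ell (Phi G H z) = (H z * cauchyT (fun t : R => G t) z - G z * cauchyT (fun t : R => H t) z)%C.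
Proof.
move=> hG hH LG LH hz. have [f_add f_scal _] := Fn.
have rc F t : (forall z, holo F z) -> rcont (fun t : R => F t) t by move=> hF; apply: rcont_real; apply: holo_cont; exact: hF.
have [k1 _] := kernel_Lp _ z (fun t => rc G t hG) LG hz. have [k2 _] := kernel_Lp _ z (fun t => rc H t hH) LH hz.
have -> : Phi G H z = (fun t : R => H z * (G t / (t - z)) + (- G z) * (H t / (t - z)))%C.
  apply: functional_extensionality => t. have n := real_sub_neq0 z t hz.
  rewrite Phi_off; last by move=> E; apply: n; rewrite E; ring. by field.
rewrite (f_add (fun t : R => H z * (G t / (t - z)))%C (fun t : R => (- G z) * (H t / (t - z)))%C); try exact: (l2_scal _ _ LI).
rewrite (f_scal (H z) (fun t : R => G t / (t - z))%C) // (f_scal (- G z)%C (fun t : R => H t / (t - z))%C) //. rewrite /cauchyT. ring.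
Qed.
End Kernel.

(** The properties of a de Branges space on which the comparison rests. Division by z - w, [db_div],
    is what makes the quotient independent of H and removes common zeros. *)
Record dBlike (Lp : (R -> C) -> Prop) (B : (C -> C) -> Prop) : Prop := {
  db_entire : forall F, B F -> forall z, holo F z;
  db_type : forall F, B F -> type_zero F;
  db_Lp : forall F, B F -> Lp (fun t : R => F t);
  db_add : forall F G, B F -> B G -> B (fun z => F z + G z)%C;
  db_scal : forall c F, B F -> B (fun z => c * F z)%C;
  db_div : forall F w, B F -> F w = 0%C -> B (dq F w) }.

Section Build.
Variables (Lp : (R -> C) -> Prop) (ip : (R -> C) -> (R -> C) -> R) (B : (C -> C) -> Prop).
Hypothesis LI : L2space Lp ip.
Hypothesis DB : dBlike Lp B.

(** If all elements of B vanished at w, any of them could be divided by z - w within B again and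
    again and would be 0. *)
Lemma nonvanishing w : (exists F z, B F /\ F z <> 0%C) -> exists F, B F /\ F w <> 0%C.
Proof.
move=> [F [z [hF nz]]]. apply: NNPP => N.
have V H : B H -> H w = 0%C by move=> hH; apply: NNPP => n; apply: N; exists H.
apply: nz. apply: (entire_flat_zero F w); first exact: (db_entire _ _ DB).
move=> k. suff [H [h1 h2]] : exists H, B H /\ forall z, F z = ((z - w) ^ k * H z)%C by exists H; split => //; exact: (db_entire _ _ DB).
elim: k => [|k [H [h1 h2]]].
- exists F; split => // u. simpl. ring.
- exists (dq H w); split; first by apply: (db_div _ _ DB) => //; exact: V.
  move=> u. rewrite h2. have := dq_mul H w u. rewrite (V H h1) => E. replace (H u) with (H u - 0)%C by ring. rewrite -E. simpl. ring.
Qed.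

Variables (ell : (R -> C) -> C) (G : C -> C).
Hypothesis Fn : functional Lp ip ell.
Hypothesis ellB : forall F, B F -> ell (fun t : R => F t) = 0%C.
Hypothesis hG : forall z, holo G z.
Hypothesis tG : type_zero G.
Hypothesis LG : Lp (fun t : R => G t).
Hypothesis B_ne : exists F z, B F /\ F z <> 0%C.

Lemma ell_Phi_cross H1 H2 z : B H1 -> B H2 -> (H1 z * ell (Phi G H2 z) = H2 z * ell (Phi G H1 z))%C.
Proof.
move=> b1 b2. have [f_add f_scal _] := Fn. have h1 := db_entire _ _ DB _ b1. have h2 := db_entire _ _ DB _ b2.
pose F u := (H2 z * H1 u + (- H1 z) * H2 u)%C.
have bF : B F by apply: (db_add _ _ DB (fun u => H2 z * H1 u)%C (fun u => (- H1 z) * H2 u)%C); exact: (db_scal _ _ DB).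
have bD : B (dq F z) by apply: (db_div _ _ DB) => //; rewrite /F; ring.
have L1 := Phi_Lp _ _ LI G H1 z hG h1 LG (db_Lp _ _ DB _ b1). have L2 := Phi_Lp _ _ LI G H2 z hG h2 LG (db_Lp _ _ DB _ b2).
have E : (fun t : R => H1 z * Phi G H2 z t)%C = (fun t : R => H2 z * Phi G H1 z t + G z * dq F z t)%C.
  apply: functional_extensionality => t. rewrite /F dq_lin // /Phi. ring.
rewrite -!f_scal // E (f_add (fun t : R => H2 z * Phi G H1 z t)%C (fun t : R => G z * dq F z t)%C).
- rewrite (f_scal (G z) (fun t : R => dq F z t)); last exact: (db_Lp _ _ DB). rewrite ellB //. ring.
- exact: (l2_scal _ _ LI).
- apply: (l2_scal _ _ LI). exact: (db_Lp _ _ DB).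
Qed.

(** At each w a denominator [Hc w] in B with [Hc w w] nonzero is chosen; [ell_Phi_cross] shows that
    near w a fixed denominator gives the same values, hence L is holomorphic. For the type, H L is
    estimated off the line through [cauchyT_bound], on the line through [type_zero_offaxis], and H
    is divided out by [quotient_type_zero]. *)
Lemma quotient_function : exists L, (forall z, holo L z) /\ type_zero L /\
  forall H z, B H -> snd z <> 0 -> (H z * L z = H z * cauchyT ell (fun t : R => G t) z - G z * cauchyT ell (fun t : R => H t) z)%C.
Proof.
pose Hc w := proj1_sig (constructive_indefinite_description _ (nonvanishing w B_ne)).
have Hc_B w : B (Hc w) by rewrite /Hc; case: (constructive_indefinite_description _ _) => s [].
have Hc_n w : Hc w w <> 0%C by rewrite /Hc; case: (constructive_indefinite_description _ _) => s [].
pose L w := (ell (Phi G (Hc w) w) / Hc w w)%C.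
have LE H z : B H -> (H z * L z = ell (Phi G H z))%C.
  move=> bH. have := ell_Phi_cross H (Hc z) z bH (Hc_B z) => E. rewrite /L.
  have n := Hc_n z. replace (H z * (ell (Phi G (Hc z) z) / Hc z z))%C with (H z * ell (Phi G (Hc z) z) / Hc z z)%C by field => //. rewrite E. by field.
have NH H z : B H -> holo (fun z => ell (Phi G H z)) z.
  move=> bH. apply: (ell_Phi_holo _ _ LI) => //; [exact: (db_entire _ _ DB) | exact: (db_Lp _ _ DB)].
have Lh z : holo L z.
  have hz := db_entire _ _ DB _ (Hc_B z). have p := Cmod_pos _ (Hc_n z).
  have [d [d0 K]] := holo_cont _ _ (hz z) _ p.
  apply: (holo_ext_loc (fun w => ell (Phi G (Hc z) w) / Hc z w)%C _ _ d) => //; last by apply: holo_div => //; exact: NH.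
  move=> w Hw. have n : Hc z w <> 0%C.
    move=> E. have := K w Hw. rewrite E. replace (0 - Hc z z)%C with (- Hc z z)%C by ring. rewrite Cmod_opp. lra.
  rewrite -LE //. by field.
exists L; split => //. split; last by move=> H z bH hz; rewrite LE //; apply: (ell_Phi_off _ _ LI) => //; [exact: (db_entire _ _ DB) | exact: (db_Lp _ _ DB)].
have bH := Hc_B 0%C. set H := Hc 0%C in bH.
have hH := db_entire _ _ DB _ bH. have LH := db_Lp _ _ DB _ bH.
apply: (quotient_type_zero L H) => //; [exact: Hc_n | exact: (db_type _ _ DB) |].
have [K [K0 HK]] := cauchyT_bound _ _ LI ell Fn.
apply: type_zero_offaxis; first by move=> z; apply: holo_mult.
move=> e e0. have [KG [g0 bG]] := tG e e0. have [KH [h0 bHH]] := db_type _ _ DB _ bH e e0.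
have rc F t : (forall z, holo F z) -> rcont (fun t : R => F t) t by move=> hF; apply: rcont_real; apply: holo_cont; exact: hF.
set sG := sqrt (ip (fun t : R => G t) (fun t : R => G t)). set sH := sqrt (ip (fun t : R => H t) (fun t : R => H t)).
have sG0 : 0 <= sG by exact: sqrt_pos. have sH0 : 0 <= sH by exact: sqrt_pos.
have c0 : 0 <= KH * (K * sG) + KG * (K * sH) by apply: Rplus_le_le_0_compat; apply: Rmult_le_pos; try lra; exact: Rmult_le_pos.
exists (KH * (K * sG) + KG * (K * sH) + 1); split; first lra.
move=> z hz. rewrite Cmult_comm LE // (ell_Phi_off _ _ LI) //.
apply: Rle_trans (Cmod_sub _ _) _. rewrite !Cmod_mult.
have c1 := HK _ z (fun t => rc G t hG) LG hz. have c2 := HK _ z (fun t => rc H t hH) LH hz. rewrite -/sG in c1. rewrite -/sH in c2.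
have iy : 0 < / Rabs (snd z) by apply: Rinv_0_lt_compat; exact: Rabs_pos_lt.
have x0 := exp_pos (e * Cmod z). set X := exp _ in x0 bG bHH *.
have b1 := bHH z. have b2 := bG z. rewrite -/X in b1 b2.
have d1 : Cmod (H z) * Cmod (cauchyT ell (fun t : R => G t) z) <= KH * X * (K * sG / Rabs (snd z)) by apply: Rmult_le_compat => //; exact: Cmod_ge_0.
have d2 : Cmod (G z) * Cmod (cauchyT ell (fun t : R => H t) z) <= KG * X * (K * sH / Rabs (snd z)) by apply: Rmult_le_compat => //; exact: Cmod_ge_0.
have -> : (KH * (K * sG) + KG * (K * sH) + 1) * X * (1 + / Rabs (snd z)) = KH * X * (K * sG / Rabs (snd z)) + KG * X * (K * sH / Rabs (snd z)) + (X * / Rabs (snd z) + (KH * (K * sG) + KG * (K * sH) + 1) * X) by rewrite /Rdiv; ring.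
have : 0 <= X * / Rabs (snd z) by apply: Rmult_le_pos; lra.
have : 0 <= (KH * (K * sG) + KG * (K * sH) + 1) * X by apply: Rmult_le_pos; lra. lra.
Qed.
End Build.


(** * Comparability of two spaces *)

(** Extends a bound by continuity to the points where it could not be derived because a denominator
    vanishes. *)
Lemma limit_bound L z c : holo L z ->
  (forall d, 0 < d -> exists w, Cmod (w - z)%C < d /\ Cmod (L w) * Rabs (snd w) <= c) -> Cmod (L z) * Rabs (snd z) <= c.
Proof.
move=> hL H. apply: Rnot_lt_le => h. set a := Cmod (L z) in h. set b := Rabs (snd z) in h.
have a0 : 0 <= a by exact: Cmod_ge_0. have b0 : 0 <= b by exact: Rabs_pos.
set eta := (a * b - c) / (2 * (a + b + 1)). have e0 : 0 < eta by apply: Rdiv_lt_0_compat; lra.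
have eE : eta * (a + b + 1) = (a * b - c) / 2 by rewrite /eta; field; lra.
have [d [d0 K]] := holo_cont L z hL eta e0.
have m0 : 0 < Rmin d (Rmin 1 eta) by apply: Rmin_glb_lt => //; apply: Rmin_glb_lt; lra.
have [w [hw bw]] := H _ m0.
have h1 : Cmod (w - z)%C < d by apply: Rlt_le_trans hw (Rmin_l _ _).
have h2 : Cmod (w - z)%C < 1 by apply: Rlt_le_trans hw (Rle_trans _ _ _ (Rmin_r _ _) (Rmin_l _ _)).
have h3 : Cmod (w - z)%C < eta by apply: Rlt_le_trans hw (Rle_trans _ _ _ (Rmin_r _ _) (Rmin_r _ _)).
have k := K w h1. have r1 := Cmod_rev (L z) (L w). rewrite (Cmod_sub_sym (L z)) in r1. rewrite -/a in r1.
have s := Cmod_snd (w - z)%C. simpl in s.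
have r2 : b - Rabs (snd w) <= Rabs (snd w + - snd z).
  have := Rabs_triang_inv (snd z) (snd w). rewrite Rabs_minus_sym /Rminus -/b. lra.
have r3 : Rabs (snd w) - b <= Rabs (snd w + - snd z) by have := Rabs_triang_inv (snd w) (snd z); rewrite /Rminus -/b; lra.
set a' := Cmod (L w) in bw r1. set b' := Rabs (snd w) in bw r2 r3 s.
have b'0 : 0 <= b' by exact: Rabs_pos.
have p1 : a * (b - b') <= a * eta by apply: Rmult_le_compat_l; lra.
have p2 : b' * (a - a') <= (b + 1) * eta.
  apply: (Rle_trans _ (b' * eta)); first by apply: Rmult_le_compat_l; lra. apply: Rmult_le_compat_r; lra.
nra.
Qed.

(** L is bounded on the imaginary axis, hence constant by [type_zero_axis_const], and a constant
    that decays is 0. *)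
Lemma axis_decay L c Y : (forall z, holo L z) -> type_zero L -> (forall y, Y <= Rabs y -> y <> 0 -> Cmod (L (0, y)) * Rabs y <= c) ->
  forall z, L z = 0%C.
Proof.
move=> hL tL H. set Y1 := Rmax Y 1. have y1 : 1 <= Y1 by exact: Rmax_r. have y2 : Y <= Y1 by exact: Rmax_l.
have H1 y : Y1 <= Rabs y -> Cmod (L (0, y)) * Rabs y <= c.
  move=> h. apply: H; first lra. move=> E. rewrite E Rabs_R0 in h. lra.
have c0 : 0 <= c by apply: Rle_trans (H1 Y1 _); [apply: Rmult_le_pos; [exact: Cmod_ge_0 | exact: Rabs_pos] | rewrite Rabs_pos_eq; lra].
have [M [M0 HM]] := entire_bounded_disc L Y1 hL.
have cst := type_zero_axis_const L (M + c) hL tL ltac:(lra).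
have axis y : Cmod (L (0, y)) <= M + c.
  case: (Rle_lt_dec Y1 (Rabs y)) => h.
  - have := H1 y h. have := Cmod_ge_0 (L (0, y)). nra.
  - have : Cmod (L (0, y)) <= M; last lra.
    apply: HM. apply: Rle_trans (Cmod_le_sum _) _. rewrite /= Rabs_R0. lra.
move=> z. apply: Cmod_eq_0. apply: Rle_antisym; last exact: Cmod_ge_0. apply: Rnot_lt_le => p.
set y := Rmax Y1 ((c + 1) / Cmod (L z)).
have yy : Y1 <= y by exact: Rmax_l. have yc : (c + 1) / Cmod (L z) <= y by exact: Rmax_r.
have := H1 y. rewrite (Rabs_pos_eq y); last lra. move=> /(_ yy). rewrite (cst axis (0, y) z).
have : Cmod (L z) * ((c + 1) / Cmod (L z)) <= Cmod (L z) * y by apply: Rmult_le_compat_l; lra.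
have -> : Cmod (L z) * ((c + 1) / Cmod (L z)) = c + 1 by field; lra. lra.
Qed.

Lemma nonzero_near G z d : (forall z, holo G z) -> (exists z, G z <> 0%C) -> 0 < d -> exists h, 0 < h < d /\ G (z + (0, h))%C <> 0%C.
Proof.
move=> hG nz d0. have [r [r0 K]] := isolated_zeros G z hG nz.
have m0 : 0 < Rmin d r / 2 by have := Rmin_glb_lt _ _ _ d0 r0; lra. have m1 := Rmin_l d r. have m2 := Rmin_r d r.
exists (Rmin d r / 2); split; first lra.
apply: K.
- move=> E. have := f_equal snd E. simpl. lra.
- replace (z + (0, (Rmin d r / 2)%R) - z)%C with ((0, (Rmin d r / 2)%R) : C) by (apply: injective_projections; simpl; ring).
  apply: Rle_lt_trans (Cmod_le_sum _) _. rewrite /= Rabs_R0 Rabs_pos_eq; lra.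
Qed.

Lemma Cmod_0h h : 0 < h -> Cmod (0, h) = h.
Proof. move=> h0. have -> : ((0, h) : C) = (Ci * h)%C by apply: injective_projections; simpl; ring. rewrite Cmod_mult Cmod_Ci Cmod_R Rabs_pos_eq; lra. Qed.

Section Core.
Variables (Lp : (R -> C) -> Prop) (ip : (R -> C) -> (R -> C) -> R).
Hypothesis LI : L2space Lp ip.

Section OneSided.
Variables (ell : (R -> C) -> C) (G H L : C -> C).
Hypothesis Fn : functional Lp ip ell.
Hypothesis hG : forall z, holo G z.
Hypothesis hH : forall z, holo H z.
Hypothesis LG : Lp (fun t : R => G t).
Hypothesis LH : Lp (fun t : R => H t).
Hypothesis ellG : ell (fun t : R => G t) <> 0%C.
Hypothesis ellH : ell (fun t : R => H t) = 0%C.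
Hypothesis LE : forall z, snd z <> 0 -> (H z * L z = H z * cauchyT ell (fun t : R => G t) z - G z * cauchyT ell (fun t : R => H t) z)%C.

Lemma rcont_entire F t : (forall z, holo F z) -> rcont (fun t : R => F t) t.
Proof. move=> hF. apply: rcont_real. apply: holo_cont. exact: hF. Qed.

Lemma zero_ratio : (forall z, L z = 0%C) -> exists Y, forall y, Y <= Rabs y -> y <> 0 -> Cmod (H (0, y)) <= / 2 * Cmod (G (0, y)).
Proof.
move=> L0. have a0 := Cmod_pos _ ellG. set a := Cmod _ in a0.
have [Y1 h1] := cauchyT_axis _ _ LI ell Fn _ (a / 4) (fun t => rcont_entire G t hG) LG ltac:(lra).
have [Y2 h2] := cauchyT_axis _ _ LI ell Fn _ (a / 4) (fun t => rcont_entire H t hH) LH ltac:(lra).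
exists (Rmax Y1 Y2) => y hy yn.
have k1 := h1 y (Rle_trans _ _ _ (Rmax_l _ _) hy) yn. have k2 := h2 y (Rle_trans _ _ _ (Rmax_r _ _) hy) yn.
rewrite ellH Cplus_0_r in k2.
have E := LE (0, y) yn. rewrite L0 in E.
set cG := cauchyT ell (fun t : R => G t) (0, y) in k1 E. set cH := cauchyT ell (fun t : R => H t) (0, y) in k2 E.
have E2 : (H (0, y) * ((0, y) * cG) = G (0, y) * ((0, y) * cH))%C.
  replace (H (0, y) * ((0, y) * cG))%C with ((0, y) * (H (0, y) * cG - G (0, y) * cH) + G (0, y) * ((0, y) * cH))%C by ring. rewrite -E. ring.
have E3 := f_equal Cmod E2. rewrite Cmod_mult (Cmod_mult (G (0, y))) in E3.
have k3 : 3 * a / 4 <= Cmod ((0, y) * cG)%C.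
  have := Cmod_sub ((0, y) * cG + ell (fun t : R => G t))%C ((0, y) * cG)%C.
  replace ((0, y) * cG + ell (fun t : R => G t) - (0, y) * cG)%C with (ell (fun t : R => G t)) by ring. rewrite -/a. lra.
have g0 := Cmod_ge_0 (G (0, y)). have h0 := Cmod_ge_0 (H (0, y)).
have p1 : Cmod (H (0, y)) * (3 * a / 4) <= Cmod (H (0, y)) * Cmod ((0, y) * cG)%C by exact: Rmult_le_compat_l.
have p2 : Cmod (G (0, y)) * Cmod ((0, y) * cH)%C <= Cmod (G (0, y)) * (a / 4) by exact: Rmult_le_compat_l.
apply: (Rmult_le_reg_r a) => //. nra.
Qed.

Lemma dominated_bound : exists c, 0 <= c /\ forall z, snd z <> 0 -> H z <> 0%C -> Cmod (G z) <= Cmod (H z) -> Cmod (L z) * Rabs (snd z) <= c.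
Proof.
have [K [K0 HK]] := cauchyT_bound _ _ LI ell Fn.
set sG := sqrt (ip (fun t : R => G t) (fun t : R => G t)). set sH := sqrt (ip (fun t : R => H t) (fun t : R => H t)).
have sG0 : 0 <= sG by exact: sqrt_pos. have sH0 : 0 <= sH by exact: sqrt_pos.
exists (K * sG + K * sH); split; first by apply: Rplus_le_le_0_compat; exact: Rmult_le_pos.
move=> z hz nz GH. have p := Cmod_pos _ nz. have y0 : 0 < Rabs (snd z) by exact: Rabs_pos_lt.
have c1 := HK _ z (fun t => rcont_entire G t hG) LG hz. have c2 := HK _ z (fun t => rcont_entire H t hH) LH hz. rewrite -/sG in c1. rewrite -/sH in c2.
have E := f_equal Cmod (LE z hz). rewrite Cmod_mult in E.
apply: (Rmult_le_reg_l (Cmod (H z))) => //. rewrite -Rmult_assoc E.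
have : Cmod (H z * cauchyT ell (fun t : R => G t) z - G z * cauchyT ell (fun t : R => H t) z)%C <= Cmod (H z) * ((K * sG + K * sH) / Rabs (snd z)).
  apply: Rle_trans (Cmod_sub _ _) _. rewrite !Cmod_mult.
  have -> : (K * sG + K * sH) / Rabs (snd z) = K * sG / Rabs (snd z) + K * sH / Rabs (snd z) by field; lra.
  rewrite Rmult_plus_distr_l. apply: Rplus_le_compat; apply: Rmult_le_compat => //; try exact: Cmod_ge_0. lra.
move=> h. apply: (Rle_trans _ (Cmod (H z) * ((K * sG + K * sH) / Rabs (snd z)) * Rabs (snd z))); first by apply: Rmult_le_compat_r; lra.
right. field. lra.
Qed.
End OneSided.

Section TwoSided.
Variables (ell1 ell2 : (R -> C) -> C) (G1 G2 L1 L2 : C -> C).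
Hypothesis Fn1 : functional Lp ip ell1.
Hypothesis Fn2 : functional Lp ip ell2.
Hypothesis hG1 : forall z, holo G1 z.
Hypothesis hG2 : forall z, holo G2 z.
Hypothesis LG1 : Lp (fun t : R => G1 t).
Hypothesis LG2 : Lp (fun t : R => G2 t).
Hypothesis e11 : ell1 (fun t : R => G1 t) = 0%C.
Hypothesis e12 : ell1 (fun t : R => G2 t) <> 0%C.
Hypothesis e21 : ell2 (fun t : R => G1 t) <> 0%C.
Hypothesis e22 : ell2 (fun t : R => G2 t) = 0%C.
Hypothesis hL1 : forall z, holo L1 z.
Hypothesis hL2 : forall z, holo L2 z.
Hypothesis tL1 : type_zero L1.
Hypothesis tL2 : type_zero L2.
Hypothesis LE1 : forall z, snd z <> 0 -> (G1 z * L1 z = G1 z * cauchyT ell1 (fun t : R => G2 t) z - G2 z * cauchyT ell1 (fun t : R => G1 t) z)%C.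
Hypothesis LE2 : forall z, snd z <> 0 -> (G2 z * L2 z = G2 z * cauchyT ell2 (fun t : R => G1 t) z - G1 z * cauchyT ell2 (fun t : R => G2 t) z)%C.

Lemma functional_nonzero ell (G : C -> C) : functional Lp ip ell -> Lp (fun t : R => G t) -> ell (fun t : R => G t) <> 0%C -> exists z : C, G z <> 0%C.
Proof.
move=> [_ sc _] LG n. apply: NNPP => N. apply: n.
have E : (fun t : R => G t) = (fun t : R => 0 * G t)%C.
  apply: functional_extensionality => t. rewrite Cmult_0_l. apply: NNPP => h. apply: N. by exists (RtoC t).
rewrite E sc //. ring.
Qed.

(** The larger of |G1(z)| and |G2(z)| serves as denominator. A common zero is approached through
    points where G1 is nonzero; one of the two alternatives then occurs arbitrarily close to it, and
    [limit_bound] applies. *)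
Lemma min_bound : exists c, 0 <= c /\ forall z, snd z <> 0 -> Cmod (L1 z) * Rabs (snd z) <= c \/ Cmod (L2 z) * Rabs (snd z) <= c.
Proof.
have [c1 [p1 b1]] := dominated_bound ell1 G2 G1 L1 Fn1 hG2 hG1 LG2 LG1 LE1.
have [c2 [p2 b2]] := dominated_bound ell2 G1 G2 L2 Fn2 hG1 hG2 LG1 LG2 LE2.
exists (c1 + c2); split; first lra.
have direct z : snd z <> 0 -> G1 z <> 0%C \/ G2 z <> 0%C -> Cmod (L1 z) * Rabs (snd z) <= c1 + c2 \/ Cmod (L2 z) * Rabs (snd z) <= c1 + c2.
  move=> hz n. case: (Rle_lt_dec (Cmod (G2 z)) (Cmod (G1 z))) => h.
  - left. have : G1 z <> 0%C.
      case: n => // n E. rewrite E Cmod_0 in h. have := Cmod_pos _ n. lra.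
    move=> n1. have := b1 z hz n1 h. lra.
  - right. have : G2 z <> 0%C by apply: Cneq_mod; have := Cmod_ge_0 (G1 z); lra.
    move=> n2. have := b2 z hz n2 (Rlt_le _ _ h). lra.
have nz1 := functional_nonzero ell2 G1 Fn2 LG1 e21.
move=> z hz. have y0 : 0 < Rabs (snd z) by exact: Rabs_pos_lt.
have near d : 0 < d -> exists w, Cmod (w - z)%C < d /\ (Cmod (L1 w) * Rabs (snd w) <= c1 + c2 \/ Cmod (L2 w) * Rabs (snd w) <= c1 + c2).
  move=> d0. have [h [hh n]] := nonzero_near G1 z (Rmin d (Rabs (snd z))) hG1 nz1 (Rmin_glb_lt _ _ _ d0 y0).
  have m1 := Rmin_l d (Rabs (snd z)). have m2 := Rmin_r d (Rabs (snd z)).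
  exists (z + (0, h))%C; split.
  - replace (z + (0, h) - z)%C with ((0, h) : C) by (apply: injective_projections; simpl; ring). rewrite Cmod_0h; lra.
  - apply: direct; last by left. simpl. move=> E. have E2 : Rabs (snd z) = h by rewrite (_ : snd z = - h); [rewrite Rabs_Ropp Rabs_pos_eq; lra | lra]. lra.
case: (classic (forall d, 0 < d -> exists w, Cmod (w - z)%C < d /\ Cmod (L1 w) * Rabs (snd w) <= c1 + c2)) => h.
  left. exact: limit_bound.
right. apply: limit_bound => // d d0. apply: NNPP => N. apply: h => d' d'0.
have [w [hw [hb|hb]]] := near (Rmin d d') (Rmin_glb_lt _ _ _ d0 d'0).
- exists w; split => //. apply: Rlt_le_trans hw (Rmin_r _ _).
- case: N. exists w; split => //. apply: Rlt_le_trans hw (Rmin_l _ _).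
Qed.

(** If the constant is not 0, the alternative for L1 fails high up on the axis, so L2 decays
    there. *)
Lemma const_case : (forall z w, L1 z = L1 w) -> (forall z, L1 z = 0%C) \/ (forall z, L2 z = 0%C).
Proof.
move=> cst. case: (classic (L1 0%C = 0%C)) => n; first by left => z; rewrite (cst z 0%C).
right. have k0 := Cmod_pos _ n. have [c [c0 H]] := min_bound.
apply: (axis_decay L2 c (c / Cmod (L1 0%C) + 1)) => // y hy yn.
case: (H (0, y) yn) => //=. rewrite (cst (0, y) 0%C) => h.
have : Cmod (L1 0%C) * (c / Cmod (L1 0%C) + 1) <= Cmod (L1 0%C) * Rabs y by apply: Rmult_le_compat_l; lra.
have -> : Cmod (L1 0%C) * (c / Cmod (L1 0%C) + 1) = c + Cmod (L1 0%C) by field; lra. lra.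
Qed.

(** By [zero_ratio] the vanishing of L1 makes G1 smaller than G2 far out on the axis, and there
    [dominated_bound] controls L2. *)
Lemma zero_case : (forall z, L1 z = 0%C) -> forall z, L2 z = 0%C.
Proof.
move=> L0. have [Y HY] := zero_ratio ell1 G2 G1 L1 Fn1 hG2 hG1 LG2 LG1 e12 e11 LE1 L0.
have [c [c0 b]] := dominated_bound ell2 G1 G2 L2 Fn2 hG1 hG2 LG1 LG2 LE2.
have nz2 := functional_nonzero ell1 G2 Fn1 LG2 e12.
apply: (axis_decay L2 c (Rmax Y 0 + 1)) => // y hy yn.
have y1 := Rmax_l Y 0. have y2 := Rmax_r Y 0.
apply: (limit_bound L2 (0, y)) => // d d0.
have m0 : 0 < Rmin d 1 by apply: Rmin_glb_lt; lra. have m1 := Rmin_l d 1. have m2 := Rmin_r d 1.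
have [h [hh n]] := nonzero_near G2 (0, y) (Rmin d 1) hG2 nz2 m0.
have E : ((0, y) + (0, h))%C = (0, (y + h)%R) by apply: injective_projections; simpl; ring.
rewrite E in n. have yh : Rmax Y 0 < Rabs (y + h).
  have := Rabs_triang_inv y (- h). rewrite Rabs_Ropp (Rabs_pos_eq h); last lra. rewrite (_ : y - - h = y + h); [lra | ring].
have yhn : y + h <> 0 by move=> E0; rewrite E0 Rabs_R0 in yh; lra.
exists (0, (y + h)%R); split.
- rewrite -E. replace ((0, y) + (0, h) - (0, y))%C with ((0, h) : C) by (apply: injective_projections; simpl; ring). rewrite Cmod_0h; lra.
- apply: b => //. have := HY (y + h) ltac:(lra) yhn. have := Cmod_ge_0 (G2 (0, (y + h)%R)). lra.
Qed.
End TwoSided.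

Variables B1 B2 : (C -> C) -> Prop.
Hypothesis DB1 : dBlike Lp B1.
Hypothesis DB2 : dBlike Lp B2.
Hypothesis dist1 : forall G, B2 G -> ~ B1 G -> exists d, 0 < d /\ forall F, B1 F ->
  d <= ip (fun t : R => G t - F t)%C (fun t : R => G t - F t)%C.
Hypothesis dist2 : forall G, B1 G -> ~ B2 G -> exists d, 0 < d /\ forall F, B2 F ->
  d <= ip (fun t : R => G t - F t)%C (fun t : R => G t - F t)%C.

Lemma annihilator B G H : dBlike Lp B -> B H -> Lp (fun t : R => G t) ->
  (exists d, 0 < d /\ forall F, B F -> d <= ip (fun t : R => G t - F t)%C (fun t : R => G t - F t)%C) ->
  exists ell, functional Lp ip ell /\ (forall F, B F -> ell (fun t : R => F t) = 0%C) /\ ell (fun t : R => G t) <> 0%C.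
Proof.
move=> DB bH LG [d [d0 hd]].
have [ell [h1 [h2 h3]]] := separating_functional Lp ip LI (fun s => exists F, B F /\ s = (fun t : R => F t)) (fun t : R => G t) d
  ltac:(move=> s [F [bF ->]]; exact: (db_Lp _ _ DB))
  ltac:(move=> f g [F [bF ->]] [F' [bF' ->]]; exists (fun z => F z + F' z)%C; split => //; exact: (db_add _ _ DB))
  ltac:(move=> c f [F [bF ->]]; exists (fun z => c * F z)%C; split => //; exact: (db_scal _ _ DB))
  (ex_intro _ _ (ex_intro _ H (conj bH eq_refl))) LG d0 ltac:(move=> s [F [bF ->]]; exact: hd).
exists ell; split => //; split => // F bF. apply: h2. by exists F.
Qed.

Theorem ordering_core : (forall F, B2 F -> B1 F) \/ (forall F, B1 F -> B2 F).
Proof.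
apply: NNPP => N.
have [G2 [g2 n2]] : exists G, B2 G /\ ~ B1 G.
  apply: NNPP => n. apply: N. left => F h. apply: NNPP => h'. apply: n. by exists F.
have [G1 [g1 n1]] : exists G, B1 G /\ ~ B2 G.
  apply: NNPP => n. apply: N. right => F h. apply: NNPP => h'. apply: n. by exists F.
have LG1 := db_Lp _ _ DB1 _ g1. have LG2 := db_Lp _ _ DB2 _ g2.
have hG1 := db_entire _ _ DB1 _ g1. have hG2 := db_entire _ _ DB2 _ g2.
have [ell1 [F1 [z1 e12]]] := annihilator B1 G2 G1 DB1 g1 LG2 (dist1 G2 g2 n2).
have [ell2 [F2 [z2 e21]]] := annihilator B2 G1 G2 DB2 g2 LG1 (dist2 G1 g1 n1).
have nz1 := functional_nonzero ell2 G1 F2 LG1 e21. have nz2 := functional_nonzero ell1 G2 F1 LG2 e12.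
have ne1 : exists F z, B1 F /\ F z <> 0%C by have [z hz] := nz1; exists G1, z.
have ne2 : exists F z, B2 F /\ F z <> 0%C by have [z hz] := nz2; exists G2, z.
have [L1 [hL1 [tL1 E1]]] := quotient_function Lp ip B1 LI DB1 ell1 G2 F1 z1 hG2 (db_type _ _ DB2 _ g2) LG2 ne1.
have [L2 [hL2 [tL2 E2]]] := quotient_function Lp ip B2 LI DB2 ell2 G1 F2 z2 hG1 (db_type _ _ DB1 _ g1) LG1 ne2.
have LE1 z : snd z <> 0 -> _ := fun hz => E1 G1 z g1 hz. have LE2 z : snd z <> 0 -> _ := fun hz => E2 G2 z g2 hz.
have e11 := z1 G1 g1. have e22 := z2 G2 g2.
have [c [c0 mb]] := min_bound ell1 ell2 G1 G2 L1 L2 F1 F2 hG1 hG2 LG1 LG2 e21 hL1 hL2 LE1 LE2.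
have mb' : exists c, 0 <= c /\ forall z, snd z <> 0 -> Cmod (L2 z) * Rabs (snd z) <= c \/ Cmod (L1 z) * Rabs (snd z) <= c.
  exists c; split => // z hz. case: (mb z hz); tauto.
have zz12 := zero_case ell1 ell2 G1 G2 L1 L2 F1 F2 hG1 hG2 LG1 LG2 e11 e12 hL2 tL2 LE1 LE2.
have zz21 := zero_case ell2 ell1 G2 G1 L2 L1 F2 F1 hG2 hG1 LG2 LG1 e22 e21 hL1 tL1 LE2 LE1.
have zero : (forall z, L1 z = 0%C) /\ (forall z, L2 z = 0%C).
  (* For |Im z| >= c + 1 a bound c/|Im z| is at most 1, and c + 1 is positive even if c = 0. *)
  case: (carleman_pair L1 L2 (c + 1) hL1 hL2 tL1 tL2 ltac:(lra)).
  - move=> z hz. have zn : snd z <> 0 by move=> E; rewrite E Rabs_R0 in hz; lra.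
    have le1 x : 0 <= x -> x * Rabs (snd z) <= c -> x <= 1 by move=> x0 h; nra.
    case: (mb z zn) => h; [left|right]; apply: le1 => //; exact: Cmod_ge_0.
  - move=> cst. case: (const_case ell1 ell2 G1 G2 L1 L2 F1 F2 hG1 hG2 LG1 LG2 e21 hL1 hL2 tL2 LE1 LE2 cst) => h; split => //; [exact: zz12 | exact: zz21].
  - move=> cst. case: (const_case ell2 ell1 G2 G1 L2 L1 F2 F1 hG2 hG1 LG2 LG1 e12 hL2 hL1 tL1 LE2 LE1 cst) => h; split => //; [exact: zz21 | exact: zz12].
have [Y1 r1] := zero_ratio ell1 G2 G1 L1 F1 hG2 hG1 LG2 LG1 e12 e11 LE1 (proj1 zero).
have [Y2 r2] := zero_ratio ell2 G1 G2 L2 F2 hG1 hG2 LG1 LG2 e21 e22 LE2 (proj2 zero).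
set Y := Rmax (Rmax Y1 Y2) 1. have y1 : Rmax Y1 Y2 <= Y by exact: Rmax_l. have y2 : 1 <= Y by exact: Rmax_r.
have y3 := Rmax_l Y1 Y2. have y4 := Rmax_r Y1 Y2.
(* Beyond Y each of |G1| and |G2| is at most half of the other, which forces G1 = 0 at a point
   chosen with G1 nonzero. *)
have [h [hh n]] := nonzero_near G1 (0, Y) 1 hG1 nz1 Rlt_0_1. apply: n.
have -> : ((0, Y) + (0, h))%C = (0, (Y + h)%R) by apply: injective_projections; simpl; ring.
have a : Rabs (Y + h) = Y + h by apply: Rabs_pos_eq; lra.
have k1 := r1 (Y + h) ltac:(lra) ltac:(lra). have k2 := r2 (Y + h) ltac:(lra) ltac:(lra).
apply: Cmod_eq_0. have := Cmod_ge_0 (G1 (0, (Y + h)%R)). lra.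
Qed.
End Core.


(** * Functions of bounded type and nonpositive mean type *)

Definition sq_mod (f : R -> C) (t : R) : R := Cmod (f t) * Cmod (f t).

(** Relates L2 of Lebesgue measure to Riemann integrals of continuous functions over segments:
    [leb_le] restricts to a segment, [leb_ge] exhausts the line by segments. *)
Record lebesgue_like (Lp : (R -> C) -> Prop) (ip : (R -> C) -> (R -> C) -> R) : Prop := {
  leb_space : L2space Lp ip;
  leb_le : forall phi a b, (forall t, rcont phi t) -> Lp phi -> a <= b -> RInt (sq_mod phi) a b <= ip phi phi;
  leb_ge : forall phi c, (forall t, rcont phi t) -> (forall a b, a <= b -> RInt (sq_mod phi) a b <= c) -> Lp phi /\ ip phi phi <= c }.

Lemma continuous_Cmod g t : rcont g t -> continuous (fun t => Cmod (g t)) t.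
Proof.
move=> H. apply/filterlim_locally => e. have [d [d0 K]] := H e (cond_pos e). exists (mkposreal d d0) => s Hs.
apply: Rle_lt_trans (K s Hs). apply: Rabs_le. rewrite /minus /plus /opp /=.
have := Cmod_rev (g s) (g t). have := Cmod_rev (g t) (g s). rewrite (Cmod_sub_sym (g t)). lra.
Qed.

Lemma sq_mod_cont g t : (forall t, rcont g t) -> continuous (sq_mod g) t.
Proof. move=> H. have c := continuous_Cmod g t (H t). exact: (continuous_Rmult (fun t => Cmod (g t)) (fun t => Cmod (g t)) t c c). Qed.

Lemma sq_mod_add f g t : sq_mod (fun t => f t + g t)%C t <= 2 * sq_mod f t + 2 * sq_mod g t.
Proof.
rewrite /sq_mod. have h := Cmod_triangle (f t) (g t). have := Cmod_ge_0 (f t). have := Cmod_ge_0 (g t). have := Cmod_ge_0 (f t + g t)%C.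
have := pow2_ge_0 (Cmod (f t) - Cmod (g t)). nra.
Qed.

Lemma RInt_sq_add f g a b : a <= b -> (forall t, rcont f t) -> (forall t, rcont g t) ->
  RInt (sq_mod (fun t => f t + g t)%C) a b <= 2 * RInt (sq_mod f) a b + 2 * RInt (sq_mod g) a b.
Proof.
move=> ab hf hg.
have c1 t : continuous (fun t => 2 * sq_mod f t) t by apply: continuous_Rmult; [exact: continuous_const | exact: sq_mod_cont].
have c2 t : continuous (fun t => 2 * sq_mod g t) t by apply: continuous_Rmult; [exact: continuous_const | exact: sq_mod_cont].
have -> : 2 * RInt (sq_mod f) a b + 2 * RInt (sq_mod g) a b = RInt (fun t => 2 * sq_mod f t + 2 * sq_mod g t) a b.
  rewrite (@RInt_plus R_CompleteNormedModule); [|exact: exRc|exact: exRc].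
  by rewrite !(@RInt_scal R_CompleteNormedModule); [| apply: exRc => t; exact: sq_mod_cont | apply: exRc => t; exact: sq_mod_cont].
apply: RInt_le => //; last by move=> t _; exact: sq_mod_add.
- apply: exRc => t. apply: sq_mod_cont => s. exact: rcont_plus.
- apply: exRc => t. exact: continuous_Rplus.
Qed.

Lemma RInt_sq_bound f a b M : a <= b -> (forall t, rcont f t) -> (forall t, a <= t <= b -> Cmod (f t) <= M) ->
  RInt (sq_mod f) a b <= (b - a) * (M * M).
Proof.
move=> ab hf hM. have -> : (b - a) * (M * M) = RInt (fun _ => M * M) a b by rewrite RInt_const.
apply: RInt_le => //; [apply: exRc => t; exact: sq_mod_cont | apply: exRc => t; exact: continuous_const |].
move=> t ht. apply: Rmult_le_compat; try exact: Cmod_ge_0; apply: hM; lra.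
Qed.

Lemma Cconj_sub (a b : C) : Cconj (a - b)%C = (Cconj a - Cconj b)%C.
Proof. apply: injective_projections; simpl; ring. Qed.

Lemma holo_sharp F : (forall z, holo F z) -> forall z, holo (sharp F) z.
Proof.
move=> H z. have [l Hl] := H (Cconj z). exists (Cconj l) => e e0. have [d [d0 K]] := Hl e e0. exists d; split => // h Hh.
rewrite /sharp. have k := K (Cconj h) ltac:(by rewrite Cmod_conj). rewrite Cmod_conj in k.
rewrite -Cmod_conj. have -> : Cconj (Cconj (F (Cconj (z + h))) - Cconj (F (Cconj z)) - Cconj l * h)%C = (F (Cconj z + Cconj h) - F (Cconj z) - l * Cconj h)%C; last exact: k.
rewrite !Cconj_sub Cmult_conj !Cconj_conj. have -> : Cconj (z + h) = (Cconj z + Cconj h)%C by apply: injective_projections; simpl; ring. done.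
Qed.

Definition nevanlinna0 (N : C -> C) : Prop := bounded_type N /\ nonpos_mean_type N.

Lemma bounded_type_elim N : bounded_type N -> (forall z, 0 < snd z -> holo N z) /\ exists g h M z0, 0 <= M /\
  (forall z, 0 < snd z -> holo g z /\ holo h z /\ Cmod (g z) <= M /\ Cmod (h z) <= M) /\ 0 < snd z0 /\ h z0 <> 0%C /\
  forall z, 0 < snd z -> h z <> 0%C -> N z = (g z / h z)%C.
Proof.
move=> [hN [g [h [[hg [M1 b1]] [[hh [M2 b2]] [[z0 [y0 n0]] E]]]]]].
split; first by move=> z hz; apply/holo_ex_derive; exact: hN.
exists g, h, (Rmax M1 M2), z0. have p := b1 z0 y0. have q := Cmod_ge_0 (g z0). have r := Rmax_l M1 M2. have r2 := Rmax_r M1 M2.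
split; first lra. split => // z hz. have := b1 z hz. have := b2 z hz. split; first by apply/holo_ex_derive; exact: hg.
split; first by apply/holo_ex_derive; exact: hh. lra.
Qed.

Lemma bounded_type_intro N (g h : C -> C) M (z0 : C) : (forall z, 0 < snd z -> holo N z) ->
  (forall z, 0 < snd z -> holo g z /\ holo h z /\ Cmod (g z) <= M /\ Cmod (h z) <= M) -> 0 < snd z0 -> h z0 <> 0%C ->
  (forall z, 0 < snd z -> h z <> 0%C -> N z = (g z / h z)%C) -> bounded_type N.
Proof.
move=> hN H y0 n0 E. split; first by move=> z hz; apply/holo_ex_derive; exact: hN.
exists g, h; split; [|split; [|split => //; by exists z0]].
- split; first by move=> z hz; apply/holo_ex_derive; exact: (proj1 (H z hz)). exists M => z hz. by have [_ [_ []]] := H z hz.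
- split; first by move=> z hz; apply/holo_ex_derive; exact: (proj1 (proj2 (H z hz))). exists M => z hz. by have [_ [_ []]] := H z hz.
Qed.

Lemma nevanlinna_growth N : bounded_type N -> exists A, 0 <= A /\ forall z, 0 < snd z -> Cmod (N z) <= exp (A * (1 + Cmod z * Cmod z) / snd z).
Proof.
move=> /bounded_type_elim [hN [g [h [M [z0 [M0 [H [y0 [n0 E]]]]]]]]].
apply: (bounded_type_growth N h z0 M y0 hN) => //.
- by move=> z hz; have [_ []] := H z hz.
- by move=> z hz; have [_ [_ []]] := H z hz.
- move=> z hz. have [_ [_ [b1 _]]] := H z hz. case: (classic (h z = 0%C)) => n.
  + rewrite n Cmult_0_r Cmod_0. lra.
  + rewrite E //. replace (g z / h z * h z)%C with (g z) by (by field). done.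
Qed.

Lemma nevanlinna_scal (c : C) N : nevanlinna0 N -> nevanlinna0 (fun z => c * N z)%C.
Proof.
move=> [/bounded_type_elim [hN [g [h [M [z0 [M0 [H [y0 [n0 E]]]]]]]]] mt]. split.
- have c0 := Cmod_ge_0 c. apply: (bounded_type_intro _ (fun z => c * g z)%C h ((Cmod c + 1) * M) z0) => //.
  + move=> z hz. apply: holo_mult; [exact: holo_const | exact: hN].
  + move=> z hz. have [h1 [h2 [h3 h4]]] := H z hz. split; first by apply: holo_mult => //; exact: holo_const. split => //.
    rewrite Cmod_mult. have := Cmod_ge_0 (g z). have := Cmod_ge_0 (h z). nra.
  + move=> z hz n. rewrite E //. by field.
(* Half of the exponent absorbs the constant, since exp(e y/2) >= e y/2 >= |c|. *)
- move=> e e0. have [Y HY] := mt (e / 2) ltac:(lra). exists (Rmax Y (2 * Cmod c / e)) => y hy.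
  have y1 : Y <= y by apply: Rle_trans hy; exact: Rmax_l. have y2 : 2 * Cmod c / e <= y by apply: Rle_trans hy; exact: Rmax_r.
  rewrite Cmod_mult. have -> : e * y = e * y / 2 + e / 2 * y by field. rewrite exp_plus.
  apply: Rmult_le_compat; try exact: Cmod_ge_0; last exact: HY.
  apply: (Rle_trans _ (e * y / 2)); last by have := exp_ineq1_le (e * y / 2); lra.
  have -> : Cmod c = e * (2 * Cmod c / e) / 2 by field; lra. have : e * (2 * Cmod c / e) <= e * y by apply: Rmult_le_compat_l; lra. lra.
Qed.

Lemma nevanlinna_add N1 N2 : nevanlinna0 N1 -> nevanlinna0 N2 -> nevanlinna0 (fun z => N1 z + N2 z)%C.
Proof.
move=> [/bounded_type_elim [hN [g [h [M [z0 [M0 [H [y0 [n0 E]]]]]]]]] mt].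
move=> [/bounded_type_elim [hN' [g' [h' [M' [z0' [M0' [H' [y0' [n0' E']]]]]]]]] mt']. split.
- have [z1 [y1 n1]] := upper_product_neq0 h h' z0 z0' M' (fun z hz => proj1 (proj2 (H z hz))) (fun z hz => proj1 (proj2 (H' z hz)))
    (fun z hz => proj2 (proj2 (proj2 (H' z hz)))) y0 y0' n0 n0'.
  apply: (bounded_type_intro _ (fun z => g z * h' z + g' z * h z)%C (fun z => h z * h' z)%C (2 * (M * M')) z1) => //.
  + move=> z hz. apply: holo_plus; [exact: hN | exact: hN'].
  + move=> z hz. have [h1 [h2 [h3 h4]]] := H z hz. have [h1' [h2' [h3' h4']]] := H' z hz.
    split; first by apply: holo_plus; apply: holo_mult. split; first exact: holo_mult.
    have p a b a' b' : 0 <= a -> 0 <= b -> a <= a' -> b <= b' -> a * b <= a' * b' by move=> *; apply: Rmult_le_compat.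
    have q1 := p _ _ _ _ (Cmod_ge_0 (g z)) (Cmod_ge_0 (h' z)) h3 h4'. have q2 := p _ _ _ _ (Cmod_ge_0 (h z)) (Cmod_ge_0 (g' z)) h4 h3'.
    have q3 := p _ _ _ _ (Cmod_ge_0 (h z)) (Cmod_ge_0 (h' z)) h4 h4'.
    split.
      apply: Rle_trans (Cmod_triangle _ _) _. rewrite !Cmod_mult. lra.
    rewrite Cmod_mult. have := Rmult_le_pos _ _ M0 M0'. lra.
  + move=> z hz n. have nh : h z <> 0%C by move=> e; apply: n; rewrite e; ring.
    have nh' : h' z <> 0%C by move=> e; apply: n; rewrite e; ring. rewrite E // E' //. field. by split.
- move=> e e0. have [Y HY] := mt (e / 2) ltac:(lra). have [Y' HY'] := mt' (e / 2) ltac:(lra). exists (Rmax (Rmax Y Y') (2 / e)) => y hy.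
  have y2 : 2 / e <= y by apply: Rle_trans hy; exact: Rmax_r. have y3 : Rmax Y Y' <= y by apply: Rle_trans hy; exact: Rmax_l.
  have k1 := HY y (Rle_trans _ _ _ (Rmax_l _ _) y3). have k2 := HY' y (Rle_trans _ _ _ (Rmax_r _ _) y3).
  apply: Rle_trans (Cmod_triangle _ _) _. have -> : e * y = e / 2 * y + e / 2 * y by field. rewrite exp_plus.
  have : 2 <= exp (e / 2 * y).
    have := exp_ineq1_le (e / 2 * y). have : e / 2 * (2 / e) <= e / 2 * y by apply: Rmult_le_compat_l; lra.
    have -> : e / 2 * (2 / e) = 1 by field; lra. lra.
  nra.
Qed.

Lemma upper_plus_i (z : C) : 0 < snd z -> (z + Ci)%C <> 0%C /\ 1 <= Cmod (z + Ci)%C.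
Proof.
move=> hz. have := Cmod_snd (z + Ci)%C. rewrite /= Rabs_pos_eq; last lra. move=> h. split; last lra. apply: Cneq_mod. lra.
Qed.

(* The zero of N at w is divided out of the quotient g/h as [g/(z + i)] / [h (z - w)/(z + i)]. *)
Lemma nevanlinna_divide N N' w : nevanlinna0 N -> (forall z, 0 < snd z -> holo N' z) -> (forall z, z <> w -> N' z = (N z / (z - w))%C) -> nevanlinna0 N'.
Proof.
move=> [/bounded_type_elim [hN [g [h [M [z0 [M0 [H [y0 [n0 E]]]]]]]]] mt] hN' EN.
(* The new denominator contains the factor z - w, so its nonvanishing has to be shown at a point
   other than w. *)
have [z1 [y1 [n1 w1]]] : exists z1, 0 < snd z1 /\ h z1 <> 0%C /\ z1 <> w.
  case: (classic (z0 = w)) => e; last by exists z0.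
  have [d [d0 K]] := holo_cont h z0 (proj1 (proj2 (H z0 y0))) (Cmod (h z0)) (Cmod_pos _ n0).
  exists (z0 + RtoC (d / 2))%C. split; first by simpl; lra. split.
  - move=> q. have := K (z0 + RtoC (d / 2))%C. replace (z0 + RtoC (d/2) - z0)%C with (RtoC (d/2)) by ring.
    rewrite Cmod_R Rabs_pos_eq; last lra. move=> /(_ ltac:(lra)). rewrite q. replace (0 - h z0)%C with (- h z0)%C by ring. rewrite Cmod_opp. lra.
  - rewrite -e. move=> q. have := f_equal fst q. simpl. lra.
split.
- apply: (bounded_type_intro _ (fun z => g z / (z + Ci))%C (fun z => h z * ((z - w) / (z + Ci)))%C (M * (1 + Cmod (w + Ci)%C)) z1) => //.
  + move=> z hz. have [h1 [h2 [h3 h4]]] := H z hz. have [n i1] := upper_plus_i z hz. have wp := Cmod_ge_0 (w + Ci)%C.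
    have hi : holo (fun z => z + Ci)%C z by holo_tac.
    split; first exact: holo_div. split; first by apply: holo_mult => //; apply: holo_div => //; holo_tac.
    have i2 : / Cmod (z + Ci)%C <= 1 by rewrite -Rinv_1; apply: Rinv_le_contravar; lra.
    split.
    * rewrite Cmod_div //. apply: Rmult_le_compat; [exact: Cmod_ge_0 | left; apply: Rinv_0_lt_compat; lra | done | lra].
    * rewrite Cmod_mult. apply: Rmult_le_compat => //; try exact: Cmod_ge_0.
      replace ((z - w) / (z + Ci))%C with (1 - (w + Ci) / (z + Ci))%C by (by field).
      apply: Rle_trans (Cmod_sub _ _) _. rewrite Cmod_1 Cmod_div //. apply: Rplus_le_compat_l. rewrite -[X in _ <= X]Rmult_1_r. apply: Rmult_le_compat_l; lra.
  + have [n i1] := upper_plus_i z1 y1. apply: Cmult_neq_0 => //. apply: Cmult_neq_0; first exact: Csub_neq0.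
    move=> q. have : (/ (z1 + Ci) * (z1 + Ci))%C = 1%C by field. rewrite q Cmult_0_l => q2. have := f_equal fst q2. simpl. lra.
  + move=> z hz n. have [ni i1] := upper_plus_i z hz.
    have nh : h z <> 0%C by move=> e; apply: n; rewrite e; ring.
    have nw : (z - w)%C <> 0%C by move=> e; apply: n; rewrite e /Cdiv; ring.
    rewrite EN; last by move=> q; apply: nw; rewrite q; ring. rewrite E //. by field.
- move=> e e0. have [Y HY] := mt e e0. exists (Rmax Y (Cmod w + 1)) => y hy.
  have y1' : Y <= y by apply: Rle_trans hy; exact: Rmax_l. have y2 : Cmod w + 1 <= y by apply: Rle_trans hy; exact: Rmax_r.
  have w0 := Cmod_ge_0 w. have d1 : 1 <= Cmod ((0, y) - w)%C by have := Cmod_rev (0, y) w; rewrite Cmod_0h; lra.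
  have nw : ((0, y) - w)%C <> 0%C by apply: Cneq_mod; lra.
  rewrite EN; last by move=> q; apply: nw; rewrite q; ring. rewrite Cmod_div //. apply: Rle_trans (HY y y1').
  rewrite -[X in _ <= X]Rmult_1_r. apply: Rmult_le_compat_l; first exact: Cmod_ge_0. rewrite -Rinv_1. apply: Rinv_le_contravar; lra.
Qed.


Definition holo_near (f : C -> C) : Prop := forall z, 0 <= snd z -> exists d, 0 < d /\ forall w, Cmod (w - z)%C < d -> holo f w.

Lemma holo_near_at f z : holo_near f -> 0 <= snd z -> holo f z.
Proof. move=> H hz. have [d [d0 K]] := H z hz. apply: K. rewrite (_ : (z - z)%C = 0%C); [by rewrite Cmod_0 | ring]. Qed.

Lemma holo_near_rcont f t : holo_near f -> rcont (fun t : R => f t) t.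
Proof. move=> H. apply: rcont_real. apply: holo_cont. apply: holo_near_at => //=. lra. Qed.

Section HardyClass.
Variables (LpL : (R -> C) -> Prop) (ipL : (R -> C) -> (R -> C) -> R).
Hypothesis LB : lebesgue_like LpL ipL.
Let LI := leb_space _ _ LB.

Lemma hardy_pointwise f A z : holo_near f -> 0 <= A ->
  (forall z, 0 < snd z -> Cmod (f z) <= exp (A * (1 + Cmod z * Cmod z) / snd z)) -> nonpos_mean_type f ->
  LpL (fun t : R => f t) -> 0 < snd z ->
  Cmod (f z) * Cmod (f z) <= 64 * PI * snd z * ipL (fun t : R => f t / (t - z))%C (fun t : R => f t / (t - z))%C.
Proof.
move=> hf A0 gr mt L hz. have zn : snd z <> 0 by lra.
have rc t := holo_near_rcont f t hf.
have [k1 k2] := kernel_Lp _ _ LI _ z rc L zn.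
have rk t : rcont (fun t : R => f t / (t - z))%C t by apply: rcont_mult; [exact: rc | exact: rcont_sub_inv].
have -> : f z = f (fst z, snd z) by rewrite -surjective_pairing.
apply: (hardy_estimate f hf A A0 gr mt (fst z) (snd z) hz); first exact: (ip_ge0 _ _ LI).
move=> a b ab. apply: Rle_trans (leb_le _ _ LB _ a b rk k1 ab). right.
apply: RInt_ext => t _. rewrite /sq_mod Cmod_div; last exact: real_sub_neq0.
have n : (t - z)%C <> 0%C by exact: real_sub_neq0. have p := Cmod_pos _ n.
have -> : (t - fst z) * (t - fst z) + snd z * snd z = Cmod (t - z)%C * Cmod (t - z)%C by rewrite Cmod_sq /=; ring.
change (Cmod (f t) * Cmod (f t) * / (Cmod (t - z)%C * Cmod (t - z)%C) = Cmod (f t) / Cmod (t - z)%C * (Cmod (f t) / Cmod (t - z)%C)).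
field. lra.
Qed.

(** Uses |t - z| >= Im z under the integral; 256 rounds 64 PI up. *)
Lemma hardy_crude f A z : holo_near f -> 0 <= A ->
  (forall z, 0 < snd z -> Cmod (f z) <= exp (A * (1 + Cmod z * Cmod z) / snd z)) -> nonpos_mean_type f ->
  LpL (fun t : R => f t) -> 0 < snd z ->
  Cmod (f z) * Cmod (f z) <= 256 * ipL (fun t : R => f t) (fun t : R => f t) / snd z.
Proof.
move=> hf A0 gr mt L hz. have zn : snd z <> 0 by lra.
apply: Rle_trans (hardy_pointwise f A z hf A0 gr mt L hz) _.
have [_ k2] := kernel_Lp _ _ LI _ z (fun t => holo_near_rcont f t hf) L zn. rewrite Rabs_pos_eq in k2; last lra.
have Q0 := ip_ge0 _ _ LI (fun t : R => f t). have P4 := PI_4. have P0 := PI_RGT_0. have i0 := Rinv_0_lt_compat _ hz.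
apply: (Rle_trans _ (64 * PI * snd z * (/ snd z * / snd z * ipL (fun t : R => f t) (fun t : R => f t)))).
  apply: Rmult_le_compat_l => //. apply: Rmult_le_pos; lra.
have -> : 64 * PI * snd z * (/ snd z * / snd z * ipL (fun t : R => f t) (fun t : R => f t)) = 64 * PI * (ipL (fun t : R => f t) (fun t : R => f t) * / snd z) by field; lra.
have -> : 256 * ipL (fun t : R => f t) (fun t : R => f t) / snd z = 256 * (ipL (fun t : R => f t) (fun t : R => f t) * / snd z) by rewrite /Rdiv; ring.
apply: Rmult_le_compat_r; last lra. apply: Rmult_le_pos; lra.
Qed.

(* With w(z) = -i int |f|^2/(t - z) dt, whose real part is y int |f|^2/|t - z|^2, the function
   1/(1 + 64 pi w) is bounded by 1 and so is its product with f. *)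
Lemma hardy_nevanlinna f c : holo_near f -> 0 <= c -> (forall z, 0 < snd z -> Cmod (f z) * Cmod (f z) <= c / snd z) ->
  LpL (fun t : R => f t) -> nevanlinna0 f.
Proof.
move=> hf c0 hc L.
have hu z : 0 < snd z -> holo f z by move=> hz; apply: holo_near_at => //; lra.
have le1 x b : 0 <= x -> x * x <= b -> x <= 1 + b by move=> x0 h; nra.
have gr z : 0 < snd z -> Cmod (f z) <= exp (c * (1 + Cmod z * Cmod z) / snd z).
  move=> hz. have h := le1 _ _ (Cmod_ge_0 _) (hc z hz). apply: Rle_trans h _. apply: Rle_trans (exp_ineq1_le _) _. apply: exp_le_mono.
  apply: Rmult_le_compat_r; first by left; exact: Rinv_0_lt_compat. have := Cmod_ge_0 z. nra.
have mt : nonpos_mean_type f.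
  move=> e e0. exists (Rmax 1 (2 / e * (c + 1))) => y hy.
  have y1 : 1 <= y by apply: Rle_trans hy; exact: Rmax_l. have y2 : 2 / e * (c + 1) <= y by apply: Rle_trans hy; exact: Rmax_r.
  have h := le1 _ _ (Cmod_ge_0 _) (hc (0, y) ltac:(simpl; lra)). simpl in h.
  apply: Rle_trans h _. apply: Rle_trans (exp_ineq1_le _). apply: Rplus_le_compat_l.
  have : c / y <= c by rewrite -[X in _ <= X]Rmult_1_r; apply: Rmult_le_compat_l => //; rewrite -Rinv_1; apply: Rinv_le_contravar; lra.
  have : e * (2 / e * (c + 1)) <= e * y by apply: Rmult_le_compat_l; lra.
  have -> : e * (2 / e * (c + 1)) = 2 * (c + 1) by field; lra. lra.
split => //.
have rc t := holo_near_rcont f t hf.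
pose lR phi := ipL phi (fun t : R => f t).
have Fn := functional_of_real _ _ LI lR (sqrt (ipL (fun t : R => f t) (fun t : R => f t))) (sqrt_pos _)
  (fun g h hg hh => ip_add _ _ LI g h _ hg hh L) (fun r g hg => ip_scal _ _ LI r g _ hg L)
  ltac:(move=> g Lg; rewrite /lR; rewrite -sqrt_mult; [|exact: (ip_ge0 _ _ LI)|exact: (ip_ge0 _ _ LI)];
    rewrite -sqrt_Rsqr_abs; apply: sqrt_le_1_alt; rewrite /Rsqr Rmult_comm; have := ip_CS _ _ LI g _ Lg L; lra).
set ell := (fun f0 : R -> C => _) in Fn.
(* [ell] is the inner product with f made complex linear, so that ell (Ph z) is the function w(z);
   it is holomorphic by [functional_holo]. *)
pose Ph (z : C) (t : R) := (- Ci * (f t / (t - z)))%C.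
have wh z0 : 0 < snd z0 -> holo (fun z => ell (Ph z)) z0.
  move=> hz0. set r := snd z0 / 2. have r0 : 0 < r by rewrite /r; lra.
  have up z : Cmod (z - z0)%C < r -> r < snd z.
    move=> hz. have := Cmod_snd (z - z0)%C. simpl. have := Rle_abs (- (snd z + - snd z0)). rewrite Rabs_Ropp /r in hz *. lra.
  apply: (functional_holo _ _ LI ell Ph z0 r (fun t : R => RtoC (/ r) * f t)%C Fn r0); first exact: (l2_scal _ _ LI).
  - move=> z t hz. have n : (t - z)%C <> 0%C by apply: real_sub_neq0; have := up z hz; lra.
    refine (holo_mult (fun _ => (- Ci)%C) (fun z => f t / (t - z))%C _ (holo_const _ _) _).
    refine (holo_div (fun _ => f t) (fun z => t - z)%C _ n (holo_const _ _) _).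
    exact: (holo_minus (fun _ => RtoC t) (fun z => z) z (holo_const _ _) (holo_id _)).
  - move=> z t hz. have u := up z hz. have n : (t - z)%C <> 0%C by apply: real_sub_neq0; lra.
    rewrite /Ph !Cmod_mult Cmod_opp Cmod_Ci Rmult_1_l Cmod_inv // Cmod_R Rabs_pos_eq; last by left; exact: Rinv_0_lt_compat.
    rewrite Rmult_comm. apply: Rmult_le_compat_r; first exact: Cmod_ge_0. apply: Rinv_le_contravar => //.
    have := real_sub_im z t. rewrite Rabs_pos_eq; lra.
  - move=> z t hz. apply: rcont_mult; first exact: rcont_const. apply: rcont_mult; first exact: rc. apply: rcont_sub_inv. have := up z hz. lra.
have Rew z : 0 < snd z -> fst (ell (Ph z)) = snd z * ipL (fun t : R => f t / (t - z))%C (fun t : R => f t / (t - z))%C.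
  move=> hz. have zn : snd z <> 0 by lra. have [k1 _] := kernel_Lp _ _ LI _ z rc L zn.
  rewrite -(ip_scal _ _ LI) //. rewrite /ell /= /lR. apply: (ip_pointwise _ _ LI) => t.
  rewrite /Ph. have n : (t - z)%C <> 0%C by exact: real_sub_neq0.
  have e : f t = ((t - z) * (f t / (t - z)))%C by field.
  move: (f t / (t - z))%C e => q e. rewrite e. simpl. ring.
(* The pointwise estimate bounds |f|^2 by 64 PI Re w, so |1 + 64 PI w| >= 1 + |f|^2, which dominates
   both 1 and |f|. *)
have key z : 0 < snd z -> 1 + Cmod (f z) * Cmod (f z) <= Cmod (1 + RtoC (64 * PI) * ell (Ph z))%C.
  move=> hz. have h := hardy_pointwise f c z hf c0 gr mt L hz.
  have : fst (1 + RtoC (64 * PI) * ell (Ph z))%C = 1 + 64 * PI * fst (ell (Ph z)) by simpl; ring.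
  rewrite Rew // => E. apply: Rle_trans (Rle_trans _ _ _ (Rle_abs _) (Cmod_fst _)). rewrite E. lra.
have nz z : 0 < snd z -> (1 + RtoC (64 * PI) * ell (Ph z))%C <> 0%C.
  move=> hz. apply: Cneq_mod. have := key z hz. nra.
pose h (z : C) := (/ (1 + RtoC (64 * PI) * ell (Ph z)))%C.
have hh z : 0 < snd z -> holo h z.
  move=> hz. apply: (holo_inv (fun z => 1 + RtoC (64 * PI) * ell (Ph z))%C); first exact: nz.
  apply: holo_plus; first exact: holo_const. apply: holo_mult; [exact: holo_const | exact: wh].
have hn z : 0 < snd z -> h z <> 0%C.
  move=> hz e. have : (h z * (1 + RtoC (64 * PI) * ell (Ph z)))%C = 1%C by rewrite /h; field; exact: nz.
  rewrite e Cmult_0_l => e2. have := f_equal fst e2. simpl. lra.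
apply: (bounded_type_intro f (fun z => f z * h z)%C h 1 Ci) => //; first last.
- move=> z hz n. by field.
- apply: hn. simpl. lra.
- simpl. lra.
- move=> z hz. split; first by apply: holo_mult; [exact: hu | exact: hh]. split; first exact: hh.
  have k := key z hz. have d1 : 1 <= Cmod (1 + RtoC (64 * PI) * ell (Ph z))%C by nra.
  rewrite Cmod_mult /h Cmod_inv; last exact: nz. split.
  + apply: (Rmult_le_reg_r (Cmod (1 + RtoC (64 * PI) * ell (Ph z))%C)); first lra. rewrite Rmult_assoc Rinv_l; last lra. have := Cmod_ge_0 (f z). nra.
  + rewrite -[X in _ <= X]Rinv_1. apply: Rinv_le_contravar; lra.
Qed.
End HardyClass.


(** * De Branges spaces *)

Lemma exp_type_zero_type_zero E : (forall z, holo E z) -> exp_type_zero E -> type_zero E.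
Proof.
move=> hE H e e0. have [r Hr] := H e e0. have [M [M0 HM]] := entire_bounded_disc E r hE.
exists (M + 1); split; first lra. move=> z. have x1 : 1 <= exp (e * Cmod z).
  have := exp_ineq1_le (e * Cmod z). have := Rmult_le_pos _ _ (Rlt_le _ _ e0) (Cmod_ge_0 z). lra.
case: (Rle_lt_dec r (Cmod z)) => h.
- have k := Hr z h. have : Cmod (E z) <= exp (e * Cmod z); last nra.
  case: (Rle_lt_dec (Cmod (E z)) 0) => p; first lra.
  rewrite -[X in X <= _]exp_ln //. apply: exp_le_mono. apply: Rle_trans k. exact: ln_le_lnp.
- have := HM z (Rlt_le _ _ h). nra.
Qed.

Section DeBranges.
Variables (LpL : (R -> C) -> Prop) (ipL : (R -> C) -> (R -> C) -> R).
Hypothesis LB : lebesgue_like LpL ipL.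
Let LI := leb_space _ _ LB.
Variable E : C -> C.
Hypothesis hE : forall z, holo E z.
Hypothesis EU : forall z, upper z -> Cmod (E (Cconj z)) < Cmod (E z).
Hypothesis ER : no_real_zeros E.

Definition norm_fun (F : C -> C) (t : R) : C := (F t / E t)%C.

Definition inB (F : C -> C) : Prop := (forall z, holo F z) /\ LpL (norm_fun F) /\
  nevanlinna0 (fun z => F z / E z)%C /\ nevanlinna0 (fun z => sharp F z / E z)%C.

(** PI times the squared de Branges norm; the factor is restored in [dB_norm2_normB]. *)
Definition normB (F : C -> C) : R := ipL (norm_fun F) (norm_fun F).

Lemma E_neq0 z : 0 <= snd z -> E z <> 0%C.
Proof.
move=> h. case: (Rle_lt_or_eq_dec _ _ h) => h'.
- apply: Cneq_mod. have := EU z h'. have := Cmod_ge_0 (E (Cconj z)). lra.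
- have -> : z = RtoC (fst z) by apply: injective_projections. exact: ER.
Qed.

Lemma quot_near F : (forall z, holo F z) -> holo_near (fun z => F z / E z)%C.
Proof.
move=> hF z hz. have n := E_neq0 z hz. have [d [d0 K]] := holo_cont E z (hE z) _ (Cmod_pos _ n).
exists d; split => // w hw. apply: holo_div => //. move=> e. have := K w hw. rewrite e.
replace (0 - E z)%C with (- E z)%C by ring. rewrite Cmod_opp. lra.
Qed.

Lemma norm_fun_rcont F t : (forall z, holo F z) -> rcont (norm_fun F) t.
Proof. move=> hF. exact: (holo_near_rcont (fun z => F z / E z)%C t (quot_near F hF)). Qed.

Lemma normB_ge0 F : 0 <= normB F. Proof. exact: (ip_ge0 _ _ LI). Qed.

Lemma norm_fun_sharp F : (forall z, holo F z) -> LpL (norm_fun F) -> LpL (norm_fun (sharp F)) /\ normB (sharp F) <= normB F.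
Proof.
move=> hF L. have := l2_dom _ _ LI (norm_fun (sharp F)) (norm_fun F) 1 _ L Rle_0_1. rewrite /normB !Rmult_1_l. apply.
- move=> t. apply: norm_fun_rcont. exact: holo_sharp.
- move=> t. rewrite /norm_fun !Cmod_div ?Rmult_1_l; try exact: ER. rewrite /sharp Cmod_conj Cconj_RtoC. lra.
Qed.

Lemma upper_estimate F z : (forall z, holo F z) -> LpL (norm_fun F) -> nevanlinna0 (fun z => F z / E z)%C -> 0 < snd z ->
  Cmod (F z / E z)%C * Cmod (F z / E z)%C <= 256 * normB F / snd z.
Proof.
move=> hF L [bt mt] hz. have [A [A0 gr]] := nevanlinna_growth _ bt.
exact: (hardy_crude _ _ LB (fun z => F z / E z)%C A z (quot_near F hF) A0 gr mt L hz).
Qed.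

(** In the lower half plane F is controlled through F# at the conjugate point. The bound M is
    required on the whole circle through z because that set is invariant under conjugation. *)
Lemma offaxis_estimate F z M : inB F -> snd z <> 0 -> (forall w, Cmod w = Cmod z -> Cmod (E w) <= M) ->
  Cmod (F z) * Cmod (F z) <= 256 * normB F / Rabs (snd z) * (M * M).
Proof.
move=> [hF [L [n1 n2]]] hz HM.
have main G z' : (forall z, holo G z) -> LpL (norm_fun G) -> nevanlinna0 (fun z => G z / E z)%C -> 0 < snd z' -> Cmod z' = Cmod z ->
   Cmod (G z') * Cmod (G z') <= 256 * normB G / snd z' * (M * M).
  move=> hG LG nG hz' mz. have u := upper_estimate G z' hG LG nG hz'. have n := E_neq0 z' (Rlt_le _ _ hz').
  have em := HM z' mz. have e0 := Cmod_pos _ n. have Q0 := normB_ge0 G. have i0 := Rinv_0_lt_compat _ hz'.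
  have -> : Cmod (G z') = Cmod (G z' / E z')%C * Cmod (E z') by rewrite -Cmod_mult; congr Cmod; field.
  replace (Cmod (G z' / E z')%C * Cmod (E z') * (Cmod (G z' / E z')%C * Cmod (E z'))) with
    ((Cmod (G z' / E z')%C * Cmod (G z' / E z')%C) * (Cmod (E z') * Cmod (E z'))) by ring.
  apply: Rmult_le_compat => //; [apply: Rmult_le_pos; exact: Cmod_ge_0 | nra | apply: Rmult_le_compat; lra].
case: (Rlt_le_dec 0 (snd z)) => h.
- rewrite Rabs_pos_eq; last lra. exact: main.
- have h' : 0 < snd (Cconj z) by simpl; lra.
  have [Ls Ns] := norm_fun_sharp F hF L.
  have := main (sharp F) (Cconj z) (holo_sharp F hF) Ls n2 h' (Cmod_conj z). move: (normB (sharp F)) Ns => Q Ns. rewrite /sharp Cconj_conj Cmod_conj => b.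
  rewrite Rabs_left1 //. apply: Rle_trans b _. simpl. apply: Rmult_le_compat_r; first exact: Rle_0_sqr.
  apply: Rmult_le_compat_r; [left; apply: Rinv_0_lt_compat; lra | lra].
Qed.

(** The root of 1/|Im z| is weakened to 1 + 1/|Im z|, the shape used in [offaxis_bound]; 16 is the
    root of 256. *)
Lemma offaxis_linear F z M : inB F -> snd z <> 0 -> 0 <= M -> (forall w, Cmod w = Cmod z -> Cmod (E w) <= M) ->
  Cmod (F z) <= 16 * sqrt (normB F) * M * (1 + / Rabs (snd z)).
Proof.
move=> bF hz M0 HM. have h := offaxis_estimate F z M bF hz HM.
have i0 : 0 < / Rabs (snd z) by apply: Rinv_0_lt_compat; exact: Rabs_pos_lt.
have s0 := sqrt_pos (normB F). have ss := sqrt_sqrt _ (normB_ge0 F). set s := sqrt (normB F) in s0 ss *. set i := / Rabs (snd z) in i0 *.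
have p0 : 0 <= 16 * s * M by apply: Rmult_le_pos => //; lra.
apply: Rsqr_incr_0_var; last by apply: Rmult_le_pos; lra. rewrite /Rsqr. apply: Rle_trans h _.
rewrite -ss /Rdiv -/i.
have -> : 256 * (s * s) * i * (M * M) = (16 * s * M) * (16 * s * M) * i by ring.
have -> : 16 * s * M * (1 + i) * (16 * s * M * (1 + i)) = (16 * s * M) * (16 * s * M) * ((1 + i) * (1 + i)) by ring.
apply: Rmult_le_compat_l; nra.
Qed.

(** Point evaluations are bounded uniformly on discs, also on the real line, where [offaxis_bound]
    removes the singularity of the estimate at the cost of the larger radius r + 3. *)
Lemma local_estimate r : exists K, 0 <= K /\ forall F z, inB F -> Cmod z <= r -> Cmod (F z) * Cmod (F z) <= K * normB F.
Proof.
have [M [M0 HM]] := entire_bounded_disc E (r + 3) hE.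
exists (64 * M * (64 * M)); split; first nra. move=> F z bF hz. have s0 := sqrt_pos (normB F).
have b : Cmod (F z) <= 4 * (16 * sqrt (normB F) * M).
  apply: offaxis_bound; [exact: (proj1 bF) | apply: Rmult_le_pos; lra |].
  move=> w wn hw. apply: offaxis_linear => //; first lra. move=> u hu. apply: HM. lra.
rewrite -(sqrt_sqrt _ (normB_ge0 F)).
replace (64 * M * (64 * M) * (sqrt (normB F) * sqrt (normB F))) with (4 * (16 * sqrt (normB F) * M) * (4 * (16 * sqrt (normB F) * M))) by ring.
apply: Rmult_le_compat => //; exact: Cmod_ge_0.
Qed.

Lemma inB_type_zero F : type_zero E -> inB F -> type_zero F.
Proof.
move=> tE bF. apply: type_zero_offaxis; first exact: (proj1 bF). move=> e e0. have [K [K0 HK]] := tE e e0.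
have s0 := sqrt_pos (normB F). have x0 z := exp_pos (e * Cmod z).
have p0 : 0 <= 16 * sqrt (normB F) * K by apply: Rmult_le_pos; lra.
exists (16 * sqrt (normB F) * K + 1); split; first lra.
move=> z hz. have i0 : 0 < / Rabs (snd z) by apply: Rinv_0_lt_compat; exact: Rabs_pos_lt.
apply: Rle_trans (offaxis_linear F z (K * exp (e * Cmod z)) bF hz _ _) _.
- apply: Rmult_le_pos; [lra | left; exact: x0].
- move=> w <-. exact: HK.
- apply: Rmult_le_compat_r; first lra. rewrite -Rmult_assoc. apply: Rmult_le_compat_r; [left; exact: x0 | lra].
Qed.

Lemma sharp_add F G : sharp (fun z => F z + G z)%C = (fun z => sharp F z + sharp G z)%C.
Proof. apply: functional_extensionality => z. rewrite /sharp. apply: injective_projections; simpl; ring. Qed.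

Lemma sharp_scal c F : sharp (fun z => c * F z)%C = (fun z => Cconj c * sharp F z)%C.
Proof. apply: functional_extensionality => z. by rewrite /sharp Cmult_conj. Qed.

Lemma quot_add (F G : C -> C) : (fun z => (F z + G z) / E z)%C = (fun z => F z / E z + G z / E z)%C.
Proof. apply: functional_extensionality => z. rewrite /Cdiv. ring. Qed.

Lemma quot_scal c (F : C -> C) : (fun z => c * F z / E z)%C = (fun z => c * (F z / E z))%C.
Proof. apply: functional_extensionality => z. rewrite /Cdiv. ring. Qed.

Lemma norm_fun_add F G : norm_fun (fun z => F z + G z)%C = (fun t => norm_fun F t + norm_fun G t)%C.
Proof. apply: functional_extensionality => z. rewrite /norm_fun /Cdiv. ring. Qed.

Lemma norm_fun_scal c F : norm_fun (fun z => c * F z)%C = (fun t => c * norm_fun F t)%C.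
Proof. apply: functional_extensionality => z. rewrite /norm_fun /Cdiv. ring. Qed.

Lemma inB_add F G : inB F -> inB G -> inB (fun z => F z + G z)%C.
Proof.
move=> [hF [LF [n1 n2]]] [hG [LG [m1 m2]]]. split; first by move=> z; apply: holo_plus.
split; first by rewrite norm_fun_add; exact: (l2_add _ _ LI).
split; first by rewrite quot_add; exact: (nevanlinna_add (fun z => F z / E z)%C (fun z => G z / E z)%C).
rewrite sharp_add quot_add. exact: (nevanlinna_add (fun z => sharp F z / E z)%C (fun z => sharp G z / E z)%C).
Qed.

Lemma inB_scal c F : inB F -> inB (fun z => c * F z)%C.
Proof.
move=> [hF [LF [n1 n2]]]. split; first by move=> z; apply: holo_mult => //; exact: holo_const.
split; first by rewrite norm_fun_scal; exact: (l2_scal _ _ LI).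
split; first by rewrite quot_scal; exact: (nevanlinna_scal c (fun z => F z / E z)%C).
rewrite sharp_scal quot_scal. exact: (nevanlinna_scal (Cconj c) (fun z => sharp F z / E z)%C).
Qed.

Lemma inB_sub F G : inB F -> inB G -> inB (fun z => F z - G z)%C.
Proof.
move=> hF hG. have -> : (fun z => F z - G z)%C = (fun z => F z + RtoC (-1) * G z)%C by apply: functional_extensionality => z; apply: injective_projections; simpl; ring.
apply: inB_add => //. exact: inB_scal.
Qed.

Lemma inB_div F w : inB F -> F w = 0%C -> inB (dq F w).
Proof.
move=> [hF [LF [n1 n2]]] F0. have hD z : holo (dq F w) z by apply: (dq_holo _ _ 1) => //; lra.
have En z : 0 < snd z -> E z <> 0%C by move=> hz; apply: E_neq0; lra.
have rD t := norm_fun_rcont (dq F w) t hD. have rF t := norm_fun_rcont F t hF.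
split => //. split; [|split].
- set x := fst w. have [M HM] := rcont_bounded (norm_fun (dq F w)) (x - 1) (x + 1) ltac:(lra) rD.
  have M0 : 0 <= M by apply: Rle_trans (HM x ltac:(lra)); exact: Cmod_ge_0.
  (* An integrable majorant: 2 p >= 1 for |t - x| <= 1, where the quotient is at most M, and for |t
     - x| >= 1 division by t - w does not increase the modulus. The integral of p is bounded by
     [poisson_mass]. *)
  pose p t := / ((t - x) * (t - x) + 1 * 1).
  have pos t : 0 < (t - x) * (t - x) + 1 * 1 by have := Rle_0_sqr (t - x); rewrite /Rsqr; lra.
  have cp t : continuous p t.
    apply: continuous_Rinv_comp; last by apply: Rgt_not_eq; exact: pos.
    apply: continuous_Rplus; last exact: continuous_const. apply: continuous_Rmult; apply: continuous_Rminus; first [exact: continuous_id | exact: continuous_const].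
  have c2 t : continuous (fun t => 2 * (M * M) * p t) t by apply: continuous_Rmult; [exact: continuous_const | exact: cp].
  apply: (proj1 (leb_ge _ _ LB _ (normB F + 2 * (M * M) * (PI / 1)) rD _)) => a b ab.
  have B : RInt (sq_mod (norm_fun (dq F w))) a b <= RInt (fun t => sq_mod (norm_fun F) t + 2 * (M * M) * p t) a b.
    apply: RInt_le => //; [apply: exRc => t; exact: sq_mod_cont | by apply: exRc => t; apply: continuous_Rplus; [exact: sq_mod_cont | exact: c2] |].
    move=> t _. have pp : 0 < p t by apply: Rinv_0_lt_compat; exact: pos.
    have s0 : 0 <= sq_mod (norm_fun F) t by apply: Rmult_le_pos; exact: Cmod_ge_0.
    have q0 : 0 <= M * M * p t by apply: Rmult_le_pos; nra.
    case: (Rle_lt_dec 1 (Rabs (t - x))) => h.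
    + have tw : 1 <= Cmod (t - w)%C by have := Cmod_fst (t - w)%C; rewrite /= -/x; move: h; rewrite /Rminus; lra.
      have n : (t - w)%C <> 0%C by apply: Cneq_mod; lra.
      have : Cmod (norm_fun (dq F w) t) <= Cmod (norm_fun F t).
        rewrite /norm_fun dq_off; last by move=> e; apply: n; rewrite e; ring.
        rewrite F0 !Cmod_div //; try exact: ER. have := Cmod_pos _ (ER t) => e0.
        apply: Rmult_le_compat_r; first by left; exact: Rinv_0_lt_compat. replace (F t - 0)%C with (F t) by ring.
        rewrite -[X in _ <= X]Rmult_1_r. apply: Rmult_le_compat_l; first exact: Cmod_ge_0. rewrite -Rinv_1. apply: Rinv_le_contravar; lra.
      move=> k. have := Cmod_ge_0 (norm_fun (dq F w) t). rewrite /sq_mod in s0 *. nra.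
    + have ht : x - 1 <= t <= x + 1 by have := Rabs_def2 _ _ h; lra.
      have k := HM t ht. have k0 := Cmod_ge_0 (norm_fun (dq F w) t).
      have p2 : 1 <= 2 * p t.
        have : (t - x) * (t - x) <= 1 by have := Rabs_def2 _ _ h; nra.
        move=> h2. apply: (Rmult_le_reg_r ((t - x) * (t - x) + 1 * 1)); first exact: pos.
        rewrite Rmult_assoc /p Rinv_l; last by apply: Rgt_not_eq; exact: pos. lra.
      rewrite {1}/sq_mod. have : M * M * 1 <= M * M * (2 * p t) by apply: Rmult_le_compat_l; nra. nra.
  apply: Rle_trans B _.
  rewrite (@RInt_plus R_CompleteNormedModule); [|by apply: exRc => t; exact: sq_mod_cont|exact: exRc].
  rewrite (@RInt_scal R_CompleteNormedModule); last exact: exRc.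
  apply: Rplus_le_compat; first exact: (leb_le _ _ LB).
  apply: Rmult_le_compat_l; first nra. exact: (poisson_mass x 1 a b Rlt_0_1).
- apply: (nevanlinna_divide (fun z => F z / E z)%C _ w n1).
  + move=> z hz. apply: holo_div => //. exact: En.
  + move=> z nz. rewrite dq_off // F0. have := Csub_neq0 _ _ nz => n. rewrite /Cdiv. ring.
- apply: (nevanlinna_divide (fun z => sharp F z / E z)%C _ (Cconj w) n2).
  + move=> z hz. apply: holo_div => //; [exact: En | exact: holo_sharp].
  + move=> z nz. have n3 : Cconj z <> w by move=> e; apply: nz; rewrite -e Cconj_conj.
    rewrite {1}/sharp dq_off // F0 /sharp. have n4 := Csub_neq0 _ _ n3.
    have cd : Cconj ((F (Cconj z) - 0) / (Cconj z - w))%C = (Cconj (F (Cconj z)) / (z - Cconj w))%C.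
      have n5 := Csub_neq0 _ _ nz.
      have : (Cconj ((F (Cconj z) - 0) / (Cconj z - w)) * (z - Cconj w))%C = Cconj (F (Cconj z)).
        have -> : (z - Cconj w)%C = Cconj (Cconj z - w)%C by rewrite Cconj_sub Cconj_conj. rewrite -Cmult_conj. congr Cconj. by field.
      move=> <-. by field.
    rewrite cd /Cdiv. ring.
Qed.

Lemma norm_fun_sub F G : norm_fun (fun z => F z - G z)%C = (fun t => norm_fun F t - norm_fun G t)%C.
Proof. apply: functional_extensionality => z. rewrite /norm_fun /Cdiv. ring. Qed.

Section Closed.
Variables (G : C -> C) (F : nat -> C -> C) (c : R).
Hypothesis hG : forall z, holo G z.
Hypothesis bF : forall n, inB (F n).
Hypothesis c0 : 0 <= c.
Hypothesis cauchyF : forall n k, normB (fun z => F n z - F k z)%C <= c * (/ (INR n + 1) + / (INR k + 1)).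
Hypothesis F_G : forall n, RInt (sq_mod (fun t : R => G t - F n t)%C) 0 1 <= c * / (INR n + 1).

Lemma inv_INR_small e : 0 < e -> exists N, forall n, (N <= n)%nat -> / (INR n + 1) <= e.
Proof.
move=> e0. have [N HN] := INR_unbounded (/ e). exists N => n hn. rewrite -(Rinv_inv e). have i0 := Rinv_0_lt_compat _ e0.
apply: Rinv_le_contravar => //. have := le_INR _ _ hn. lra.
Qed.

(** By [local_estimate] a Cauchy sequence in norm is uniformly Cauchy on discs; real and imaginary
    parts are treated separately. *)
Lemma locally_uniform_limit : exists Fl, forall r e, 0 < e -> exists N, forall n, (N <= n)%nat -> forall z, Cmod z <= r -> Cmod (F n z - Fl z)%C <= e.
Proof.
have comp (p : C -> R) (z : C) : (forall z, Rabs (p z) <= Cmod z) -> (forall z w, p (z - w)%C = p z - p w) ->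
   forall K, 0 <= K -> (forall H, inB H -> Cmod (H z) * Cmod (H z) <= K * normB H) ->
   forall n k, (p (F n z) - p (F k z)) * (p (F n z) - p (F k z)) <= K * c * (/ (INR n + 1) + / (INR k + 1)).
  move=> hp pm K K0 HK n k. rewrite -pm.
  have h := HK _ (inB_sub _ _ (bF n) (bF k)). simpl in h. have a := hp (F n z - F k z)%C. set u := p _ in a *.
  have -> : u * u = Rabs u * Rabs u by rewrite -Rabs_mult Rabs_pos_eq //; exact: Rle_0_sqr.
  apply: (Rle_trans _ (Cmod (F n z - F k z)%C * Cmod (F n z - F k z)%C)); first by apply: Rmult_le_compat => //; exact: Rabs_pos.
  apply: Rle_trans h _. rewrite Rmult_assoc. apply: Rmult_le_compat_l => //.
pose Fl z : C := (real (Lim_seq (fun n => fst (F n z))), real (Lim_seq (fun n => snd (F n z)))).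
exists Fl => r e e0. have [K [K0 HK]] := local_estimate r.
have lim (p : C -> R) (z : C) : (forall z, Rabs (p z) <= Cmod z) -> (forall z w, p (z - w)%C = p z - p w) -> Cmod z <= r ->
   forall n, Rabs (p (F n z) - real (Lim_seq (fun n => p (F n z)))) <= sqrt (K * c * / (INR n + 1)).
  move=> hp pm hz n. have Q := comp p z hp pm K K0 (fun H bH => HK H z bH hz).
  have Kc : 0 <= K * c by exact: Rmult_le_pos.
  have L := Lim_seq_correct' _ (cauchy_rate (fun n => p (F n z)) (K * c) Kc Q). set l := real _ in L *.
  rewrite -sqrt_Rsqr_abs. apply: sqrt_le_1_alt. rewrite /Rsqr.
  have L1 : is_lim_seq (fun k => (p (F n z) - p (F k z)) * (p (F n z) - p (F k z))) ((p (F n z) - l) * (p (F n z) - l)).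
    by apply: is_lim_seq_mult'; (apply: is_lim_seq_minus' => //; exact: is_lim_seq_const).
  have L2 : is_lim_seq (fun k => K * c * / (INR n + 1) + K * c * / (INR k + 1)) (K * c * / (INR n + 1)).
    have -> : Finite (K * c * / (INR n + 1)) = Finite (K * c * / (INR n + 1) + 0) by rewrite Rplus_0_r. apply: is_lim_seq_plus'; [exact: is_lim_seq_const | exact: inv_INR_lim].
  apply: (is_lim_seq_le _ _ _ _ _ L1 L2) => k. rewrite -Rmult_plus_distr_l. exact: Q.
have [N HN] := inv_INR_small (e / 2 * (e / 2) / (K * c + 1)) ltac:(have := Rmult_le_pos _ _ K0 c0 => ?; apply: Rdiv_lt_0_compat; nra).
exists N => n hn z hz.
have small : sqrt (K * c * / (INR n + 1)) <= e / 2.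
  have kc := Rmult_le_pos _ _ K0 c0. rewrite -(sqrt_square (e / 2)); last lra. apply: sqrt_le_1_alt.
  have i0 := INR1_inv n. have h := HN n hn.
  apply: (Rle_trans _ ((K * c + 1) * / (INR n + 1))); first nra.
  apply: (Rle_trans _ ((K * c + 1) * (e / 2 * (e / 2) / (K * c + 1)))); first by apply: Rmult_le_compat_l; lra. right. field. lra.
apply: Rle_trans (Cmod_le_sum _) _.
have h1 := lim fst z Cmod_fst (fun z w => eq_refl) hz n. have h2 := lim snd z Cmod_snd (fun z w => eq_refl) hz n.
rewrite /Fl /=. change (Rabs (fst (F n z) - real (Lim_seq (fun n => fst (F n z)))) + Rabs (snd (F n z) - real (Lim_seq (fun n => snd (F n z)))) <= e). lra.
Qed.

(** This is where Lebesgue measure on [0, 1] serves: the locally uniform limit agrees with G on that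
    interval, hence everywhere by the identity theorem. *)
Lemma limit_is_G : forall r e, 0 < e -> exists N, forall n, (N <= n)%nat -> forall z, Cmod z <= r -> Cmod (F n z - G z)%C <= e.
Proof.
have [Fl U] := locally_uniform_limit.
have hFl z : holo Fl z.
  apply: (holo_unif_lim F Fl z 1 Rlt_0_1); first by move=> n w _; exact: (proj1 (bF n)).
  move=> e e0. have [N HN] := U (Cmod z + 1) e e0. exists N => w hw. apply: (HN N (le_n _)).
  have := Cmod_triangle (w - z)%C z. replace (w - z + z)%C with w by ring. lra.
have rc H t : (forall z, holo H z) -> rcont (fun t : R => H t) t by move=> hH; apply: rcont_real; apply: holo_cont; exact: hH.
have rD H H' t : (forall z, holo H z) -> (forall z, holo H' z) -> rcont (fun t : R => H t - H' t)%C t by move=> h h'; apply: rcont_minus; exact: rc.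
have Z : RInt (sq_mod (fun t : R => G t - Fl t)%C) 0 1 <= 0.
  apply: le_epsilon => e e0. rewrite Rplus_0_l.
  set d := Rmin 1 (e / 4). have d0 : 0 < d by apply: Rmin_glb_lt; lra. have d1 : d <= 1 by exact: Rmin_l. have d2 : d <= e / 4 by exact: Rmin_r.
  have [N1 H1] := U 1 d d0.
  have [N2 H2] := inv_INR_small (e / 4 / (c + 1)) ltac:(apply: Rdiv_lt_0_compat; lra).
  set n := (N1 + N2)%nat. have l1 : (N1 <= n)%nat by rewrite /n; lia. have l2 : (N2 <= n)%nat by rewrite /n; lia.
  have -> : (fun t : R => G t - Fl t)%C = (fun t : R => (G t - F n t) + (F n t - Fl t))%C by apply: functional_extensionality => t; ring.
  apply: Rle_trans (RInt_sq_add (fun t : R => G t - F n t)%C (fun t : R => F n t - Fl t)%C 0 1 Rle_0_1 _ _) _.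
  - move=> t. apply: rD => //. exact: (proj1 (bF n)).
  - move=> t. apply: rD => //. exact: (proj1 (bF n)).
  - have h1 := F_G n. have h2 := RInt_sq_bound (fun t : R => F n t - Fl t)%C 0 1 d Rle_0_1 (fun t => rD _ _ t (proj1 (bF n)) hFl)
      (fun t ht => H1 n l1 (RtoC t) ltac:(rewrite Cmod_R Rabs_pos_eq; lra)).
    have i0 := INR1_inv n. have h3 := H2 n l2.
    have : c * / (INR n + 1) <= e / 4.
      apply: (Rle_trans _ ((c + 1) * / (INR n + 1))); first nra.
      apply: (Rle_trans _ ((c + 1) * (e / 4 / (c + 1)))); first by apply: Rmult_le_compat_l; lra. right. field. lra.
    nra.
have eq z : (G z - Fl z)%C = 0%C.
  apply: (identity_segment (fun z => G z - Fl z)%C); first by move=> w; apply: holo_minus.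
  move=> x hx. have := RInt_zero _ 0 1 (fun t => sq_mod_cont _ t (fun t => rD _ _ t hG hFl)) (fun t => Rle_0_sqr _) Z x hx.
  rewrite /sq_mod => q. apply: Cmod_eq_0. by apply: Rsqr_0_uniq.
move=> r e e0. have [N HN] := U r e e0. exists N => n hn z hz. have -> : G z = Fl z by rewrite -[G z](Cplus_0_r) -(eq z) ; have := eq z; move=> q; rewrite q Cplus_0_r; replace (G z) with (G z - Fl z + Fl z)%C by ring; rewrite q; ring.
exact: HN.
Qed.

Lemma norm_bounded : exists Q, 0 <= Q /\ forall n, normB (F n) <= Q.
Proof.
have n0 := normB_ge0 (F 0%nat). exists (2 * (2 * c) + 2 * normB (F 0%nat)); split; first lra. move=> n.
have -> : normB (F n) = normB (fun z => (F n z - F 0%nat z) + F 0%nat z)%C.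
  f_equal. apply: functional_extensionality => z. ring.
rewrite /normB norm_fun_add. apply: Rle_trans (ip_parallelogram _ _ LI _ _ _ _) _.
- exact: (proj1 (proj2 (inB_sub _ _ (bF n) (bF 0%nat)))).
- exact: (proj1 (proj2 (bF 0%nat))).
- apply: Rplus_le_compat; last by right. apply: Rmult_le_compat_l; first lra. apply: Rle_trans (cauchyF n 0%nat) _.
  rewrite /= Rplus_0_l Rinv_1. have : / (INR n + 1) <= 1 by rewrite -[X in _ <= X]Rinv_1; apply: Rinv_le_contravar; have := pos_INR n; lra. nra.
Qed.

(** On each segment F N is uniformly close to G for large N. The tolerance is chosen so that the
    error contributes at most 1 to the integral, and the bound 2 Q + 2 does not depend on the
    segment. *)
Lemma limit_norm Q : 0 <= Q -> (forall n, normB (F n) <= Q) -> LpL (norm_fun G).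
Proof.
move=> Q0 HQ. have rG t := norm_fun_rcont G t hG.
apply: (proj1 (leb_ge _ _ LB _ (2 * Q + 2) rG _)) => a b ab.
have ie t : rcont (fun t : R => / E t)%C t.
  apply: rcont_inv; first exact: ER. apply: rcont_real. exact: holo_cont.
have [M HM] := rcont_bounded _ a b ab ie.
have M0 : 0 <= M by apply: Rle_trans (HM a ltac:(lra)); exact: Cmod_ge_0.
have dd : 0 < / ((b - a + 1) * (M + 1)) by apply: Rinv_0_lt_compat; apply: Rmult_lt_0_compat; lra.
have [N HN] := limit_is_G (Rabs a + Rabs b) _ dd.
have rF t := norm_fun_rcont (F N) t (proj1 (bF N)).
have rFG t : rcont (norm_fun (fun z => G z - F N z)%C) t by apply: norm_fun_rcont => z; apply: holo_minus => //; exact: (proj1 (bF N)).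
have -> : norm_fun G = (fun t => norm_fun (fun z => G z - F N z)%C t + norm_fun (F N) t)%C.
  rewrite norm_fun_sub. apply: functional_extensionality => t. ring.
apply: Rle_trans (RInt_sq_add _ _ a b ab rFG rF) _.
have h1 := leb_le _ _ LB _ a b rF (proj1 (proj2 (bF N))) ab.
have h2 := RInt_sq_bound _ a b (/ (b - a + 1)) ab rFG.
have i1 : 0 < / (b - a + 1) by apply: Rinv_0_lt_compat; lra.
have i2 : / (b - a + 1) <= 1 by rewrite -[X in _ <= X]Rinv_1; apply: Rinv_le_contravar; lra.
have : RInt (sq_mod (norm_fun (fun z => G z - F N z)%C)) a b <= (b - a) * (/ (b - a + 1) * / (b - a + 1)).
  apply: h2 => t ht. rewrite /norm_fun /Cdiv Cmod_mult Cmod_sub_sym.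
  have k := HM t ht. have g := HN N (le_n _) (RtoC t).
  have gt : Cmod t <= Rabs a + Rabs b.
    rewrite Cmod_R. have := Rle_abs b. have := Rle_abs (- a). rewrite Rabs_Ropp. have := Rabs_pos a. have := Rabs_pos b => p1 p2 p3 p4. apply: Rabs_le. lra.
  have gg := g gt.
  apply: (Rle_trans _ (/ ((b - a + 1) * (M + 1)) * M)); first by apply: Rmult_le_compat => //; exact: Cmod_ge_0.
  have -> : / ((b - a + 1) * (M + 1)) * M = / (b - a + 1) * (M / (M + 1)) by field; lra.
  rewrite -[X in _ <= X]Rmult_1_r. apply: Rmult_le_compat_l; first lra. apply: (Rmult_le_reg_r (M + 1)); first lra. rewrite /Rdiv Rmult_assoc Rinv_l; lra.
have : (b - a) * (/ (b - a + 1) * / (b - a + 1)) <= 1.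
  have -> : (b - a) * (/ (b - a + 1) * / (b - a + 1)) = (1 - / (b - a + 1)) * / (b - a + 1) by field; lra. nra.
have := HQ N. rewrite /normB. lra.
Qed.

(** The estimate |H n/E|^2 <= 256 Q / Im z passes to the limit, and [hardy_nevanlinna] recovers from
    it that the limit has bounded type and nonpositive mean type. *)
Lemma limit_nevanlinna (H : nat -> C -> C) G' Q : (forall z, holo G' z) -> (forall n z, holo (H n) z) ->
  (forall n, LpL (norm_fun (H n))) -> (forall n, nevanlinna0 (fun z => H n z / E z)%C) -> (forall n, normB (H n) <= Q) -> 0 <= Q ->
  (forall z e, 0 < e -> exists n, Cmod (H n z - G' z)%C <= e) -> LpL (norm_fun G') -> nevanlinna0 (fun z => G' z / E z)%C.
Proof.
move=> hG' hH LH nH HQ Q0 lim LG'.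
apply: (hardy_nevanlinna _ _ LB _ (256 * Q) (quot_near G' hG')) => //; first lra.
move=> z hz. have n := E_neq0 z (Rlt_le _ _ hz). have ep := Cmod_pos _ n.
set b := 256 * Q / snd z. have b0 : 0 <= b by apply: Rmult_le_pos; [lra | left; exact: Rinv_0_lt_compat].
have hb k : Cmod (H k z / E z)%C <= sqrt b.
  have u := upper_estimate (H k) z (hH k) (LH k) (nH k) hz. rewrite -(sqrt_square _ (Cmod_ge_0 _)). apply: sqrt_le_1_alt.
  apply: Rle_trans u _. rewrite /b. apply: Rmult_le_compat_r; [left; exact: Rinv_0_lt_compat | have := HQ k; lra].
have : Cmod (G' z / E z)%C <= sqrt b.
  apply: le_epsilon => e e0. have [k Hk] := lim z (e * Cmod (E z)) ltac:(exact: Rmult_lt_0_compat).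
  replace (G' z / E z)%C with (H k z / E z - (H k z - G' z) / E z)%C by (by field).
  apply: Rle_trans (Cmod_sub _ _) _. apply: Rplus_le_compat; first exact: hb. rewrite Cmod_div //.
  apply: (Rmult_le_reg_r (Cmod (E z))) => //. rewrite /Rdiv Rmult_assoc Rinv_l; lra.
move=> h. rewrite -(sqrt_sqrt b b0). apply: Rmult_le_compat => //; exact: Cmod_ge_0.
Qed.

Lemma inB_closed : inB G.
Proof.
have [Q [Q0 HQ]] := norm_bounded. have LG := limit_norm Q Q0 HQ. have [LGs _] := norm_fun_sharp G hG LG.
have pt z e : 0 < e -> exists n, Cmod (F n z - G z)%C <= e.
  move=> e0. have [N HN] := limit_is_G (Cmod z) e e0. exists N. apply: (HN N (le_n _)). lra.
split => //. split => //. split.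
- apply: (limit_nevanlinna F G Q) => // n; [exact: (proj1 (bF n)) | exact: (proj1 (proj2 (bF n))) | exact: (proj1 (proj2 (proj2 (bF n))))].
- apply: (limit_nevanlinna (fun n => sharp (F n)) (sharp G) Q) => //.
  + exact: holo_sharp.
  + move=> n. apply: holo_sharp. exact: (proj1 (bF n)).
  + move=> n. exact: (proj1 (norm_fun_sharp (F n) (proj1 (bF n)) (proj1 (proj2 (bF n))))).
  + move=> n. exact: (proj2 (proj2 (proj2 (bF n)))).
  + move=> n. apply: Rle_trans (HQ n). exact: (proj2 (norm_fun_sharp (F n) (proj1 (bF n)) (proj1 (proj2 (bF n))))).
  + move=> z e e0. have [n hn] := pt (Cconj z) e e0. exists n. by rewrite /sharp -Cconj_sub Cmod_conj.
Qed.
End Closed.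

Section Embedded.
Variables (Lp : (R -> C) -> Prop) (ip : (R -> C) -> (R -> C) -> R).
Hypothesis LN : L2space Lp ip.
Hypothesis seg : forall phi, (forall t, rcont phi t) -> Lp phi -> RInt (sq_mod phi) 0 1 <= ip phi phi.
Hypothesis emb : forall F, inB F -> Lp (fun t : R => F t).
Variable k0 : R.
Hypothesis k00 : 0 <= k0.
Hypothesis emb_le : forall F, inB F -> normB F <= k0 * ip (fun t : R => F t) (fun t : R => F t).

(** If the distance were 0, elements F n at squared distance at most 1/(n + 1) from G would form a
    Cauchy sequence in the norm of the space, by [emb_le], and [inB_closed] would put G into it. *)
Lemma inB_dist G : (forall z, holo G z) -> Lp (fun t : R => G t) -> ~ inB G ->
  exists d, 0 < d /\ forall F, inB F -> d <= ip (fun t : R => G t - F t)%C (fun t : R => G t - F t)%C.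
Proof.
move=> hG LG nG. apply: NNPP => N. apply: nG.
have ex n : exists F, inB F /\ ip (fun t : R => G t - F t)%C (fun t : R => G t - F t)%C <= / (INR n + 1).
  apply: NNPP => M. apply: N. exists (/ (INR n + 1)); split; first exact: INR1_inv.
  move=> F bF. apply: Rnot_lt_le => h. apply: M. exists F; split => //. lra.
pose F n := proj1_sig (constructive_indefinite_description _ (ex n)).
have FP n : inB (F n) /\ ip (fun t : R => G t - F n t)%C (fun t : R => G t - F n t)%C <= / (INR n + 1).
  rewrite /F. by case: (constructive_indefinite_description _ _).
have Ls n : Lp (fun t : R => G t - F n t)%C.
  have -> : (fun t : R => G t - F n t)%C = (fun t : R => G t + RtoC (-1) * F n t)%C by apply: functional_extensionality => t; apply: injective_projections; simpl; ring.
  apply: (l2_scal_add _ _ LN) => //. apply: emb. exact: (proj1 (FP n)).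
apply: (inB_closed G F (2 * k0 + 1)) => //.
- move=> n. exact: (proj1 (FP n)).
- lra.
- move=> n k. have [b1 q1] := FP n. have [b2 q2] := FP k. apply: Rle_trans (emb_le _ (inB_sub _ _ b1 b2)) _.
  have i1 := INR1_inv n. have i2 := INR1_inv k.
  have h : ip (fun t : R => F n t - F k t)%C (fun t : R => F n t - F k t)%C <= 2 * (/ (INR n + 1) + / (INR k + 1)).
    have -> : (fun t : R => F n t - F k t)%C = (fun t : R => (G t - F k t) + RtoC (-1) * (G t - F n t))%C.
      by apply: functional_extensionality => t; apply: injective_projections; simpl; ring.
    apply: Rle_trans (ip_parallelogram _ _ LN (fun t : R => G t - F k t)%C (fun t : R => RtoC (-1) * (G t - F n t))%C (Ls k) (l2_scal _ _ LN _ _ (Ls n))) _.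
    rewrite (ip_scal _ _ LN (-1) (fun t : R => G t - F n t)%C) //; last exact: (l2_scal _ _ LN).
    rewrite (ip_sym _ _ LN (fun t : R => G t - F n t)%C (fun t : R => RtoC (-1) * _)%C) (ip_scal _ _ LN (-1) (fun t : R => G t - F n t)%C) //. lra.
  apply: (Rle_trans _ (k0 * (2 * (/ (INR n + 1) + / (INR k + 1))))); first exact: Rmult_le_compat_l. nra.
- move=> n. have [b q] := FP n. have i1 := INR1_inv n. apply: Rle_trans (seg _ _ (Ls n)) _; last nra.
  move=> t. apply: rcont_minus; apply: rcont_real; apply: holo_cont; [exact: hG | exact: (proj1 b)].
Qed.

Lemma inB_dBlike : exp_type_zero E -> dBlike Lp inB.
Proof.
move=> tE. have tz := exp_type_zero_type_zero E hE tE. split.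
- by move=> F [].
- move=> F. exact: inB_type_zero.
- exact: emb.
- exact: inB_add.
- exact: inB_scal.
- exact: inB_div.
Qed.
End Embedded.
End DeBranges.


(** * L2 of a measure on the line *)

Lemma L2space_sum Lp1 ip1 Lp2 ip2 : L2space Lp1 ip1 -> L2space Lp2 ip2 ->
  L2space (fun f => Lp1 f /\ Lp2 f) (fun f g => ip1 f g + ip2 f g).
Proof.
move=> A B. split.
- move=> f g [a b] [a' b']; split; [exact: (l2_add _ _ A) | exact: (l2_add _ _ B)].
- move=> c f [a b]; split; [exact: (l2_scal _ _ A) | exact: (l2_scal _ _ B)].
- move=> f g. by rewrite (ip_sym _ _ A) (ip_sym _ _ B).
- move=> f g h [a b] [a' b'] [a'' b'']. rewrite (ip_add _ _ A) // (ip_add _ _ B) //. ring.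
- move=> r f g [a b] [a' b']. rewrite (ip_scal _ _ A) // (ip_scal _ _ B) //. ring.
- move=> f. by rewrite (ip_Ci _ _ A) (ip_Ci _ _ B).
- move=> f. have := ip_ge0 _ _ A f. have := ip_ge0 _ _ B f. lra.
- move=> f g f' g' h. by rewrite (ip_pointwise _ _ A f g f' g') // (ip_pointwise _ _ B f g f' g').
- move=> phi kappa c hc [a b] c0 hd. have [a1 a2] := l2_dom _ _ A phi kappa c hc a c0 hd. have [b1 b2] := l2_dom _ _ B phi kappa c hc b c0 hd.
  split => //. lra.
- move=> G hG [a b] e e0. have [Y1 h1] := l2_tail _ _ A G hG a (e / 2) ltac:(lra). have [Y2 h2] := l2_tail _ _ B G hG b (e / 2) ltac:(lra).
  exists (Rmax Y1 Y2) => y hy. have := h1 y (Rle_trans _ _ _ (Rmax_l _ _) hy). have := h2 y (Rle_trans _ _ _ (Rmax_r _ _) hy). lra.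
Qed.

Definition prod_re (f g : R -> C) (t : R) : R := fst (f t) * fst (g t) + snd (f t) * snd (g t).

Lemma prod_re_sq f t : sq_mod f t = prod_re f f t.
Proof. exact: Cmod_sq. Qed.

Lemma prod_re_ge0 f t : 0 <= prod_re f f t.
Proof. rewrite -prod_re_sq. apply: Rmult_le_pos; exact: Cmod_ge_0. Qed.

Lemma prod_re_bound f g t : Rabs (prod_re f g t) <= prod_re f f t + prod_re g g t.
Proof.
rewrite /prod_re. set a := fst (f t). set b := fst (g t). set c := snd (f t). set d := snd (g t).
have := Rle_0_sqr (a - b). have := Rle_0_sqr (a + b). have := Rle_0_sqr (c - d). have := Rle_0_sqr (c + d). rewrite /Rsqr => *.
have := Rle_0_sqr a. have := Rle_0_sqr b. have := Rle_0_sqr c. have := Rle_0_sqr d. rewrite /Rsqr => *.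
apply: Rabs_le. split; nra.
Qed.

Lemma prod_re_add f g t : prod_re (fun t => f t + g t)%C (fun t => f t + g t)%C t <= 2 * (prod_re f f t + prod_re g g t).
Proof. have := sq_mod_add f g t. rewrite !prod_re_sq. lra. Qed.

Lemma prod_re_scal (c : C) f t : prod_re (fun t => c * f t)%C (fun t => c * f t)%C t = Cmod c * Cmod c * prod_re f f t.
Proof. rewrite -!prod_re_sq /sq_mod Cmod_mult. ring. Qed.

Lemma prod_re_dom phi kappa c t : Cmod (phi t) <= c * Cmod (kappa t) -> prod_re phi phi t <= c * c * prod_re kappa kappa t.
Proof.
move=> h. rewrite -!prod_re_sq /sq_mod. have h0 := Cmod_ge_0 (phi t).
replace (c * c * (Cmod (kappa t) * Cmod (kappa t))) with ((c * Cmod (kappa t)) * (c * Cmod (kappa t))) by ring. apply: Rmult_le_compat; lra.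
Qed.

Lemma rcont_continuity (p : C -> R) f t : (forall z, Rabs (p z) <= Cmod z) -> (forall z w, p (z - w)%C = p z - p w) -> rcont f t ->
  continuity_pt (fun t => p (f t)) t.
Proof.
move=> hp pm H e e0. have [d [d0 K]] := H e e0. exists d; split => // s [_ hs]. rewrite /= /Rdist -pm.
apply: Rle_lt_trans (hp _) _. exact: K.
Qed.

Lemma RInt_derivable g a x : (forall t, continuity_pt g t) -> derivable_pt_lim (fun x => RInt g a x) x (g x).
Proof.
move=> H. have c t : continuous g t by apply/continuity_pt_filterlim.
apply/is_derive_Reals. apply: (is_derive_RInt g _ a) => //. exists (mkposreal 1 Rlt_0_1) => y _. apply: RInt_correct. exact: exRc.
Qed.

Definition tail_fun (G : R -> C) (y : R) (t : R) : C := (t * G t / (t - (0, y)))%C.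

Lemma tail_prod G y t : y <> 0 -> prod_re (tail_fun G y) (tail_fun G y) t = prod_re G G t * (t * t / (t * t + y * y)).
Proof.
move=> yn. have n : (t - (0, y))%C <> 0%C by exact: real_sub_neq0.
have p : 0 < t * t + y * y by have := Rle_0_sqr t; have := Rsqr_pos_lt y yn; rewrite /Rsqr; lra.
have q := Cmod_pos _ n. have s := Cmod_sq (t - (0, y))%C. simpl in s.
rewrite -!prod_re_sq /sq_mod /tail_fun Cmod_div // Cmod_mult Cmod_R.
have -> : t * t + y * y = Cmod (t - (0, y))%C * Cmod (t - (0, y))%C by rewrite s; ring.
have -> : t * t = Rabs t * Rabs t by rewrite -Rabs_mult Rabs_pos_eq //; exact: Rle_0_sqr.
field. lra.
Qed.

Lemma tail_rcont G y t : (forall t, rcont G t) -> y <> 0 -> rcont (tail_fun G y) t.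
Proof.
move=> hG yn. apply: rcont_mult; last exact: rcont_sub_inv. apply: rcont_mult => //.
move=> e e0. exists e; split => // s Hs. by rewrite -RtoC_minus Cmod_R.
Qed.

Lemma tail_mono G y n t : 0 < n -> n <= Rabs y -> prod_re (tail_fun G y) (tail_fun G y) t <= prod_re (tail_fun G n) (tail_fun G n) t.
Proof.
move=> n0 hy. have yn : y <> 0 by move=> e; rewrite e Rabs_R0 in hy; lra. have nn : n <> 0 by lra.
rewrite !tail_prod //. apply: Rmult_le_compat_l; first exact: prod_re_ge0.
have t0 : 0 <= t * t by exact: Rle_0_sqr. apply: Rmult_le_compat_l => //. apply: Rinv_le_contravar; first nra.
have -> : y * y = Rabs y * Rabs y by rewrite -Rabs_mult Rabs_pos_eq //; exact: Rle_0_sqr. nra.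
Qed.

Lemma tail_le G n t : 0 < n -> prod_re (tail_fun G n) (tail_fun G n) t <= prod_re G G t.
Proof.
move=> n0. rewrite tail_prod; last lra. rewrite -[X in _ <= X]Rmult_1_r. apply: Rmult_le_compat_l; first exact: prod_re_ge0.
have t0 : 0 <= t * t by exact: Rle_0_sqr. have p : 0 < t * t + n * n by nra.
apply: (Rmult_le_reg_r (t * t + n * n)) => //. rewrite /Rdiv Rmult_assoc Rinv_l; nra.
Qed.

Lemma tail_small G t e : 0 < e -> exists N : nat, forall n : nat, (N <= n)%nat -> prod_re (tail_fun G (INR n + 1)) (tail_fun G (INR n + 1)) t <= e.
Proof.
move=> e0. have g0 := prod_re_ge0 G t. set g := prod_re G G t in g0 *.
have t0 : 0 <= t * t by exact: Rle_0_sqr.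
have p0 : 0 < e / (g * (t * t) + 1) by apply: Rdiv_lt_0_compat; nra.
have [N HN] := inv_INR_small _ p0. exists N => n hn. have i := HN n hn. have np := pos_INR n.
rewrite tail_prod; last lra. rewrite -/g.
have : t * t / (t * t + (INR n + 1) * (INR n + 1)) <= t * t * / (INR n + 1).
  apply: Rmult_le_compat_l => //. apply: Rinv_le_contravar; nra.
move=> h. apply: (Rle_trans _ (g * (t * t * / (INR n + 1)))); first exact: Rmult_le_compat_l.
have ip := INR1_inv n. apply: (Rle_trans _ ((g * (t * t) + 1) * / (INR n + 1))); first nra.
apply: (Rle_trans _ ((g * (t * t) + 1) * (e / (g * (t * t) + 1)))); first by apply: Rmult_le_compat_l => //; nra. right. field. nra.
Qed.

From mathcomp Require Import all_boot all_order all_algebra.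
From mathcomp Require Import all_classical all_reals all_analysis.
From mathcomp Require Import measurable_realfun Rstruct Rstruct_topology.
Import Order.TTheory GRing.Theory Num.Theory.
Import numFieldNormedType.Exports.
Local Open Scope classical_set_scope.
Local Open Scope ring_scope.
Local Open Scope R_scope.

Section L2measure.
Variables (m : {measure set (measurableTypeR R) -> \bar R}) (D : set (measurableTypeR R)).
Hypothesis mD : measurable D.

Definition L2m (f : R -> C) : Prop := [/\ measurable_fun setT (fun t : measurableTypeR R => fst (f t) : measurableTypeR R),
  measurable_fun setT (fun t : measurableTypeR R => snd (f t) : measurableTypeR R) & (\int[m]_(x in D) (prod_re f f x)%:E < +oo)%E].

Definition ipm (f g : R -> C) : R := Rintegral m D (prod_re f g).

Lemma prod_re_meas f g : L2m f -> L2m g -> measurable_fun D (fun t : measurableTypeR R => prod_re f g t : measurableTypeR R).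
Proof.
move=> [f1 f2 _] [g1 g2 _]. apply: measurable_funTS.
apply: (@measurable_funD _ (measurableTypeR R) R setT (fun t => Rmult (fst (f t)) (fst (g t))) (fun t => Rmult (snd (f t)) (snd (g t))));
  by apply: measurable_funM.
Qed.

Lemma prod_re_sq_integrable f : L2m f -> m.-integrable D (EFin \o prod_re f f).
Proof.
move=> Lf. have [_ _ fin] := Lf. apply/integrableP; split; first by apply/measurable_EFinP; exact: prod_re_meas.
rewrite (@eq_integral _ _ _ m D (fun x => (prod_re f f x)%:E)) //.
move=> x _ /=. by rewrite ger0_norm //; apply/RleP; exact: prod_re_ge0.
Qed.

Lemma prod_re_integrable f g : L2m f -> L2m g -> m.-integrable D (EFin \o prod_re f g).
Proof.
move=> Lf Lg. have If := prod_re_sq_integrable f Lf. have Ig := prod_re_sq_integrable g Lg.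
apply: (le_integrable mD _ _ (integrableD mD If Ig)); first by apply/measurable_EFinP; exact: prod_re_meas.
move=> x _ /=. rewrite lee_fin. apply/RleP. rewrite -!RabsE.
apply: Rle_trans (prod_re_bound f g x) (Rle_abs _).
Qed.

Lemma ipm_EFin f g : L2m f -> L2m g -> (\int[m]_(x in D) (prod_re f g x)%:E)%E = (ipm f g)%:E.
Proof. move=> Lf Lg. rewrite /ipm /Rintegral fineK //. apply: integrable_fin_num => //. exact: prod_re_integrable. Qed.

Lemma L2m_dom phi kappa c : measurable_fun setT (fun t : measurableTypeR R => fst (phi t) : measurableTypeR R) ->
  measurable_fun setT (fun t : measurableTypeR R => snd (phi t) : measurableTypeR R) -> L2m kappa ->
  (forall t, Rle (prod_re phi phi t) (c * prod_re kappa kappa t)) -> L2m phi.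
Proof.
move=> m1 m2 Lk H. split => //.
have mphi : measurable_fun D (fun t : measurableTypeR R => prod_re phi phi t : measurableTypeR R).
  apply: measurable_funTS.
  apply: (@measurable_funD _ (measurableTypeR R) R setT (fun t => Rmult (fst (phi t)) (fst (phi t))) (fun t => Rmult (snd (phi t)) (snd (phi t))));
  by apply: measurable_funM.
have I := integrableZl mD c (prod_re_sq_integrable kappa Lk).
apply: (integrable_lty mD). apply: (le_integrable mD _ _ I); first by apply/measurable_EFinP.
move=> x _ /=. rewrite -?EFinM lee_fin. apply/RleP. rewrite -!RabsE.
rewrite (Rabs_pos_eq (prod_re phi phi x)); last exact: prod_re_ge0. apply: Rle_trans (H x) (Rle_abs _).
Qed.

Lemma ipm_le f g : L2m f -> L2m g -> (forall t, Rle (prod_re f f t) (prod_re g g t)) -> Rle (ipm f f) (ipm g g).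
Proof.
move=> Lf Lg H. apply/RleP. apply: le_Rintegral => //; [exact: prod_re_sq_integrable | exact: prod_re_sq_integrable |].
move=> x _. apply/RleP. exact: H.
Qed.

Lemma ipm_scal_le f g c : L2m f -> L2m g -> (forall t, Rle (prod_re f f t) (c * prod_re g g t)) -> Rle (ipm f f) (c * ipm g g).
Proof.
move=> Lf Lg H. apply/RleP. rewrite RmultE /ipm -(RintegralZl c mD (prod_re_sq_integrable g Lg)). apply: le_Rintegral => //; first exact: prod_re_sq_integrable.
- have -> : EFin \o (fun x => (c * prod_re g g x)%R) = (fun x => c%:E * (EFin \o prod_re g g) x)%E by apply: funext.
  apply: integrableZl => //. exact: prod_re_sq_integrable.
- move=> x _. apply/RleP. exact: H.
Qed.

Lemma continuous_measurableR (g : R -> R) : (forall t, continuity_pt g t) -> measurable_fun setT (g : measurableTypeR R -> measurableTypeR R).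
Proof. move=> H. apply: continuous_measurable_fun => x. apply/continuity_pt_cvg. exact: H. Qed.

Lemma rcont_measurable phi : (forall t, rcont phi t) -> measurable_fun setT (fun t : measurableTypeR R => fst (phi t) : measurableTypeR R) /\
  measurable_fun setT (fun t : measurableTypeR R => snd (phi t) : measurableTypeR R).
Proof.
move=> H. split; apply: continuous_measurableR => t.
- exact: (rcont_continuity fst phi t Cmod_fst (fun z w => Logic.eq_refl) (H t)).
- exact: (rcont_continuity snd phi t Cmod_snd (fun z w => Logic.eq_refl) (H t)).
Qed.

Lemma L2m_add f g : L2m f -> L2m g -> L2m (fun t => Cplus (f t) (g t)).
Proof.
move=> Lf Lg. have [f1 f2 _] := Lf. have [g1 g2 _] := Lg.
have m1 : measurable_fun setT (fun t : measurableTypeR R => fst (Cplus (f t) (g t)) : measurableTypeR R).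
  exact: (@measurable_funD _ (measurableTypeR R) R setT (fun t => fst (f t)) (fun t => fst (g t))).
have m2 : measurable_fun setT (fun t : measurableTypeR R => snd (Cplus (f t) (g t)) : measurableTypeR R).
  exact: (@measurable_funD _ (measurableTypeR R) R setT (fun t => snd (f t)) (fun t => snd (g t))).
split => //.
have I := integrableZl mD 2 (integrableD mD (prod_re_sq_integrable f Lf) (prod_re_sq_integrable g Lg)).
apply: (integrable_lty mD). apply: (le_integrable mD _ _ I).
  apply/measurable_EFinP. apply: measurable_funTS. by apply: (@measurable_funD _ (measurableTypeR R) R setT (fun t => Rmult (fst (Cplus (f t) (g t))) (fst (Cplus (f t) (g t)))) (fun t => Rmult (snd (Cplus (f t) (g t))) (snd (Cplus (f t) (g t))))); apply: measurable_funM.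
move=> x _ /=. rewrite -?EFinD -?EFinM lee_fin. apply/RleP. rewrite -!RabsE.
rewrite (Rabs_pos_eq (prod_re _ _ x)); last exact: prod_re_ge0. apply: Rle_trans (prod_re_add f g x) (Rle_abs _).
Qed.

Lemma L2m_scal c f : L2m f -> L2m (fun t => Cmult c (f t)).
Proof.
move=> Lf. have [f1 f2 _] := Lf.
apply: (L2m_dom _ f (Rmult (Cmod c) (Cmod c))) => //; last by move=> t; rewrite prod_re_scal; apply: Rle_refl.
- apply: (@measurable_funB _ (measurableTypeR R) R setT (fun t => Rmult (fst c) (fst (f t))) (fun t => Rmult (snd c) (snd (f t))));
  by apply: measurable_funM => //; exact: measurable_cst.
- apply: (@measurable_funD _ (measurableTypeR R) R setT (fun t => Rmult (fst c) (snd (f t))) (fun t => Rmult (snd c) (fst (f t))));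
  by apply: measurable_funM => //; exact: measurable_cst.
Qed.

Lemma L2m_cont_dom phi kappa c : (forall t, rcont phi t) -> L2m kappa -> Rle 0 c -> (forall t, Rle (Cmod (phi t)) (c * Cmod (kappa t))) ->
  L2m phi /\ Rle (ipm phi phi) (c * c * ipm kappa kappa).
Proof.
move=> hc Lk c0 H. have [m1 m2] := rcont_measurable phi hc.
have B t : Rle (prod_re phi phi t) (c * c * prod_re kappa kappa t) by exact: prod_re_dom.
have L := L2m_dom phi kappa (c * c) m1 m2 Lk B. split => //. exact: ipm_scal_le.
Qed.

(** The factor t^2/(t^2 + y^2) is at most 1 and tends to 0, so dominated convergence applies along y
    = n + 1; it decreases in |y|, which covers all larger |y|. *)
Lemma L2m_tail G : (forall t, rcont G t) -> L2m G -> forall e, Rlt 0 e -> exists Y, forall y, Rle Y (Rabs y) -> Rle (ipm (tail_fun G y) (tail_fun G y)) e.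
Proof.
move=> hG LG e e0.
pose T (n : nat) := tail_fun G (INR n + 1).
have np n : Rlt 0 (INR n + 1) by have := pos_INR n; lra.
have LT y : y <> 0 -> Rlt 0 (Rabs y) -> L2m (tail_fun G y).
  move=> yn y0. have [m1 m2] := rcont_measurable _ (fun t => tail_rcont G y t hG yn).
  apply: (L2m_dom _ G 1 m1 m2 LG) => t. rewrite Rmult_1_l.
  apply: Rle_trans (tail_le G (Rabs y) t y0). apply: tail_mono => //. apply: Rle_refl.
have LTn n : L2m (T n) by have := np n => h; apply: LT; [lra | rewrite Rabs_pos_eq; lra].
have mT n : measurable_fun D (EFin \o prod_re (T n) (T n)) by apply/measurable_EFinP; exact: prod_re_meas.
have pT x : (fun n => (prod_re (T n) (T n) x)%:E) @ \oo --> (0%R)%:E.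
  apply: cvg_EFin; first by near=> n.
  apply/cvgrPdist_le => eps /RltP eps0. have [N HN] := tail_small G x eps eps0. exists N => //= n /= /ssrnat.leP hn.
  rewrite sub0r normrN -RabsE Rabs_pos_eq; last exact: prod_re_ge0. apply/RleP. exact: HN.
have [_ _ cv] : [/\ m.-integrable D (cst 0%E),
    [sequence (\int[m]_(x in D) `|(EFin \o prod_re (T n) (T n)) x - cst 0%E x|)%E]_n @ \oo --> 0%E &
    [sequence (\int[m]_(x in D) (EFin \o prod_re (T n) (T n)) x)%E]_n @ \oo --> (\int[m]_(x in D) cst 0%E x)%E].
  apply: (@dominated_convergence _ (measurableTypeR R) R m D mD (fun n => EFin \o prod_re (T n) (T n)) (cst 0%E) (EFin \o prod_re G G)) => //.
  - by apply: aeW => x _; exact: pT.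
  - exact: prod_re_sq_integrable.
  - apply: aeW => x n _ /=. rewrite lee_fin ger0_norm; last by apply/RleP; exact: prod_re_ge0. apply/RleP. exact: tail_le.
rewrite integral0 in cv.
have cv2 : (fun n => ipm (T n) (T n)) @ \oo --> (0%R : R) by exact: (fine_cvg cv).
have [cv3 _] := @cvgrPdist_le R (R^o)%R nat \oo _ (fun n => ipm (T n) (T n)) 0%R.
have e0' : (0 < e)%R by apply/RltP.
have [N _ HN] := cv3 cv2 e e0'.
exists (INR N + 1) => y hy. have y0 : Rlt 0 (Rabs y) by have := np N; lra.
have yn : y <> 0 by move=> E; rewrite E Rabs_R0 in y0; lra.
have := HN N (leqnn N). rewrite /= sub0r normrN -RabsE => /RleP h.
apply: (Rle_trans _ (ipm (T N) (T N))); last exact: Rle_trans (Rle_abs _) h.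
apply: ipm_le; [exact: LT | exact: LTn | move=> t; exact: tail_mono].
Unshelve. all: by end_near.
Qed.

Lemma L2m_space : L2space L2m ipm.
Proof.
split.
- exact: L2m_add.
- exact: L2m_scal.
- move=> f g. rewrite /ipm. congr (Rintegral m D _). apply: functional_extensionality => t. rewrite /prod_re. by rewrite (Rmult_comm (fst (f t))) (Rmult_comm (snd (f t))).
- move=> f g h Lf Lg Lh. rewrite RplusE /ipm -(RintegralD mD (prod_re_integrable f h Lf Lh) (prod_re_integrable g h Lg Lh)).
  congr (Rintegral m D _). apply: functional_extensionality => t. rewrite /prod_re -RplusE /=. lra.
- move=> r f g Lf Lg. rewrite RmultE /ipm -(RintegralZl r mD (prod_re_integrable f g Lf Lg)).
  congr (Rintegral m D _). apply: functional_extensionality => t. rewrite /prod_re -RmultE /=. lra.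
- move=> f. rewrite /ipm. congr (Rintegral m D _). apply: functional_extensionality => t. rewrite /prod_re /=. lra.
- move=> f. apply/RleP. apply: Rintegral_ge0 => x _. apply/RleP. exact: prod_re_ge0.
- move=> f g f' g' h. rewrite /ipm. congr (Rintegral m D _). apply: functional_extensionality => t. exact: h.
- exact: L2m_cont_dom.
- exact: L2m_tail.
Qed.
End L2measure.


(** * Lebesgue measure and Riemann integrals *)

Lemma derivable_pt_lim_cvg f x l : derivable_pt_lim f x l ->
  (fun h : R => h^-1 *: ((f (h *: (1 : R^o) + x) : R^o) - f x))%R @ (0 : R)%R^' --> (l : R^o).
Proof.
move=> H. apply/cvgrPdist_lt => e e0. have [d K] := H e (elimT RltP e0).
near=> h. rewrite distrC.
have hn : h <> 0 by apply/eqP; near: h; exact: nbhs_dnbhs_neq.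
have hd : (`|h| < pos d)%R by near: h; apply: (@dnbhs0_lt R (R^o)%R (pos d)); apply/RltP; exact: cond_pos.
have k := K h hn (elimT RltP (etrans (congr1 (fun x => x < pos d)%R (RabsE h)) hd)).
rewrite (_ : (h *: (1 : R^o) + x)%R = Rplus x h); last by change (Rplus (Rmult h 1) x = Rplus x h); lra.
apply/RltP. rewrite -RabsE.
rewrite (_ : (_ - _)%R = Rminus (Rdiv (Rminus (f (Rplus x h)) (f x)) h) l) //.
change (Rminus (Rmult (Rinv h) (Rminus (f (Rplus x h)) (f x))) l = Rminus (Rdiv (Rminus (f (Rplus x h)) (f x)) h) l).
by rewrite /Rdiv Rmult_comm.
Unshelve. all: by end_near.
Qed.

(** The function x -> RInt g a x is a primitive of g, and the fundamental theorem for the Lebesgue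
    integral evaluates the left side with it. *)
Lemma lebesgue_RInt g a b : (forall t, continuity_pt g t) -> Rlt a b ->
  (\int[@lebesgue_measure R]_(x in `[a, b]%classic) (g x)%:E = (RInt g a b)%:E)%E.
Proof.
move=> hg ab.
have dl x := RInt_derivable g a x hg.
have dv x := derivable_pt_lim_cvg _ _ _ (dl x).
have Fc x : {for x, continuous (fun x => RInt g a x)}.
  apply/continuity_pt_cvg. apply: derivable_continuous_pt. exists (g x). exact: dl.
rewrite (@continuous_FTC2 R g (fun x => RInt g a x) a b).
- rewrite RInt_point. by rewrite /zero /= sube0.
- by apply/RltP.
- by apply: continuous_subspaceT => x; apply/continuity_pt_cvg.
- split.
  + move=> x _. apply/cvg_ex. exists (g x). exact: dv.
  + apply: cvg_at_right_filter. exact: Fc.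
  + apply: cvg_at_left_filter. exact: Fc.
- move=> x _. rewrite derive1E. apply: cvg_lim => //. exact: dv.
Qed.

Lemma prod_re_continuity phi t : (forall t, rcont phi t) -> continuity_pt (prod_re phi phi) t.
Proof.
move=> H. have a := rcont_continuity fst phi t Cmod_fst (fun z w => Logic.eq_refl) (H t).
have b := rcont_continuity snd phi t Cmod_snd (fun z w => Logic.eq_refl) (H t).
exact: (continuity_pt_plus _ _ t (continuity_pt_mult _ _ t a a) (continuity_pt_mult _ _ t b b)).
Qed.

Lemma sq_mod_prod phi : sq_mod phi = prod_re phi phi.
Proof. apply: functional_extensionality => t. exact: prod_re_sq. Qed.

Lemma prod_re_cont_meas phi (A : set (measurableTypeR R)) : (forall t, rcont phi t) ->
  measurable_fun A (fun x : measurableTypeR R => (prod_re phi phi x)%:E).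
Proof.
move=> H. apply/measurable_EFinP. apply: measurable_funTS. apply: (continuous_measurableR (prod_re phi phi)) => t. exact: prod_re_continuity.
Qed.

Lemma prod_re_ge0e phi x : (0 <= (prod_re phi phi x)%:E)%E.
Proof. rewrite lee_fin. apply/RleP. exact: prod_re_ge0. Qed.

Local Notation leb := (@lebesgue_measure R).

Lemma lebesgue_like_L2 : lebesgue_like (L2m leb setT) (ipm leb setT).
Proof.
split.
- exact: L2m_space.
- move=> phi a b hc L [ab|<-]; last by rewrite RInt_point; exact: (ip_ge0 _ _ (L2m_space leb setT measurableT)).
  apply/RleP. rewrite -lee_fin -(ipm_EFin leb setT measurableT phi phi L L) sq_mod_prod -lebesgue_RInt //; last by move=> t; exact: prod_re_continuity.
  apply: ge0_subset_integral => //; [exact: prod_re_cont_meas | by move=> x _; exact: prod_re_ge0e].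
- move=> phi c hc H.
  have np n : Rlt 0 (INR n + 1) by have := pos_INR n; lra.
  (* The half length n + 1 keeps the interval nondegenerate at n = 0, as [lebesgue_RInt] demands. *)
  pose I (n : nat) : set (measurableTypeR R) := `[Ropp (Rplus (INR n) 1), Rplus (INR n) 1]%classic.
  have U : \bigcup_n (I n) = setT.
    apply/seteqP; split => // x _. have [n Hn] := INR_unbounded (Rabs x). exists n => //=. rewrite /I /= in_itv /=. apply/andP; split; apply/RleP.
    - have := Rle_abs (- x). rewrite Rabs_Ropp. lra.
    - have := Rle_abs x. lra.
  have cv : (\int[leb]_(x in I n) (prod_re phi phi x)%:E)%E @[n --> \oo] --> (\int[leb]_(x in setT) (prod_re phi phi x)%:E)%E.
    rewrite -U. apply: ge0_nondecreasing_set_cvg_integral.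
    - move=> n k /ssrnat.leP /le_INR nk. apply/subsetPset => x. rewrite /I /= !in_itv /= => /andP[/RleP a /RleP b]. apply/andP; split; apply/RleP; lra.
    - move=> n. exact: measurable_itv.
    - move=> n. exact: prod_re_cont_meas.
    - move=> n x _. exact: prod_re_ge0e.
  have fin : (\int[leb]_(x in setT) (prod_re phi phi x)%:E <= c%:E)%E.
    rewrite -(cvg_lim (@ereal_hausdorff R) cv). apply: lime_le; first by apply/cvg_ex; eexists; exact: cv.
    apply: nearW => n. have nn := np n.
    rewrite lebesgue_RInt; [|by move=> t; exact: prod_re_continuity | lra].
    rewrite lee_fin. apply/RleP. rewrite -sq_mod_prod. apply: H. lra.
  have L : L2m leb setT phi.
    have [m1 m2] := rcont_measurable phi hc. split => //. exact: (le_lt_trans fin (ltry c)).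
  split => //. apply/RleP. by rewrite -lee_fin -(ipm_EFin leb setT measurableT phi phi L L).
Qed.

Lemma segment_L2 phi : (forall t, rcont phi t) -> L2m leb `[0%R, 1%R]%classic phi /\ ipm leb `[0%R, 1%R]%classic phi phi = RInt (sq_mod phi) 0 1.
Proof.
move=> hc. have circle_int : measurable (`[0%R, 1%R]%classic : set (measurableTypeR R)) by exact: measurable_itv.
have E : (\int[leb]_(x in `[0%R, 1%R]%classic) (prod_re phi phi x)%:E = (RInt (sq_mod phi) 0 1)%:E)%E.
  rewrite sq_mod_prod. apply: lebesgue_RInt; last exact: Rlt_0_1. move=> t. exact: prod_re_continuity.
have L : L2m leb `[0%R, 1%R]%classic phi.
  have [m1 m2] := rcont_measurable phi hc. split => //. rewrite E. exact: ltry.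
split => //. apply: EFin_inj. by rewrite -(ipm_EFin leb _ circle_int phi phi L L).
Qed.


(** * The ordering theorem *)

Lemma sq_exprz (a : R) : (a ^ 2)%R = Rmult a a :> R.
Proof. by rewrite -exprnP expr2. Qed.

Lemma entire_holo F : entire F -> forall z, holo F z.
Proof. move=> H z. apply/holo_ex_derive. exact: H. Qed.

Section Bridge.
Variable E : C -> C.
Hypothesis dB : deBranges_function E.
Hypothesis ER : no_real_zeros E.
Let hE := entire_holo E (proj1 dB).
Let EU := proj2 dB.

Lemma norm_fun_integral F : (\int[leb]_(x in setT) ((Cmod (F (RtoC x)) / Cmod (E (RtoC x))) ^ 2)%R%:E =
  \int[leb]_(x in setT) (prod_re (norm_fun E F) (norm_fun E F) x)%:E)%E.
Proof.
apply: eq_integral => x _. congr EFin. rewrite -prod_re_sq /sq_mod /norm_fun Cmod_div; last exact: ER. exact: sq_exprz.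
Qed.

Lemma in_dB_inB F : in_dB E F <-> inB (L2m leb setT) E F.
Proof.
split.
- move=> [eF [fin [b1 [m1 [b2 m2]]]]]. have hF := entire_holo F eF. split => //. split; last by split; split.
  have [f1 f2] := rcont_measurable _ (fun t => norm_fun_rcont E hE EU ER F t hF). split => //. by rewrite -norm_fun_integral.
- move=> [hF [[_ _ L] [[b1 m1] [b2 m2]]]]. split; first by move=> z; apply/holo_ex_derive; exact: hF.
  split; last by []. by rewrite norm_fun_integral.
Qed.

Lemma dB_norm2_normB F : inB (L2m leb setT) E F -> dB_norm2 E F = (Rmult (/ PI) (normB (ipm leb setT) E F))%:E.
Proof.
move=> [_ [L _]]. rewrite /dB_norm2 norm_fun_integral (ipm_EFin leb setT measurableT _ _ L L) -EFinM. congr EFin.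
by rewrite mul1r.
Qed.

Variable mu : {measure set (measurableTypeR R) -> \bar R}.
Hypothesis emb : homeo_embedded E mu.

Lemma L2_norm2_int F : L2_norm2 mu F = (\int[mu]_(x in setT) (prod_re (fun t => F (RtoC t)) (fun t => F (RtoC t)) x)%:E)%E.
Proof. apply: eq_integral => x _. congr EFin. rewrite -prod_re_sq. exact: sq_exprz. Qed.

Lemma embedded_L2 F : inB (L2m leb setT) E F -> L2m mu setT (fun t => F (RtoC t)).
Proof.
move=> bF. have [f1 f2] := rcont_measurable _ (fun t => rcont_real F t (holo_cont F _ (proj1 bF _))).
split => //. rewrite -L2_norm2_int. apply: (proj1 emb). exact/in_dB_inB.
Qed.

Lemma embedded_bound : exists k0, Rle 0 k0 /\ forall F, inB (L2m leb setT) E F ->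
  Rle (normB (ipm leb setT) E F) (k0 * ipm mu setT (fun t => F (RtoC t)) (fun t => F (RtoC t))).
Proof.
have [_ [c1 [c2 [p1 [p2 H]]]]] := emb. have P := PI_RGT_0. exists (Rmult PI (/ c1)). have i1 := Rinv_0_lt_compat _ p1. split; first by nra.
move=> F bF. have [h _] := H F (proj2 (in_dB_inB F) bF). have L := embedded_L2 F bF.
rewrite dB_norm2_normB // L2_norm2_int (ipm_EFin mu setT measurableT _ _ L L) -EFinM lee_fin in h. move/RleP in h.
set x := normB _ _ _ in h *. set y := ipm _ _ _ _ in h *.
have -> : x = Rmult (Rmult PI (/ c1)) (Rmult c1 (Rmult (/ PI) x)) by field; split; lra.
apply: Rmult_le_compat_l => //. by nra.
Qed.
End Bridge.

Theorem theoremA2 (E1 E2 : C -> C) (mu : {measure set (measurableTypeR R) -> \bar R}) :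
  deBranges_function E1 -> deBranges_function E2 ->
  no_real_zeros E1 -> no_real_zeros E2 ->
  homeo_embedded E1 mu -> homeo_embedded E2 mu ->
  exp_type_zero E1 -> exp_type_zero E2 ->
  (forall F, in_dB E2 F -> in_dB E1 F) \/ (forall F, in_dB E1 F -> in_dB E2 F).
Proof.
move=> d1 d2 r1 r2 m1 m2 t1 t2.
pose I : set (measurableTypeR R) := `[0%R, 1%R]%classic.
have circle_int : measurable I by exact: measurable_itv.
pose Lp f := L2m mu setT f /\ L2m leb I f.
pose ip f g := Rplus (ipm mu setT f g) (ipm leb I f g).
have LN : L2space Lp ip := L2space_sum _ _ _ _ (L2m_space mu setT measurableT) (L2m_space leb I circle_int).
have seg phi : (forall t, rcont phi t) -> Lp phi -> Rle (RInt (sq_mod phi) 0 1) (ip phi phi).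
  move=> hc _. have [_ <-] := segment_L2 phi hc. have := ip_ge0 _ _ (L2m_space mu setT measurableT) phi. rewrite /ip /I. lra.
have key E : deBranges_function E -> no_real_zeros E -> homeo_embedded E mu -> exp_type_zero E ->
   dBlike Lp (inB (L2m leb setT) E) /\ forall G, (forall z, holo G z) -> Lp (fun t => G (RtoC t)) -> ~ inB (L2m leb setT) E G ->
   exists d, Rlt 0 d /\ forall F, inB (L2m leb setT) E F -> Rle d (ip (fun t => Cminus (G (RtoC t)) (F (RtoC t))) (fun t => Cminus (G (RtoC t)) (F (RtoC t)))).
  move=> d r m t. have hE := entire_holo E (proj1 d).
  have emb F : inB (L2m leb setT) E F -> Lp (fun t => F (RtoC t)).
    move=> bF. split; first exact: (embedded_L2 E d r mu m).
    exact: (proj1 (segment_L2 _ (fun t => rcont_real F t (holo_cont F _ (proj1 bF _))))).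
  have [k0 [k00 hk]] := embedded_bound E d r mu m.
  split; first exact: (inB_dBlike _ _ lebesgue_like_L2 E hE (proj2 d) r Lp emb t).
  apply: (inB_dist _ _ lebesgue_like_L2 E hE (proj2 d) r Lp ip LN seg emb k0 k00) => F bF.
  apply: Rle_trans (hk F bF) _. apply: Rmult_le_compat_l => //.
  have := ip_ge0 _ _ (L2m_space leb I circle_int) (fun t => F (RtoC t)). rewrite /ip. lra.
have [D1 dist1] := key E1 d1 r1 m1 t1. have [D2 dist2] := key E2 d2 r2 m2 t2.
have [H|H] := ordering_core Lp ip LN (inB (L2m leb setT) E1) (inB (L2m leb setT) E2) D1 D2
  (fun G b2 n1 => dist1 G (db_entire _ _ D2 G b2) (db_Lp _ _ D2 G b2) n1) (fun G b1 n2 => dist2 G (db_entire _ _ D1 G b1) (db_Lp _ _ D1 G b1) n2).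
- left => F /(in_dB_inB E2 d2 r2) bF. apply/(in_dB_inB E1 d1 r1). exact: H.
- right => F /(in_dB_inB E1 d1 r1) bF. apply/(in_dB_inB E2 d2 r2). exact: H.
Qed.
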